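(* Let $\mathring{B}^H$ be an $n$-dimensional fractional Brownian bridge on $[0,1]$ with Hurst index $0<H<1$ over a probability space $(\Omega,\mathcal{F},\mathbb{P})$ and let $\varphi:[0,1]\to\mathbb{R}^n$ be a bounded Borel function. (i) If $0<\alpha<n$, $n-\frac{1}{\max(H,1-H)}<\alpha$ and $0<\gamma<H$, then there is some $\Omega_1\in\mathcal{F}$ with $\mathbb{P}(\Omega_1)=1$ such that for any $\omega\in\Omega_1$ we have $\mathring{B}^H(\cdot,\omega)\in\mathcal{C}^\gamma_{0\to0}([0,1],\mathbb{R}^n)$ and $G^\alpha\mu_{\mathring{B}^H(\cdot,\omega)+\varphi}\in C(\mathbb{R}^n)$. For each such $\omega$ the potential $G^\alpha\mu_{\mathring{B}^H(\cdot,\omega)+\varphi}$ is bounded on $\mathbb{R}^n$, and the same is true for $U^\alpha\mu_{\mathring{B}^H(\cdot,\omega)+\varphi}$. (ii) If $n=1$ and $0<\gamma<H$, then there is an event $\Omega_1\in\mathcal{F}$ with $\mathbb{P}(\Omega_1)=1$ such that for any $\omega\in\Omega_1$ we have $\mathring{B}^H(\cdot,\omega)\in\mathcal{C}^\gamma_{0\to0}([0,1],\mathbb{R}^n)$ and the function $\mathring{B}^H(\cdot,\omega)+\varphi$ has local times $L_{\mathring{B}^H(\cdot,\omega)+\varphi}\in C(\mathbb{R}^n)$. In particular, $L_{\mathring{B}^H(\cdot,\omega)+\varphi}$ is locally bounded for any such $\omega$.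
   Context: Let $b^H$ be a fractional Brownian motion with Hurst index $H\in(0,1)$, i.e. a centered Gaussian process on $[0,+\infty)$ with $b^H(0)=0$ a.s. and $\mathbb{E}|b^H(t)-b^H(s)|^2=|t-s|^{2H}$, taken with continuous paths. The fractional Brownian bridge on $[0,1]$ is $\mathring{b}^H(t):=b^H(t)-\frac12\big(|t|^{2H}+1-|1-t|^{2H}\big)b^H(1)$, $t\in[0,1]$. An $n$-dimensional fractional Brownian bridge is $\mathring{B}^H=(\mathring{b}^H_1,\dots,\mathring{b}^H_n)$ with $n$ independent copies of $\mathring{b}^H$. $\mathcal{C}^\gamma_{0\to 0}([0,1],\mathbb{R}^n)$ is the set of functions $X:[0,1]\to\mathbb{R}^n$ with $X(0)=X(1)=0$ and $\sup_{s\ne t}\frac{|X(t)-X(s)|}{|t-s|^\gamma}<+\infty$. The occupation measure of a Borel function $X:[0,1]\to\mathbb{R}^n$ is $\mu_X(B)=\mathcal{L}^1(\{t\in[0,1]:X(t)\in B\})$; if $\mu_X$ is absolutely continuous with respect to $\mathcal{L}^n$, its density $L_X=\frac{d\mu_X}{d\mathcal{L}^n}$ is called the local time(s) of $X$, and $L_X\in C(\mathbb{R}^n)$ means that the density has a continuous version. The Riesz potential is $U^\alpha\mu(x)=\int_{\mathbb{R}^n}|x-y|^{\alpha-n}\mu(dy)$. The Bessel kernel $g_\alpha$ is determined by $\hat g_\alpha(\xi)=(1+|\xi|^2)^{-\alpha/2}$, with the Fourier transform convention $\hat\mu(\xi)=\int_{\mathbb{R}^n}e^{i\langle x,\xi\rangle}\mu(dx)$,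 and the Bessel potential is $G^\alpha\mu(x)=\int_{\mathbb{R}^n}g_\alpha(x-y)\mu(dy)$. *)

(* Defs.v *)
From HB Require Import structures.
From mathcomp Require Import all_boot all_order all_algebra.
From mathcomp Require Import all_classical all_reals all_analysis.
From mathcomp Require Import measurable_realfun complex.

Set Implicit Arguments.
Unset Strict Implicit.
Unset Printing Implicit Defensive.

Import Order.TTheory GRing.Theory Num.Theory.
Import numFieldNormedType.Exports.

Local Open Scope classical_set_scope.
Local Open Scope ring_scope.

(* R^n is 'rV[R]_n with its Borel sigma-algebra.  Its library norm `|x| is the
   sup norm; the Euclidean norm is [enorm] below. *)
Section borel_rV.
Context {R : realType} {n : nat}.

HB.instance Definition _ := @isMeasurable.Build
  (sigma_display (@open 'rV[R]_n)) 'rV[R]_n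
  <<s @open 'rV[R]_n >> (@sigma_algebra0 _ setT (@open 'rV[R]_n))
  (@sigma_algebraC _ (@open 'rV[R]_n))
  (@sigma_algebra_bigcup _ setT (@open 'rV[R]_n)).

Let box (c : 'rV[rat]_n * nat) : set 'rV[R]_n :=
  [set v | forall i, `|v 0 i - ratr (c.1 0 i)| < c.2.+1%:R^-1].

Let open_rV_bigcup (U : set 'rV[R]_n) : open U ->
  U = \bigcup_c (if `[< box c `<=` U >] then box c else set0).
Proof.
move=> oU; apply/seteqP; split => [v Uv|v [c _]]; last first.
  by case: asboolP => // + cv; apply.
have /nbhs_ballP[e /= e0 eU] : nbhs v U by apply: open_nbhs_nbhs.
have [k ke] : exists k : nat, k.+1%:R^-1 < e / 2 :> R.
  have e2 : 0 < e / 2 by rewrite divr_gt0.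
  by have [k _ /(_ _ (leqnn k))] := near_infty_natSinv_lt (PosNum e2); exists k.
have k0 : 0 < k.+1%:R^-1 :> R by rewrite invr_gt0.
have /choice[q qP] (i : 'I_n) :
    exists q : rat, `|v 0 i - ratr q| < k.+1%:R^-1 :> R.
  have /rat_in_itvoo[q] : v 0 i - k.+1%:R^-1 < v 0 i + k.+1%:R^-1.
    by rewrite ltrBlDr -addrA ltrDl addr_gt0.
  rewrite in_itv/= => /andP[q1 q2]; exists q.
  by rewrite ltr_distlC q1 q2.
exists (\row_i q i, k) => //; case: asboolP => [_ i|]; first by rewrite mxE.
move=> nb; exfalso; apply: nb => w bw; apply: eU; split => // i0 i; rewrite (ord1 i0).
rewrite /ball /= (splitr e).
have := bw i; rewrite /= mxE => wq.
rewrite (le_lt_trans (ler_distD (ratr (q i)) _ _))//.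
by rewrite ltrD// (lt_trans _ ke)// distrC.
Qed.

Lemma measurable_fun_rV d (T : measurableType d) (D : set T)
    (f : T -> 'rV[R]_n) : measurable D ->
  (forall i, measurable_fun D (fun x => f x 0 i)) -> measurable_fun D f.
Proof.
move=> mD mf; apply: (measurability (@open 'rV[R]_n)) => //.
move=> _ [U oU <-].
rewrite (open_rV_bigcup oU) preimage_bigcup setI_bigcupr.
apply: countable_bigcupT_measurable => // c.
case: ifPn => _; last by rewrite preimage_set0 setI0.
have [n0|n0] := eqVneq n 0%N.
  rewrite (_ : f @^-1` _ = setT) ?setIT//.
  by apply/seteqP; split => // x _ [i ilt]; exfalso; move: ilt; rewrite n0.
rewrite (_ : D `&` _ = \bigcap_(i in [set: 'I_n])
    (D `&` [set x | `|f x 0 i - ratr (c.1 0 i)| < c.2.+1%:R^-1])).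
  apply: fin_bigcap_measurable => // i _.
  have : measurable_fun D (fun x => `|f x 0 i - ratr (c.1 0 i)|).
    by apply: measurableT_comp => //; apply: measurable_funB.
  move=> /(_ mD `]-oo, c.2.+1%:R^-1[%classic).
  by move=> /(_ (measurable_itv _)); rewrite set_itvE.
apply/seteqP; split => [x [Dx bx] i _|x xb]; first by split => //; exact: bx.
split; last by move=> i; have [] := xb i I.
by move: n0; rewrite -lt0n => n0; have [] := xb (Ordinal n0) I.
Qed.

Lemma measurable_coord (i : 'I_n) :
  measurable_fun setT (fun v : 'rV[R]_n => v 0 i).
Proof.
apply: (measurability _ (RGenOpens.measurableE R)) => _ [_ [a [b ->] <-]].
rewrite setTI; apply: sub_sigma_algebra.
by apply: open_comp => // v _; exact: coord_continuous.
Qed.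

End borel_rV.

Section lebesgue_rV.
Context {R : realType}.

Definition rV_cons n (p : measurableTypeR R * 'rV[R]_n) : 'rV[R]_n.+1 :=
  \row_i (if unlift ord0 i is Some j then p.2 0 j else p.1).

Definition rV_uncons n (v : 'rV[R]_n.+1) : measurableTypeR R * 'rV[R]_n :=
  (v 0 ord0, \row_j v 0 (lift ord0 j)).

Lemma rV_consK n : cancel (@rV_cons n) (@rV_uncons n).
Proof.
move=> [x v]; rewrite /rV_uncons mxE unlift_none; congr pair.
by apply/rowP => j; rewrite !mxE liftK.
Qed.

Lemma measurable_rV_cons n : measurable_fun setT (@rV_cons n).
Proof.
apply: measurable_fun_rV => // i.
under [X in measurable_fun _ X]eq_fun do rewrite mxE.
case: unliftP => [j _|_]; last exact: measurable_fst.
exact: (measurableT_comp (measurable_coord j) measurable_snd).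
Qed.

Lemma measurable_rV_uncons n : measurable_fun setT (@rV_uncons n).
Proof.
apply/measurable_fun_pairP; split; first exact: measurable_coord.
apply: measurable_fun_rV => // j.
under [X in measurable_fun _ X]eq_fun do rewrite /= mxE.
exact: measurable_coord.
Qed.

Let leb1 : {sigma_finite_measure set (measurableTypeR R) -> \bar R} :=
  lebesgue_measure.

Section step.
Variables (n : nat) (m : {sigma_finite_measure set 'rV[R]_n -> \bar R}).

Definition lebesgue_step : set 'rV[R]_n.+1 -> \bar R :=
  pushforward (leb1 \x m)%E (@rV_cons n).

Let mpre (A : set 'rV[R]_n.+1) :
  measurable A -> measurable (@rV_cons n @^-1` A).
Proof. by move=> mA; rewrite -[X in measurable X]setTI; exact: measurable_rV_cons. Qed.

Let lebesgue_step0 : lebesgue_step set0 = 0%E.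
Proof. by rewrite /lebesgue_step /pushforward preimage_set0 measure0. Qed.

Let lebesgue_step_ge0 A : (0 <= lebesgue_step A)%E.
Proof. by rewrite /lebesgue_step /pushforward; exact: (measure_ge0 (leb1 \x m)%E). Qed.

Let lebesgue_step_sigma_additive : semi_sigma_additive lebesgue_step.
Proof.
move=> F mF tF mUF; rewrite /lebesgue_step /pushforward preimage_bigcup.
apply: measure_semi_sigma_additive.
- by move=> k; exact: mpre.
- apply/trivIsetP => /= i j _ _ ij; rewrite -preimage_setI.
  by move/trivIsetP : tF => /(_ _ _ _ _ ij) ->//; rewrite preimage_set0.
- by rewrite -preimage_bigcup; exact: mpre.
Qed.

HB.instance Definition _ := isMeasure.Build _ _ _ lebesgue_step
  lebesgue_step0 lebesgue_step_ge0 lebesgue_step_sigma_additive.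

Let lebesgue_step_sigma_finite : sigma_finite setT lebesgue_step.
Proof.
have /sigma_finiteP[F [TF ndF Foo]] := sigma_finiteT leb1.
have /sigma_finiteP[G [TG ndG Goo]] := sigma_finiteT m.
exists (fun k => @rV_uncons n @^-1` (F k `*` G k)).
  rewrite -preimage_bigcup (_ : \bigcup_k _ = setT) ?preimage_setT//.
  apply/seteqP; split => // -[x v] _.
  have [i _ Fx] : (\bigcup_k F k) x by rewrite -TF.
  have [j _ Gv] : (\bigcup_k G k) v by rewrite -TG.
  exists (maxn i j) => //; split => /=.
    by move: x Fx; exact/subsetPset/ndF/leq_maxl.
  by move: v Gv; exact/subsetPset/ndG/leq_maxr.
move=> k; have [mF Fk] := Foo k; have [mG Gk] := Goo k; split.
  by rewrite -[X in measurable X]setTI; apply: measurable_rV_uncons => //; exact: measurableX.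
rewrite /lebesgue_step /pushforward -comp_preimage.
rewrite (_ : _ \o _ = id) ?preimage_id; last first.
  by apply/funext => p /=; rewrite rV_consK.
by rewrite product_measure1E// lte_mul_pinfty// ge0_fin_numE.
Qed.

HB.instance Definition _ := Measure_isSigmaFinite.Build _ _ _ lebesgue_step
  lebesgue_step_sigma_finite.

End step.

Fixpoint lebesgue_rV n : {sigma_finite_measure set 'rV[R]_n -> \bar R} :=
  if n is k.+1 then lebesgue_step (lebesgue_rV k) else \d_(0 : 'rV[R]_0).

End lebesgue_rV.
Arguments lebesgue_rV {R} n.

Section euclidean.
Context {R : realType} {n : nat}.
Implicit Types x y : 'rV[R]_n.

Definition dot x y : R := \sum_i x 0 i * y 0 i.

Definition enorm x : R := Num.sqrt (dot x x).

End euclidean.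

Section potentials.
Context {R : realType} {n : nat}.
Implicit Types (X : R -> 'rV[R]_n) (mu : set 'rV[R]_n -> \bar R).
Implicit Types (f g u : 'rV[R]_n -> \bar R).

(* Functions on [0, 1] are represented by functions on R whose values outside
   [0, 1] are irrelevant. *)
Definition occupation_measure X : set 'rV[R]_n -> \bar R :=
  fun A => lebesgue_measure (`[0, 1]%classic `&` X @^-1` A).

Definition fourier f (xi : 'rV[R]_n) : R[i] :=
  (fine (\int[lebesgue_rV n]_x (f x * (cos (dot x xi))%:E)%E) +i*
   fine (\int[lebesgue_rV n]_x (f x * (sin (dot x xi))%:E)%E))%C.

(* The Fourier transform determines g only up to a null set, whereas potentials
   of singular measures depend on its pointwise values; as usual, g is the
   version continuous into [0, +oo], so that g 0 = +oo when alpha <= n. *)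
Definition bessel_kernel (alpha : R) g : Prop :=
  [/\ continuous g,
      forall x, (0 <= g x)%E,
      (lebesgue_rV n).-integrable setT g
    & forall xi,
        fourier g xi = ((1 + enorm xi ^+ 2) `^ (- (alpha / 2)))%:C%C].

(* |x|^(alpha - n) for alpha < n; note that powR would give 0 at x = 0. *)
Definition riesz_kernel (alpha : R) (x : 'rV[R]_n) : \bar R :=
  if x == 0 then +oo%E else (enorm x `^ (alpha - n%:R))%:E.

Definition potential f mu (x : 'rV[R]_n) : \bar R :=
  (\int[mu]_y f (x - y)%R)%E.

Definition finite_continuous u : Prop :=
  exists2 h : 'rV[R]_n -> R, continuous h & forall x, u x = (h x)%:E.

Definition bounded_potential u : Prop :=
  exists M : R, forall x, (`|u x| <= M%:E)%E.

(* L is a version of the density of the occupation measure of X. *)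
Definition local_time X (L : 'rV[R]_n -> R) : Prop :=
  [/\ occupation_measure X `<< lebesgue_rV n,
      measurable_fun setT L,
      forall x, 0 <= L x
    & forall A, measurable A ->
        occupation_measure X A = (\int[lebesgue_rV n]_(x in A) (L x)%:E)%E].

Definition locally_bounded (L : 'rV[R]_n -> R) : Prop :=
  forall x : 'rV[R]_n, exists M : R, \forall y \near x, `|L y| <= M.

Definition holder00 (gamma : R) X : Prop :=
  [/\ X 0 = 0, X 1 = 0
    & has_ubound [set q : R | exists s t, [/\ 0 <= s <= 1, 0 <= t <= 1, s != t
        & q = enorm (X t - X s) / `|t - s| `^ gamma]]].

End potentials.

Section processes.
Context {R : realType} {d : measure_display} {T : measurableType d}.
Variable P : probability T R.
Implicit Types (X b : R -> T -> R) (I : set R).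

(* The law is a possibly degenerate normal distribution; normal_prob m 0 is not
   the Dirac mass at m. *)
Definition gaussian (Y : T -> R) : Prop :=
  measurable_fun setT Y /\
  exists m s : R, forall A : set R, measurable A ->
    P (Y @^-1` A) = if s == 0 then \d_m A else normal_prob m s A.

Definition gaussian_process I X : Prop :=
  forall k (c t : 'I_k -> R), (forall j, I (t j)) ->
    gaussian (fun w => \sum_j c j * X (t j) w).

Definition continuous_paths I X : Prop :=
  forall w, {within I, continuous (X^~ w)}.

Definition fbm (H : R) b : Prop :=
  let I := `[0, +oo[%classic in
  [/\ gaussian_process I b,
      forall t, I t -> ('E_P[b t] = 0)%E,
      {ae P, forall w, b 0 w = 0},
      forall s t, I s -> I t ->
        ('E_P[fun w => (`|b t w - b s w| ^+ 2)%R] = (`|t - s| `^ (2 * H))%:E)%E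
    & continuous_paths I b].

Definition bridge (H : R) b : R -> T -> R := fun t w =>
  b t w - 2^-1 * (`|t| `^ (2 * H) + 1 - `|1 - t| `^ (2 * H)) * b 1 w.

Definition process_sigma_algebra I X : set (set T) :=
  <<s \bigcup_(t in I) preimage_set_system setT (X t) measurable >>.

Definition independent_processes k I (X : 'I_k -> R -> T -> R) : Prop :=
  forall E : 'I_k -> set T,
    (forall i, process_sigma_algebra I (X i) (E i)) ->
    P (\bigcap_(i in [set: 'I_k]) E i) = (\prod_i P (E i))%E.

End processes.

Definition same_law (R : realType) (I : set R)
    (d : measure_display) (T : measurableType d) (P : probability T R)
    (X : R -> T -> R)
    (d' : measure_display) (T' : measurableType d') (P' : probability T' R)
    (X' : R -> T' -> R) : Prop :=
  forall k (t : 'I_k -> R), (forall j, I (t j)) ->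
    forall A : set 'rV[R]_k, measurable A ->
      P [set w | A (\row_j X (t j) w)] = P' [set w | A (\row_j X' (t j) w)].

(* A copy of the fractional Brownian bridge: the underlying fractional Brownian
   motion may live on another probability space. *)
Definition fbridge (R : realType) (d : measure_display) (T : measurableType d)
    (P : probability T R) (H : R) (X : R -> T -> R) : Prop :=
  [/\ forall t, 0 <= t <= 1 -> measurable_fun setT (X t),
      continuous_paths `[0, 1]%classic X
    & exists (d' : measure_display) (T' : measurableType d')
        (P' : probability T' R) (b : R -> T' -> R),
        fbm P' H b /\ same_law `[0, 1]%classic P X P' (bridge H b)].

Definition fbridge_rV (R : realType) (d : measure_display)
    (T : measurableType d) (P : probability T R) (H : R) (n : nat)
    (B : R -> T -> 'rV[R]_n) : Prop :=
  (forall i, fbridge P H (fun t w => B t w 0 i)) /\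
  independent_processes P `[0, 1]%classic (fun i t w => B t w 0 i).

(* Main.v *)
(** The increments of the bridge are locally nondeterministic: given its values
    at finitely many other times, the value at [t] keeps a conditional variance
    of at least [c r^(2H)] if these times, [0] and [1] are at distance at least
    [r] from [t].  By Fourier inversion this bounds the moments
    [E (int_0^1 f (B_s - y_s) ds)^p] uniformly in the measurable shift [y], so
    that [phi] costs nothing.  A centred Gaussian function [f] of width [r],
    Markov's inequality on a grid and the Borel-Cantelli lemma give almost surely
    [mu (cube y 2^-k) <= C 2^(-k theta)] for all [y] and [k], where [mu] is the
    occupation measure and [theta < min(n, 1/H)].  If a kernel is at most
    [A |z|^(alpha - n)] and [n - alpha < theta], then its potentials are bounded,
    and truncating a continuous kernel approximates them uniformly by continuous
    functions.  The Bessel kernel is only known through its Fourier transform;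
    integrating it against narrow Gaussian functions compares it with the Riesz
    kernel.

    For [n = 1], take [f] to be the difference of the normal densities with
    standard deviations [2^-k] and [2^-(k+1)].  Its Fourier transform vanishes to
    second order at [0], which gains a factor [2^(-2 e k)] in the moment bound at
    the price of an exponent [H (1 + 6 e) < 1].  Hence the convolutions of [mu]
    with these densities converge locally uniformly, and since [mu] has no atoms
    the limit is its density. *)

Require Import Defs.
From HB Require Import structures.
From mathcomp Require Import all_boot all_order all_algebra.
From mathcomp Require Import all_classical all_reals all_analysis.
From mathcomp Require Import measurable_realfun complex ring lra.

Set Implicit Arguments.
Unset Strict Implicit.
Unset Printing Implicit Defensive.

Import Order.TTheory GRing.Theory Num.Theory.
Import numFieldNormedType.Exports.

Local Open Scope classical_set_scope.
Local Open Scope ring_scope.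

(** * Power integrals and local nondeterminism *)

(** The moment bound integrates out one frequency at a time. After Fourier inversion the shifts only
    turn phases, which absolute values discard; what remains is the Gaussian decay of a quadratic
    form in the frequencies. Completing the square in the frequency of one time leaves a
    one-dimensional integral governed by the variance conditional on the times after it in the list.
    Local nondeterminism bounds it below by [gap^(2H)], so each time costs [gap^(-H)] per
    coordinate, and interpolating [n] coordinates with the trivial bound 1 gives [gap^(-H e)] for
    any [e <= n]. Integrability over the time asks [H e < 1]: hence [theta < min(n, 1/H)]. For
    [n = 1] the quadratic zero at frequency 0 yields a factor [u^(2e)] that grows, and all
    frequencies must pay for it at once. A quarter of the quadratic form is set aside and bounded
    below at every time by the power [2H] of an isolation radius. The product of inverse radii is at
    most that of [gap^(-3)], and its power [2 H e] is the loss [6 H e] in the exponent. *)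

Section monotone.
Local Open Scope ereal_scope.
Context d (T : measurableType d) (R : realType) (mu : {measure set T -> \bar R}).

Import HBNNSimple.

(* Unlike [ge0_le_integral], measurability is not required. *)
Lemma ge0_le_integral_nomeas (D : set T) (f g : T -> \bar R) :
  (forall x, D x -> 0 <= f x) -> (forall x, D x -> f x <= g x) ->
  \int[mu]_(x in D) f x <= \int[mu]_(x in D) g x.
Proof.
move=> f0 fg.
have g0 x : D x -> 0 <= g x by move=> Dx; rewrite (le_trans (f0 _ Dx))// fg.
rewrite !ge0_integralE//; apply: ereal_sup_le.
move=> _ [h hf <-]; exists h => // x.
have /= := hf x; rewrite /patch; case: ifPn => // /set_mem Dx /le_trans; apply.
exact: fg.
Qed.

End monotone.

Section scaling.
Context {R : realType}.
Notation mu := (@lebesgue_measure R).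
Local Open Scope ereal_scope.

Lemma measurable_mulr (c : R) : measurable_fun setT (fun x : R => c * x)%R.
Proof. by apply: measurable_funM => //; exact: measurable_id. Qed.

Lemma lebesgue_measure_scale (c : R) (c0 : (0 < c)%R) (A : set R) : measurable A ->
  mu A = (c)%:E * mu ((fun x => c * x)%R @^-1` A).
Proof.
move=> mA.
pose f : measurableTypeR R -> measurableTypeR R := fun x => (c * x)%R.
have mf : measurable_fun setT f := measurable_mulr c.
rewrite (_ : _ * _ = mscale (NngNum (ltW c0)) (pushforward mu f) A)//.
apply: lebesgue_measure_unique => //= _ [[a b]] _ <-.
transitivity (c%:E * mu (f @^-1` `]a, b]%classic)); last by [].
rewrite (_ : _ @^-1` _ = `]c^-1 * a, c^-1 * b]%classic)%R; last first.
  by apply/seteqP; split=> x; rewrite /= !in_itv/= ltr_pdivrMl// ler_pdivlMl//.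
rewrite !lebesgue_measure_itv/= !lte_fin ltr_pM2l ?invr_gt0//.
case: ifPn => _; rewrite ?mule0// -!EFinD -EFinM; congr EFin.
by rewrite -mulrBr mulrA divff ?gt_eqF// mul1r.
Qed.

Lemma ge0_integral_scale (c : R) (f : R -> \bar R) : (0 < c)%R ->
  measurable_fun setT f -> (forall x, 0 <= f x) ->
  \int[mu]_(x in `]0%R, +oo[) f (c * x)%R
  = (c^-1)%:E * \int[mu]_(x in `]0%R, +oo[) f x.
Proof.
move=> c0 mf f0.
have mD : measurable (`]0%R, +oo[%classic : set R) by [].
pose m : measurableTypeR R -> measurableTypeR R := fun x => (c * x)%R.
have mm : measurable_fun setT m := measurable_mulr c.
have E : \int[mu]_(x in `]0%R, +oo[) f x =
   \int[mscale (NngNum (ltW c0)) (pushforward mu m)]_(x in `]0%R, +oo[) f x.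
  move=> mm'; apply: eq_measure_integral => A mA AD /=.
  exact: (lebesgue_measure_scale c0 mA).
rewrite (E mm).
rewrite ge0_integral_mscale//; last exact: measurable_funTS.
rewrite ge0_integral_pushforward//; last exact: measurable_funTS.
rewrite /= muleA -EFinM mulVf ?gt_eqF// mul1e.
congr integral; apply/seteqP; split => x; rewrite /= !in_itv/= !andbT.
  by move=> x0; rewrite mulr_gt0.
by rewrite pmulr_rgt0.
Qed.

End scaling.

Section Rint_tools.
Context d (T : measurableType d) (R : realType) (mu : {measure set T -> \bar R}).
Variables (D : set T) (mD : measurable D).
Implicit Types f g : T -> R.

(** Integrability of real functions: linear combinations of integrals are then formed in [R],
    without the side conditions of sums in [\bar R]. *)
Definition rint f := mu.-integrable D (EFin \o f).

Lemma rint_meas f : rint f -> measurable_fun D f.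
Proof. by move=> /measurable_int/measurable_EFinP. Qed.

Lemma rintD f g : rint f -> rint g -> rint (fun x => f x + g x).
Proof. by move=> If Ig; have := integrableD mD If Ig; apply: eq_integrable. Qed.

Lemma rintB f g : rint f -> rint g -> rint (fun x => f x - g x).
Proof. by move=> If Ig; have := integrableB mD If Ig; apply: eq_integrable. Qed.

Lemma rintZ k f : rint f -> rint (fun x => k * f x).
Proof. by move=> If; have := integrableZl mD k If; apply: eq_integrable. Qed.

Lemma eq_rint f g : {in D, f =1 g} -> rint f -> rint g.
Proof. by move=> fg; apply: eq_integrable => // x xD /=; rewrite fg. Qed.

Lemma le_rint f g : measurable_fun D f -> (forall x, D x -> `|f x| <= g x) ->
  rint g -> rint f.
Proof.
move=> mf fg Ig; apply: (le_integrable mD _ _ Ig).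
  exact/measurable_EFinP.
by move=> x Dx /=; rewrite lee_fin (le_trans (fg _ Dx))// ler_norm.
Qed.

Lemma rint_ge0 f : measurable_fun D f -> (forall x, D x -> 0 <= f x) ->
  (\int[mu]_(x in D) (f x)%:E < +oo)%E -> rint f.
Proof.
move=> mf f0 foo; apply/integrableP; split; first exact/measurable_EFinP.
rewrite (eq_integral (fun x => (f x)%:E))// => x /set_mem Dx /=.
by rewrite ger0_norm// f0.
Qed.

Lemma rintE f : rint f -> (\int[mu]_(x in D) (f x)%:E = (\int[mu]_(x in D) f x)%:E)%E.
Proof. by move=> If; rewrite /Rintegral fineK//; exact: integrable_fin_num. Qed.

Lemma rint_sum (I : Type) (s : seq I) (F : I -> T -> R) :
  (forall i, rint (F i)) -> rint (fun x => \sum_(i <- s) F i x) /\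
  \int[mu]_(x in D) (\sum_(i <- s) F i x) = \sum_(i <- s) \int[mu]_(x in D) F i x.
Proof.
move=> IF; elim: s => [|i s [IH1 IH2]].
  rewrite big_nil; split.
    have := integrable0 mu D; apply: eq_integrable => // x _ /=.
    by rewrite big_nil.
  under eq_Rintegral do rewrite big_nil.
  by rewrite Rintegral_cst ?mul0r.
split.
  by apply: eq_rint (rintD (IF i) IH1) => x _; rewrite big_cons.
under eq_Rintegral do rewrite big_cons.
by rewrite big_cons -IH2 (RintegralD mD (IF i) IH1).
Qed.

End Rint_tools.

Section integral_exhaustion.
Local Open Scope ereal_scope.
Context d (T : measurableType d) (R : realType) (mu : {measure set T -> \bar R}).

Lemma ge0_integral_bigcup_le (F : (set T)^nat) (f : T -> \bar R) (M : \bar R) :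
  nondecreasing_seq F -> (forall i, measurable (F i)) ->
  measurable_fun (\bigcup_i F i) f -> (forall x, 0 <= f x) ->
  (forall i, \int[mu]_(x in F i) f x <= M) ->
  \int[mu]_(x in \bigcup_i F i) f x <= M.
Proof.
move=> ndF mF mf f0 FM.
have mfi i : measurable_fun (F i) f.
  by apply: measurable_funS mf; [exact: bigcup_measurable|exact: bigcup_sup].
have h := ge0_nondecreasing_set_cvg_integral ndF mF mfi (fun i x _ => f0 x) (mu:=mu).
rewrite -(cvg_lim _ h)//; apply: lime_le; last exact: nearW.
by apply/cvg_ex; exists (\int[mu]_(x in \bigcup_i F i) f x).
Qed.

End integral_exhaustion.

Section power_integrals.
Context {R : realType}.
Notation mu := (@lebesgue_measure R).

Lemma continuous_powR_pos (p x : R) : 0 < x -> {for x, continuous (@powR R ^~ p)}.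
Proof.
move=> x0; apply/differentiable_continuous/derivable1_diffP.
by have [] := is_derive1_powR p x0.
Qed.

Lemma measurable_powR_cst (p : R) : measurable_fun setT (@powR R ^~ p).
Proof. exact: measurable_powR. Qed.

Lemma integral_powR (p a b : R) : 0 < a -> a < b -> p + 1 != 0 ->
  (\int[mu]_(x in `[a, b]) (x `^ p)%:E =
  ((b `^ (p + 1) - a `^ (p + 1)) / (p + 1))%:E)%E.
Proof.
move=> a0 ab p1.
have D (x : R) : 0 < x -> is_derive x 1 (fun x => x `^ (p + 1) / (p + 1)) (x `^ p).
  move=> x0; have h := is_derive1_powR (p + 1) x0.
  have -> : (fun x => x `^ (p + 1) / (p + 1)) =
            (fun x => (p + 1)^-1 *: (x `^ (p + 1))).
    by apply/funext => y; rewrite mulrC.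
  apply: is_derive_eq.
  by rewrite -mulr_algl addrK /GRing.scale/= mulr1 mulrA mulVf// mul1r.
rewrite (@continuous_FTC2 _ _ (fun x => x `^ (p + 1) / (p + 1)))//.
- by rewrite -EFinB mulrBl.
- apply: continuous_in_subspaceT => x /set_mem/=; rewrite in_itv/= => /andP[ax _].
  by apply: continuous_powR_pos; rewrite (lt_le_trans a0).
- have c x : 0 < x -> {for x, continuous (fun x => x `^ (p + 1) / (p + 1))}.
    move=> x0; apply/differentiable_continuous/derivable1_diffP.
    by have [] := D _ x0.
  split.
  + move=> x; rewrite in_itv/= => /andP[ax _].
    by have [] := D x (lt_trans a0 ax).
  + by apply: cvg_at_right_filter; apply: c.
  + by apply: cvg_at_left_filter; apply: c; rewrite (lt_trans a0).
- move=> x; rewrite in_itv/= => /andP[ax _].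
  rewrite derive1E.
  by have [_ ->] := D x (lt_trans a0 ax).
Qed.

Lemma integral_powR_01 (p : R) : -1 < p ->
  (\int[mu]_(x in `]0%R, 1%R]) (x `^ p)%:E <= ((p + 1)^-1)%:E)%E.
Proof.
move=> p1; have p0 : 0 < p + 1 by rewrite -ltrBlDr sub0r.
(* [n.+2] keeps the left end strictly below 1, as [integral_powR] requires. *)
have -> : `]0%R, 1%R]%classic = \bigcup_n `[(n.+2%:R^-1 : R), 1]%classic.
  apply/seteqP; split => x /=.
    rewrite in_itv/= => /andP[x0 x1].
    have [n _ /(_ n (leqnn n)) h] := near_infty_natSinv_lt (PosNum x0).
    exists n => //=; rewrite in_itv/= x1 andbT ltW// (le_lt_trans _ h)//=.
    by rewrite lef_pV2 ?posrE// ler_nat.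
  move=> [n _] /=; rewrite !in_itv/= => /andP[h ->]; rewrite andbT.
  by rewrite (lt_le_trans _ h)// invr_gt0.
apply: ge0_integral_bigcup_le => //.
- apply/nondecreasing_seqP => n; apply/subsetPset => x /=.
  rewrite !in_itv/= => /andP[h ->]; rewrite andbT (le_trans _ h)//.
  by rewrite lef_pV2 ?posrE// ler_nat.
- apply/measurable_EFinP/measurable_funTS; exact: measurable_powR.
- by move=> x; rewrite lee_fin powR_ge0.
- move=> n; rewrite integral_powR ?invr_gt0// ?gt_eqF//; last first.
    by rewrite invf_lt1// ltr1n.
  rewrite lee_fin powR1 ler_pdivrMr// mulVf ?gt_eqF// gerBl powR_ge0.
Qed.

Lemma integral_powR_1y (p : R) : p < -1 ->
  (\int[mu]_(x in `[1%R, +oo[) (x `^ p)%:E <= (- (p + 1)^-1)%:E)%E.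
Proof.
move=> p1; have p0 : p + 1 < 0 by rewrite -ltrBrDr sub0r.
have -> : `[1%R, +oo[%classic = \bigcup_n `[1, (n.+2%:R : R)]%classic.
  apply/seteqP; split => x /=.
    rewrite in_itv/= andbT => x1.
    exists (Num.truncn x) => //=; rewrite in_itv/= x1/= ltW//.
    have := truncnS_gt x => /lt_trans; apply; by rewrite ltr_nat.
  by move=> [n _] /=; rewrite !in_itv/= => /andP[->].
apply: ge0_integral_bigcup_le => //.
- apply/nondecreasing_seqP => n; apply/subsetPset => x /=.
  by rewrite !in_itv/= => /andP[-> h]/=; rewrite (le_trans h)// ler_nat.
- apply/measurable_EFinP/measurable_funTS; exact: measurable_powR.
- by move=> x; rewrite lee_fin powR_ge0.
- move=> n; rewrite integral_powR ?lt_eqF// ?ltr1n//.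
  rewrite lee_fin powR1 -invrN ler_ndivrMr// invrN mulNr mulVf ?lt_eqF//.
  by rewrite lerBrDr addNr powR_ge0.
Qed.

End power_integrals.

Section trig.
Context {R : realType}.
Implicit Types x y t r : R.

Lemma sin_le x : 0 <= x -> `|sin x| <= x.
Proof.
rewrite le_eqVlt => /predU1P[<-|x0]; first by rewrite sin0 normr0.
have [c _] := @MVT R sin cos 0 x x0 (fun y _ => is_derive_sin y)
  (continuous_subspaceT (@continuous_sin R)).
rewrite sin0 !subr0 => ->; rewrite normrM (gtr0_norm x0).
by rewrite ler_piMl ?cos_max// ltW.
Qed.

Lemma one_sub_cos_ge0 x : 0 <= 1 - cos x.
Proof. by rewrite subr_ge0 cos_le1. Qed.

Lemma one_sub_cos_le2 x : 1 - cos x <= 2.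
Proof. by have := cos_geN1 x; lra. Qed.

Lemma one_sub_cos_le_sqr x : 1 - cos x <= x ^+ 2.
Proof.
wlog x0 : x / 0 <= x.
  move=> h; case: (leP 0 x) => [/h//|x0].
  by rewrite -cosN -sqrrN; apply: h; rewrite oppr_ge0 ltW.
have -> : x = (x / 2) *+ 2 by rewrite -mulr_natr divfK.
have x20 : 0 <= x / 2 by rewrite divr_ge0.
rewrite cos_mulr2n cos2sin2; have := sin_le x20.
rewrite -ler_sqr ?nnegrE// real_normK ?num_real// => h.
set u := x / 2 in h *; move: (sin u) h => w h.
rewrite !mulr2n; nra.
Qed.

(** The left side is the real part of [(1 - e^(ix)) (1 - e^(-iy))], the right side its polarised
    form. Integrated against a power weight, the identity becomes the covariance of fractional
    Brownian motion. *)
Lemma one_sub_cosMD x y : (1 - cos x) * (1 - cos y) + sin x * sin y =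
  (1 - cos x) + (1 - cos y) - (1 - cos (x - y)).
Proof. by rewrite cosB; ring. Qed.

(** A wave times the Fejer factor [1 - cos] becomes a combination of terms [1 - cos], each of which
    integrates against [x^(-2)] to a multiple of an absolute value. *)
Lemma cosM_one_sub_cos x y : cos x * (1 - cos y) =
  2^-1 * (1 - cos (x + y)) + 2^-1 * (1 - cos (x - y)) - (1 - cos x).
Proof. by rewrite cosD cosB; field. Qed.

End trig.

(** * Integrals of [1 - cos] against power weights *)

Section stable_integrals.
Context {R : realType}.
Notation mu := (@lebesgue_measure R).
Local Notation D := (`]0%R, +oo[%classic : set (measurableTypeR R)).
Implicit Types a t r : R.

Let mD : measurable D. Proof. by []. Qed.

(** Common majorant, up to a constant depending on [t], of the integrands
    [(1 - cos (t * x)) * x^(-1 - a)]. It is integrable at 0 because [a < 2] and at infinity because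
    [0 < a]. *)
Definition stable_weight a (x : R) := Num.min 1 (x ^+ 2) * x `^ (-1 - a).

Lemma measurable_stable_weight a : measurable_fun setT (stable_weight a).
Proof.
apply: measurable_funM; last exact: measurable_powR.
by apply: measurable_minr => //; exact: measurable_funX.
Qed.

Lemma stable_weight_ge0 a x : 0 <= stable_weight a x.
Proof. by rewrite mulr_ge0 ?powR_ge0// le_min ler01 sqr_ge0. Qed.

Lemma rint_stable_weight a : 0 < a < 2 -> rint mu D (stable_weight a).
Proof.
move=> /andP[a0 a2]; apply: rint_ge0 => //.
- by apply: measurable_funTS; exact: measurable_stable_weight.
- by move=> x _; exact: stable_weight_ge0.
have -> : D = `]0%R, 1%R] `|` `[1%R, +oo[.
  apply/seteqP; split => x /=; rewrite !in_itv/= !andbT.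
    by move=> x0; have [x1|x1] := leP x 1; [left; rewrite x0|right; exact: ltW].
  by move=> [/andP[]//|]; exact: lt_le_trans.
apply: (@le_lt_trans _ _ (\int[mu]_(x in `]0%R, 1%R]) (stable_weight a x)%:E +
   \int[mu]_(x in `[1%R, +oo[) (stable_weight a x)%:E)%E).
  have mw (A : set R) : measurable_fun A (fun x => (stable_weight a x)%:E).
    apply/measurable_EFinP; apply: measurable_funTS.
    exact: measurable_stable_weight.
  rewrite (_ : `]0%R, 1%R] `|` `[1%R, +oo[ = `]0%R, 1%R] `|` `]1%R, +oo[); last first.
    apply/seteqP; split => x /=; rewrite !in_itv/= !andbT => -[h|h]; first by left.
    + by move: h; rewrite le_eqVlt => /predU1P[<-|]; [left; rewrite ltr01 lexx|right].
    + by left.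
    + by right; exact: ltW.
  rewrite ge0_integral_setU//=.
  - rewrite leeD2l//.
    by rewrite (@integral_itv_obnd_cbnd _ 1%R); last exact: mw.
  - exact: mw.
  - by move=> x _; rewrite lee_fin stable_weight_ge0.
  - apply/disj_setPS => x [] /=; rewrite !in_itv/= andbT => /andP[_ x1].
    by rewrite ltNge x1.
apply: lte_add_pinfty.
  apply: (@le_lt_trans _ _ (\int[mu]_(x in `]0%R, 1%R]) (x `^ (1 - a))%:E)%E).
    apply: ge0_le_integral_nomeas => x /=; rewrite in_itv/= => /andP[x0 x1].
      by rewrite lee_fin stable_weight_ge0.
    rewrite lee_fin /stable_weight.
    rewrite (_ : 1 - a = 2 + (-1 - a)); last by ring.
    rewrite (@powRD _ x 2 (-1 - a)); last by rewrite (gt_eqF x0)/= implybT.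
    rewrite (@powR_mulrn _ x 2) ?(ltW x0)//; apply: ler_wpM2r; first exact: powR_ge0.
    by rewrite ge_min lexx orbT.
  by apply: (le_lt_trans (integral_powR_01 _)); [lra|rewrite ltry].
apply: (@le_lt_trans _ _ (\int[mu]_(x in `[1%R, +oo[) (x `^ (-1 - a))%:E)%E).
  apply: ge0_le_integral_nomeas => x /=; rewrite in_itv/= andbT => x1.
    by rewrite lee_fin stable_weight_ge0.
  by rewrite lee_fin ler_piMl ?powR_ge0// ge_min lexx.
by apply: (le_lt_trans (integral_powR_1y _)); [lra|rewrite ltry].
Qed.

Lemma measurable_one_sub_cos t : measurable_fun setT (fun x : R => 1 - cos (t * x)).
Proof.
apply: measurable_funB => //; apply: measurableT_comp; last exact: measurable_mulr.
by apply: continuous_measurable_fun; exact: continuous_cos.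
Qed.

Lemma one_sub_cos_le_min t x : 1 - cos (t * x) <= 2 * Num.max 1 (t ^+ 2) * Num.min 1 (x ^+ 2).
Proof.
have m1 : 1 <= Num.max 1 (t ^+ 2) by rewrite le_max lexx.
have m2 : t ^+ 2 <= Num.max 1 (t ^+ 2) by rewrite le_max lexx orbT.
rewrite /(Num.min 1 _); case: ifPn => _.
  by rewrite mulr1 (le_trans (one_sub_cos_le2 _))// ler_peMr.
rewrite (le_trans (one_sub_cos_le_sqr _))// exprMn ler_wpM2r ?sqr_ge0//.
by rewrite (le_trans m2)// ler_peMl ?ler1n// (le_trans _ m1).
Qed.

Lemma rint_one_sub_cos a t : 0 < a < 2 ->
  rint mu D (fun x => (1 - cos (t * x)) * x `^ (-1 - a)).
Proof.
move=> a02; have h := (rintZ mD (2 * Num.max 1 (t ^+ 2)) (rint_stable_weight a02)). apply: (le_rint mD _ _ h).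
  apply: measurable_funTS; apply: measurable_funM; last exact: measurable_powR.
  exact: measurable_one_sub_cos.
move=> x _; rewrite ger0_norm ?mulr_ge0 ?one_sub_cos_ge0 ?powR_ge0//.
by rewrite /stable_weight mulrA ler_wpM2r ?powR_ge0// one_sub_cos_le_min.
Qed.

Lemma rint_one_sub_cos_sqr a t : 0 < a < 2 ->
  rint mu D (fun x => (1 - cos (t * x)) ^+ 2 * x `^ (-1 - a)).
Proof.
move=> a02; apply: (le_rint mD _ _ (rintZ mD 2 (rint_one_sub_cos t a02))).
  apply: measurable_funTS; apply: measurable_funM; last exact: measurable_powR.
  by apply: measurable_funX; exact: measurable_one_sub_cos.
move=> x _; rewrite ger0_norm ?mulr_ge0 ?sqr_ge0 ?powR_ge0//.
rewrite mulrA ler_wpM2r ?powR_ge0// expr2 ler_wpM2r ?one_sub_cos_ge0//.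
exact: one_sub_cos_le2.
Qed.

(** Scaling [x] extracts the power [a] of [t], so the spectral integrals depend on no other
    constants; the estimates ask only that these be positive. *)
Definition stable_cst a := \int[mu]_(x in D) ((1 - cos x) * x `^ (-1 - a)).
Definition stable_cst2 a := \int[mu]_(x in D) ((1 - cos x) ^+ 2 * x `^ (-1 - a)).

Let scale_weight (g : R -> R) a t : measurable_fun setT g -> (forall x, 0 <= g x) ->
  0 < t -> \int[mu]_(x in D) (g (t * x) * x `^ (-1 - a)) =
  t `^ a * \int[mu]_(x in D) (g x * x `^ (-1 - a)).
Proof.
move=> mg g0 t0.
have mf : measurable_fun setT (fun x => (g x * x `^ (-1 - a))%:E).
  by apply/measurable_EFinP/measurable_funM => //; exact: measurable_powR.
have f0 x : (0 <= (g x * x `^ (-1 - a))%:E)%E by rewrite lee_fin mulr_ge0 ?powR_ge0.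
have := ge0_integral_scale t0 mf f0.
have -> : (\int[mu]_(x in D) (g (t * x) * (t * x) `^ (-1 - a))%:E =
   \int[mu]_(x in D) ((t `^ (-1 - a))%:E * (g (t * x) * x `^ (-1 - a))%:E))%E.
  apply: eq_integral.
  move=> x /set_mem/=; rewrite in_itv/= andbT => x0.
  by rewrite -EFinM powRM ?ltW//; congr EFin; ring.
rewrite ge0_integralZl_EFin ?powR_ge0//; last 2 first.
- by move=> x _; rewrite lee_fin mulr_ge0 ?powR_ge0.
- apply/measurable_EFinP/measurable_funTS/measurable_funM; last exact: measurable_powR.
  by apply: measurableT_comp => //; exact: measurable_mulr.
have -> : t^-1 = t `^ (-1 - a) * t `^ a.
  by rewrite -powRD ?(gt_eqF t0) ?implybT// subrK powR_inv1 ?ltW.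
rewrite EFinM -muleA => h.
have tE : (0 < t `^ (-1 - a)) by rewrite powR_gt0.
have {}h : (\int[mu]_(x in D) (g (t * x) * x `^ (-1 - a))%:E =
  (t `^ a)%:E * \int[mu]_(x in D) (g x * x `^ (-1 - a))%:E)%E.
  have := congr1 (fun z => ((t `^ (-1 - a))^-1%:E * z)%E) h.
  by rewrite !muleA -!EFinM mulVf ?gt_eqF// mul1r mul1e.
(* At an infinite integral [fine] returns 0 on both sides, so the identity holds there as well. *)
rewrite /Rintegral h.
have := powR_gt0 a t0; case: (\int[mu]_(x in D) _)%E => [r|//|] s0 //=.
- by rewrite mulr_infty gtr0_sg// mul1e/= mulr0.
- by rewrite mulr_infty gtr0_sg// mul1e/= mulr0.
Qed.

Lemma integral_one_sub_cos a t : 0 < a < 2 ->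
  \int[mu]_(x in D) ((1 - cos (t * x)) * x `^ (-1 - a)) = `|t| `^ a * stable_cst a.
Proof.
move=> /andP[a0 a2].
wlog t0 : t / 0 <= t => [h|].
  case: (leP 0 t) => [/h//|t0]; rewrite -normrN -h ?oppr_ge0 ?ltW//.
  by apply: eq_Rintegral => x _; rewrite mulNr cosN.
rewrite ger0_norm//; move: t0; rewrite le_eqVlt => /predU1P[<-|t0].
  rewrite powR0 ?gt_eqF// mul0r.
  under eq_Rintegral do rewrite mul0r cos0 subrr mul0r.
  by rewrite Rintegral_cst ?mul0r.
rewrite -(@scale_weight (fun y => 1 - cos y))//.
have := measurable_one_sub_cos 1.
by under [X in measurable_fun _ X -> _]eq_fun do rewrite mul1r.
Qed.

Lemma integral_one_sub_cos_sqr a t : 0 < t ->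
  \int[mu]_(x in D) ((1 - cos (t * x)) ^+ 2 * x `^ (-1 - a)) = t `^ a * stable_cst2 a.
Proof.
move=> t0.
rewrite -(@scale_weight (fun y => (1 - cos y) ^+ 2))//.
apply: measurable_funX; have := measurable_one_sub_cos 1.
by under [X in measurable_fun _ X -> _]eq_fun do rewrite mul1r.
Qed.

(** Positivity is tested on [[pi/2, pi]], where the cosine is nonpositive and hence [1 - cos] is at
    least 1. *)
Let lower_itv (f : R -> R) : rint mu D f -> (forall x, 0 <= f x) ->
  (exists2 e, 0 < e & forall x, pi / 2 <= x <= pi -> e <= f x) ->
  0 < \int[mu]_(x in D) f x.
Proof.
move=> If f0 [e e0 ef].
have : (0 < \int[mu]_(x in D) (f x)%:E)%E; last by rewrite (rintE mD If) lte_fin.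
have pi0 : 0 < pi / 2 :> R by rewrite divr_gt0 ?pi_gt0.
have pi1 : pi / 2 < pi :> R by rewrite ltr_pdivrMr// ltr_pMr ?pi_gt0// ltr1n.
apply: (@lt_le_trans _ _ (\int[mu]_(x in `[(pi / 2)%R, pi%R]) e%:E)%E).
  rewrite integral_cst//= lebesgue_measure_itv/= lte_fin pi1 -EFinD -EFinM lte_fin.
  by rewrite mulr_gt0// subr_gt0.
apply: (@le_trans _ _ (\int[mu]_(x in `[(pi / 2)%R, pi%R]) (f x)%:E)%E).
  apply: ge0_le_integral_nomeas => x /=; rewrite in_itv/= => xpi.
    by rewrite lee_fin ltW.
  by rewrite lee_fin ef.
apply: ge0_subset_integral => //.
- by apply/measurable_EFinP; exact: rint_meas If.
- by move=> x _; rewrite lee_fin.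
- by move=> x /=; rewrite !in_itv/= andbT => /andP[+ _]; exact: lt_le_trans.
Qed.

Let cos_neg (x : R) : pi / 2 <= x <= pi -> cos x <= 0.
Proof.
move=> /andP[x1 x2]; rewrite leNgt -cos_pihalf.
have pi0 : 0 < pi :> R by exact: pi_gt0.
by rewrite ltr_cos ?in_itv/=; [rewrite -leNgt| |]; lra.
Qed.

Lemma stable_cst_gt0 a : 0 < a < 2 -> 0 < stable_cst a.
Proof.
move=> a02; apply: lower_itv.
- by apply: (eq_rint mD _ (rint_one_sub_cos 1 a02)) => x _; rewrite mul1r.
- by move=> x; rewrite mulr_ge0 ?powR_ge0 ?subr_ge0 ?cos_le1.
- exists (pi `^ (-1 - a)); first by rewrite powR_gt0// pi_gt0.
  move=> x xpi; have c := cos_neg xpi; move: xpi => /andP[x1 x2].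
  have x0 : 0 < x by rewrite (lt_le_trans _ x1)// divr_gt0 ?pi_gt0.
  have := a02 => /andP[a0 a2].
  rewrite (@le_trans _ _ (x `^ (-1 - a)))//; last by rewrite ler_peMl ?powR_ge0//; lra.
  rewrite -opprD !powRN lef_pV2 ?posrE ?powR_gt0 ?pi_gt0//.
  by apply: ge0_ler_powR; rewrite ?nnegrE ?(ltW x0) ?(ltW (pi_gt0 R))//; lra.
Qed.

Lemma stable_cst2_gt0 a : 0 < a < 2 -> 0 < stable_cst2 a.
Proof.
move=> a02; apply: lower_itv.
- by apply: (eq_rint mD _ (rint_one_sub_cos_sqr 1 a02)) => x _; rewrite mul1r.
- by move=> x; rewrite mulr_ge0 ?powR_ge0 ?sqr_ge0.
- exists (pi `^ (-1 - a)); first by rewrite powR_gt0// pi_gt0.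
  move=> x xpi; have c := cos_neg xpi; move: xpi => /andP[x1 x2].
  have x0 : 0 < x by rewrite (lt_le_trans _ x1)// divr_gt0 ?pi_gt0.
  have := a02 => /andP[a0 a2].
  rewrite (@le_trans _ _ (x `^ (-1 - a)))//; last first.
    by rewrite ler_peMl ?powR_ge0// exprn_ege1//; lra.
  rewrite -opprD !powRN lef_pV2 ?posrE ?powR_gt0 ?pi_gt0//.
  by apply: ge0_ler_powR; rewrite ?nnegrE ?(ltW x0) ?(ltW (pi_gt0 R))//; lra.
Qed.

End stable_integrals.

(** * Strong local nondeterminism of fractional Brownian motion *)

Section lnd.
Context {R : realType} (H : R) (hH : 0 < H < 1).
Notation mu := (@lebesgue_measure R).
Local Notation D := (`]0%R, +oo[%classic : set (measurableTypeR R)).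
Implicit Types (l : seq (R * R)) (s t r : R).

Definition fbm_cov s t := 2^-1 * (`|s| `^ (2 * H) + `|t| `^ (2 * H) - `|s - t| `^ (2 * H)).

(** A combination is coded as a list of pairs (coefficient, time). Times may repeat: the bridge adds
    an entry at time 1 to a list that may already contain it. *)
Definition fbm_var l := \sum_(p <- l) \sum_(q <- l) p.1 * q.1 * fbm_cov p.2 q.2.

Let mD : measurable D. Proof. by []. Qed.
(** [2H] is the weight exponent of the variance, 1 that of the Fejer test function, and [2 - 2H]
    that of its square divided by the spectral density. *)
Let a1 : 0 < 2 * H < 2. Proof. by move: hH => /andP[h0 h1]; lra. Qed.
Let a2 : 0 < 2 - 2 * H < 2. Proof. by move: hH => /andP[h0 h1]; lra. Qed.
Let a3 : 0 < (1 : R) < 2. Proof. by rewrite ltr01 ltr1n. Qed.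
Let c := stable_cst (2 * H).

Let e s t (x : R) := (1 - cos (s * x)) * (1 - cos (t * x)) + sin (s * x) * sin (t * x).

Let rint_e s t : rint mu D (fun x => e s t x * x `^ (-1 - 2 * H)).
Proof.
have h := rintB mD (rintD mD (rint_one_sub_cos s a1) (rint_one_sub_cos t a1))
  (rint_one_sub_cos (s - t) a1).
by apply: (eq_rint mD _ h) => x _; rewrite /e one_sub_cosMD -(mulrBl x s t); ring.
Qed.

Let int_e s t : \int[mu]_(x in D) (e s t x * x `^ (-1 - 2 * H)) = 2 * c * fbm_cov s t.
Proof.
have Is := rint_one_sub_cos s a1; have It := rint_one_sub_cos t a1.
have Ist := rint_one_sub_cos (s - t) a1.
transitivity (\int[mu]_(x in D) ((1 - cos (s * x)) * x `^ (-1 - 2 * H) +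
   (1 - cos (t * x)) * x `^ (-1 - 2 * H) - (1 - cos ((s - t) * x)) * x `^ (-1 - 2 * H))).
  by apply: eq_Rintegral => x _; rewrite /e one_sub_cosMD -(mulrBl x s t); ring.
rewrite (RintegralB mD (rintD mD Is It) Ist) (RintegralD mD Is It).
by rewrite !integral_one_sub_cos// /fbm_cov -/c; field.
Qed.

(** The spectral integrand [|\sum c (1 - e^(i t x))|^2] of the variance, expanded so that it
    integrates termwise. *)
Let S2 l x := \sum_(p <- l) \sum_(q <- l) p.1 * q.1 * e p.2 q.2 x.

Let S2E l x : S2 l x = (\sum_(p <- l) p.1 * (1 - cos (p.2 * x))) ^+ 2 +
  (\sum_(p <- l) p.1 * sin (p.2 * x)) ^+ 2.
Proof.
rewrite !expr2 !big_distrl/= -big_split/=; apply: eq_bigr => p _.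
rewrite !big_distrr/= -big_split/=; apply: eq_bigr => q _.
by rewrite /e; ring.
Qed.

Let fbm_varE l : rint mu D (fun x => S2 l x * x `^ (-1 - 2 * H)) /\
  \int[mu]_(x in D) (S2 l x * x `^ (-1 - 2 * H)) = 2 * c * fbm_var l.
Proof.
pose F (p q : R * R) x := p.1 * q.1 * (e p.2 q.2 x * x `^ (-1 - 2 * H)).
have IF p q : rint mu D (F p q) by apply: rintZ => //; exact: rint_e.
have G p := rint_sum mD l (IF p).
have [G1 G2] := rint_sum mD l (fun p => (G p).1).
have E x : \sum_(p <- l) \sum_(q <- l) F p q x = S2 l x * x `^ (-1 - 2 * H).
  rewrite /S2 big_distrl/=; apply: eq_bigr => p _; rewrite big_distrl/=.
  by apply: eq_bigr => q _; rewrite /F mulrA.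
split; first by apply: (eq_rint mD _ G1) => x _; rewrite E.
under eq_Rintegral do rewrite -E.
rewrite G2 /fbm_var big_distrr/=; apply: eq_bigr => p _; rewrite (G p).2 big_distrr/=.
apply: eq_bigr => q _; rewrite /F RintegralZl//; last exact: rint_e.
by rewrite int_e; ring.
Qed.

Let c1 := stable_cst (1 : R).
(** The triangle function [max(0, r - |u|)]: it vanishes for [|u| >= r] and equals [r] at 0. *)
Let T r u := 2^-1 * (`|u + r| + `|u - r|) - `|u|.

Let int_T r u : rint mu D (fun x => cos (u * x) * (1 - cos (r * x)) * x `^ (-1 - 1)) /\
  \int[mu]_(x in D) (cos (u * x) * (1 - cos (r * x)) * x `^ (-1 - 1)) = c1 * T r u.
Proof.
pose f t x := (1 - cos (t * x)) * x `^ (-1 - 1 : R).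
have If t : rint mu D (f t) := rint_one_sub_cos t a3.
have E x : cos (u * x) * (1 - cos (r * x)) * x `^ (-1 - 1) =
   2^-1 * f (u + r) x + 2^-1 * f (u - r) x - f u x.
  by rewrite cosM_one_sub_cos -mulrDl -mulrBl /f; ring.
have h := rintD mD (rintZ mD 2^-1 (If (u + r))) (rintZ mD 2^-1 (If (u - r))).
split.
  by apply: (eq_rint mD _ (rintB mD h (If u))) => x _; rewrite E.
under eq_Rintegral do rewrite E.
rewrite (RintegralB mD h (If u)).
rewrite (RintegralD mD (rintZ mD 2^-1 (If (u + r))) (rintZ mD 2^-1 (If (u - r)))).
have Ef t : \int[mu]_(x in D) f t x = `|t| * c1.
  by rewrite -(powRr1 (normr_ge0 t)); exact: integral_one_sub_cos.
have EZ k t : \int[mu]_(x in D) (k * f t x) = k * (`|t| * c1).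
  by rewrite -Ef; exact: (RintegralZl k mD (If t)).
transitivity (2^-1 * (`|u + r| * c1) + 2^-1 * (`|u - r| * c1) - `|u| * c1).
  by congr (_ + _ - _); [exact: EZ|exact: EZ|exact: Ef].
by rewrite /T; ring.
Qed.

(** Real part of [e^(-i t x) \sum c_p (e^(i t_p x) - 1)], hence dominated by the modulus, whose
    square is [S2]. *)
Let A l t x := \sum_(p <- l) p.1 * (cos ((p.2 - t) * x) - cos (t * x)).

Let A_le l t x : A l t x ^+ 2 <= S2 l x.
Proof.
rewrite S2E; set a := \sum_(p <- l) _; set b := \sum_(p <- l) _.
have -> : A l t x = - cos (t * x) * a + sin (t * x) * b.
  rewrite /A !big_distrr/= -big_split/=; apply: eq_bigr => p _.
  by rewrite mulrBl cosB; ring.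
have := cos2Dsin2 (t * x); move: (cos _) (sin _) => C S CS.
have -> : a ^+ 2 + b ^+ 2 = (C ^+ 2 + S ^+ 2) * (a ^+ 2 + b ^+ 2) by rewrite CS mul1r.
have := sqr_ge0 (S * a + C * b); nra.
Qed.

Let int_A l t r : 0 < r -> r <= `|t| ->
  (forall p, p \in l -> p.2 != t -> p.1 != 0 -> r <= `|p.2 - t|) ->
  rint mu D (fun x => A l t x * ((1 - cos (r * x)) * x `^ (-1 - 1))) /\
  \int[mu]_(x in D) (A l t x * ((1 - cos (r * x)) * x `^ (-1 - 1))) =
  c1 * r * \sum_(p <- l | p.2 == t) p.1.
Proof.
move=> r0 rt lt.
have T0 u : r <= `|u| -> T r u = 0.
  by move=> ru; rewrite /T; move: ru; case: (ler0P u); case: (ler0P (u + r));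
    case: (ler0P (u - r)); lra.
pose g u x := cos (u * x) * (1 - cos (r * x)) * x `^ (-1 - 1 : R).
pose F (p : R * R) x := p.1 * (g (p.2 - t) x - g t x).
have IF p : rint mu D (F p).
  by apply: rintZ => //; apply: rintB => //; exact: (int_T r _).1.
have [h1 h2] := rint_sum mD l IF.
have E x : A l t x * ((1 - cos (r * x)) * x `^ (-1 - 1)) = \sum_(p <- l) F p x.
  by rewrite /A big_distrl/=; apply: eq_bigr => p _; rewrite /F /g; ring.
split; first by apply: (eq_rint mD _ h1) => x _; rewrite E.
under eq_Rintegral do rewrite E.
rewrite h2 big_distrr/= [RHS]big_mkcond/= !big_seq; apply: eq_bigr => p pl.
rewrite /F RintegralZl//; last by apply: rintB => //; exact: (int_T r _).1.
rewrite (RintegralB mD (int_T r _).1 (int_T r _).1) /g !(int_T r _).2 (T0 t)// mulr0 subr0.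
case: ifPn => [/eqP->|pt].
  by rewrite subrr /T add0r sub0r normrN normr0 gtr0_norm//; field.
have [->|p0] := eqVneq p.1 0; first by rewrite mul0r.
by rewrite T0 ?mulr0// lt.
Qed.

(* Strong local nondeterminism, after Pitt: test the spectral representation
   of the variance against the Fejer kernel of width [r] centred at [t]. *)
Lemma fbm_var_lnd : exists2 k : R, 0 < k & forall l t r, 0 < r -> r <= `|t| ->
  (forall p, p \in l -> p.2 != t -> p.1 != 0 -> r <= `|p.2 - t|) ->
  k * r `^ (2 * H) * (\sum_(p <- l | p.2 == t) p.1) ^+ 2 <= fbm_var l.
Proof.
pose c2 := stable_cst2 (2 - 2 * H).
have c0 : 0 < c by exact: stable_cst_gt0.
have c10 : 0 < c1 by exact: stable_cst_gt0.
have c20 : 0 < c2 by exact: stable_cst2_gt0.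
exists (c1 ^+ 2 / c2 / (2 * c)); first apply: divr_gt0.
- by apply: divr_gt0; [exact: exprn_gt0|exact: c20].
- by apply: mulr_gt0; [rewrite ltr0n|exact: c0].
move=> l t r r0 rt lt; set u := \sum_(p <- l | _) _.
have [I1 E1] := fbm_varE l.
have [I2 E2] := int_A r0 rt lt.
have I3 := rint_one_sub_cos_sqr r a2.
have E3 := integral_one_sub_cos_sqr (2 - 2 * H) r0.
(* [m] maximises the quadratic [2 m (c1 r u) - m^2 (c2 r^(2 - 2H))]. Integrating
   [2 m a k - m^2 k^2 <= a^2] with this [m] is Cauchy-Schwarz without square roots. *)
pose m := c1 * u * r `^ (2 * H - 1) / c2.
have : \int[mu]_(x in D) (2 * m * (A l t x * ((1 - cos (r * x)) * x `^ (-1 - 1))) -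
    m ^+ 2 * ((1 - cos (r * x)) ^+ 2 * x `^ (-1 - (2 - 2 * H)))) <= 2 * c * fbm_var l.
  rewrite -E1; apply: le_Rintegral => //.
    exact: rintB (rintZ mD _ I2) (rintZ mD _ I3).
  move=> x /=; rewrite in_itv/= andbT => x0.
  apply: (@le_trans _ _ (A l t x ^+ 2 * x `^ (-1 - 2 * H))); last first.
    by rewrite ler_wpM2r ?powR_ge0.
  have w0 : 0 < x `^ (-1 - 2 * H) by exact: powR_gt0.
  have e1 : x `^ (-1 - 1) = x `^ (-1 - 2 * H) * x `^ (2 * H - 1).
    by rewrite -powRD ?(gt_eqF x0) ?implybT//; congr (_ `^ _); ring.
  have e2 : x `^ (-1 - (2 - 2 * H)) = x `^ (-1 - 2 * H) * x `^ (2 * H - 1) ^+ 2.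
    by rewrite expr2 mulrA -e1 -powRD ?(gt_eqF x0) ?implybT//; congr (_ `^ _); ring.
  rewrite e1 e2; set w := x `^ (-1 - 2 * H) in w0 *; set v := x `^ (2 * H - 1).
  have := mulr_ge0 (ltW w0) (sqr_ge0 (A l t x - m * ((1 - cos (r * x)) * v))).
  move=> h0; rewrite -subr_ge0.
  by rewrite (_ : _ - _ = w * (A l t x - m * ((1 - cos (r * x)) * v)) ^+ 2)//; ring.
rewrite (RintegralB mD (rintZ mD _ I2) (rintZ mD _ I3)) !RintegralZl// E2 E3 -/c2.
have r1 : r `^ (2 * H - 1) * r = r `^ (2 * H).
  by rewrite -{2}(powRr1 (ltW r0)) -powRD ?(gt_eqF r0) ?implybT// subrK.
have r2 : r `^ (2 * H - 1) ^+ 2 * r `^ (2 - 2 * H) = r `^ (2 * H).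
  rewrite expr2 -!powRD ?(gt_eqF r0) ?implybT//; congr (_ `^ _); ring.
rewrite -/u.
have -> : 2 * m * (c1 * r * u) - m ^+ 2 * (r `^ (2 - 2 * H) * c2) =
   c1 ^+ 2 / c2 * r `^ (2 * H) * u ^+ 2.
  transitivity (2 * (c1 * u) ^+ 2 / c2 * (r `^ (2 * H - 1) * r) -
    (c1 * u) ^+ 2 / c2 * (r `^ (2 * H - 1) ^+ 2 * r `^ (2 - 2 * H))).
    by rewrite /m; field; rewrite gt_eqF.
  by rewrite r1 r2; field; rewrite gt_eqF.
move=> h; rewrite -(ler_pM2l (mulr_gt0 (ltr0n _ 2) c0)); apply: le_trans h.
by rewrite le_eqVlt; apply/orP; left; apply/eqP; field; rewrite (gt_eqF c0) (gt_eqF c20).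
Qed.

End lnd.

(** * The normal characteristic function *)

Section integral_derivative.
Context {R : realType}.
Notation mu := (@lebesgue_measure R).
Let mT : measurable (setT : set (measurableTypeR R)). Proof. by []. Qed.

(** The bounds [K / n.+1] kill the boundary terms of the fundamental theorem of calculus along
    growing intervals, and integrability of [g] allows the passage to the limit. *)
Lemma integral_derivative_eq0 (G g : R -> R) (m K : R) :
  (forall x : R, is_derive x 1 G (g x)) -> continuous g ->
  rint mu setT g ->
  (forall n : nat, `|G (m + n.+1%:R)| <= K / n.+1%:R /\
                   `|G (m - n.+1%:R)| <= K / n.+1%:R) ->
  \int[mu]_x g x = 0.
Proof.
move=> dG cg Ig bG.
pose I (n : nat) : set (measurableTypeR R) := `[m - n.+1%:R, m + n.+1%:R]%classic.
pose f_ n x := (g \_ (I n) x)%:E.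
have mg : measurable_fun setT g by exact: continuous_measurable_fun.
have H1 n : measurable_fun setT (f_ n).
  apply/measurable_EFinP/(measurable_restrictT g) => //.
    exact: measurable_itv.
  exact: measurable_funS mg.
have H2 : measurable_fun setT (EFin \o g) by exact/measurable_EFinP.
have H3 : {ae mu, forall x, setT x -> f_ ^~ x @ \oo --> (EFin \o g) x}.
  apply: nearW => x _; apply: cvg_near_cst; near=> n.
  rewrite /f_ /patch ifT// inE /I/= in_itv/=.
  have xm : `|x - m| <= n.+1%:R.
    apply: (le_trans (ltW (truncnS_gt _))); rewrite ler_nat ltnS.
    by near: n; exact: nbhs_infty_ge.
  by move: xm; rewrite ler_norml => /andP[a b]; apply/andP; split; lra.
have H4 : mu.-integrable setT (fun x => `|g x|%:E).
  exact: integrable_norm.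
have H5 : {ae mu, forall x n, setT x -> (`|f_ n x| <= `|g x|%:E)%E}.
  apply: nearW => x n _; rewrite /f_ lee_fin /patch.
  by case: ifPn => // _; rewrite normr0.
have [_ _] := dominated_convergence mT H1 H2 H3 H4 H5.
have E n : (\int[mu]_(x in setT) f_ n x)%E = (G (m + n.+1%:R) - G (m - n.+1%:R))%:E.
  rewrite EFinB -(@continuous_FTC2 _ g G).
  - by rewrite [RHS]integral_mkcond/= restrict_EFin.
  - have : (0 < n.+1%:R :> R) by rewrite ltr0n.
    lra.
  - by apply: continuous_subspaceT.
  - have cG x : {for x, continuous G}.
      by apply/differentiable_continuous/derivable1_diffP; have [] := dG x.
    split.
    + by move=> x _; have [] := dG x.
    + by apply: cvg_at_right_filter; exact: cG.
    + by apply: cvg_at_left_filter; exact: cG.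
  - by move=> x _; rewrite derive1E; have [_ ->] := dG x.
under eq_fun do rewrite E.
move=> h.
have c : (fun n : nat => G (m + n.+1%:R) - G (m - n.+1%:R)) @ \oo --> (0 : R).
  apply: (@squeeze_cvgr _ _ _ _ (fun n => - (2 * K * n.+1%:R^-1)) (fun n => 2 * K * n.+1%:R^-1)).
  - apply: nearW => n; have [h1 h2] := bG n.
    rewrite -ler_norml (le_trans (ler_normB _ _))//.
    by rewrite -mulrA mulr_natl mulr2n lerD.
  - rewrite -oppr0; apply: cvgN; rewrite -(mulr0 (2 * K)); apply: cvgM; first exact: cvg_cst.
    exact: cvg_harmonic.
  - rewrite -(mulr0 (2 * K)); apply: cvgM; first exact: cvg_cst.
    exact: cvg_harmonic.
have c' : (G (m + n.+1%:R) - G (m - n.+1%:R))%:E @[n --> \oo] --> 0%:E.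
  by apply: cvg_EFin; [exact: nearW|exact: c].
by rewrite /Rintegral (cvg_unique (@ereal_hausdorff R) h c').
Unshelve. all: by end_near. Qed.

End integral_derivative.

Section normal_moments.
Context {R : realType} (m s : R) (s0 : s != 0).
Notation mu := (@lebesgue_measure R).
Let mT : measurable (setT : set (measurableTypeR R)). Proof. by []. Qed.
Let p := normal_pdf m s.
(** The exponential is a square [E * E]: one factor absorbs powers of [x - m], the other is up to a
    constant the normal density of deviation [sqrt 2 * s], an integrable majorant. *)
Let p' := normal_pdf m (Num.sqrt 2 * s).
Let s2 : 0 < s ^+ 2. Proof. by rewrite exprn_even_gt0. Qed.
Let s0' : Num.sqrt 2 * s != 0.
Proof. by rewrite mulf_neq0// sqrtr_eq0 -ltNge ltr0n. Qed.

Let E (x : R) := expR (- ((x - m) ^+ 2 / (4 * s ^+ 2))).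

Let pE x : p x = normal_peak s * (E x * E x).
Proof.
rewrite /p normal_pdfE// /normal_fun /E -expRD; congr (_ * expR _).
by rewrite -[s ^+ 2 *+ 2]mulr_natr; field.
Qed.

Let p'E x : p' x = normal_peak (Num.sqrt 2 * s) * E x.
Proof.
rewrite /p' normal_pdfE// /normal_fun /E; congr (_ * expR _).
by rewrite exprMn sqr_sqrtr ?ler0n// -mulr_natr; field.
Qed.

Let peak0 : 0 < normal_peak s. Proof. exact: normal_peak_gt0. Qed.
Let peak0' : 0 < normal_peak (Num.sqrt 2 * s). Proof. exact: normal_peak_gt0. Qed.
Let E0 x : 0 < E x. Proof. exact: expR_gt0. Qed.
Let E1 x : E x <= 1.
Proof. by rewrite /E expR_le1 oppr_le0 divr_ge0 ?sqr_ge0// mulr_ge0// ltW. Qed.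

Lemma is_derive_normal_pdf (x : R) : is_derive x 1 p (- (x - m) / s ^+ 2 * p x).
Proof.
have -> : p = fun x => normal_peak s * expR (- (x - m) ^+ 2 / (s ^+ 2 *+ 2)).
  by rewrite /p normal_pdfE.
apply: is_derive_eq.
rewrite !(scaler0, addr0, subr0, add0r, scaler1) /GRing.scale/= -[s ^+ 2 *+ 2]mulr_natr.
by field.
Qed.

Let sqE x : (x - m) ^+ 2 * E x <= 4 * s ^+ 2.
Proof.
rewrite /E; set u := _ / _.
have -> : (x - m) ^+ 2 = 4 * s ^+ 2 * u by rewrite /u; field.
have c0 : 0 <= 4 * s ^+ 2 by rewrite mulr_ge0// ltW.
rewrite [leLHS](_ : _ = 4 * s ^+ 2 * (u * expR (- u))); last by ring.
apply: ler_piMr => //; rewrite expRN ler_pdivrMr ?expR_gt0// mul1r.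
by have := expR_ge1Dx u; lra.
Qed.

Lemma normal_pdf_sq_le (x : R) : (x - m) ^+ 2 * p x <=
  4 * s ^+ 2 * normal_peak s / normal_peak (Num.sqrt 2 * s) * p' x.
Proof.
rewrite pE p'E.
have -> : (x - m) ^+ 2 * (normal_peak s * (E x * E x)) =
  normal_peak s * E x * ((x - m) ^+ 2 * E x) by ring.
have -> : 4 * s ^+ 2 * normal_peak s / normal_peak (Num.sqrt 2 * s) *
   (normal_peak (Num.sqrt 2 * s) * E x) = normal_peak s * E x * (4 * s ^+ 2).
  by field; rewrite gt_eqF.
by apply: ler_wpM2l; [rewrite mulr_ge0// ltW|exact: sqE].
Qed.

Lemma normal_pdf_sq_bounded (x : R) : (x - m) ^+ 2 * p x <= 4 * s ^+ 2 * normal_peak s.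
Proof.
rewrite pE.
have -> : (x - m) ^+ 2 * (normal_peak s * (E x * E x)) =
  normal_peak s * E x * ((x - m) ^+ 2 * E x) by ring.
rewrite [leRHS]mulrC; apply: ler_pM => //.
- by rewrite mulr_ge0// ltW.
- by rewrite mulr_ge0 ?sqr_ge0// ltW.
- by apply: ler_piMr; [exact: ltW|].
Qed.

Let p0 x : 0 <= p x. Proof. exact: normal_pdf_ge0. Qed.
Let mp : measurable_fun setT p. Proof. exact: measurable_normal_pdf. Qed.
Let Ip : rint mu setT p. Proof. exact: integrable_normal_pdf. Qed.

Lemma rint_normal_sq : rint mu setT (fun x => (x - m) ^+ 2 * p x).
Proof.
have h : rint mu setT p' by exact: integrable_normal_pdf.
apply: (le_rint mT _ _ (rintZ mT (4 * s ^+ 2 * normal_peak s / normal_peak (Num.sqrt 2 * s)) h)); last first.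
  move=> x _; rewrite ger0_norm; first exact: normal_pdf_sq_le.
  by apply: mulr_ge0; [exact: sqr_ge0|exact: p0].
apply: measurable_funM => //; apply: measurable_funX; exact: measurable_funB.
Qed.

Lemma rint_normal_lip (h : R -> R) : measurable_fun setT h ->
  (forall x, `|h x| <= 1 + (x - m) ^+ 2) -> rint mu setT (fun x => h x * p x).
Proof.
move=> mh hb; apply: (le_rint mT _ _ (rintD mT Ip rint_normal_sq)).
  exact: measurable_funM.
move=> x _; rewrite normrM (ger0_norm (p0 x)).
by rewrite -{2}(mul1r (p x)) -mulrDl ler_wpM2r.
Qed.

(** Stein's identity, obtained by integrating the derivative of [h * p]. The growth allowed for [h]
    covers constants, [x - m] and sines, which give the mean, the variance and the characteristic
    function. *)
Lemma integral_normal_stein (h h' : R -> R) (B : R) :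
  (forall x : R, is_derive x 1 h (h' x)) -> continuous h' ->
  (forall x, `|h x| <= 1 + `|x - m|) -> (forall x, `|h' x| <= B) ->
  rint mu setT (fun x => h x * (x - m) * p x) /\
  \int[mu]_x (h x * (x - m) * p x) = s ^+ 2 * \int[mu]_x (h' x * p x).
Proof.
move=> dh ch' hb hb'.
have ch : continuous h.
  by move=> x; apply/differentiable_continuous/derivable1_diffP; have [] := dh x.
have cp : continuous p by exact: continuous_normal_pdf.
have cm : continuous (fun x : R => x - m).
  by move=> x; apply: cvgB; [exact: cvg_id|exact: cvg_cst].
have mh := continuous_measurable_fun ch.
have mh' := continuous_measurable_fun ch'.
have mm := continuous_measurable_fun cm.
have I1 : rint mu setT (fun x => h x * (x - m) * p x).
  have I0 : rint mu setT (fun x => 2^-1 * (h x * (x - m)) * p x).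
    apply: rint_normal_lip.
      by apply: measurable_funM => //; exact: measurable_funM.
    move=> x; rewrite 2!normrM; have := hb x; rewrite -(real_normK (num_real (x - m))).
    rewrite ger0_norm//; move: (normr_ge0 (h x)) (normr_ge0 (x - m)).
    move: `|h x| `|x - m| => u v; nra.
  apply: (eq_rint mT _ (rintZ mT 2 I0)) => x _; by rewrite !mulrA divff// mul1r.
have B0 : 0 <= B by exact: le_trans (hb' m).
have I2 : rint mu setT (fun x => h' x * p x).
  apply: (le_rint mT _ _ (rintZ mT B Ip)); first exact: measurable_funM.
  by move=> x _; rewrite normrM (ger0_norm (p0 x)) ler_wpM2r.
split => //.
pose g x := h' x * p x - (s ^+ 2)^-1 * (h x * (x - m) * p x).
have : \int[mu]_x g x = 0.
  apply: (@integral_derivative_eq0 _ (fun x => h x * p x) g m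
     (normal_peak s + 2 * (4 * s ^+ 2 * normal_peak s))).
  - move=> x; have d1 := dh x; have d2 := is_derive_normal_pdf x.
    apply: is_derive_eq; by rewrite /g /GRing.scale/= -/p; field.
  - move=> x; apply: cvgB; first by apply: cvgM; [exact: ch'|exact: cp].
    apply: cvgM; first exact: cvg_cst.
    by apply: cvgM; [apply: cvgM; [exact: ch|exact: cm]|exact: cp].
  - exact: rintB I2 (rintZ mT _ I1).
  - have key x : `|x - m| * `|h x * p x| <= normal_peak s + 2 * (4 * s ^+ 2 * normal_peak s).
      rewrite normrM (ger0_norm (p0 x)); have := hb x.
      have := normal_pdf_sq_bounded x; have := normal_pdf_ub m x s0; rewrite -/p.
      have := p0 x; rewrite -(real_normK (num_real (x - m))).
      move: (normr_ge0 (h x)) (normr_ge0 (x - m)).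
      move: (p x) `|h x| `|x - m| => q u v u0 v0 q0 qp vq uv.
      have q1 : v * (u * q) <= v * ((1 + v) * q) by rewrite ler_wpM2l// ler_wpM2r.
      have q2 : v * q <= (1 + v ^+ 2) * q by rewrite ler_wpM2r//; nra.
      nra.
    move=> n; have n0 : 0 < n.+1%:R :> R by rewrite ltr0n.
    have k1 := key (m + n.+1%:R); have k2 := key (m - n.+1%:R).
    have e1 : `|m + n.+1%:R - m| = n.+1%:R by rewrite addrAC subrr add0r gtr0_norm.
    have e2 : `|m - n.+1%:R - m| = n.+1%:R by rewrite addrAC subrr add0r normrN gtr0_norm.
    rewrite e1 in k1; rewrite e2 in k2.
    by rewrite !ler_pdivlMr// ![_ * n.+1%:R]mulrC.
rewrite /g (RintegralB mT I2 (rintZ mT _ I1)) (RintegralZl _ mT I1).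
move=> /eqP; rewrite subr_eq0 => /eqP ->; rewrite mulrA divff ?mul1r//.
by rewrite gt_eqF.
Qed.

Lemma Rintegral_normal_pdf : \int[mu]_x p x = 1.
Proof. by rewrite /Rintegral integral_normal_pdf. Qed.

Lemma Rintegral_normal_mean : rint mu setT (fun x => x * p x) /\ \int[mu]_x (x * p x) = m.
Proof.
have [I J] := @integral_normal_stein (fun=> 1) (fun=> 0) 0
  (fun x => is_derive_cst _ _ _) (fun x => cvg_cst _)
  (fun x => ltac:(by rewrite normr1 lerDl)) (fun x => ltac:(by rewrite normr0)).
have I' : rint mu setT (fun x => 1 * (x - m) * p x + m * p x).
  exact: rintD (rintZ mT m Ip).
split; first by apply: (eq_rint mT _ I') => x _; ring.
transitivity (\int[mu]_x (1 * (x - m) * p x + m * p x)).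
  by apply: eq_Rintegral => x _; ring.
rewrite (RintegralD mT I (rintZ mT m Ip)) J (RintegralZl _ mT Ip) Rintegral_normal_pdf.
have -> : \int[mu]_x (0 * p x) = 0.
  under eq_Rintegral do rewrite mul0r.
  by rewrite Rintegral_cst ?mul0r.
by rewrite mulr0 add0r mulr1.
Qed.

Lemma Rintegral_normal_var : \int[mu]_x ((x - m) ^+ 2 * p x) = s ^+ 2.
Proof.
have d (x : R) : is_derive x 1 (fun x => x - m) 1.
  by apply: is_derive_eq; rewrite subr0.
have [I J] := @integral_normal_stein (fun x => x - m) (fun=> 1) 1
  d (fun x => cvg_cst _)
  (fun x => ltac:(by rewrite lerDr)) (fun x => ltac:(by rewrite normr1)).
rewrite -[RHS]mulr1 -[in RHS]Rintegral_normal_pdf.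
transitivity (\int[mu]_x ((x - m) * (x - m) * p x)).
  by apply: eq_Rintegral => x _; rewrite expr2.
by rewrite J; congr (_ * _); apply: eq_Rintegral => x _; rewrite mul1r.
Qed.

End normal_moments.

Section normal_char.
Context {R : realType} (s : R).
Notation mu := (@lebesgue_measure R).
Let mT : measurable (setT : set (measurableTypeR R)). Proof. by []. Qed.
Let p := normal_pdf 0 s.
Let p0 x : 0 <= p x. Proof. exact: normal_pdf_ge0. Qed.
Let mp : measurable_fun setT p. Proof. exact: measurable_normal_pdf. Qed.
Let Ip : rint mu setT p. Proof. exact: integrable_normal_pdf. Qed.

Lemma measurable_cos_affine (x th : R) : measurable_fun setT (fun y => cos (x * y + th)).
Proof.
apply: continuous_measurable_fun => y.
apply: (cvg_comp (fun y => x * y + th) cos); last exact: continuous_cos.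
by apply: cvgD; [apply: cvgM; [exact: cvg_cst|exact: cvg_id]|exact: cvg_cst].
Qed.

Lemma rint_cos_normal x th : rint mu setT (fun y => cos (x * y + th) * p y).
Proof.
apply: (le_rint mT _ _ Ip).
  by apply: measurable_funM => //; exact: measurable_cos_affine.
by move=> y _; rewrite normrM (ger0_norm (p0 y)) ler_piMl// cos_max.
Qed.

(** Sines are cosines with another phase, so this one family carries the whole characteristic
    function. *)
Let C th (x : R) := \int[mu]_y (cos (x * y + th) * p y).

(** Differentiation brings down [- y * sin], which Stein's identity turns into [- s^2 x * cos]. The
    resulting linear differential equation is solved in [normal_char] by an integrating factor. *)
Let is_derive_C (s0 : s != 0) th (x : R) : is_derive x 1 (C th) (- s ^+ 2 * x * C th x).
Proof.
pose f (x y : R) := cos (x * y + th) * p y.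
have df (x' y : R) : is_derive x' 1 (f ^~ y) (- (y * sin (x' * y + th) * p y)).
  by apply: is_derive_eq; rewrite /GRing.scale/= !(mulr0, addr0, mulr1, add0r); ring.
pose G y := (1 + (y - 0) ^+ 2) * p y.
have IG : rint mu setT G.
  have := rintD mT Ip (rint_normal_sq 0 s0).
  by apply: (eq_rint mT) => y _; rewrite /G mulrDl mul1r.
have Gub x' y : (`]x - 1, x + 1[%classic : set R) x' -> setT y -> `|partial1of2 f x' y| <= G y.
  move=> _ _; rewrite partial1of2E; have [_ ->] := df x' y.
  rewrite normrN !normrM (ger0_norm (p0 y)) /G ler_wpM2r//.
  have := sin_max (x' * y + th); move: (normr_ge0 y) (normr_ge0 (sin (x' * y + th))).
  rewrite subr0 -(real_normK (num_real y)); move: `|y| `|sin _| => u v; nra.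
have G0 y : 0 <= G y by rewrite /G mulr_ge0// addr_ge0 ?sqr_ge0.
have Ix : (`]x - 1, x + 1[%classic : set R) x by rewrite /= in_itv/=; lra.
have If x' : (`]x - 1, x + 1[%classic : set R) x' -> mu.-integrable setT (EFin \o f x').
  by move=> _; exact: rint_cos_normal.
have Df x' y : (`]x - 1, x + 1[%classic : set R) x' -> setT y -> derivable (f ^~ y) x' 1.
  by move=> _ _; have [] := df x' y.
split.
  exact: (derivable_under_integral mT Ix If Df G0 IG Gub).
rewrite -derive1E (differentiation_under_integral mT Ix If Df G0 IG Gub).
have ds (y : R) : is_derive y 1 (fun y => sin (x * y + th)) (x * cos (x * y + th)).
  by apply: is_derive_eq; rewrite /GRing.scale/= !(mulr0, addr0, mulr1, add0r); ring.
have cs : continuous (fun y => x * cos (x * y + th)).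
  move=> y; apply: cvgM; first exact: cvg_cst.
  apply: (cvg_comp (fun y => x * y + th) cos); last exact: continuous_cos.
  by apply: cvgD; [apply: cvgM; [exact: cvg_cst|exact: cvg_id]|exact: cvg_cst].
have sb (y : R) : `|sin (x * y + th)| <= 1 + `|y - 0|.
  by rewrite (le_trans (sin_max _))// lerDl.
have cb (y : R) : `|x * cos (x * y + th)| <= `|x|.
  by rewrite normrM ler_piMr// cos_max.
have [I J] := integral_normal_stein s0 ds cs sb cb.
have -> : - s ^+ 2 * x * C th x = - (s ^+ 2 * \int[mu]_y (x * cos (x * y + th) * p y)).
  rewrite /C !mulNr -mulrA; congr (- (_ * _)).
  rewrite -(RintegralZl x mT (rint_cos_normal x th)).
  by apply: eq_Rintegral => y _; rewrite mulrA.
rewrite -J -mulN1r -(RintegralZl (-1) mT I); apply: eq_Rintegral => y _.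
by rewrite partial1of2E; have [_ ->] := df x y; rewrite subr0 /p; ring.
Qed.

Lemma normal_char x th : s != 0 ->
  \int[mu]_y (cos (x * y + th) * p y) = cos th * expR (- (s ^+ 2 * x ^+ 2) / 2).
Proof.
move=> s0.
pose D x := C th x * expR (s ^+ 2 * x ^+ 2 / 2).
have dD (y : R) : is_derive y 1 D 0.
  have d1 := is_derive_C s0 th y.
  by apply: is_derive_eq; rewrite /GRing.scale/= !(mulr0, addr0, mulr1, add0r); field.
have := is_derive_0_is_cst x 0 dD; rewrite /D /C.
rewrite expr0n/= mulr0 mul0r expR0 mulr1.
under [X in _ = X -> _]eq_Rintegral do rewrite mul0r add0r.
rewrite (RintegralZl _ mT Ip) Rintegral_normal_pdf mulr1 => <-.
rewrite -[RHS]mulrA -expRD (_ : _ + _ = 0) ?expR0 ?mulr1//.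
by rewrite mulNr subrr.
Qed.

End normal_char.

(** * Products of functions of a Gaussian vector *)

Section fubini_bounded.
Context d1 d2 (T : measurableType d1) (S : measurableType d2) (R : realType).
Variables (P : probability T R) (m : {sigma_finite_measure set S -> \bar R}).
Variables (K : T * S -> R) (w : S -> R) (C : R).
Hypotheses (mK : measurable_fun setT K) (bK : forall z, `|K z| <= C).
Hypothesis Iw : rint m setT w.

Let f z := (K z * w z.2)%:E.

Let mw : measurable_fun setT w. Proof. exact: rint_meas Iw. Qed.

Let mf : measurable_fun setT f.
Proof.
apply/measurable_EFinP; apply: measurable_funM => //.
exact: (measurableT_comp mw measurable_snd).
Qed.

Let C0 : 0 <= C. Proof. exact: le_trans (bK point). Qed.

Let If : (P \x m)%E.-integrable setT f.
Proof.
apply/integrable12ltyP => //.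
apply: (@le_lt_trans _ _ (\int[P]_x (C * \int[m]_y `|w y|)%:E)%E); last first.
  by rewrite integral_cst//= probability_setT mule1 ltry.
apply: ge0_le_integral_nomeas => x _; first exact: integral_ge0.
rewrite EFinM -(rintE measurableT (integrable_norm Iw)).
rewrite -ge0_integralZl//; last 2 first.
- exact/measurable_EFinP/measurableT_comp.
- by move=> y _; rewrite lee_fin /= normr_ge0.
apply: ge0_le_integral_nomeas => y _ //.
by rewrite /f /= -EFinM lee_fin normrM ler_wpM2r.
Qed.

Let IK (x : T) : rint m setT (fun y => K (x, y) * w y).
Proof.
apply: (le_rint measurableT _ _ (rintZ measurableT C (integrable_norm Iw))).
  apply: measurable_funM => //.
  by apply: (measurableT_comp mK); exact: measurable_pair1.
by move=> y _; rewrite normrM ler_wpM2r.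
Qed.

Let IKy (y : S) : rint P setT (fun x => K (x, y)).
Proof.
have IC : rint P setT (fun=> C) by exact: finite_measure_integrable_cst.
apply: (le_rint measurableT _ _ IC) => //.
by apply: (measurableT_comp mK); exact: measurable_pair2.
Qed.

Let F1 x : (\int[m]_y f (x, y))%E = (\int[m]_y (K (x, y) * w y))%:E.
Proof. by rewrite -(rintE measurableT (IK x)). Qed.

Let F2 y : (\int[P]_x f (x, y))%E = (w y * \int[P]_x K (x, y))%:E.
Proof.
rewrite -(RintegralZl (w y) measurableT (IKy y)) -(rintE measurableT).
  by apply: eq_integral => x _; rewrite /f /= mulrC.
exact: rintZ.
Qed.

Lemma rint_fubini_left : rint P setT (fun x => \int[m]_y (K (x, y) * w y)).
Proof.
by have := integrable_fubini_F If; apply: eq_integrable => // x _ /=; rewrite /fubini_F F1.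
Qed.

Lemma measurable_fubini_right : measurable_fun setT (fun y => w y * \int[P]_x K (x, y)).
Proof.
have := measurable_fubini_G If; rewrite /fubini_G.
by under eq_fun do rewrite F2; move/measurable_EFinP.
Qed.

Lemma Rintegral_fubini : \int[P]_x \int[m]_y (K (x, y) * w y) =
  \int[m]_y (w y * \int[P]_x K (x, y)).
Proof.
rewrite [LHS]/Rintegral [RHS]/Rintegral; congr fine.
transitivity (\int[P]_x \int[m]_y f (x, y))%E.
  by apply: eq_integral => x _; rewrite F1.
rewrite (Fubini If) [LHS]/=; apply: eq_integral => y _.
by rewrite F2.
Qed.

(** Meant for [y] a frequency: the expectation is bounded at each frequency before integrating over
    it. *)
Lemma Rintegral_fubini_le (g : S -> R) :
  rint m setT g -> (forall y, `|w y| * `|\int[P]_x K (x, y)| <= g y) ->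
  `|\int[P]_x \int[m]_y (K (x, y) * w y)| <= \int[m]_y g y.
Proof.
move=> Ig wg; rewrite Rintegral_fubini.
have I : rint m setT (fun y => w y * \int[P]_x K (x, y)).
  apply: (le_rint measurableT _ _ Ig); first exact: measurable_fubini_right.
  by move=> y _; rewrite normrM.
apply: (le_trans (le_normr_Rintegral measurableT I)).
by apply: le_Rintegral => //; [exact: integrable_norm|move=> y _; rewrite normrM].
Qed.

End fubini_bounded.

(** * Conditional variances by Gram-Schmidt *)

Section gram_schmidt.
Context {R : realType}.
Implicit Types (l : seq R) (c d : R -> R).

(** Coefficient vectors are functions of the time, so that passing to a sublist of times does not
    change their type. *)
Definition vec_delta (t : R) : R -> R := fun s => (s == t)%:R.
Definition vec_add c (k : R) d : R -> R := fun s => c s + k * d s.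

Variable q : (R -> R) -> (R -> R) -> R.
Hypothesis q_sym : forall c d, q c d = q d c.
Hypothesis q_add : forall c k d e, q (vec_add c k d) e = q c e + k * q d e.

(* [gs l] is the form [q] after projecting off the span of the deltas of [l]. *)
Fixpoint gs l c d : R :=
  if l is t :: l' then
    gs l' c d - gs l' c (vec_delta t) * gs l' d (vec_delta t)
                / gs l' (vec_delta t) (vec_delta t)
  else q c d.

Lemma gs_sym l c d : gs l c d = gs l d c.
Proof. by elim: l => [|t l IH] //=; rewrite IH [X in X / _]mulrC. Qed.

Lemma gs_add l c k d e : gs l (vec_add c k d) e = gs l c e + k * gs l d e.
Proof.
elim: l c d e => [|t l IH] c d e //=.
by rewrite !IH; ring.
Qed.

Lemma gs_sqr l c k t : gs l (vec_add c k (vec_delta t)) (vec_add c k (vec_delta t)) =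
  gs l c c + 2 * k * gs l c (vec_delta t) + k ^+ 2 * gs l (vec_delta t) (vec_delta t).
Proof.
rewrite gs_add (gs_sym l c) (gs_sym l (vec_delta t) (vec_add _ _ _)) !gs_add.
by rewrite (gs_sym l (vec_delta t) c); ring.
Qed.

(** A conditional variance is the variance of a residual, and conditioning on [l] alters
    coefficients on [l] only. Lower bounds on [q] thereby carry over to the projected form. *)
Lemma gs_min l c : exists d, gs l c c = q d d /\ forall s, s \notin l -> d s = c s.
Proof.
elim: l c => [|t l IH] c; first by exists c.
(* Division by a zero pivot yields 0: such a [t] changes nothing. *)
have [A0|A0] := eqVneq (gs l (vec_delta t) (vec_delta t)) 0.
  have [d [h1 h2]] := IH c; exists d; split.
    by rewrite /= A0 invr0 mulr0 subr0.
  by move=> s; rewrite inE negb_or => /andP[_ /h2].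
have [d [h1 h2]] :=
  IH (vec_add c (- (gs l c (vec_delta t) / gs l (vec_delta t) (vec_delta t))) (vec_delta t)).
exists d; split.
  by rewrite -h1 gs_sqr /=; field.
move=> s; rewrite inE negb_or => /andP[st /h2 ->].
by rewrite /vec_add /vec_delta (negbTE st) mulr0 addr0.
Qed.

Lemma gs_complete_square l c k t : gs l (vec_delta t) (vec_delta t) != 0 ->
  gs l (vec_add c k (vec_delta t)) (vec_add c k (vec_delta t)) =
  gs (t :: l) c c + gs l (vec_delta t) (vec_delta t) *
    (k + gs l c (vec_delta t) / gs l (vec_delta t) (vec_delta t)) ^+ 2.
Proof. by move=> A0; rewrite gs_sqr /=; field. Qed.

End gram_schmidt.

(** * Integrating out one frequency at a time *)

Section fourier_products.
Context {R : realType} d (T : measurableType d) (P : probability T R).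
Notation mu := (@lebesgue_measure R).
Variables (X : R -> T -> R) (L : seq R).
Hypothesis uL : uniq L.
Hypothesis mX : forall t, measurable_fun setT (X t).
Implicit Types (l : seq R) (c : R -> R).

Definition combo c w := \sum_(t <- L) c t * X t w.

Variable q : (R -> R) -> (R -> R) -> R.
Hypothesis q_sym : forall c d, q c d = q d c.
Hypothesis q_add : forall c k d e, q (vec_add c k d) e = q c e + k * q d e.
(** The Gaussian decay is shared: [k * q] stays quadratic for completing squares, the rest is spent
    on weights [h], one for each frequency. *)
Variables (h : R -> R -> R) (k : R).
Hypothesis k0 : 0 < k.
Hypothesis h0 : forall t x, 0 <= h t x.
Hypothesis hN : forall t x, h t (- x) = h t x.
Hypothesis bchar : forall c th, `|\int[P]_w cos (combo c w + th)| <=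
  \prod_(t <- L) h t (c t) * expR (- k * q c c).

Variables (f w : R -> R) (B : R).
Hypothesis Iw : rint mu setT w.
Hypothesis bf : forall x, `|f x| <= B.
Hypothesis mf : measurable_fun setT f.
Hypothesis fw : forall x, f x = \int[mu]_u (cos (u * x) * w u).
Variables (y M : R -> R).

(* [M t] bounds the integral over one frequency, with [A] the conditional variance. *)
Hypothesis hM : forall s t l, L = s ++ t :: l ->
  let A := gs q l (vec_delta t) (vec_delta t) in
  A != 0 /\ forall b,
  rint mu setT (fun u => `|w u| * h t u * expR (- k * (A * (u + b) ^+ 2))) /\
  \int[mu]_u (`|w u| * h t u * expR (- k * (A * (u + b) ^+ 2))) <= M t.

Definition fprod l w0 := \prod_(t <- l) f (X t w0 - y t).

Let B0 : 0 <= B. Proof. exact: le_trans (bf 0). Qed.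

Lemma measurable_combo c : measurable_fun setT (combo c).
Proof.
apply: measurable_sum => t; apply: measurable_funM => //.
Qed.

Lemma measurable_fprod l : measurable_fun setT (fprod l).
Proof.
apply: measurable_prod => t _.
apply: (measurableT_comp mf); exact: measurable_funB.
Qed.

Lemma fprod_le l w0 : `|fprod l w0| <= B ^+ size l.
Proof.
rewrite /fprod; elim: l => [|t l IH]; first by rewrite big_nil normr1 expr0.
by rewrite big_cons normrM exprS ler_pM.
Qed.

Let combo_add c x t w0 : t \in L ->
  combo (vec_add c x (vec_delta t)) w0 = combo c w0 + x * X t w0.
Proof.
move=> tL; rewrite /combo /vec_add.
transitivity (\sum_(s <- L) (c s * X s w0 + (s == t)%:R * (x * X s w0))).
  by apply: eq_bigr => s _; rewrite /vec_delta; ring.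
rewrite big_split/=; congr (_ + _).
rewrite (bigD1_seq t)//= eqxx mul1r big1 ?addr0// => s /negbTE ->.
by rewrite mul0r.
Qed.

Let rintP (g : T -> R) (b : R) : measurable_fun setT g -> (forall x, `|g x| <= b) ->
  rint P setT g.
Proof.
move=> mg gb; apply: (le_rint measurableT mg (fun x _ => gb x)).
exact: finite_measure_integrable_cst.
Qed.

Let M0 t : t \in L -> 0 <= M t.
Proof.
have split L' : t \in L' -> exists s l, L' = s ++ t :: l.
  by case/splitPr => s l; exists s, l.
move=> /split[s [l LE]].
have [_ /(_ 0) [_]] := hM LE; apply: le_trans.
apply: Rintegral_ge0 => u _.
by rewrite mulr_ge0 ?expR_ge0// mulr_ge0.
Qed.

(** Induction on the times [l] still to be integrated; [c] holds the frequencies of the others. The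
    factor at [t] is written as a cosine integral, the product of two cosines as a sum of two with
    frequencies [u] and [-u] at [t], and completing the square in [u] leaves an integral that [M t]
    bounds whatever the centre. The shifts [y] enter only the phase [th], in which the bound is
    uniform. *)
Lemma fourier_product_le s l c th : L = s ++ l -> {in l, forall t, c t = 0} ->
  `|\int[P]_w0 (cos (combo c w0 + th) * fprod l w0)| <=
  \prod_(t <- L | t \notin l) h t (c t) * \prod_(t <- l) M t * expR (- k * gs q l c c).
Proof.
elim: l s c th => [|t l IH] s c th lL cl.
  rewrite big_nil mulr1 /= (eq_bigl predT)//.
  apply: le_trans (bchar c th); rewrite /fprod.
  by under eq_Rintegral do rewrite big_nil mulr1.
have tL : t \in L by rewrite lL mem_cat mem_head orbT.
have lL' : L = rcons s t ++ l by rewrite cat_rcons.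
have tl : t \notin l.
  by move: uL; rewrite lL cat_uniq => /and3P[_ _] /= /andP[].
have [A0 hMt] := hM lL.
set A := gs q l _ _ in A0 hMt.
pose b := gs q l c (vec_delta t) / A.
pose K (z : T * measurableTypeR R) :=
  cos (combo c z.1 + th) * cos (z.2 * (X t z.1 - y t)) * fprod l z.1.
have mK : measurable_fun setT K.
  apply: measurable_funM; last exact: (measurableT_comp (measurable_fprod l)).
  have mcos : measurable_fun setT (@cos R).
    by apply: continuous_measurable_fun; exact: continuous_cos.
  apply: measurable_funM; apply: (measurableT_comp mcos).
    apply: measurable_funD => //; exact: (measurableT_comp (measurable_combo c)).
  apply: measurable_funM; first exact: measurable_snd.
  by apply: measurable_funB => //; exact: (measurableT_comp (mX t)).
have bK z : `|K z| <= B ^+ size l.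
  rewrite /K !normrM; apply: le_trans (fprod_le l z.1).
  by rewrite ler_piMl// mulr_ile1// cos_max.
have -> : \int[P]_w0 (cos (combo c w0 + th) * fprod (t :: l) w0) =
   \int[P]_w0 \int[mu]_u (K (w0, u) * w u).
  apply: eq_Rintegral => w0 _; rewrite /fprod big_cons fw.
  have I1 : rint mu setT (fun u => cos (u * (X t w0 - y t)) * w u).
    apply: (le_rint measurableT _ _ (integrable_norm Iw)).
      apply: measurable_funM; last exact: rint_meas Iw.
      under eq_fun do rewrite mulrC -[_ * _]addr0.
      exact: measurable_cos_affine.
    by move=> u _; rewrite normrM ler_piMl// cos_max.
  rewrite -/(fprod l w0) mulrCA mulrC -(RintegralZl _ measurableT I1).
  by apply: eq_Rintegral => u _; rewrite /K /=; ring.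
set HL := \prod_(t <- L | _) _; set ML := \prod_(t <- l) M t.
(* [e] is 1 or -1, the sign of the frequency in the product-to-sum formula; as [e^2 = 1], it can be
   moved onto the centre [b]. *)
pose g e u := `|w u| * h t u * expR (- k * (A * (u + e * b) ^+ 2)).
have Ig e : rint mu setT (g e) by exact: (hMt (e * b)).1.
have HL0 : 0 <= HL by apply: prodr_ge0.
have e0 x : 0 <= expR (x : R) by exact: expR_ge0.
have ML0 : 0 <= ML.
  rewrite /ML big_seq; apply: prodr_ge0 => r rl; apply: M0.
  by rewrite lL mem_cat inE rl !orbT.
pose G u := HL * ML * expR (- k * gs q (t :: l) c c) * (2^-1 * g 1 u + 2^-1 * g (-1) u).
have IG : rint mu setT G.
  by apply: rintZ => //; apply: rintD => //; apply: rintZ.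
apply: (@le_trans _ _ (\int[mu]_u G u)).
  apply: (Rintegral_fubini_le mK bK Iw IG) => u.
  have step e : e ^+ 2 = 1 ->
     `|\int[P]_w0 (cos (combo (vec_add c (e * u) (vec_delta t)) w0 + (th - e * u * y t)) * fprod l w0)|
     <= h t u * HL * ML * expR (- k * gs q (t :: l) c c) * expR (- k * (A * (u + e * b) ^+ 2)).
    move=> e2; have e_neq0 : e != 0 by apply: contra_eq_neq e2 => ->; rewrite expr0n/= eq_sym oner_eq0.
    apply: le_trans (IH _ _ _ lL' _) _.
      move=> r rl; rewrite /vec_add /vec_delta cl ?inE ?rl ?orbT// add0r.
      by case: eqP => [rt|_]; [rewrite -rt rl in tl|rewrite mulr0].
    rewrite gs_complete_square// -/A -/b mulrDr expRD.
    have -> : (e * u + b) ^+ 2 = (u + e * b) ^+ 2.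
      have -> : e * u + b = e * (u + e * b) by rewrite mulrDr mulrA -expr2 e2 mul1r.
      by rewrite exprMn e2 mul1r.
    rewrite big_mkcond (bigD1_seq t)//= tl -big_mkcondr/= {1}/vec_add {1}/vec_delta eqxx mulr1 cl ?mem_head// add0r.
    have -> : h t (e * u) = h t u.
      have /orP[/eqP ->|/eqP ->] : (e == 1) || (e == -1) by rewrite -sqrf_eq1 e2.
        by rewrite mul1r.
      by rewrite mulN1r hN.
    have -> : \prod_(i <- L | (i != t) && (i \notin l)) h i (vec_add c (e * u) (vec_delta t) i) = HL.
      rewrite /HL; apply: eq_big => [r|r /andP[st _]]; first by rewrite inE negb_or.
      by rewrite /vec_add /vec_delta (negbTE st) mulr0 addr0.
    by rewrite -!mulrA.
  have -> : \int[P]_x K (x, u) =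
    2^-1 * \int[P]_w0 (cos (combo (vec_add c (1 * u) (vec_delta t)) w0 + (th - 1 * u * y t)) * fprod l w0) +
    2^-1 * \int[P]_w0 (cos (combo (vec_add c (-1 * u) (vec_delta t)) w0 + (th - -1 * u * y t)) * fprod l w0).
    have I1 c' th' : rint P setT (fun w0 => cos (combo c' w0 + th') * fprod l w0).
      apply: (@rintP _ (B ^+ size l)).
        apply: measurable_funM; last exact: measurable_fprod.
        apply: (measurableT_comp (continuous_measurable_fun (@continuous_cos R))).
        by apply: measurable_funD => //; exact: measurable_combo.
      move=> w0; rewrite normrM; apply: le_trans (fprod_le l w0).
      by rewrite ler_piMl// cos_max.
    rewrite -!(RintegralZl _ measurableT (I1 _ _)).
    rewrite -(RintegralD measurableT (rintZ measurableT _ (I1 _ _)) (rintZ measurableT _ (I1 _ _))).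
    apply: eq_Rintegral => w0 _; rewrite /K /= !combo_add//.
    set a := combo c w0; set x := X t w0.
    have -> : a + 1 * u * x + (th - 1 * u * y t) = (a + th) + u * (x - y t) by ring.
    have -> : a + -1 * u * x + (th - -1 * u * y t) = (a + th) - u * (x - y t) by ring.
    by rewrite (cosD (a + th) (u * (x - y t))) (cosB (a + th) (u * (x - y t))); field.
  have s1 := step 1 (expr1n _ _); have s2 := step (-1) ltac:(by rewrite sqrrN expr1n).
  apply: (@le_trans _ _ (`|w u| * (2^-1 * (h t u * HL * ML * expR (- k * gs q (t :: l) c c) *
    expR (- k * (A * (u + 1 * b) ^+ 2))) + 2^-1 * (h t u * HL * ML *
    expR (- k * gs q (t :: l) c c) * expR (- k * (A * (u + -1 * b) ^+ 2)))))).
    rewrite ler_wpM2l//; apply: (le_trans (ler_normD _ _)).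
    by rewrite !normrM ger0_norm//; apply: lerD; apply: ler_wpM2l.
  by rewrite /G /g le_eqVlt; apply/orP; left; apply/eqP; ring.
have Mg e : \int[mu]_u g e u <= M t by exact: (hMt (e * b)).2.
have IE : \int[mu]_u G u = HL * ML * expR (- k * gs q (t :: l) c c) *
    (2^-1 * \int[mu]_u g 1 u + 2^-1 * \int[mu]_u g (-1) u).
  rewrite (RintegralZl _ measurableT (rintD measurableT (rintZ measurableT _ (Ig 1))
     (rintZ measurableT _ (Ig (-1))))).
  congr (_ * _).
  rewrite (RintegralD measurableT (rintZ measurableT _ (Ig 1)) (rintZ measurableT _ (Ig (-1)))).
  by rewrite (RintegralZl _ measurableT (Ig 1)) (RintegralZl _ measurableT (Ig (-1))).
rewrite IE big_cons -/ML.
have -> : HL * (M t * ML) * expR (- k * gs q (t :: l) c c) =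
  HL * ML * expR (- k * gs q (t :: l) c c) * M t by ring.
apply: ler_wpM2l; first by apply: mulr_ge0 => //; exact: mulr_ge0.
by have := Mg 1; have := Mg (-1); lra.
Qed.

End fourier_products.

(** * Moments of time integrals *)

Section translation.
Context {R : realType}.
Notation mu := (@lebesgue_measure R).
Local Open Scope ereal_scope.

Lemma measurable_addr (c : R) : measurable_fun setT (fun x : R => x + c)%R.
Proof. by apply: measurable_funD => //; exact: measurable_id. Qed.

Lemma ge0_integral_shift (c : R) (f : R -> \bar R) :
  measurable_fun setT f -> (forall x, 0 <= f x) ->
  \int[mu]_x f (x + c)%R = \int[mu]_x f x.
Proof.
move=> mf f0.
pose m : measurableTypeR R -> measurableTypeR R := fun x => (x + c)%R.
have mm : measurable_fun setT m := measurable_addr c.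
have E : \int[mu]_x f x = \int[pushforward mu m]_x f x.
  apply: eq_measure_integral => A mA AD /=.
  apply: lebesgue_measure_unique => //= _ [[a b]] _ <-.
  transitivity (mu (m @^-1` `]a, b]%classic)); last by [].
  rewrite (_ : _ @^-1` _ = `]a - c, b - c]%classic)%R; last first.
    by apply/seteqP; split=> x; rewrite /= !in_itv/= ltrBlDr lerBrDr.
  rewrite !lebesgue_measure_itv/= !lte_fin ltrD2r.
  by case: ifPn => // _; rewrite -!EFinD; congr EFin; ring.
by rewrite E ge0_integral_pushforward.
Qed.

Lemma ge0_integral_opp (f : R -> \bar R) :
  measurable_fun setT f -> (forall x, 0 <= f x) ->
  \int[mu]_x f (- x)%R = \int[mu]_x f x.
Proof.
move=> mf f0.
pose m : measurableTypeR R -> measurableTypeR R := fun x => (- x)%R.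
have mm : measurable_fun setT m by exact: oppr_measurable.
have E : \int[mu]_x f x = \int[pushforward mu m]_x f x.
  apply: eq_measure_integral => A mA AD /=.
  exact/esym/lebesgue_measureN.
by rewrite E ge0_integral_pushforward.
Qed.

End translation.

(** * Singular time kernels and their iterated integrals *)

Section singular_kernel.
Context {R : realType}.
Notation mu := (@lebesgue_measure R).
Local Notation I01 := (`[0%R, 1%R]%classic : set (measurableTypeR R)).
Local Open Scope ereal_scope.

(** The value at 0 has to be [+oo]: where times coincide the moment bound is then trivially true,
    whereas [powR] may return 0 there. *)
Definition skern (b x : R) : \bar R := if x == 0%R then +oo else (`|x| `^ (- b))%:E.

Lemma skern_ge0 b x : 0 <= skern b x.
Proof. by rewrite /skern; case: ifP => // _; rewrite lee_fin powR_ge0. Qed.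

Lemma skernN b x : skern b (- x) = skern b x.
Proof. by rewrite /skern oppr_eq0 normrN. Qed.

Lemma measurable_skern b : measurable_fun setT (skern b).
Proof.
apply: measurable_fun_ifT => //.
  by apply: measurable_fun_eqr => //; exact: measurable_cst.
apply/measurable_EFinP.
exact: (measurableT_comp (measurable_powR_cst (- b)) (@normr_measurable R setT)).
Qed.

(** Translation moves the interval into [[-1, 1]], uniformly in [t], and each half contributes at
    most [1 / (1 - b)]. *)
Lemma integral_skern_le b t : (0 <= b < 1)%R -> (0 <= t <= 1)%R ->
  \int[mu]_(s in I01) skern b (s - t)%R <= (2 / (1 - b))%:E.
Proof.
move=> /andP[b0 b1] /andP[t0 t1].
pose J : set (measurableTypeR R) := `[(-1)%R, 1%R]%classic.
pose g (s : R) := skern b s * (\1_J s)%:E.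
have mg : measurable_fun setT g.
  apply: emeasurable_funM; first exact: measurable_skern.
  by apply/measurable_EFinP; apply: measurable_indic; exact: measurable_itv.
have g0 s : 0 <= g s by rewrite mule_ge0 ?skern_ge0// lee_fin.
apply: (@le_trans _ _ (\int[mu]_s g (s - t)%R)).
  rewrite integral_mkcond; apply: ge0_le_integral_nomeas => s _.
    by apply: erestrict_ge0 => x _; exact: skern_ge0.
  rewrite patchE; case: ifPn => [|_]; last exact: g0.
  rewrite inE/= in_itv/= => /andP[s0 s1].
  rewrite /g indicE mem_set ?mule1// /J /= in_itv/=; apply/andP; split; lra.
rewrite (ge0_integral_shift (- t)%R mg g0).
have -> : \int[mu]_s g s = \int[mu]_(s in `[(-1)%R, 1%R]) skern b s.
  rewrite [RHS]integral_mkcond; apply: eq_integral => s _.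
  by rewrite patchE /g indicE -/J; case: ifPn => _; rewrite ?mule1 ?mule0.
have h1 : \int[mu]_(s in `]0%R, 1%R]) skern b s <= ((1 - b)^-1)%:E.
  have := @integral_powR_01 R (- b); rewrite ltrN2 b1 [(- b + 1)%R]addrC => /(_ isT).
  apply: le_trans; apply: ge0_le_integral_nomeas => s /=; rewrite in_itv/= => /andP[s0 _].
    exact: skern_ge0.
  by rewrite /skern gt_eqF// gtr0_norm.
have h2 : \int[mu]_(s in `[(-1)%R, 0%R[) skern b s <= ((1 - b)^-1)%:E.
  apply: le_trans h1; rewrite integral_mkcond [leRHS]integral_mkcond.
  rewrite -[leRHS]ge0_integral_opp.
  - apply: ge0_le_integral_nomeas => s _.
      by apply: erestrict_ge0 => x _; exact: skern_ge0.
    rewrite !patchE skernN; case: ifPn => sI; last first.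
      by case: ifPn => // _; exact: skern_ge0.
    rewrite ifT//; move: sI; rewrite !inE/= !in_itv/= => /andP[s1 s0].
    by apply/andP; split; lra.
  - apply/(measurable_restrictT _ _).1 => //.
    by apply: measurable_funTS; exact: measurable_skern.
  - by move=> x; apply: erestrict_ge0 => y _; exact: skern_ge0.
have -> : `[(-1)%R, 1%R]%classic = `[(-1)%R, 0%R[ `|` [set 0%R] `|` `]0%R, 1%R] :> set (measurableTypeR R).
  apply/seteqP; split => s /=; rewrite !in_itv/=.
    move=> /andP[s1 s2]; case: (ltgtP s 0%R) => s0.
    - by left; left; rewrite s1.
    - by right; rewrite s2.
    - by left; right.
  by case=> [[|->]|] => [/andP[]| |/andP[]] => *; apply/andP; split; lra.
have ms (A : set R) : measurable_fun A (skern b).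
  by apply: measurable_funTS; exact: measurable_skern.
rewrite ge0_integral_setU//=; last 4 first.
- by apply: measurableU => //; exact: measurable_set1.
- exact: ms.
- by move=> x _; exact: skern_ge0.
- apply/disj_setPS => s /= [[]]; rewrite ?in_itv/=.
    by move=> /andP[_ s0] /andP[/(lt_trans s0)]; rewrite ltxx.
  by move=> -> ; rewrite ltxx.
rewrite ge0_integral_setU//=; last 3 first.
- exact: ms.
- by move=> x _; exact: skern_ge0.
- by apply/disj_setPS => s /= []; rewrite in_itv/= => /andP[_ /[swap] ->]; rewrite ltxx.
rewrite integral_set1 adde0.
have -> : (2 / (1 - b) = (1 - b)^-1 + (1 - b)^-1)%R by ring.
by rewrite EFinD leeD.
Qed.

(** A sum that dominates the inverse power of the distance to the nearest time and integrates term
    by term. The times 0 and 1 belong to it because the bridge is pinned there. *)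
Definition rho (b s : R) (ts : seq R) : \bar R := \sum_(t <- 0%R :: 1%R :: ts) skern b (s - t).

Lemma rho_ge0 b s ts : 0 <= rho b s ts.
Proof. by apply: sume_ge0 => t _; exact: skern_ge0. Qed.

Lemma measurable_rho b ts : measurable_fun setT (rho b ^~ ts).
Proof.
apply: emeasurable_sum => t; apply: (measurableT_comp (measurable_skern b)).
exact: measurable_funB.
Qed.

Lemma integral_rho_le b ts : (0 <= b < 1)%R -> {in ts, forall t, 0 <= t <= 1}%R ->
  \int[mu]_(s in I01) rho b s ts <= ((size ts).+2%:R * (2 / (1 - b)))%:E.
Proof.
move=> b01 ts01; rewrite ge0_integral_sum//; last 2 first.
- move=> t; apply: measurable_funTS; apply: (measurableT_comp (measurable_skern b)).
  exact: measurable_funB.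
- by move=> t s _; exact: skern_ge0.
rewrite big_seq; apply: (@le_trans _ _ (\sum_(t <- 0%R :: 1%R :: ts | t \in 0%R :: 1%R :: ts) (2 / (1 - b))%:E)).
  apply: lee_sum => t tin; apply: integral_skern_le => //.
  move: tin; rewrite !inE => /or3P[/eqP ->|/eqP ->|/ts01//]; rewrite ?lexx ?ler01//.
rewrite -big_seq sumEFin big_const_seq count_predT iter_addr_0.
by rewrite -[in leRHS]mulr_natl /= lee_fin !mulr_natl.
Qed.

Fixpoint rprod (b C : R) (ts : seq R) : \bar R :=
  if ts is s :: ts' then C%:E * rho b s ts' * rprod b C ts' else 1.

Lemma rprod_ge0 b C ts : (0 <= C)%R -> 0 <= rprod b C ts.
Proof. by move=> C0; elim: ts => //= s ts IH; rewrite !mule_ge0// rho_ge0. Qed.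

Fixpoint iter_integral (p : nat) (F : seq R -> \bar R) (ts : seq R) : \bar R :=
  if p is p'.+1 then \int[mu]_(s in I01) iter_integral p' F (s :: ts) else F ts.

(** [m] times are already placed; with the two end points they give [m.+2] singularities, each of
    integral at most [2 / (1 - b)]. *)
Fixpoint rcst (b C : R) (p m : nat) : R :=
  if p is p'.+1 then (rcst b C p' m.+1 * (C * (m.+2%:R * (2 / (1 - b)))))%R else 1%R.

Lemma rcst_ge0 b C p m : (0 <= b < 1)%R -> (0 <= C)%R -> (0 <= rcst b C p m)%R.
Proof.
move=> /andP[b0 b1] C0; elim: p m => [|p IH] m //=.
by rewrite !mulr_ge0// invr_ge0 subr_ge0 ltW.
Qed.

Lemma iter_integral_rprod_le b C p ts : (0 <= b < 1)%R -> (0 <= C)%R ->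
  {in ts, forall t, 0 <= t <= 1}%R ->
  iter_integral p (rprod b C) ts <= (rcst b C p (size ts))%:E * rprod b C ts.
Proof.
move=> b01 C0; elim: p ts => [|p IH] ts ts01 /=; first by rewrite mul1e.
have r0 := rcst_ge0 p (size ts).+1 b01 C0.
apply: (@le_trans _ _ (\int[mu]_(s in I01)
   (((rcst b C p (size ts).+1 * C)%:E * rprod b C ts) * rho b s ts))).
  apply: ge0_le_integral_nomeas => s /=; rewrite in_itv/= => s01.
    elim: (p) (s :: ts) => [|p' IH'] ts' /=; first exact: rprod_ge0.
    by apply: integral_ge0 => x _; exact: IH'.
  apply: (le_trans (IH (s :: ts) _)).
    by move=> t; rewrite inE => /predU1P[->//|/ts01].
  rewrite /= EFinM -!muleA lee_wpmul2l// lee_wpmul2l//.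
  by rewrite muleC.
rewrite ge0_integralZl//; last 3 first.
- by apply: measurable_funTS; exact: measurable_rho.
- by move=> s _; exact: rho_ge0.
- by rewrite mule_ge0 ?rprod_ge0// lee_fin mulr_ge0.
set I := \int[_]_(_ in _) _; set M := (_.+2%:R * _)%R.
have -> : (rcst b C p (size ts).+1 * (C * M))%:E * rprod b C ts =
  (rcst b C p (size ts).+1 * C)%:E * rprod b C ts * M%:E.
  by rewrite mulrA EFinM muleAC.
apply: lee_wpmul2l; last exact: integral_rho_le.
by rewrite mule_ge0 ?rprod_ge0// lee_fin mulr_ge0.
Qed.

Lemma rcstE b C p m : rcst b C p m = (rcst b 1 p m * C ^+ p)%R.
Proof. by elim: p m => [|p IH] m /=; rewrite ?mulr1// IH exprS; ring. Qed.

End singular_kernel.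

Section moments.
Context {R : realType} d (T : measurableType d) (P : probability T R).
Notation mu := (@lebesgue_measure R).
Local Notation I01 := (`[0%R, 1%R]%classic : set (measurableTypeR R)).
Variables (g : measurableTypeR R * T -> R) (B : R).
Hypothesis mg : measurable_fun setT g.
Hypothesis bg : forall z, `|g z| <= B.

Definition time_int (w : T) := \int[mu]_(s in I01) g (s, w).

Let B0 : 0 <= B. Proof. exact: le_trans (bg (0, point)). Qed.

Let w01 (s : R) : R := \1_(I01 : set R) s.

Let Iw01 : rint mu setT w01.
Proof.
exact: (@integrable_indic_itv R 0 1 true false).
Qed.

Let Ig w : rint mu I01 (fun s => g (s, w)).
Proof.
have IC : rint mu I01 (fun=> B).
  apply: rint_ge0 => //; rewrite integral_cst//= lebesgue_measure_itv/= lte01.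
  by rewrite -EFinD -EFinM ltry.
apply: (le_rint _ _ _ IC) => //.
by apply: measurable_funTS; apply: (measurableT_comp mg); exact: measurable_pair2.
Qed.

Let time_intE w : time_int w = \int[mu]_s (g (s, w) * w01 s).
Proof.
rewrite /time_int Rintegral_mkcond; apply: eq_Rintegral => s _.
by rewrite /patch /w01 indicE; case: ifPn => _; rewrite ?mulr1 ?mulr0.
Qed.

Lemma time_int_le w : `|time_int w| <= B.
Proof.
have IC : rint mu I01 (fun=> B).
  apply: rint_ge0 => //; rewrite integral_cst//= lebesgue_measure_itv/= lte01.
  by rewrite -EFinD -EFinM ltry.
apply: (le_trans (le_normr_Rintegral _ (Ig w))) => //.
apply: (@le_trans _ _ (\int[mu]_(s in I01) B)).
  by apply: le_Rintegral => //; exact: integrable_norm (Ig w).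
by rewrite Rintegral_cst//= lebesgue_measure_itv/= lte01 -EFinD/= subr0 mulr1.
Qed.

Let K (z : T * measurableTypeR R) := g (z.2, z.1).
Let mK : measurable_fun setT K.
Proof. by apply: (measurableT_comp mg); exact: measurable_swap. Qed.
Let bK z : `|K z| <= B. Proof. exact: bg. Qed.

Lemma measurable_time_int : measurable_fun setT time_int.
Proof.
have := rint_meas (rint_fubini_left P mK bK Iw01).
by under eq_fun do rewrite -time_intE.
Qed.

Definition gprod (ts : seq R) w := \prod_(t <- ts) g (t, w).

Lemma measurable_gprod ts : measurable_fun setT (gprod ts).
Proof.
apply: measurable_prod => t _; apply: (measurableT_comp mg).
exact: measurable_pair1.
Qed.

Lemma gprod_le ts w : `|gprod ts w| <= B ^+ size ts.
Proof.
rewrite /gprod; elim: ts => [|t ts IH]; first by rewrite big_nil normr1 expr0.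
by rewrite big_cons normrM exprS ler_pM.
Qed.

(** The power is unfolded one factor at a time, the new time joining [ts]; Fubini then puts the
    expectation inside all time integrals. *)
Lemma moment_le (bnd : seq R -> \bar R) q p ts :
  (forall l, (0 <= bnd l)%E) ->
  (forall l, size l = q -> {in l, forall t, 0 <= t <= 1} -> ((\int[P]_w gprod l w)%:E <= bnd l)%E) ->
  (size ts + p)%N = q -> {in ts, forall t, 0 <= t <= 1} ->
  ((\int[P]_w (gprod ts w * time_int w ^+ p))%:E <= iter_integral p bnd ts)%E.
Proof.
move=> bnd0 hb; elim: p ts => [|p IH] ts tsq ts01 /=.
  by under eq_Rintegral do rewrite expr0 mulr1; apply: hb => //; rewrite -tsq addn0.
pose K' (z : T * measurableTypeR R) := gprod (z.2 :: ts) z.1 * time_int z.1 ^+ p.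
have mK' : measurable_fun setT K'.
  apply: measurable_funM.
    rewrite (_ : (fun z => _) = (fun z : T * measurableTypeR R => K z * gprod ts z.1)).
      by apply: measurable_funM => //; exact: (measurableT_comp (measurable_gprod ts)).
    by apply/funext => z; rewrite /gprod big_cons.
  by apply: measurable_funX; exact: (measurableT_comp measurable_time_int).
have bK' z : `|K' z| <= B ^+ (size ts).+1 * B ^+ p.
  rewrite /K' normrM; apply: ler_pM => //; first exact: gprod_le.
  by rewrite normrX lerXn2r ?nnegrE//; exact: time_int_le.
have -> : \int[P]_w (gprod ts w * time_int w ^+ p.+1) =
   \int[P]_w \int[mu]_s (K' (w, s) * w01 s).
  apply: eq_Rintegral => w _.
  have I1 : rint mu setT (fun s => g (s, w) * w01 s).
    apply: (le_rint measurableT _ _ (rintZ measurableT B Iw01)).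
      apply: measurable_funM; last exact: rint_meas Iw01.
      by apply: (measurableT_comp mg); exact: measurable_pair2.
    move=> s _; rewrite normrM [`|w01 s|]ger0_norm ?ler_wpM2r//.
  rewrite exprS {1}time_intE mulrCA mulrC -(RintegralZl _ measurableT I1).
  by apply: eq_Rintegral => s _; rewrite /K' /gprod big_cons /=; ring.
rewrite (Rintegral_fubini P mK' bK' Iw01).
pose h (s : measurableTypeR R) := w01 s * \int[P]_x K' (x, s).
rewrite -/h.
have Ih : rint mu setT h.
  apply: (le_rint measurableT _ _ (rintZ measurableT (B ^+ (size ts).+1 * B ^+ p) Iw01)).
    exact: (measurable_fubini_right P mK' bK' Iw01).
  move=> s _; rewrite /h normrM mulrC [`|w01 s|]ger0_norm// ler_wpM2r//.
  have IK : rint P setT (fun w => K' (w, s)).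
    have IC : rint P setT (fun=> B ^+ (size ts).+1 * B ^+ p).
      exact: finite_measure_integrable_cst.
    apply: (le_rint measurableT _ _ IC) => //.
    by apply: (measurableT_comp mK'); exact: measurable_pair2.
  apply: (le_trans (le_normr_Rintegral measurableT IK)).
  apply: (@le_trans _ _ (\int[P]_w (B ^+ (size ts).+1 * B ^+ p))).
    by apply: le_Rintegral => //; [exact: integrable_norm IK|exact: finite_measure_integrable_cst].
  rewrite /Rintegral integral_cst//.
  by rewrite [X in fine (_ * X)%E](_ : _ = 1%E) ?mule1//; exact: probability_setT.
rewrite -(rintE measurableT Ih).
have mh := rint_meas Ih.
(* [h] may be negative and [iter_integral] is not known to be measurable, so the comparison passes
   through the positive part. *)
apply: (@le_trans _ _ (\int[mu]_s (Num.max (h s) 0)%:E)%E).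
  apply: le_integral => //.
    have := integrable_funrpos measurableT Ih; by apply: eq_integrable.
  by move=> s _; rewrite lee_fin le_max lexx.
rewrite [leRHS]integral_mkcond; apply: ge0_le_integral_nomeas => s _.
  by rewrite lee_fin le_max lexx orbT.
have J0 l : (0 <= iter_integral p bnd l)%E.
  elim: (p) l => [|p' IH'] l //=; apply: integral_ge0 => x _; exact: IH'.
rewrite patchE /h /w01 indicE; case: ifPn => sI; last by rewrite mul0r maxxx.
rewrite mul1r; have [h0|h0] := leP 0 (\int[P]_x K' (x, s)); last exact: J0.
apply: IH => [|t]; first by rewrite /= addSnnS.
rewrite inE => /predU1P[->|/ts01//].
by move: sI; rewrite inE/= in_itv/=.
Qed.

Lemma moment_rprod_le b C p : 0 <= b < 1 -> 0 <= C ->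
  (forall l, size l = p -> {in l, forall t, 0 <= t <= 1} ->
     ((\int[P]_w gprod l w)%:E <= rprod b C l)%E) ->
  \int[P]_w (time_int w ^+ p) <= rcst b 1 p 0 * C ^+ p.
Proof.
move=> b01 C0 hb; rewrite -lee_fin -rcstE.
have := @moment_le (rprod b C) p p [::] (fun l => rprod_ge0 b l C0) hb (add0n p).
move=> /(_ ltac:(by [])).
under eq_Rintegral do rewrite /gprod big_nil mul1r.
move=> /le_trans; apply.
have := @iter_integral_rprod_le R b C p [::] b01 C0; rewrite /= mule1; exact.
Qed.

End moments.

(** * The law of the bridge *)

Section density.
Local Open Scope ereal_scope.
Context d (T : measurableType d) (R : realType).
Variables (mu nu : {measure set T -> \bar R}) (g : T -> R).
Hypotheses (mg : measurable_fun setT g) (g0 : forall x, (0 <= g x)%R).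
Hypothesis nuE : forall A, measurable A -> nu A = \int[mu]_(x in A) (g x)%:E.

Import HBNNSimple.

Let mgE : measurable_fun setT (EFin \o g). Proof. exact/measurable_EFinP. Qed.

Let integral_density_nnsfun (h : {nnsfun T >-> R}) :
  \int[nu]_x (h x)%:E = \int[mu]_x ((h x)%:E * (g x)%:E).
Proof.
under [LHS]eq_integral do rewrite fimfunE -fsumEFin//.
rewrite [LHS]ge0_integral_fsum//; last 2 first.
  - by move=> r; exact/measurable_EFinP/measurableT_comp.
  - by move=> n x _; rewrite EFinM nnfun_muleindic_ge0.
under [RHS]eq_integral.
  move=> x _; rewrite fimfunE -fsumEFin// ge0_mule_fsuml; last first.
    by move=> r; rewrite EFinM nnfun_muleindic_ge0.
  over.
rewrite [RHS]ge0_integral_fsum//; last 2 first.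
  - move=> r; apply: emeasurable_funM => //.
    by apply/measurable_EFinP; do 2 apply/measurableT_comp => //.
  - move=> n x _; apply: mule_ge0; last by rewrite lee_fin.
    by rewrite EFinM nnfun_muleindic_ge0.
apply: eq_fsbigr => r _.
have mA : measurable (h @^-1` [set r]) by exact: measurable_sfunP.
rewrite integralZl_indic_nnsfun//= integral_indic// setIT nuE//.
have [r0|r0] := leP 0%R r; last first.
  have A0 : h @^-1` [set r] = set0 by rewrite preimage_nnfun0.
  rewrite A0 integral_set0 mule0; apply/esym.
  under eq_integral do rewrite indic0 mulr0 mul0e.
  by rewrite integral0.
under [RHS]eq_integral do rewrite EFinM -muleA.
rewrite ge0_integralZl//; last 2 first.
- apply: emeasurable_funM => //; apply/measurable_EFinP; exact: measurable_indic.
- by move=> x _; rewrite mule_ge0 ?lee_fin.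
congr (_ * _); rewrite integral_mkcond; apply: eq_integral => x _.
by rewrite patchE indicE; case: ifPn => _; rewrite ?mul1e ?mul0e.
Qed.

Lemma ge0_integral_density (f : T -> \bar R) : measurable_fun setT f ->
  (forall x, 0 <= f x) -> \int[nu]_x f x = \int[mu]_x (f x * (g x)%:E).
Proof.
move=> mf f0; pose f_ := nnsfun_approx measurableT mf.
have cf x : (f_ n x)%:E @[n --> \oo] --> f x by apply: cvg_nnsfun_approx.
have ndf x : {homo (fun n => (f_ n x)%:E) : a b / (a <= b)%N >-> a <= b}.
  by move=> a b ab; rewrite lee_fin; exact/lefP/nd_nnsfun_approx.
transitivity (limn (fun n => \int[nu]_x (f_ n x)%:E)).
  rewrite -monotone_convergence//=.
  - by apply: eq_integral => x _; exact/esym/cvg_lim.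
  - by move=> n; apply/measurable_EFinP.
  - by move=> n x _; rewrite lee_fin.
rewrite (_ : \int[mu]_x _ = limn (fun n => \int[mu]_x ((f_ n x)%:E * (g x)%:E))); last first.
  rewrite -monotone_convergence//=.
  - apply: eq_integral => x _; apply/esym/cvg_lim => //.
    rewrite muleC; under eq_fun do rewrite muleC.
    by apply: cvgeZl.
  - by move=> n; apply: emeasurable_funM => //; exact/measurable_EFinP.
  - by move=> n x _; rewrite mule_ge0 ?lee_fin.
  - by move=> x _ a b ab; apply: lee_wpmul2r; [rewrite lee_fin|exact: ndf].
by congr (limn _); apply/funext => n; exact: integral_density_nnsfun.
Qed.

End density.

Section gaussian_laws.
Context {R : realType} d (T : measurableType d) (P : probability T R).
Notation mu := (@lebesgue_measure R).

Definition gauss_law (m s : R) (A : set R) : \bar R :=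
  if s == 0 then \d_m A else normal_prob m s A.

Variables (Y : T -> R) (m s : R).
Hypothesis mY : measurable_fun setT Y.
Hypothesis lawY : forall A : set R, measurable A -> P (Y @^-1` A) = gauss_law m s A.

Lemma gauss_law_ge0_integral (f : R -> R) : measurable_fun setT f ->
  (forall x, 0 <= f x) ->
  (\int[P]_w (f (Y w))%:E = if (s == 0)%R then (f m)%:E
     else \int[mu]_x (f x * normal_pdf m s x)%:E)%E.
Proof.
move=> mf f0.
have mfE : measurable_fun setT (EFin \o f) by exact/measurable_EFinP.
pose Y' : T -> measurableTypeR R := Y.
have mY' : measurable_fun setT Y' := mY.
have -> : (\int[P]_w (f (Y w))%:E = \int[pushforward P Y']_x (f x)%:E)%E.
  by rewrite (ge0_integral_pushforward mY' P measurableT mfE)// => x _; rewrite lee_fin.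
case: ifPn => s0.
  transitivity (\int[\d_(m : measurableTypeR R)]_x (f x)%:E)%E; last first.
    by rewrite integral_dirac//= diracT mul1e.
  apply: eq_measure_integral => A mA _; transitivity (P (Y @^-1` A)) => //.
  by rewrite lawY// /gauss_law s0.
transitivity (\int[normal_prob m s]_x (f x)%:E)%E.
  apply: eq_measure_integral => A mA _; transitivity (P (Y @^-1` A)) => //.
  by rewrite lawY// /gauss_law (negbTE s0).
rewrite (@ge0_integral_density _ _ _ mu _ (normal_pdf m s))//.
- exact: measurable_normal_pdf.
- exact: normal_pdf_ge0.
Qed.

Lemma gauss_law_Rintegral (f : R -> R) : measurable_fun setT f ->
  (s != 0 -> rint mu setT (fun x => f x * normal_pdf m s x)) ->
  rint P setT (fun w => f (Y w)) /\
  \int[P]_w f (Y w) = if s == 0 then f m else \int[mu]_x (f x * normal_pdf m s x).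
Proof.
move=> mf If; have mfY : measurable_fun setT (fun w => f (Y w)) by exact: measurableT_comp.
have I : rint P setT (fun w => f (Y w)).
  apply/integrableP; split; first exact/measurable_EFinP.
  have -> : (\int[P]_x `|(EFin \o (fun w => f (Y w))) x| = \int[P]_w (`|f (Y w)|)%:E)%E by [].
  rewrite (@gauss_law_ge0_integral (fun x => `|f x|))//; last exact: measurableT_comp.
  case: ifPn => s0; first by rewrite ltry.
  have /integrableP[_] := If s0; apply: le_lt_trans.
  rewrite le_eqVlt; apply/orP; left; apply/eqP; apply: eq_integral => x _ /=.
  by rewrite normrM (ger0_norm (normal_pdf_ge0 m s x)).
split => //.
have mp : measurable_fun setT (fun x => Num.max (f x) 0) by exact: measurable_maxr.
have mn : measurable_fun setT (fun x => Num.max (- f x) 0).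
  by apply: measurable_maxr => //; exact: measurableT_comp.
have Ep := gauss_law_ge0_integral mp (fun x => ltac:(by rewrite le_max lexx orbT)).
have En := gauss_law_ge0_integral mn (fun x => ltac:(by rewrite le_max lexx orbT)).
have fE x : f x = Num.max (f x) 0 - Num.max (- f x) 0.
  by case: (leP (f x) 0) => h; case: (leP (- f x) 0) => h'; lra.
have Ip : rint P setT (fun w => Num.max (f (Y w)) 0).
  by have := integrable_funrpos measurableT I; apply: eq_integrable.
have In : rint P setT (fun w => Num.max (- f (Y w)) 0).
  by have := integrable_funrneg measurableT I; apply: eq_integrable.
transitivity (\int[P]_w Num.max (f (Y w)) 0 - \int[P]_w Num.max (- f (Y w)) 0).
  rewrite -(RintegralB measurableT Ip In); apply: eq_Rintegral => w _; exact: fE.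
rewrite /Rintegral Ep En; case: ifPn => s0; first by rewrite /= -fE.
have p0 x : 0 <= normal_pdf m s x by exact: normal_pdf_ge0.
have mpdf := @measurable_normal_pdf R m s.
have I1 : rint mu setT (fun x => Num.max (f x) 0 * normal_pdf m s x).
  apply: (le_rint measurableT _ _ (integrable_norm (If s0))); first exact: measurable_funM.
  move=> x _; rewrite /= !normrM; apply: ler_wpM2r => //.
  by case: (leP (f x) 0) => h; rewrite ?normr0.
have I2 : rint mu setT (fun x => Num.max (- f x) 0 * normal_pdf m s x).
  apply: (le_rint measurableT _ _ (integrable_norm (If s0))); first exact: measurable_funM.
  move=> x _; rewrite /= !normrM; apply: ler_wpM2r => //.
  by case: (leP (- f x) 0) => h; rewrite ?normr0 ?normrN.
rewrite -!/(Rintegral _ _ _) -(RintegralB measurableT I1 I2).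
by apply: eq_Rintegral => x _; rewrite -mulrBl -fE.
Qed.

Lemma gauss_law_mean : rint P setT Y /\ \int[P]_w Y w = m.
Proof.
have [//|s0|I E] := @gauss_law_Rintegral id.
  by have [] := Rintegral_normal_mean m s0.
split => //; rewrite E; case: ifPn => // s0.
by have [_] := Rintegral_normal_mean m s0.
Qed.

Lemma gauss_law_var : rint P setT (fun w => (Y w - m) ^+ 2) /\
  \int[P]_w (Y w - m) ^+ 2 = s ^+ 2.
Proof.
have [|s0|I E] := @gauss_law_Rintegral (fun x => (x - m) ^+ 2).
- by apply: measurable_funX; exact: measurable_funB.
- exact: rint_normal_sq.
split => //; rewrite E; case: ifPn => [/eqP ->|s0]; first by rewrite subrr.
exact: Rintegral_normal_var.
Qed.

Lemma gauss_law_sqr : rint P setT (fun w => Y w ^+ 2).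
Proof.
have [I1 _] := gauss_law_mean; have [I2 _] := gauss_law_var.
have I0 : rint P setT (fun=> m ^+ 2) by exact: finite_measure_integrable_cst.
have := rintD measurableT I2 (rintB measurableT (rintZ measurableT (2 * m) I1) I0).
by apply: (eq_rint measurableT) => w _; ring.
Qed.

Lemma gauss_law_cos th : m = 0 ->
  \int[P]_w cos (Y w + th) = cos th * expR (- s ^+ 2 / 2).
Proof.
move=> m0.
have [|s0|I E] := @gauss_law_Rintegral (fun x => cos (x + th)).
- by have := measurable_cos_affine 1 th; under eq_fun do rewrite mul1r.
- have := rint_cos_normal s 1 th; rewrite -m0.
  by apply: (eq_rint measurableT) => x _; rewrite mul1r.
rewrite E m0; case: ifPn => [/eqP ->|s0].
  by rewrite expr0n/= oppr0 mul0r expR0 mulr1 add0r.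
have := normal_char 1 th s0; rewrite expr1n mulr1 => <-.
by apply: eq_Rintegral => x _; rewrite mul1r.
Qed.

(** Half of the exponent is replaced by its value at [a]. The other half belongs to the normal
    density of deviation [sqrt 2 * s], of mass at most 1 on any set; [sqrt 2] is the ratio of the
    peaks. *)
Lemma gauss_law_tail (a : R) : m = 0 -> 0 < a -> s != 0 ->
  (P [set w | (a <= `|Y w|)%R] <= (Num.sqrt 2 * expR (- (a ^+ 2 / (4 * s ^+ 2))))%:E)%E.
Proof.
move=> m0 a0 s0.
pose A : set R := [set x | a <= `|x|].
have mA : measurable A.
  rewrite (_ : A = (@Num.norm R R) @^-1` `[a, +oo[%classic).
    by rewrite -[X in measurable X]setTI; exact: normr_measurable.
  by apply/seteqP; split => x; rewrite /A /= in_itv/= andbT.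
have -> : [set w | a <= `|Y w|] = Y @^-1` A by [].
rewrite lawY// /gauss_law (negbTE s0) /normal_prob.
have s0' : Num.sqrt 2 * s != 0 by rewrite mulf_neq0// sqrtr_eq0 -ltNge ltr0n.
have s2 : 0 < s ^+ 2 by rewrite exprn_even_gt0.
pose E := expR (- (a ^+ 2 / (4 * s ^+ 2))).
apply: (@le_trans _ _ (\int[mu]_(x in A) ((Num.sqrt 2 * E)%:E * (normal_pdf m (Num.sqrt 2 * s) x)%:E))%E).
  apply: ge0_le_integral_nomeas => x; first by rewrite lee_fin normal_pdf_ge0.
  rewrite /A/= => ax; rewrite -EFinM lee_fin !normal_pdfE// /normal_fun m0 !subr0.
  have -> : normal_peak (Num.sqrt 2 * s) = normal_peak s / Num.sqrt 2.
    rewrite /normal_peak exprMn sqr_sqrtr ?ler0n// -mulrnAr -mulrA sqrtrM ?ler0n//.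
    by rewrite invfM mulrC mulrnAr.
  have -> : Num.sqrt 2 * E * (normal_peak s / Num.sqrt 2 * expR (- x ^+ 2 / ((Num.sqrt 2 * s) ^+ 2 *+ 2)))
     = normal_peak s * (E * expR (- x ^+ 2 / ((Num.sqrt 2 * s) ^+ 2 *+ 2))).
    by field; rewrite sqrtr_eq0 -ltNge ltr0n.
  rewrite ler_wpM2l ?normal_peak_ge0// /E -expRD ler_expR exprMn sqr_sqrtr ?ler0n//.
  have ax2 : a ^+ 2 <= x ^+ 2.
    rewrite -(real_normK (num_real x)); apply: lerXn2r => //.
    by rewrite nnegrE (ltW a0).
  have -> : - x ^+ 2 / (s ^+ 2 *+ 2) = - (x ^+ 2 / (4 * s ^+ 2)) + - x ^+ 2 / (2 * s ^+ 2 *+ 2).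
    by rewrite -[s ^+ 2 *+ 2]mulr_natr -[2 * s ^+ 2 *+ 2]mulr_natr; field.
  by rewrite lerD2r lerN2 ler_pM2r// invr_gt0 mulr_gt0.
rewrite ge0_integralZl//; last 3 first.
- by apply/measurable_EFinP; apply: measurable_funTS; exact: measurable_normal_pdf.
- by move=> x _; rewrite lee_fin normal_pdf_ge0.
- by rewrite lee_fin mulr_ge0 ?expR_ge0.
rewrite -[leRHS]mule1 lee_wpmul2l ?lee_fin ?mulr_ge0 ?expR_ge0//.
by have := @probability_le1 _ _ _ (normal_prob m (Num.sqrt 2 * s)) A mA.
Qed.

End gaussian_laws.

Section bridge_covariance.
Context {R : realType} (H : R) (hH : 0 < H < 1).
Implicit Types (L : seq R) (c : R -> R).

(** [bridge] subtracts [fbm_cov H t 1] times [b 1], and [b 1] has variance 1: this is the covariance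
    left after regression on [b 1]. *)
Definition bridge_cov (s t : R) := fbm_cov H s t - fbm_cov H s 1 * fbm_cov H t 1.

Definition bridge_form L c c' := \sum_(s <- L) \sum_(t <- L) c s * c' t * bridge_cov s t.

Lemma fbm_covC s t : fbm_cov H s t = fbm_cov H t s.
Proof. by rewrite /fbm_cov distrC [_ + `|t| `^ _]addrC. Qed.

Lemma bridge_covC s t : bridge_cov s t = bridge_cov t s.
Proof. by rewrite /bridge_cov fbm_covC [X in _ - X]mulrC. Qed.

Lemma bridge_formC L c c' : bridge_form L c c' = bridge_form L c' c.
Proof.
rewrite /bridge_form exchange_big; apply: eq_bigr => s _; apply: eq_bigr => t _ /=.
by rewrite bridge_covC [c t * c' s]mulrC.
Qed.

Lemma bridge_form_add L c k d e :
  bridge_form L (vec_add c k d) e = bridge_form L c e + k * bridge_form L d e.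
Proof.
rewrite /bridge_form big_distrr/= -big_split/=; apply: eq_bigr => s _.
rewrite big_distrr/= -big_split/=; apply: eq_bigr => t _.
by rewrite /vec_add; ring.
Qed.

Let H2 : 2 * H != 0. Proof. by move: hH => /andP[h0 _]; rewrite gt_eqF// mulr_gt0. Qed.

Lemma fbm_cov11 : fbm_cov H 1 1 = 1.
Proof. by rewrite /fbm_cov subrr normr0 powR0// normr1 powR1 subr0; field. Qed.

Lemma fbm_cov0 t : fbm_cov H 0 t = 0.
Proof. by rewrite /fbm_cov sub0r normrN normr0 powR0// add0r subrr mulr0. Qed.

Lemma bridge_cov00 : bridge_cov 0 0 = 0.
Proof. by rewrite /bridge_cov !fbm_cov0 mul0r subrr. Qed.

Lemma bridge_cov11 : bridge_cov 1 1 = 0.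
Proof. by rewrite /bridge_cov fbm_cov11 mulr1 subrr. Qed.

(** Regression on [b 1] can only diminish the variance of an increment, here by the square of a
    difference of covariances. *)
Lemma bridge_incr_le s t :
  bridge_cov t t - 2 * bridge_cov s t + bridge_cov s s <= `|t - s| `^ (2 * H).
Proof.
have e : fbm_cov H t t - 2 * fbm_cov H s t + fbm_cov H s s = `|t - s| `^ (2 * H).
  by rewrite /fbm_cov !subrr normr0 powR0// (distrC s t); field.
by have := sqr_ge0 (fbm_cov H t 1 - fbm_cov H s 1); rewrite /bridge_cov -e; lra.
Qed.

(** A combination of bridge values rewritten for the motion itself, all multiples of [b 1] being
    collected in one entry. *)
Definition bridge_list L c : seq (R * R) :=
  (- \sum_(s <- L) c s * fbm_cov H s 1, 1) :: [seq (c s, s) | s <- L].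

Lemma bridge_form_var L c : bridge_form L c c = fbm_var H (bridge_list L c).
Proof.
rewrite /fbm_var /bridge_list !big_cons /= !big_map fbm_cov11.
set k := \sum_(s <- L) _.
have -> : \sum_(s <- L) - k * c s * fbm_cov H 1 s = - k * k.
  transitivity (- k * \sum_(s <- L) c s * fbm_cov H s 1); last by [].
  rewrite big_distrr/=; apply: eq_bigr => s _.
  by rewrite (fbm_covC 1 s); ring.
have -> : \sum_(j <- L) \sum_(q <- (- k, 1%R) :: [seq (c s, s) | s <- L])
     (c j * q.1 * fbm_cov H j q.2) =
   - k * k + \sum_(s <- L) \sum_(t <- L) c s * c t * fbm_cov H s t.
  transitivity (- k * (\sum_(s <- L) c s * fbm_cov H s 1) +
    \sum_(s <- L) \sum_(t <- L) c s * c t * fbm_cov H s t); last by [].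
  rewrite big_distrr/= -big_split/=; apply: eq_bigr => s _.
  by rewrite big_cons/= big_map; congr (_ + _); ring.
rewrite /bridge_form.
have -> : \sum_(s <- L) \sum_(t <- L) c s * c t * bridge_cov s t =
  \sum_(s <- L) \sum_(t <- L) c s * c t * fbm_cov H s t - k * k.
  transitivity (\sum_(s <- L) \sum_(t <- L) c s * c t * fbm_cov H s t -
    (\sum_(s <- L) c s * fbm_cov H s 1) * (\sum_(s <- L) c s * fbm_cov H s 1)); last by [].
  rewrite big_distrl/= -sumrB; apply: eq_bigr => s _.
  rewrite big_distrr/= -sumrB; apply: eq_bigr => t _.
  by rewrite /bridge_cov; ring.
by ring.
Qed.

(** The extra entry of [bridge_list] makes 1 one more time to stay away from, whence [r <= 1 - t];
    the condition [r <= t] is inherited from the motion, which starts at 0. *)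
Lemma bridge_lnd : exists2 k : R, 0 < k & forall L c t r, uniq L -> t \in L ->
  0 < r -> r <= t -> r <= 1 - t ->
  (forall s, s \in L -> s != t -> c s != 0 -> r <= `|s - t|) ->
  k * r `^ (2 * H) * c t ^+ 2 <= bridge_form L c c.
Proof.
have [k k0 hk] := fbm_var_lnd hH; exists k => // L c t r uL tL r0 rt r1t hL.
have t1 : (1 == t) = false by apply/eqP => t1; move: r1t r0; rewrite -t1 subrr; lra.
have := hk (bridge_list L c) t r r0; rewrite bridge_form_var.
rewrite big_cons/= t1 big_map (_ : \sum_(j <- L | _) _ = c t); last first.
  by rewrite -big_filter (filter_pred1_uniq uL tL) big_seq1.
apply; first by rewrite ger0_norm// (le_trans _ rt)// ltW.
move=> p; rewrite inE => /predU1P[-> _ _|/mapP[s sL ->] st cs].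
  by rewrite /= ger0_norm//; lra.
exact: hL.
Qed.

End bridge_covariance.

Section bridge_law.
Context {R : realType} d (T : measurableType d) (P : probability T R).
Variable H : R.

Section fbm.
Variable b : R -> T -> R.
Hypothesis bH : fbm P H b.

Lemma fbm_gauss (l : seq (R * R)) : {in l, forall p, 0 <= p.2} ->
  measurable_fun setT (fun w => \sum_(p <- l) p.1 * b p.2 w) /\
  exists m s, forall A : set R, measurable A ->
    P ((fun w => \sum_(p <- l) p.1 * b p.2 w) @^-1` A) = gauss_law m s A.
Proof.
move=> l0; have [gb _ _ _ _] := bH.
have := gb (size l) (fun j => (nth (0, 0) l j).1) (fun j => (nth (0, 0) l j).2).
have -> : (fun w => \sum_(j < size l) (nth (0, 0) l j).1 * b (nth (0, 0) l j).2 w) =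
   (fun w => \sum_(p <- l) p.1 * b p.2 w).
  by apply/funext => w; rewrite (big_nth (0, 0)) big_mkord.
move=> [|mY [m [s E]]]; last by split => //; exists m, s.
by move=> j; rewrite /= in_itv/= andbT l0// mem_nth.
Qed.

Let g1 t : 0 <= t -> measurable_fun setT (b t) /\ exists m s,
  forall A : set R, measurable A -> P (b t @^-1` A) = gauss_law m s A.
Proof.
move=> t0; have := @fbm_gauss [:: (1, t)].
rewrite (_ : (fun w => _) = b t); last first.
  by apply/funext => w; rewrite big_seq1 mul1r.
by apply; move=> p; rewrite inE => /eqP ->.
Qed.

Let Ib t : 0 <= t -> rint P setT (b t).
Proof. by move=> /g1 [mb [m [s E]]]; have [] := gauss_law_mean mb E. Qed.

Let Ib2 t : 0 <= t -> rint P setT (fun w => b t w ^+ 2).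
Proof. by move=> /g1 [mb [m [s E]]]; exact: (gauss_law_sqr mb E). Qed.

Let Eb t : 0 <= t -> \int[P]_w b t w = 0.
Proof.
move=> t0; have [_ Eb _ _ _] := bH; have := Eb t; rewrite /= in_itv/= andbT => /(_ t0).
by rewrite unlock /Rintegral => ->.
Qed.

Let Iincr s t : 0 <= s -> 0 <= t -> rint P setT (fun w => (b t w - b s w) ^+ 2).
Proof.
move=> s0 t0; have := @fbm_gauss [:: (1, t); (-1, s)].
rewrite (_ : (fun w => _) = (fun w => b t w - b s w)); last first.
  by apply/funext => w; rewrite big_cons big_seq1 mul1r mulN1r.
case=> [p|mb [m [v E]]]; first by rewrite !inE => /orP[] /eqP ->.
exact: (gauss_law_sqr mb E).
Qed.

Let Eincr s t : 0 <= s -> 0 <= t ->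
  \int[P]_w (b t w - b s w) ^+ 2 = `|t - s| `^ (2 * H).
Proof.
move=> s0 t0; have [_ _ _ E _] := bH; have := E s t.
rewrite /= !in_itv/= !andbT => /(_ s0 t0); rewrite unlock /Rintegral.
move=> h; transitivity (fine (\int[P]_w (`|b t w - b s w| ^+ 2)%:E)); last by rewrite h.
by congr fine; apply: eq_integral => w _; rewrite real_normK// num_real.
Qed.

Let Eb2 t : 0 <= t -> \int[P]_w b t w ^+ 2 = `|t| `^ (2 * H).
Proof.
move=> t0; rewrite -[in RHS](subr0 t) -(Eincr (lexx 0) t0).
rewrite /Rintegral; congr fine.
have [_ _ b0 _ _] := bH.
apply: ae_eq_integral => //.
- by have [mb _] := g1 t0; apply/measurable_EFinP; exact: measurable_funX.
- have [mb _] := g1 t0; have [mb0 _] := g1 (lexx 0).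
  by apply/measurable_EFinP; apply: measurable_funX; exact: measurable_funB.
- by apply: filterS b0 => w -> _; rewrite subr0.
Qed.

Let Ibb s t : 0 <= s -> 0 <= t -> rint P setT (fun w => b s w * b t w) /\
  \int[P]_w (b s w * b t w) = fbm_cov H s t.
Proof.
move=> s0 t0.
have I1 := rintD measurableT (Ib2 s0) (Ib2 t0).
have I2 := rintB measurableT I1 (Iincr t0 s0).
have E w : b s w * b t w = 2^-1 * (b s w ^+ 2 + b t w ^+ 2 - (b s w - b t w) ^+ 2).
  by field.
split; first by apply: (eq_rint measurableT _ (rintZ measurableT 2^-1 I2)) => w _; rewrite -E.
under eq_Rintegral do rewrite E.
rewrite (RintegralZl _ measurableT I2) (RintegralB measurableT I1 (Iincr t0 s0)).
by rewrite (RintegralD measurableT (Ib2 s0) (Ib2 t0)) Eincr// !Eb2.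
Qed.

(** [gaussian] provides some mean and variance; first and second moments computed from [fbm]
    identify them. Covariances come from the variances of increments by polarisation. *)
Lemma fbm_combo_law (l : seq (R * R)) : {in l, forall p, 0 <= p.2} ->
  measurable_fun setT (fun w => \sum_(p <- l) p.1 * b p.2 w) /\
  exists2 s, s ^+ 2 = fbm_var H l & forall A : set R, measurable A ->
    P ((fun w => \sum_(p <- l) p.1 * b p.2 w) @^-1` A) = gauss_law 0 s A.
Proof.
move=> l0; have [mY [m [s E]]] := fbm_gauss l0; split => //.
have [I1 E1] := gauss_law_mean mY E; have [I2 E2] := gauss_law_var mY E.
(* [rint_sum] asks for integrability at every index, so the terms outside [l], whose times could be
   negative, are set to 0. *)
pose F (p : R * R) w := if p \in l then p.1 * b p.2 w else 0.
have IF p : rint P setT (F p).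
  rewrite /F; have [pl|pl] := boolP (p \in l); first by apply: rintZ => //; apply: Ib; exact: l0.
  exact: finite_measure_integrable_cst.
have m0 : m = 0.
  rewrite -E1; transitivity (\int[P]_w \sum_(p <- l) F p w).
    by apply: eq_Rintegral => w _; rewrite !big_seq; apply: eq_bigr => p pl; rewrite /F pl.
  rewrite (rint_sum measurableT l IF).2 big_seq big1// => p pl.
  under eq_Rintegral do rewrite /F pl.
  by rewrite (RintegralZl _ measurableT (Ib (l0 _ pl))) Eb ?mulr0//; exact: l0.
exists s; last by move: E; rewrite m0.
rewrite -E2 m0.
pose G (p q : R * R) w := if (p \in l) && (q \in l) then p.1 * q.1 * (b p.2 w * b q.2 w) else 0.
have IG p q : rint P setT (G p q).
  rewrite /G; have [/andP[pl ql]|_] := boolP ((p \in l) && (q \in l)).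
    by apply: rintZ => //; exact: (Ibb (l0 _ pl) (l0 _ ql)).1.
  exact: finite_measure_integrable_cst.
transitivity (\int[P]_w \sum_(p <- l) \sum_(q <- l) G p q w).
  apply: eq_Rintegral => w _; rewrite subr0 expr2 big_distrl/= !big_seq.
  apply: eq_bigr => p pl; rewrite big_distrr/= !big_seq; apply: eq_bigr => q ql.
  by rewrite /G pl ql/=; ring.
have IGp p := rint_sum measurableT l (IG p).
rewrite (rint_sum measurableT l (fun p => (IGp p).1)).2 /fbm_var !big_seq.
apply: eq_bigr => p pl; rewrite (IGp p).2 !big_seq; apply: eq_bigr => q ql.
under eq_Rintegral do rewrite /G pl ql/=.
have [I3 E3] := Ibb (l0 _ pl) (l0 _ ql).
by rewrite (RintegralZl _ measurableT I3) E3.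
Qed.

End fbm.
End bridge_law.

(** Only finite-dimensional laws are shared with the motion, which may live on another space. The
    event is therefore written as a measurable set of coordinate vectors and evaluated over
    there. *)
Lemma fbridge_combo_law (R : realType) d (T : measurableType d) (P : probability T R)
    (H : R) (X : R -> T -> R) (L : seq R) (c : R -> R) : 0 < H < 1 ->
  fbridge P H X -> {in L, forall t, 0 <= t <= 1} ->
  measurable_fun setT (fun w => \sum_(t <- L) c t * X t w) /\
  exists2 s, s ^+ 2 = bridge_form H L c c & forall A : set R, measurable A ->
    P ((fun w => \sum_(t <- L) c t * X t w) @^-1` A) = gauss_law 0 s A.
Proof.
move=> hH [mX _ [d' [T' [P' [b [bH sl]]]]]] L01.
split.
  rewrite (_ : (fun w => _) = (fun w => \sum_(t <- L) (if t \in L then c t * X t w else 0))).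
    apply: measurable_sum => t; have [tL|tL] := boolP (t \in L); last exact: measurable_cst.
    by apply: measurable_funM => //; apply: mX; exact: L01.
  by apply/funext => w; rewrite !big_seq; apply: eq_bigr => t ->.
have l0 : {in bridge_list H L c, forall p, 0 <= p.2}.
  move=> p; rewrite inE => /predU1P[->//|/mapP[t tL ->]] /=.
  by have /andP[] := L01 _ tL.
have [mY [s s2 E]] := fbm_combo_law bH l0.
exists s; first by rewrite bridge_form_var.
move=> A mA; rewrite -(E _ mA).
pose S : set 'rV[R]_(size L) := [set v | A (\sum_(j < size L) c (nth 0 L j) * v 0 j)].
have mS : measurable S.
  rewrite -[X in measurable X]setTI.
  have mf : measurable_fun setT (fun v : 'rV[R]_(size L) =>
      \sum_(j < size L) c (nth 0 L j) * v 0 j).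
    apply: measurable_sum => j; apply: measurable_funM => //.
    exact: measurable_coord.
  exact: mf.
have := sl (size L) (fun j => nth 0 L j) _ S mS.
rewrite (_ : [set w | S (\row_j X (nth 0 L j) w)] =
   (fun w => \sum_(t <- L) c t * X t w) @^-1` A); last first.
  apply/seteqP; split => w; rewrite /S /= (big_nth 0) big_mkord;
    by under eq_bigr do rewrite mxE.
rewrite (_ : [set w | S (\row_j bridge H b (nth 0 L j) w)] =
   (fun w => \sum_(p <- bridge_list H L c) p.1 * b p.2 w) @^-1` A); last first.
  suff E' w : \sum_(j < size L) c (nth 0 L j) * (\row_j bridge H b (nth 0 L j) w : 'rV_ _) 0 j =
      \sum_(p <- bridge_list H L c) p.1 * b p.2 w.
    by apply/seteqP; split => w; rewrite /S /= E'.
  under eq_bigr do rewrite mxE.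
  rewrite /bridge_list big_cons big_map/=.
  transitivity (\sum_(t <- L) c t * bridge H b t w); first by rewrite (big_nth 0) big_mkord.
  rewrite mulNr big_distrl/= -sumrN -big_split/=; apply: eq_bigr => t _.
  by rewrite /bridge /fbm_cov normr1 powR1 (distrC 1 t); ring.
by apply => j; rewrite /= in_itv/= L01// mem_nth.
Qed.

(** * Product bounds along the bridge *)

Section gaps.
Context {R : realType}.
Implicit Types (s t b C : R) (l ts : seq R).

(** Distance to the times already placed and to the pinned end points. The default 1 agrees with
    this for [s] in [[0, 1]], where [|s - 0|] is already at most 1. *)
Definition gap s l : R := \big[Num.min/1]_(t <- 0 :: 1 :: l) `|s - t|.

Fixpoint spread l : bool := if l is s :: l' then (s \notin 0 :: 1 :: l') && spread l' else true.

(** Parallel to [rprod]: each time is weighed against those after it in the list, on which it is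
    conditioned. *)
Fixpoint tailprod (F : R -> seq R -> R) l : R :=
  if l is s :: l' then F s l' * tailprod F l' else 1.

Lemma gap_le s t l : t \in 0 :: 1 :: l -> gap s l <= `|s - t|.
Proof.
rewrite /gap; elim: (0 :: _) => [//|u l' IH]; rewrite inE big_cons ge_min.
by case: eqP => [<-|_ /IH ->]; rewrite ?lexx ?orbT.
Qed.

Lemma spread_uniq l : spread l -> uniq l.
Proof.
by elim: l => //= s l IH; rewrite !inE !negb_or => /andP[/and3P[_ _ ->] /IH].
Qed.

Lemma gap_le1 s l : gap s l <= 1.
Proof. by rewrite /gap; elim/big_rec: _ => // t x _ h; rewrite ge_min h orbT. Qed.

Lemma gap_gt0 s l : s \notin 0 :: 1 :: l -> 0 < gap s l.
Proof.
rewrite /gap; elim: (0 :: _) => [|t l' IH]; first by rewrite big_nil.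
rewrite inE negb_or big_cons => /andP[st /IH h].
by rewrite lt_min h andbT normr_gt0 subr_eq0.
Qed.

Lemma gap_ge0 s l : 0 <= gap s l.
Proof.
rewrite /gap; elim/big_rec: _ => // t x _ h; by rewrite le_min h andbT.
Qed.

Lemma gap_rho b s l : 0 <= b -> 0 <= s <= 1 -> s \notin 0 :: 1 :: l ->
  ((gap s l `^ (- b))%:E <= rho b s l)%E.
Proof.
move=> b0 /andP[s0 s1] sl.
have [t tl ->] : exists2 t, t \in 0 :: 1 :: l & gap s l = `|s - t|.
  have [g1|] := boolP (gap s l == 1).
    exists 0; first by rewrite mem_head.
    apply/eqP; rewrite eq_le gap_le ?mem_head//= (eqP g1) subr0.
    by rewrite ger0_norm.
  rewrite /gap; elim: (0 :: _) => [|t l' IH]; first by rewrite big_nil eqxx.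
  rewrite big_cons; case: leP => [_ _|_ /IH[u ul ->]].
    by exists t; rewrite ?mem_head.
  by exists u => //; rewrite inE ul orbT.
rewrite /rho (big_rem t)//= /skern subr_eq0 ifN; last first.
  by apply: contraNneq sl => ->.
by rewrite leeDl// sume_ge0// => u _; exact: skern_ge0.
Qed.

Lemma rho_pinfty b s l : s \in 0 :: 1 :: l -> rho b s l = +oo%E.
Proof.
move=> sl; rewrite /rho (big_rem s)//= {1}/skern subrr eqxx addye// gt_eqF//.
rewrite (@lt_le_trans _ _ 0%E) ?ltNyr// sume_ge0// => u _; exact: skern_ge0.
Qed.

Lemma rho_gt0 b s l : (0 < rho b s l)%E.
Proof.
rewrite /rho big_cons; apply: (@lt_le_trans _ _ (skern b (s - 0))); last first.
  by rewrite leeDl// sume_ge0// => u _; exact: skern_ge0.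
by rewrite /skern; case: eqVneq => // s0; rewrite lte_fin powR_gt0 ?normr_gt0.
Qed.

Lemma rprod_pinfty b C l : 0 < C -> ~~ spread l -> rprod b C l = +oo%E.
Proof.
move=> C0.
have r0 l' : (0 < rprod b C l')%E.
  by elim: l' => //= s l' IH; rewrite !mule_gt0// rho_gt0.
elim: l => //= s l IH; rewrite negb_and negbK => /orP[sl|/IH ->].
  by rewrite rho_pinfty// gt0_muley// gt0_mulye.
by rewrite gt0_muley// mule_gt0// rho_gt0.
Qed.

Lemma rprod_ge b C (F : R -> seq R -> R) ts : 0 <= C -> 0 <= b ->
  (forall s l, 0 <= s <= 1 -> s \notin 0 :: 1 :: l ->
     0 <= F s l <= C * gap s l `^ (- b)) ->
  spread ts -> {in ts, forall t, 0 <= t <= 1} ->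
  0 <= tailprod F ts /\ ((tailprod F ts)%:E <= rprod b C ts)%E.
Proof.
move=> C0 b0 hF; elim: ts => [|s l IH] /= => [_ _|/andP[sl /IH{}IH] h01].
  by split.
have [|F0 le] := IH; first by move=> t tl; apply: h01; rewrite inE tl orbT.
have s01 : 0 <= s <= 1 by apply: h01; rewrite mem_head.
have /andP[Fs0 Fs] := hF s l s01 sl.
split; first exact: mulr_ge0.
rewrite EFinM; apply: lee_pmul => //; rewrite ?lee_fin//.
apply: (@le_trans _ _ (C * gap s l `^ (- b))%:E); first by rewrite lee_fin.
by rewrite EFinM lee_wpmul2l ?lee_fin// gap_rho.
Qed.

Lemma tailprodE (F : R -> seq R -> R) l : uniq l ->
  \prod_(t <- l) F t (drop (index t l).+1 l) = tailprod F l.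
Proof.
elim: l => [_|s l IH /= /andP[sl /IH <-]]; first by rewrite big_nil.
rewrite big_cons /= eqxx drop0; congr (_ * _); rewrite !big_seq.
apply: eq_bigr => t tl; case: eqP => [st|_ //].
by rewrite st tl in sl.
Qed.

Lemma drop_index_cat (s : seq R) t l : uniq (s ++ t :: l) ->
  drop (index t (s ++ t :: l)).+1 (s ++ t :: l) = l.
Proof.
rewrite cat_uniq => /and3P[_ /hasPn h _].
have ts : t \notin s by apply: h; rewrite mem_head.
by rewrite index_cat (negbTE ts) /= eqxx addn0 -cat_rcons drop_size_cat// size_rcons.
Qed.

Lemma count_le1 (a : pred R) l : uniq l ->
  (forall u v, u \in l -> v \in l -> a u -> a v -> u = v) -> (count a l <= 1)%N.
Proof.
move=> ul h; rewrite -size_filter; have := filter_uniq a ul.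
case E : [seq x <- l | a x]%SEQ => [//|u [//|v l']] /=.
have /andP[au uL] : a u && (u \in l) by rewrite -mem_filter E mem_head.
have /andP[av vL] : a v && (v \in l) by rewrite -mem_filter E !inE eqxx orbT.
by rewrite (h u v uL vL au av) mem_head.
Qed.

(* A new point [s] comes closer to [u] than all earlier points for at most two
   values of [u], its neighbours on the line. *)
Lemma isolation_radii l : spread l -> {in l, forall t, 0 <= t <= 1} ->
  exists D : R -> R,
    [/\ {in l, forall t, 0 < D t <= 1},
        {in l &, forall s t, s != t -> D t <= `|s - t|},
        {in l, forall t, D t <= t /\ D t <= 1 - t}
      & \prod_(t <- l) (D t)^-1 <= tailprod (fun s l => gap s l ^- 3) l].
Proof.
elim: l => [_ _|s l IH /= /andP[sl spl] h01].
  by exists (fun=> 1); split => //; rewrite big_nil.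
have [|D [D1 D2 D3 D4]] := IH spl; first by move=> t tl; apply: h01; rewrite inE tl orbT.
have g0 := gap_gt0 sl; have g1 := gap_le1 s l.
have s01 : 0 <= s <= 1 by apply: h01; rewrite mem_head.
have sl' : s \notin l by move: sl; rewrite !inE !negb_or => /and3P[].
have ul := spread_uniq spl.
have us u : u \in l -> 0 < `|s - u|.
  by move=> ul'; rewrite normr_gt0 subr_eq0; apply: contraNneq sl' => ->.
have gu u : u \in l -> gap s l <= `|s - u|.
  by move=> ul'; apply: gap_le; rewrite !inE ul' !orbT.
exists (fun u => if u == s then gap s l else Num.min (D u) `|s - u|); split.
- move=> t; rewrite inE; case: eqP => [_ _|_ /= tl]; first by rewrite g0.
  have /andP[d0 d1] := D1 t tl.
  by rewrite lt_min d0 us//= ge_min d1.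
- move=> u t; rewrite !inE; case: (eqVneq t s) => [->|ts] /=.
    case: (eqVneq u s) => [_|us'] //= ul' _ _; by rewrite distrC gu.
  case: (eqVneq u s) => [->|us'] /= ul' tl ut; first by rewrite ge_min lexx orbT.
  by rewrite ge_min D2.
- move=> t; rewrite inE; case: eqP => [-> _|_ /= tl].
    split; first by have := @gap_le s 0 l; rewrite mem_head subr0 ger0_norm; lra.
    have := @gap_le s 1 l; rewrite !inE eqxx orbT distrC ger0_norm; lra.
  by have [d1 d2] := D3 t tl; rewrite !ge_min d1 d2.
pose aff u := `|s - u| < D u.
(* Two affected points have [s] strictly between them, since their radii do not exceed their mutual
   distance. Hence at most one lies on each side of [s]. *)
have cnt : (count aff l <= 2)%N.
  have := count_predC (fun u => u < s) (seq.filter aff l).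
  rewrite size_filter => <-; rewrite !count_filter -[2%N]/(1 + 1)%N.
  have betw u v : u \in l -> v \in l -> aff u -> aff v -> u < v -> u < s < v.
    move=> ul' vl; rewrite /aff !ltr_norml => /andP[au1 au2] /andP[av1 av2] uv.
    have := D2 u v ul' vl (negbT (lt_eqF uv)); have := D2 v u vl ul' (negbT (gt_eqF uv)).
    rewrite (distrC v u) ltr0_norm ?subr_lt0//.
    by move=> ? ?; apply/andP; split; lra.
  apply: leq_add; apply: count_le1 => // u v ul' vl /= /andP[us1 au] /andP[vs1 av];
    apply/eqP; apply: contraT; rewrite neq_lt => /orP[uv|uv].
  - by have /andP[_ /lt_gtF] := betw u v ul' vl au av uv; rewrite vs1.
  - by have /andP[_ /lt_gtF] := betw v u vl ul' av au uv; rewrite us1.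
  - by have /andP[us2] := betw u v ul' vl au av uv; rewrite us2 in us1.
  - by have /andP[vs2] := betw v u vl ul' av au uv; rewrite vs2 in vs1.
rewrite big_cons eqxx.
have -> : \prod_(j <- l) (if j == s then gap s l else Num.min (D j) `|s - j|)^-1 =
   \prod_(j <- l) (Num.min (D j) `|s - j|)^-1.
  rewrite !big_seq; apply: eq_bigr => j jl; case: eqP => [js|//].
  by rewrite -js jl in sl'.
have step : \prod_(j <- l) (Num.min (D j) `|s - j|)^-1 <=
    \prod_(j <- l) (D j)^-1 * gap s l ^- count aff l.
  move: (gap s l) g0 g1 us gu D1 => g g0 g1 us gu D1.
  move: us gu D1; clear -g0 g1; elim: l => [|u l IH] us gu D1.
    by rewrite !big_nil/= expr0 invr1 mulr1.
  have /andP[d0 d1] := D1 u (mem_head _ _).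
  have su0 := us u (mem_head _ _); have gsu := gu u (mem_head _ _).
  have m0 : 0 < Num.min (D u) `|s - u| by rewrite lt_min d0.
  rewrite !big_cons /= exprD invfM [X in _ <= X](_ : _ =
    ((D u)^-1 * g ^- aff u) * (\prod_(j <- l) (D j)^-1 * g ^- count aff l)); last by ring.
  apply: ler_pM.
  - by rewrite invr_ge0 ltW.
  - rewrite big_seq; apply: prodr_ge0 => j jl; rewrite invr_ge0 le_min normr_ge0 andbT.
    by have /andP[/ltW] := D1 j (mem_behead (s := u :: l) jl).
  - rewrite /aff; case: ltP => h; rewrite /= ?expr1 ?expr0 ?invr1 ?mulr1//.
    apply: (@le_trans _ _ g^-1); first by rewrite lef_pV2 ?posrE.
    by rewrite ler_peMl ?invr_ge0 ?(ltW g0)// invf_ge1.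
  - by apply: IH => j jl; [apply: us|apply: gu|apply: D1]; rewrite inE jl orbT.
have p0 : 0 <= \prod_(j <- l) (D j)^-1.
  rewrite big_seq; apply: prodr_ge0 => j jl; rewrite invr_ge0.
  by have /andP[/ltW] := D1 j jl.
(* One factor [gap^(-1)] for [s] itself and at most two for the affected points make up the power
   3. *)
have e2 : gap s l ^- count aff l <= gap s l ^- 2.
  rewrite lef_pV2 ?posrE ?exprn_gt0//.
  by rewrite ler_wiXn2l ?(ltW g0).
rewrite exprS invfM -mulrA ler_wpM2l ?invr_ge0 ?(ltW g0)//.
apply: (le_trans step); rewrite mulrC; apply: ler_pM => //.
by rewrite invr_ge0 exprn_ge0// ltW.
Qed.

End gaps.

Section gaussian_weights.
Context {R : realType}.
Notation mu := (@lebesgue_measure R).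

Lemma expR_sqr_normal (a b u : R) : 0 < a -> expR (- (a * (u + b) ^+ 2)) =
  Num.sqrt (pi / a) * normal_pdf (- b) (Num.sqrt ((2 * a)^-1)) u.
Proof.
move=> a0; have s0 : Num.sqrt ((2 * a)^-1) != 0.
  by rewrite gt_eqF// sqrtr_gt0 invr_gt0 mulr_gt0.
rewrite normal_pdfE// /normal_peak /normal_fun sqr_sqrtr; last first.
  by rewrite invr_ge0 mulr_ge0// ltW.
have -> : (2 * a)^-1 * pi *+ 2 = pi / a by rewrite -mulr_natr; field; rewrite gt_eqF.
rewrite mulVKf; last by rewrite gt_eqF// sqrtr_gt0 divr_gt0// pi_gt0.
by congr expR; rewrite opprK -mulr_natr; field; rewrite gt_eqF.
Qed.

Lemma rint_expR_sqr (a b : R) : 0 < a ->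
  rint mu setT (fun u => expR (- (a * (u + b) ^+ 2))) /\
  \int[mu]_u expR (- (a * (u + b) ^+ 2)) = Num.sqrt (pi / a).
Proof.
move=> a0; have s0 : Num.sqrt ((2 * a)^-1) != 0.
  by rewrite gt_eqF// sqrtr_gt0 invr_gt0 mulr_gt0.
have I0 : rint mu setT (normal_pdf (- b) (Num.sqrt ((2 * a)^-1))).
  exact: integrable_normal_pdf.
split.
  apply: (eq_rint measurableT _ (rintZ measurableT (Num.sqrt (pi / a)) I0)) => u _.
  by rewrite expR_sqr_normal.
under eq_Rintegral do rewrite expR_sqr_normal//.
by rewrite (RintegralZl _ measurableT I0) Rintegral_normal_pdf// mulr1.
Qed.

Lemma gauss_weight_le (g : R -> R) (a b W : R) : 0 < a -> measurable_fun setT g ->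
  (forall u, `|g u| <= W) ->
  rint mu setT (fun u => g u * expR (- (a * (u + b) ^+ 2))) /\
  \int[mu]_u (g u * expR (- (a * (u + b) ^+ 2))) <= W * Num.sqrt (pi / a).
Proof.
move=> a0 mg gW; have [I E] := rint_expR_sqr b a0.
have me := rint_meas I.
have I2 : rint mu setT (fun u => g u * expR (- (a * (u + b) ^+ 2))).
  apply: (le_rint measurableT _ _ (rintZ measurableT W I)).
    exact: measurable_funM.
  by move=> u _; rewrite normrM (ger0_norm (expR_ge0 _)) ler_wpM2r ?expR_ge0.
split => //; rewrite -E -(RintegralZl _ measurableT I).
apply: le_Rintegral => //; first exact: rintZ.
by move=> u _; rewrite ler_wpM2r ?expR_ge0// (le_trans (ler_norm _)).
Qed.

(** The weight is a multiple of the normal density of deviation [s^-1], so the formula for the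
    characteristic function also serves as its own inversion. *)
Lemma normal_pdf_fourier (s x : R) : 0 < s ->
  normal_pdf 0 s x = \int[mu]_u (cos (u * x) * ((2 * pi)^-1 * expR (- (s ^+ 2 * u ^+ 2) / 2))).
Proof.
move=> s0.
have c0 : 0 < normal_peak s by rewrite normal_peak_gt0// gt_eqF.
have is0 : s^-1 != 0 by rewrite gt_eqF ?invr_gt0.
have E u : (2 * pi)^-1 * expR (- (s ^+ 2 * u ^+ 2) / 2) =
    normal_peak s * normal_pdf 0 s^-1 u.
  rewrite normal_pdfE// /normal_fun mulrA; congr (_ * _); last first.
    by congr expR; rewrite subr0 -mulr_natr; field; rewrite gt_eqF.
  rewrite /normal_peak -invfM; congr _^-1; have p0 := @pi_ge0 R; rewrite -sqrtrM; last first.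
    by rewrite mulrn_wge0// mulr_ge0// sqr_ge0.
  rewrite [X in Num.sqrt X](_ : _ = (2 * pi) ^+ 2); first by rewrite sqrtr_sqr ger0_norm// mulr_ge0.
  rewrite exprVn; transitivity (s ^+ 2 * (s ^+ 2)^-1 * (2 * pi) ^+ 2); first by ring.
  by rewrite mulfV ?mul1r// sqrf_eq0 gt_eqF.
under eq_Rintegral do rewrite E mulrCA.
rewrite (RintegralZl _ measurableT); last first.
  by have := rint_cos_normal s^-1 x 0; apply: (eq_rint measurableT) => u _; rewrite addr0 [x * u]mulrC.
rewrite (_ : \int[mu]_u _ = expR (- (s^-1 ^+ 2 * x ^+ 2) / 2)).
  by rewrite normal_pdfE ?gt_eqF// /normal_fun; congr (_ * expR _); rewrite subr0 -mulr_natr; field; rewrite gt_eqF.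
have := normal_char x 0 is0; rewrite cos0 mul1r => <-.
by apply: eq_Rintegral => u _; rewrite addr0 [x * u]mulrC.
Qed.

End gaussian_weights.

Section power_bounds.
Context {R : realType}.

Lemma min1_le_powR (z e : R) : 0 <= z -> 0 < e <= 1 -> Num.min 1 z <= z `^ e.
Proof.
move=> z0 /andP[e0 e1]; rewrite ge_min; case: (leP 1 z) => z1.
  by have := @ge0_ler_powR R e (ltW e0) 1 z; rewrite powR1 !nnegrE ler01 z0 => ->.
apply/orP; right; move: z0; rewrite le_eqVlt => /predU1P[<-|z0]; first exact: powR_ge0.
by rewrite ger1_powR// z0 ltW.
Qed.

(** The two transforms agree at 0 and their difference is of second order there; this quadratic zero
    is the source of the gain in [s]. *)
Lemma diff_fourier_le (s u : R) :
  `|(2 * pi)^-1 * expR (- (s ^+ 2 * u ^+ 2) / 2) -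
    (2 * pi)^-1 * expR (- ((s / 2) ^+ 2 * u ^+ 2) / 2)| <= Num.min 1 (s ^+ 2 * u ^+ 2).
Proof.
set z := s ^+ 2 * u ^+ 2.
have z0 : 0 <= z by rewrite mulr_ge0 ?sqr_ge0.
have -> : (s / 2) ^+ 2 * u ^+ 2 = z / 4 by rewrite /z; field.
rewrite -mulrBr normrM ger0_norm; last by rewrite invr_ge0 mulr_ge0// pi_ge0.
have p2 : (2 * pi)^-1 <= 1 :> R by have := @pi_ge2 R; rewrite invf_le1 ?mulr_gt0 ?pi_gt0//; lra.
apply: (@le_trans _ _ `|expR (- z / 2) - expR (- (z / 4) / 2)|); first by rewrite ler_piMl.
have a1 := expR_gt0 (- z / 2); have a2 := expR_gt0 (- (z / 4) / 2).
have le1 : expR (- (z / 4) / 2) <= 1 by rewrite -[X in _ <= X]expR0 ler_expR; lra.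
have le2 : expR (- z / 2) <= expR (- (z / 4) / 2) by rewrite ler_expR; lra.
have le3 := expR_ge1Dx (- z / 2).
rewrite ler0_norm ?subr_le0// opprB le_min; apply/andP; split; lra.
Qed.

Lemma prod_powR (I : Type) (l : seq I) (F : I -> R) (a : R) : (forall i, 0 <= F i) ->
  (\prod_(i <- l) F i) `^ a = \prod_(i <- l) F i `^ a.
Proof.
move=> F0; elim: l => [|i l IH]; first by rewrite !big_nil powR1.
by rewrite !big_cons powRM ?IH// prodr_ge0.
Qed.

Lemma tailprodM (F G : R -> seq R -> R) l :
  tailprod F l * tailprod G l = tailprod (fun s l => F s l * G s l) l.
Proof. by elim: l => [|s l IH] /=; rewrite ?mulr1// -IH; ring. Qed.

Lemma tailprod_powR (F : R -> seq R -> R) a l : (forall s l, 0 <= F s l) ->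
  0 <= tailprod F l /\ (tailprod F l) `^ a = tailprod (fun s l => F s l `^ a) l.
Proof.
move=> F0; elim: l => [|s l [IH0 IH]] /=; first by rewrite powR1.
by split; [rewrite mulr_ge0|rewrite powRM// IH].
Qed.

Lemma eq_tailprod (F G : R -> seq R -> R) l : spread l ->
  (forall s l, s \notin 0 :: 1 :: l -> F s l = G s l) -> tailprod F l = tailprod G l.
Proof. by move=> + FG; elim: l => //= s l IH /andP[sl /IH ->]; rewrite FG. Qed.

(** For one of [p] equal shares of a quarter of the quadratic form: of its exponential decay only
    the small power [e] is retained. *)
Lemma expR_le_powR (p : nat) (x e : R) : (0 < p)%N -> 0 <= x -> 0 < e <= 1 ->
  expR (- (4 * p%:R)^-1 * x) <= 4 * p%:R * (1 + x) `^ (- e).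
Proof.
move=> p0 x0 /andP[e0 e1].
have p1 : 1 <= p%:R :> R by rewrite ler1n.
have q0 : 0 < 4 * p%:R :> R by rewrite mulr_gt0// (lt_le_trans ltr01).
have x1 : 0 < 1 + x by rewrite ltr_pwDl.
apply: (@le_trans _ _ (4 * p%:R * (1 + x)^-1)); last first.
  rewrite ler_wpM2l ?(ltW q0)// -[X in X <= _]powR_inv1 ?(ltW x1)//.
  by rewrite ler_powR ?lerDl// lerN2.
rewrite mulNr expRN -[X in _ <= X * _]invrK -invfM lef_pV2 ?posrE ?expR_gt0//; last first.
  by rewrite mulr_gt0// invr_gt0.
have := expR_ge1Dx ((4 * p%:R)^-1 * x).
apply: le_trans; rewrite mulrDr mulr1 lerD2r.
by rewrite invf_le1//; lra.
Qed.

End power_bounds.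

(** Retraction of the line onto [[0, 1]]. Composed with it, paths become continuous and measurable
    on the whole line, whatever their values outside [[0, 1]]. *)
Definition clamp (R : realType) (t : R) : R := Num.max 0 (Num.min 1 t).

Lemma clamp01 (R : realType) (t : R) : 0 <= clamp t <= 1.
Proof. by rewrite /clamp le_max lexx/= ge_max ler01 ge_min lexx. Qed.

Lemma clamp_id (R : realType) (t : R) : 0 <= t <= 1 -> clamp t = t.
Proof. by case/andP => t0 t1; rewrite /clamp; rewrite (min_idPr t1) (max_idPr t0). Qed.

Section bridge_products.
Context {R : realType} d (T : measurableType d) (P : probability T R).
Notation mu := (@lebesgue_measure R).
Variables (H : R) (X : R -> T -> R) (k0 : R).
Hypotheses (hH : 0 < H < 1) (hX : fbridge P H X) (k00 : 0 < k0).
Hypothesis lnd : forall L c t r, uniq L -> t \in L ->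
  0 < r -> r <= t -> r <= 1 - t ->
  (forall s, s \in L -> s != t -> c s != 0 -> r <= `|s - t|) ->
  k0 * r `^ (2 * H) * c t ^+ 2 <= bridge_form H L c c.

Lemma measurable_clamp_path t : measurable_fun setT (X (clamp t)).
Proof. by have [mX _ _] := hX; apply: mX; exact: clamp01. Qed.

Lemma bridge_form_ge0 L c : {in L, forall t, 0 <= t <= 1} -> 0 <= bridge_form H L c c.
Proof. by move=> L01; have [_ [s <- _]] := fbridge_combo_law c hH hX L01; rewrite sqr_ge0. Qed.

(** Instance of [fourier_product_le] with all frequencies initially 0. The conditional variance
    enters only through its lower bound [k0 * gap^(2H)], so the caller has just a one-dimensional
    integral to bound. *)
Lemma bridge_product_le (L : seq R) (f w : R -> R) (B : R) (y M : R -> R)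
    (h : R -> R -> R) (k W : R) : spread L -> {in L, forall t, 0 <= t <= 1} ->
  rint mu setT w -> (forall x, `|f x| <= B) -> measurable_fun setT f ->
  (forall x, f x = \int[mu]_u (cos (u * x) * w u)) ->
  0 < k -> (forall t x, 0 <= h t x) -> (forall t x, h t (- x) = h t x) ->
  (forall t, measurable_fun setT (h t)) ->
  (forall t u, `|w u| * h t u <= W) ->
  (forall c, expR (- (2^-1 - k) * bridge_form H L c c) <= \prod_(t <- L) h t (c t)) ->
  (forall s t l A b, L = s ++ t :: l -> k0 * gap t l `^ (2 * H) <= A ->
     \int[mu]_u (`|w u| * h t u * expR (- (k * A * (u + b) ^+ 2))) <= M t) ->
  `|\int[P]_w0 \prod_(t <- L) f (X (clamp t) w0 - y t)| <= \prod_(t <- L) M t.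
Proof.
move=> spL L01 Iw bf mf fw kk0 h0 hN mh hW hq hM.
have uL := spread_uniq spL.
have qC := @bridge_formC R H L; have qD := @bridge_form_add R H L.
(* The residual given by [gs_min] has coefficient 1 at [t] and vanishes off [t :: l], so [lnd]
   applies with the gap as radius. *)
have hA s t l : L = s ++ t :: l ->
    k0 * gap t l `^ (2 * H) <= gs (bridge_form H L) l (vec_delta t) (vec_delta t).
  move=> LE; have [c [-> cl]] := gs_min qC qD l (vec_delta t).
  have tl : t \notin 0 :: 1 :: l.
    by move: spL; rewrite LE; elim: (s) => [|u s' IH] /= /andP[].
  have tL : t \in L by rewrite LE mem_cat mem_head orbT.
  have t01 := L01 t tL.
  have ct : c t = 1.
    rewrite cl /vec_delta ?eqxx//.
    by move: tl; rewrite !inE !negb_or => /and3P[].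
  have -> : k0 * gap t l `^ (2 * H) = k0 * gap t l `^ (2 * H) * c t ^+ 2.
    by rewrite ct expr1n mulr1.
  apply: lnd => //; first exact: gap_gt0.
  - by have := @gap_le _ t 0 l; rewrite mem_head subr0 ger0_norm; lra.
  - by have := @gap_le _ t 1 l; rewrite !inE eqxx orbT distrC ger0_norm; lra.
  move=> u uL' ut cu; rewrite distrC; apply: gap_le; rewrite !inE.
  have [ul|ul] := boolP (u \in l); first by apply/or3P; constructor 3.
  by move: cu; rewrite cl// /vec_delta (negbTE ut) eqxx.
have gapp t l s : L = s ++ t :: l -> 0 < k0 * gap t l `^ (2 * H).
  move=> LE; rewrite mulr_gt0// powR_gt0// gap_gt0//.
  by move: spL; rewrite LE; elim: (s) => [|u s' IH] /= /andP[].
have := @fourier_product_le R _ T P (fun t => X (clamp t)) L uL measurable_clamp_path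
  (bridge_form H L) qC qD h k h0 hN _
  f w B Iw bf mf fw y M _ [::] L (fun=> 0) 0 erefl (fun _ _ => erefl).
rewrite (_ : \int[P]_w0 (cos _ * _) =
  \int[P]_w0 \prod_(t <- L) f (X (clamp t) w0 - y t)); last first.
  apply: eq_Rintegral => w0 _; rewrite /combo big1 ?addr0 ?cos0 ?mul1r// => t _.
  by rewrite mul0r.
move=> main.
have M0 : 0 <= \prod_(t <- L) M t.
  rewrite big_seq; apply: prodr_ge0 => t tL.
  have LE : L = take (index t L) L ++ t :: drop (index t L).+1 L.
    by rewrite -[LHS](cat_take_drop (index t L)) (drop_nth 0) ?index_mem// nth_index.
  apply: (le_trans _ (hM _ _ _ _ 0 LE (lexx _))).
  by apply: Rintegral_ge0 => u _; rewrite !mulr_ge0 ?expR_ge0.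
apply: (le_trans (main _ _)).
- move=> c th.
  have [mc [s sE E]] := fbridge_combo_law c hH hX L01.
  have -> : combo (fun t => X (clamp t)) L c = (fun w0 => \sum_(t <- L) c t * X t w0).
    apply/funext => w0; rewrite /combo !big_seq; apply: eq_bigr => t tL.
    by rewrite clamp_id// L01.
  rewrite (gauss_law_cos mc E)// normrM (ger0_norm (expR_ge0 _)).
  apply: (@le_trans _ _ (expR (- s ^+ 2 / 2))).
    by rewrite ler_piMl ?expR_ge0// cos_max.
  rewrite sE (_ : - bridge_form H L c c / 2 =
    - (2^-1 - k) * bridge_form H L c c + - k * bridge_form H L c c); last by field.
  by rewrite expRD ler_wpM2r ?expR_ge0.
- move=> s t l LE; have hA' := hA s t l LE; have g0 := gapp _ _ _ LE.
  have A0 : 0 < gs (bridge_form H L) l (vec_delta t) (vec_delta t) := lt_le_trans g0 hA'.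
  split; first by rewrite gt_eqF.
  move=> b; have E u : - k * (gs (bridge_form H L) l (vec_delta t) (vec_delta t) * (u + b) ^+ 2) =
     - (k * gs (bridge_form H L) l (vec_delta t) (vec_delta t) * (u + b) ^+ 2).
    by ring.
  split; last by under eq_Rintegral do rewrite E; exact: (hM _ _ _ _ _ LE).
  have [|||] := @gauss_weight_le R (fun u => `|w u| * h t u) (k * gs (bridge_form H L) l (vec_delta t) (vec_delta t)) b W.
  - by rewrite mulr_gt0.
  - by apply: measurable_funM => //; apply: measurableT_comp => //; exact: rint_meas Iw.
  - by move=> u; rewrite ger0_norm// mulr_ge0.
  by move=> I _; apply: (eq_rint measurableT _ I) => u _; rewrite E.
rewrite [X in X * _ * _](_ : _ = 1) ?mul1r; last first.
  by rewrite big1_seq// => t /andP[/negbTE ->].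
rewrite ler_piMr// -expR0 ler_expR mulNr oppr_le0 mulr_ge0// ?(ltW kk0)//.
have [c [-> _]] := gs_min qC qD L (fun=> 0).
exact: bridge_form_ge0.
Qed.

Lemma gauss_product_le (L : seq R) (y : R -> R) (s : R) : 0 < s ->
  spread L -> {in L, forall t, 0 <= t <= 1} ->
  `|\int[P]_w0 \prod_(t <- L) expR (- ((X (clamp t) w0 - y t) ^+ 2 / s ^+ 2))| <=
  tailprod (fun t l => Num.min 1 (s / Num.sqrt (2 * k0) * gap t l `^ (- H))) L.
Proof.
move=> s0 spL L01.
have uL := spread_uniq spL.
rewrite -tailprodE//.
(* [exp (- x^2 / s^2)] is the characteristic function of the centred normal law of variance
   [2 / s^2]. *)
pose v := Num.sqrt 2 / s; have v0 : 0 < v by rewrite divr_gt0// sqrtr_gt0.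
have v2 : v ^+ 2 = 2 / s ^+ 2 by rewrite /v expr_div_n sqr_sqrtr.
have Iw : rint mu setT (normal_pdf 0 v) by exact: integrable_normal_pdf.
have wW u : `|normal_pdf 0 v u| <= normal_peak v.
  by rewrite ger0_norm ?normal_pdf_ge0// normal_pdf_ub// gt_eqF.
apply: (@bridge_product_le L (fun x => expR (- (x ^+ 2 / s ^+ 2))) (normal_pdf 0 v) 1 y _
  (fun _ _ => 1) 2^-1 (normal_peak v)) => //.
- by move=> x; rewrite ger0_norm ?expR_ge0// -expR0 ler_expR oppr_le0 mulr_ge0 ?invr_ge0 ?sqr_ge0.
- apply: measurableT_comp => //; apply: measurableT_comp => //; apply: measurable_funM => //.
- move=> x; have := normal_char x 0 (lt0r_neq0 v0); rewrite cos0 mul1r v2.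
  rewrite (_ : - (2 / s ^+ 2 * x ^+ 2) / 2 = - (x ^+ 2 / s ^+ 2)); last first.
    by field; rewrite gt_eqF.
  by move=> <-; apply: eq_Rintegral => u _; rewrite addr0 [x * u]mulrC.
- by move=> t u; rewrite mulr1.
- by move=> c; rewrite subrr oppr0 mul0r expR0 big1.
move=> s' t l A b LE hA.
rewrite LE drop_index_cat -?LE//.
have g0 : 0 < gap t l.
  by apply: gap_gt0; move: spL; rewrite LE; elim: (s') => [|u s1 IH] /= /andP[].
have A0 : 0 < A by rewrite (lt_le_trans _ hA)// mulr_gt0// powR_gt0.
have k0A : 0 < 2^-1 * A by rewrite mulr_gt0// invr_gt0.
have [||I E] := @gauss_weight_le R (fun u => `|normal_pdf 0 v u| * 1) (2^-1 * A) b (normal_peak v) k0A.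
- by apply: measurable_funM => //; apply: measurableT_comp => //; exact: measurable_normal_pdf.
- by move=> u; rewrite mulr1 normr_id.
(* Either factor of the integrand can be bounded by a constant: first the exponential by 1, leaving
   total mass 1, then the density by its peak. *)
rewrite le_min; apply/andP; split.
  rewrite -[X in _ <= X](@Rintegral_normal_pdf R 0 v).
  apply: le_Rintegral => // u _.
  rewrite mulr1 ger0_norm ?normal_pdf_ge0// ler_piMr ?normal_pdf_ge0//.
  rewrite -[X in _ <= X]expR0 ler_expR oppr_le0; apply: mulr_ge0; [exact: ltW|exact: sqr_ge0].
apply: (le_trans E); rewrite /normal_peak -sqrtrV; last first.
  by rewrite mulrn_wge0// mulr_ge0 ?sqr_ge0// pi_ge0.
rewrite -sqrtrM; last by rewrite invr_ge0 mulrn_wge0// mulr_ge0 ?sqr_ge0// pi_ge0.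
have g2 : gap t l `^ (2 * H) = (gap t l `^ H) ^+ 2 by rewrite mulrC -powR_mulrn ?powR_ge0// powRrM.
have gH : 0 < gap t l `^ H by exact: powR_gt0.
rewrite -(@ler_sqr _ (Num.sqrt _)) ?nnegrE ?sqrtr_ge0//; last first.
  by rewrite !mulr_ge0 ?invr_ge0 ?sqrtr_ge0 ?powR_ge0// ltW.
rewrite sqr_sqrtr; last first.
  have p0 := @pi_ge0 R; apply: mulr_ge0; last by rewrite divr_ge0// ltW.
  by rewrite invr_ge0 mulrn_wge0// mulr_ge0// sqr_ge0.
have -> : (s / Num.sqrt (2 * k0) * gap t l `^ (- H)) ^+ 2 =
    s ^+ 2 * (2 * (k0 * gap t l `^ (2 * H)))^-1.
  rewrite powRN !exprMn !exprVn sqr_sqrtr ?mulr_ge0 ?(ltW k00)// g2.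
  by rewrite -[LHS]mulrA -invfM [in RHS]mulrA.
rewrite v2.
have -> : (2 / s ^+ 2 * pi *+ 2)^-1 * (pi / (2^-1 * A)) = s ^+ 2 * (2 * A)^-1.
  have := @pi_gt0 R; move: (@pi R) => p p0; field.
  by rewrite !gt_eqF.
by rewrite ler_wpM2l ?sqr_ge0// lef_pV2 ?posrE ?mulr_gt0// ?powR_gt0// ler_wpM2l.
Qed.

(** A quarter of the quadratic form pays for the factor [(s^2 u^2)^e] extracted from the quadratic
    zero; it is bounded below through the isolation radii [D]. Another quarter gives [gap^(-H)]
    through the conditional variances. The product of the [1 / D] is at most that of [gap^(-3)], so
    its power [2 H e] adds [6 H e] to the exponent [H]. *)
Lemma diff_product_le (p : nat) (e : R) : (0 < p)%N -> 0 < e <= 1 ->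
  exists2 K, 0 <= K & forall (L : seq R) (y : R -> R) (s : R), 0 < s -> size L = p ->
  spread L -> {in L, forall t, 0 <= t <= 1} ->
  `|\int[P]_w0 \prod_(t <- L)
     (normal_pdf 0 s (X (clamp t) w0 - y t) - normal_pdf 0 (s / 2) (X (clamp t) w0 - y t))| <=
  tailprod (fun t l => K * s `^ (2 * e) * gap t l `^ (- (H * (1 + 6 * e)))) L.
Proof.
move=> p0 e01; have /andP[e0 e1] := e01.
(* The factors come from the bound on the weight [h], from [k0] inside [E], and from the Gaussian
   integral with a quarter of the conditional variance. *)
exists (4 * p%:R * k0 `^ (- e) * Num.sqrt (4 * pi / k0)).
  by rewrite !mulr_ge0 ?powR_ge0 ?sqrtr_ge0.
move=> L y s s0 sL spL L01.
have uL := spread_uniq spL; have H0 : 0 < H by have /andP[] := hH.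
have [D [D1 D2 D3 D4]] := isolation_radii spL L01.
pose E t := k0 * `|D t| `^ (2 * H).
have Et t : t \in L -> 0 < E t.
  by move=> tL; rewrite mulr_gt0// powR_gt0// normr_gt0 gt_eqF//; have /andP[] := D1 t tL.
have E0 t : 0 <= E t by rewrite mulr_ge0 ?powR_ge0// ltW.
pose h t x := 4 * p%:R * (1 + E t * x ^+ 2) `^ (- e).
pose w u := (2 * pi)^-1 * expR (- (s ^+ 2 * u ^+ 2) / 2) -
  (2 * pi)^-1 * expR (- ((s / 2) ^+ 2 * u ^+ 2) / 2).
have Iw1 s1 : 0 < s1 -> rint mu setT (fun u => (2 * pi)^-1 * expR (- (s1 ^+ 2 * u ^+ 2) / 2)).
  move=> s10; apply: rintZ => //.
  have [|I _] := @rint_expR_sqr R (s1 ^+ 2 / 2) 0.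
    by rewrite divr_gt0// exprn_gt0.
  by apply: (eq_rint measurableT _ I) => u _; congr expR; rewrite addr0; field.
have s20 : 0 < s / 2 by rewrite divr_gt0.
have Iw : rint mu setT w := rintB measurableT (Iw1 _ s0) (Iw1 _ s20).
have w1 u : `|w u| <= 1.
  by rewrite (le_trans (diff_fourier_le _ _))// ge_min lexx.
have h0 t x : 0 <= h t x by rewrite !mulr_ge0 ?powR_ge0.
have x1 t x : 1 <= 1 + E t * x ^+ 2 by rewrite lerDl mulr_ge0 ?sqr_ge0.
have hle t x : h t x <= 4 * p%:R.
  by rewrite /h ler_piMr// -[X in _ <= X](powRr0 (1 + E t * x ^+ 2)) ler_powR// oppr_le0 ltW.
have mh t : measurable_fun setT (h t).
  apply: measurable_funM => //.
  apply: (measurableT_comp (measurable_powR_cst _)).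
  by apply: measurable_funD => //; apply: measurable_funM.
(* The growth [u^(2e)] allowed for [w] cancels against the decay of [h]. *)
have bnd t u : t \in L -> `|w u| * h t u <= 4 * p%:R * (s ^+ 2 / E t) `^ e.
  move=> tL; have Et0 := Et t tL.
  have z0 : 0 <= E t * u ^+ 2 by rewrite mulr_ge0 ?sqr_ge0.
  have : `|w u| <= (s ^+ 2 / E t) `^ e * (E t * u ^+ 2) `^ e.
    rewrite -powRM ?divr_ge0 ?sqr_ge0//.
    rewrite (_ : s ^+ 2 / E t * _ = s ^+ 2 * u ^+ 2); last by field; rewrite gt_eqF.
    by apply: (le_trans (diff_fourier_le _ _)); apply: min1_le_powR => //; rewrite mulr_ge0 ?sqr_ge0.
  move=> wle; rewrite /h mulrCA ler_wpM2l// powRN ler_pdivrMr ?powR_gt0//; last first.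
    by rewrite (lt_le_trans _ (x1 t u)).
  apply: (le_trans wle); rewrite ler_wpM2l ?powR_ge0//.
  by rewrite ge0_ler_powR ?nnegrE ?(ltW e0) ?lerDr// addr_ge0.
pose M t := 4 * p%:R * (s ^+ 2 / E t) `^ e *
  (Num.sqrt (4 * pi / k0) * gap t (drop (index t L).+1 L) `^ (- H)).
apply: (@le_trans _ _ (\prod_(t <- L) M t)).
  apply: (@bridge_product_le L (fun x => normal_pdf 0 s x - normal_pdf 0 (s / 2) x) w
    (normal_peak s + normal_peak (s / 2)) y M h 4^-1 (4 * p%:R)) => //.
  - move=> x; rewrite (le_trans (ler_normB _ _))// lerD// ger0_norm ?normal_pdf_ge0//.
      by rewrite normal_pdf_ub// gt_eqF.
    by rewrite normal_pdf_ub// gt_eqF.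
  - by apply: measurable_funB; exact: measurable_normal_pdf.
  - move=> x; rewrite !normal_pdf_fourier//.
    have Ic s1 : 0 < s1 -> rint mu setT (fun u => cos (u * x) * ((2 * pi)^-1 * expR (- (s1 ^+ 2 * u ^+ 2) / 2))).
      move=> s10; have I1 := Iw1 s1 s10; apply: (le_rint measurableT _ _ I1).
        apply: measurable_funM; last exact: rint_meas I1.
        have := measurable_cos_affine x 0; apply: eq_measurable_fun => u _.
        by rewrite addr0 mulrC.
      move=> u _; rewrite normrM [X in _ * X]ger0_norm; last first.
        by rewrite mulr_ge0 ?expR_ge0// invr_ge0 mulr_ge0// pi_ge0.
      by rewrite ler_piMl ?cos_max// mulr_ge0 ?expR_ge0// invr_ge0 mulr_ge0// pi_ge0.
    rewrite -(RintegralB measurableT (Ic _ s0) (Ic _ s20)).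
    by apply: eq_Rintegral => u _; rewrite -mulrBr.
  - by move=> t x; rewrite /h sqrrN.
  - by move=> t u; rewrite -[X in _ <= X]mul1r ler_pM.
  - move=> c; have q0 := bridge_form_ge0 c L01.
    rewrite (_ : - (2^-1 - 4^-1) * _ = p%:R * (- (4 * p%:R)^-1 * bridge_form H L c c)); last first.
      by field; rewrite pnatr_eq0 -lt0n.
    rewrite expRM_natl -sL -iter_mulr_1 -count_predT -big_const_seq big_seq [X in _ <= X]big_seq.
    apply: ler_prod => t tL; rewrite expR_ge0/= count_predT sL.
    have le1 : E t * c t ^+ 2 <= bridge_form H L c c.
      have /andP[d0 d1] := D1 t tL; have [d2 d3] := D3 t tL.
      rewrite /E gtr0_norm//; apply: lnd => // u uL' ut _.
      exact: (D2 u t uL' tL ut).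
    have z0 : 0 <= E t * c t ^+ 2 by rewrite mulr_ge0 ?sqr_ge0.
    apply: le_trans (expR_le_powR p0 z0 e01); rewrite ler_expR.
    by rewrite !mulNr lerN2 ler_wpM2l// invr_ge0 mulr_ge0.
  - move=> s' t l A b LE hA; rewrite /M LE drop_index_cat -?LE//.
    have tL : t \in L by rewrite LE mem_cat mem_head orbT.
    have g0 : 0 < gap t l.
      by apply: gap_gt0; move: spL; rewrite LE; elim: (s') => [|u s1 IH] /= /andP[].
    have A0 : 0 < A by rewrite (lt_le_trans _ hA)// mulr_gt0// powR_gt0.
    have k0A : 0 < 4^-1 * A by rewrite mulr_gt0// invr_gt0.
    have [||_ le1] := @gauss_weight_le R (fun u => `|w u| * h t u) (4^-1 * A) b
      (4 * p%:R * (s ^+ 2 / E t) `^ e) k0A.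
    + by apply: measurable_funM => //; apply: measurableT_comp => //; exact: rint_meas Iw.
    + move=> u; rewrite [X in X <= _]ger0_norm; last by rewrite mulr_ge0.
      exact: bnd.
    apply: (le_trans le1); rewrite ler_wpM2l// ?mulr_ge0 ?powR_ge0//.
    have -> : Num.sqrt (4 * pi / k0) * gap t l `^ (- H) = Num.sqrt (4 * pi / (k0 * gap t l `^ (2 * H))).
      rewrite invfM mulrA [in RHS]sqrtrM; last by rewrite divr_ge0 ?mulr_ge0 ?pi_ge0// ltW.
      congr (_ * _); rewrite -powRN -(powR12_sqrt (powR_ge0 _ _)) -powRrM.
      by congr (_ `^ _); field.
    rewrite ler_wsqrtr// (_ : pi / (4^-1 * A) = 4 * pi / A); last by field; rewrite gt_eqF.
    by rewrite ler_wpM2l ?mulr_ge0 ?pi_ge0// lef_pV2 ?posrE// mulr_gt0// powR_gt0.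
set K := _ * Num.sqrt _.
have ME t : t \in L -> M t = (K * s `^ (2 * e) * gap t (drop (index t L).+1 L) `^ (- H)) *
    `|(D t)^-1| `^ (2 * H * e).
  move=> tL; have /andP[d0 d1] := D1 t tL.
  have -> : M t = 4 * p%:R * (s `^ (2 * e) * (k0 `^ (- e) * D t `^ (- (2 * H * e)))) *
      (Num.sqrt (4 * pi / k0) * gap t (drop (index t L).+1 L) `^ (- H)).
    rewrite /M /E gtr0_norm//; congr (_ * _ * _).
    rewrite powRM ?sqr_ge0//; last by rewrite invr_ge0 mulr_ge0 ?powR_ge0// ltW.
    rewrite -(powR_mulrn 2 (ltW s0)) -powRrM; congr (_ * _).
    rewrite invfM powRM ?invr_ge0 ?powR_ge0 ?(ltW k00)//.
    by rewrite -powR_inv1 ?(ltW k00)// -(powRN (D t)) -!powRrM mulN1r mulNr.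
  rewrite gtr0_norm ?invr_gt0// -(powR_inv1 (ltW d0)) -powRrM mulN1r /K.
  by ring.
rewrite big_seq; under eq_bigr do rewrite ME//.
rewrite -big_seq big_split/=.
have -> : \prod_(t <- L) `|(D t)^-1| `^ (2 * H * e) = (\prod_(t <- L) (D t)^-1) `^ (2 * H * e).
  rewrite -prod_powR//; congr (_ `^ _); rewrite !big_seq; apply: eq_bigr => t tL.
  by rewrite ger0_norm// invr_ge0; have /andP[/ltW] := D1 t tL.
have t0 : forall (t : R) (l : seq R), 0 <= (gap t l ^- 3 : R) by move=> t l; rewrite invr_ge0 exprn_ge0// gap_ge0.
have [T0 TE] := tailprod_powR (2 * H * e) L t0.
rewrite (tailprodE (fun t l => K * s `^ (2 * e) * gap t l `^ (- H)))//.
have K0 : 0 <= K * s `^ (2 * e) by rewrite /K !mulr_ge0 ?powR_ge0 ?sqrtr_ge0.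
have C0 : 0 <= tailprod (fun t l => K * s `^ (2 * e) * gap t l `^ (- H)) L.
  by elim: (L) => //= u l IH; rewrite !mulr_ge0 ?powR_ge0.
apply: (@le_trans _ _ (tailprod (fun t l => K * s `^ (2 * e) * gap t l `^ (- H)) L *
  (tailprod (fun s l => gap s l ^- 3) L) `^ (2 * H * e))).
  rewrite ler_wpM2l// ge0_ler_powR ?nnegrE// ?mulr_ge0 ?(ltW H0) ?(ltW e0)//.
  by rewrite big_seq prodr_ge0// => t tL; rewrite invr_ge0; have /andP[/ltW] := D1 t tL.
rewrite TE tailprodM le_eqVlt; apply/orP; left; apply/eqP; apply: eq_tailprod => // t l tl.
have g0 := gap_gt0 tl.
rewrite -[LHS]mulrA; congr (_ * _).
rewrite -(powR_invn 3 (ltW g0)) -powRrM -powRD ?(gt_eqF g0) ?implybT//.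
by congr (_ `^ _); ring.
Qed.

End bridge_products.

(** * Independent coordinates and measurability *)

Section independence.
Context {R : realType} d (T : measurableType d) (P : probability T R) (k : nat).
Notation mu := (@lebesgue_measure R).
Variables (G : 'I_k -> set (set T)).
Hypothesis GM : forall i A, G i A -> measurable A.
Hypothesis ind : forall E : 'I_k -> set T, (forall i, G i (E i)) ->
  P (\bigcap_(i in [set: 'I_k]) E i) = (\prod_i P (E i))%E.
Variable Y : 'I_k -> T -> R.
Hypothesis Y01 : forall i w, 0 <= Y i w <= 1.
Hypothesis mY : forall i, measurable_fun setT (Y i).
Hypothesis GY : forall i u, G i [set w | u < Y i w].

Let w01 (s : measurableTypeR R) : R := \1_(`[0%R, 1%R]%classic : set R) s.

Let Iw01 : rint mu setT w01.
Proof. exact: (@integrable_indic_itv R 0 1 true false). Qed.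

Let lt01 (u y : R) : R := (u < y)%R%:R.

Let Ilay (y : R) : rint mu setT (fun u : measurableTypeR R => lt01 u y * w01 u).
Proof.
apply: (le_rint measurableT _ _ Iw01).
  apply: measurable_funM; last exact: rint_meas Iw01.
  rewrite /lt01 (_ : (fun u => _) = \1_(`]-oo, y[%classic : set R)).
    by apply: measurable_funTS; exact: measurable_indic.
  apply/funext => u; rewrite indicE; congr (_%:R); congr nat_of_bool.
  by apply/idP/idP; rewrite inE /= in_itv.
move=> u _; rewrite normrM [`|w01 u|]ger0_norm // ler_piMl// /lt01.
by case: (_ < _); rewrite ?normr1 ?normr0.
Qed.

Let layer (y : R) : 0 <= y <= 1 -> \int[mu]_u (lt01 u y * w01 u) = y.
Proof.
move=> /andP[y0 y1].
transitivity (\int[mu]_u \1_(`[0, y[%classic : set R) u).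
  apply: eq_Rintegral => u _; rewrite /w01 /lt01 !indicE; case: ltP => uy.
    rewrite mul1r; congr (_%:R : R); congr nat_of_bool.
    by apply/idP/idP; rewrite !inE/= !in_itv/= => /andP[u0 u1]; rewrite u0 ?uy// (le_trans (ltW uy)).
  rewrite mul0r [_ \in _](_ : _ = false)//; apply/negbTE; rewrite notin_setE/= in_itv/= => /andP[_].
  by rewrite ltNge uy.
rewrite /Rintegral integral_indic//= setIT lebesgue_measure_itv/= lte_fin.
by case: ltP => h /=; [rewrite subr0|apply/eqP; rewrite eq_le y0 h].
Qed.

(** Hybrid factors for the induction: coordinates below [m] carry the functions [Y], the others
    still carry indicators of events, for which independence is known. *)
Let ind1 (m : nat) (E : 'I_k -> set T) (i : 'I_k) w : R := if (i < m)%N then Y i w else \1_(E i) w.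

Let ind1_01 m E i w : 0 <= ind1 m E i w <= 1.
Proof.
rewrite /ind1; case: ifP => _; first exact: Y01.
by rewrite indicE; case: (_ \in _); rewrite ?lexx ?ler01.
Qed.

Let mind1 m E i : (forall i, G i (E i)) -> measurable_fun setT (ind1 m E i).
Proof.
move=> GE; rewrite /ind1; case: (i < m)%N; first exact: mY.
exact/measurable_indic/GM/GE.
Qed.

Let mlt j : measurable_fun setT (fun z : T * measurableTypeR R => lt01 z.2 (Y j z.1)).
Proof.
rewrite (_ : (fun z => _) = \1_((fun z : T * measurableTypeR R => Y j z.1 - z.2) @^-1`
    (`]0, +oo[%classic : set R))).
  apply: measurable_indic; rewrite -[X in measurable X]setTI.
  have : measurable_fun setT (fun z : T * measurableTypeR R => Y j z.1 - z.2).
    by apply: measurable_funB; [exact: (measurableT_comp (mY j))|exact: measurable_snd].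
  by apply.
apply/funext => z; rewrite indicE /lt01; congr (_%:R); congr nat_of_bool.
by apply/idP/idP; rewrite inE /= in_itv/= andbT subr_gt0.
Qed.

(** Independence is given for events. Each [Y i] is the integral over [u] of the indicators of its
    level sets [u < Y i], and Fubini in [u] converts the coordinates one by one. *)
Lemma independent_expectation_prod :
  \int[P]_w \prod_i Y i w = \prod_i \int[P]_w Y i w.
Proof.
suff H m E : (forall i, G i (E i)) ->
    \int[P]_w \prod_i ind1 m E i w = \prod_i \int[P]_w ind1 m E i w.
  have := H k (fun i => [set w | 0 < Y i w]) (fun i => GY i 0).
  rewrite /ind1; under eq_Rintegral do under eq_bigr do rewrite ltn_ord.
  by under [in RHS]eq_bigr do rewrite ltn_ord.
elim: m E => [|m IH] E GE.
  rewrite /ind1 /=.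
  transitivity (\int[P]_w (\1_(\bigcap_(i in [set: 'I_k]) E i) w : R)).
    apply: eq_Rintegral => w _; rewrite indicE.
    have [/set_mem h|/negP h] := boolP (w \in _).
      by rewrite big1// => i _; rewrite indicE mem_set//; exact: h.
    have [i Ei] : exists i, ~ E i w.
      by apply: contrapT => n; apply: h; apply: mem_set => i _; apply: contrapT => nE; apply: n; exists i.
    by rewrite (bigD1 i)//= indicE memNset// mul0r.
  have mE i : measurable (E i) by exact/GM/GE.
  rewrite /Rintegral integral_indic ?setIT//; last first.
    by apply: fin_bigcap_measurable => // i _; exact: mE.
  rewrite [X in fine X](_ : _ = (\prod_i P (E i))%E); last exact: (ind GE).
  transitivity (fine (\prod_i (fine (P (E i)))%:E)%E).
    by congr fine; apply: eq_bigr => i _; rewrite fineK ?fin_num_measure.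
  by rewrite prodEFin /=; apply: eq_bigr => i _; rewrite integral_indic ?setIT.
have [km|mk] := leqP k m.
  have E1 i w : ind1 m.+1 E i w = ind1 m E i w.
    by rewrite /ind1 (leq_trans (ltn_ord i) km) (leq_trans (ltn_ord i) (leqW km)).
  under eq_Rintegral do under eq_bigr do rewrite E1.
  rewrite IH//; apply: eq_bigr => i _; apply: eq_Rintegral => w _; by rewrite E1.
pose j := Ordinal mk.
have Ene i w : i != j -> ind1 m.+1 E i w = ind1 m E i w.
  move=> ij; rewrite /ind1 ltnS leq_eqVlt [_ == _ :> nat](_ : _ = false)//.
  exact: negbTE.
pose Z w := \prod_(i | i != j) ind1 m E i w.
have Z01 w : 0 <= Z w <= 1.
  have h i : 0 <= ind1 m E i w <= 1 := ind1_01 m E i w.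
  rewrite /Z; apply/andP; split.
    by apply: prodr_ge0 => i _; have /andP[] := h i.
  by apply: prodr_ile1 => i _; exact: h.
have mZ : measurable_fun setT Z.
  rewrite (_ : Z = fun w => \prod_(i <- [seq i <- index_enum 'I_k | i != j]%SEQ) ind1 m E i w).
    by apply: measurable_prod => i _; exact: mind1.
  by apply/funext => w; rewrite big_filter.
pose K (z : T * measurableTypeR R) : R := lt01 z.2 (Y j z.1) * Z z.1.
have mK : measurable_fun setT K.
  apply: measurable_funM; [exact: mlt|exact: (measurableT_comp mZ)].
have bK z : `|K z| <= 1.
  have /andP[z0 z1] := Z01 z.1.
  by rewrite /K normrM (ger0_norm z0) mulr_ile1// /lt01; case: (_ < _); rewrite ?normr1 ?normr0.
rewrite (bigD1 j)//=.
transitivity (\int[P]_w \int[mu]_u (K (w, u) * w01 u)).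
  apply: eq_Rintegral => w _; rewrite (bigD1 j)//= {1}/ind1 leqnn.
  transitivity (Y j w * Z w).
    by congr (_ * _); apply: eq_bigr => i ij; rewrite Ene.
  rewrite -{1}(layer (Y01 j w)) mulrC -RintegralZl//.
    by apply: eq_Rintegral => u _; rewrite /K/=; ring.
  exact: Ilay.
rewrite (Rintegral_fubini P mK bK Iw01).
pose c := \prod_(i | i != j) \int[P]_w ind1 m E i w.
(* At a fixed level [u] the integrand is a hybrid product of stage [m] whose [j]-th event is the
   level set, so the induction hypothesis factors it. *)
have Eu (u : measurableTypeR R) : \int[P]_x K (x, u) = c * \int[P]_w lt01 u (Y j w).
  pose E' i := if i == j then [set w | u < Y j w] else E i.
  have GE' i : G i (E' i) by rewrite /E'; case: eqP => [->|//].
  have := IH E' GE'; rewrite [in RHS](bigD1 j)//=.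
  have Ej w : ind1 m E' j w = lt01 u (Y j w).
    rewrite /ind1 ltnn /E' eqxx indicE; congr (_%:R); congr nat_of_bool.
    by apply/idP/idP; rewrite inE.
  have Ei i w : i != j -> ind1 m E' i w = ind1 m E i w.
    by move=> ij; rewrite /ind1 /E' (negbTE ij).
  under [X in _ = X * _ -> _]eq_Rintegral do rewrite Ej.
  rewrite [X in _ = _ * X -> _](_ : _ = c); last first.
    by apply: eq_bigr => i ij; apply: eq_Rintegral => w _; rewrite Ei.
  rewrite mulrC => <-; apply: eq_Rintegral => w _; rewrite (bigD1 j)//= Ej /K; congr (_ * _).
  by apply: eq_bigr => i ij; rewrite Ei.
under eq_Rintegral do rewrite Eu.
rewrite [RHS](_ : _ = \int[P]_w Y j w * c); last first.
  congr (_ * _); first by apply: eq_Rintegral => w _; rewrite /ind1 leqnn.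
  by apply: eq_bigr => i ij; apply: eq_Rintegral => w _; rewrite Ene.
pose K1 (z : T * measurableTypeR R) : R := c * lt01 z.2 (Y j z.1).
have mK1 : measurable_fun setT K1 by exact: measurable_funM.
have bK1 z : `|K1 z| <= `|c|.
  by rewrite /K1 normrM ler_piMr// /lt01; case: (_ < _); rewrite ?normr1 ?normr0.
have Ilt u : rint P setT (fun w => lt01 u (Y j w)).
  have I1 : rint P setT (fun=> 1) by exact: finite_measure_integrable_cst.
  apply: (le_rint measurableT _ _ I1).
    exact: (measurableT_comp (mlt j) (measurable_pair2 _)).
  by move=> w _; rewrite /lt01; case: (_ < _); rewrite ?normr1 ?normr0.
under eq_Rintegral => u _ do rewrite -(RintegralZl c measurableT (Ilt u)).
have := Rintegral_fubini P mK1 bK1 Iw01; rewrite /K1 /= => <-.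
have IY : rint P setT (Y j).
  have I1 : rint P setT (fun=> 1) by exact: finite_measure_integrable_cst.
  apply: (le_rint measurableT _ _ I1) => // w _; have /andP[y0 y1] := Y01 j w.
  by rewrite ger0_norm.
rewrite mulrC -(RintegralZl c measurableT IY); apply: eq_Rintegral => w _.
rewrite -{2}(layer (Y01 j w)) -(RintegralZl c measurableT (Ilay (Y j w))).
by apply: eq_Rintegral => u _; rewrite mulrA.
Qed.

End independence.

Lemma clamp_dist (R : realType) (s t : R) : `|clamp s - clamp t| <= `|s - t|.
Proof.
rewrite /clamp.
have h (u : R) : Num.max 0 (Num.min 1 u) = if u <= 0 then 0 else if 1 <= u then 1 else u.
  case: (leP u 0) => u0.
    have u1 : u <= 1 by lra.
    by rewrite (min_idPr u1) (max_idPl u0).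
  case: (leP 1 u) => u1; first by rewrite (max_idPr _)//.
  by rewrite (max_idPr _)// ltW.
rewrite !h; case: (leP s 0) => s0; case: (leP t 0) => t0; case: (leP 1 s) => s1; case: (leP 1 t) => t1;
  rewrite ?subrr ?normr0 ?normr_ge0 ?lexx//; try (exfalso; lra).
- by rewrite distrC ger0_norm ?ltr0_norm; lra.
- by rewrite distrC [X in _ <= X]distrC !ger0_norm; lra.
- by rewrite !ger0_norm; lra.
- by rewrite !ger0_norm; lra.
- by rewrite !ger0_norm; lra.
by rewrite distrC [X in _ <= X]distrC !ger0_norm; lra.
Qed.

Lemma continuous_clamp (R : realType) : continuous (@clamp R : R -> R).
Proof.
move=> t; apply/cvgrPdist_lt => e e0; near=> u.
rewrite (le_lt_trans (clamp_dist _ _))//; near: u.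
Unshelve. all: by end_near. Qed.

Lemma continuous_clamp_path (R : realType) (x : R -> R) :
  {within `[0, 1], continuous x} -> continuous (x \o @clamp R : R -> R).
Proof.
move=> /subspace_continuousP cx t.
have ct : clamp t \in `[0, 1] by rewrite in_itv/=; exact: clamp01.
apply: cvg_trans (cx _ ct) => A; rewrite /within/= => nA.
have h : \forall u \near t, clamp u \in `[0, 1] -> A (x (clamp u)) := @continuous_clamp R t _ nA.
have : \forall u \near t, A (x (clamp u)).
  by apply: filterS h => u; apply; rewrite in_itv/=; exact: clamp01.
by [].
Qed.

Section borel_cantelli.
Context {R : realType} d (T : measurableType d) (P : probability T R).

Lemma borel_cantelli (E : nat -> set T) (C q : R) : 0 <= C -> 0 <= q < 1 ->
  (forall k, measurable (E k)) -> (forall k, (P (E k) <= (C * q ^+ k)%:E)%E) ->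
  exists O : set T, [/\ measurable O, P O = 1%E &
    forall w, O w -> exists k0, forall k, (k0 <= k)%N -> ~ E k w].
Proof.
move=> C0 /andP[q0 q1] mE PE.
pose U m := \bigcup_j E (m + j)%N.
have mU m : measurable (U m) by exact: bigcup_measurable.
pose N := \bigcap_m U m.
have mN : measurable N by exact: bigcap_measurable.
have q1' : 0 < 1 - q by rewrite subr_gt0.
have PU m : (P (U m) <= (C / (1 - q) * q ^+ m)%:E)%E.
  have := @measure_sigma_subadditive _ _ _ P (U m) (fun j => E (m + j)%N) (fun j => mE _) (mU m) (@subset_refl _ _).
  move=> /le_trans; apply; apply: lime_le.
    by apply: is_cvg_nneseries => j _ _; exact: measure_ge0.
  apply: nearW => j.
  have h : (\sum_(0 <= i < j) P (E (m + i)%N) <= (C * q ^+ m * \sum_(0 <= i < j) q ^+ i)%:E)%E.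
    elim: j => [|j IH]; first by rewrite !big_geq// mulr0.
    rewrite !big_nat_recr//= mulrDr EFinD leeD//.
    by rewrite -mulrA -exprD.
  apply: (le_trans h); rewrite lee_fin [X in _ <= X]mulrAC.
  rewrite ler_wpM2l ?mulr_ge0 ?exprn_ge0//.
  rewrite -[X in _ <= X]div1r ler_pdivlMr// mulrC big_mkord -opprB mulNr -subrX1.
  by rewrite opprB lerBlDr lerDl exprn_ge0.
have fN : (P N)%E \is a fin_num by exact: fin_num_measure.
have N0 : P N = 0%E.
  have le m : fine (P N) <= geometric (C / (1 - q)) q m.
    rewrite -lee_fin fineK// (le_trans _ (PU m))// le_measure ?inE//.
    exact: bigcap_inf.
  have cv := @cvg_geometric R (C / (1 - q)) q.
  rewrite ger0_norm// in cv.
  apply/eqP; rewrite -(fineK fN) eqe eq_le fine_ge0// andbT -(cvg_lim _ (cv q1))//.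
  apply: limr_ge; last exact: nearW.
  by apply/cvg_ex; exists 0; exact: cv.
exists (~` N); split; first exact: measurableC.
  by rewrite probability_setC// N0 sube0.
move=> w Nw; apply: contrapT => h; apply: Nw => m _.
apply: contrapT => nU; apply: h; exists m => k mk Ek; apply: nU.
by exists (k - m)%N => //; rewrite /= subnKC.
Qed.

End borel_cantelli.

Section clamped_process.
Context {R : realType} d (T : measurableType d) (P : probability T R).
Variables (H : R) (X : R -> T -> R).
Hypothesis hX : fbridge P H X.

Lemma fbridge_path_continuous w : continuous ((X ^~ w) \o @clamp R : R -> R).
Proof. by have [_ cX _] := hX; exact: continuous_clamp_path (cX w). Qed.

(** Joint measurability from measurability at fixed times: with the time frozen on a grid of mesh
    [1 / k.+1] the process is a countable patchwork, and path continuity gives pointwise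
    convergence. *)
Lemma measurable_clamped_process :
  measurable_fun setT (fun z : measurableTypeR R * T => X (clamp z.1) z.2).
Proof.
pose h k (z : measurableTypeR R * T) :=
  X (clamp ((Num.floor (k.+1%:R * (z.1 : R)))%:~R / k.+1%:R)) z.2.
apply: (@measurable_fun_cvg _ _ _ setT h) => [m|z _].
  move=> _ A mA; rewrite setTI.
  rewrite (_ : _ @^-1` _ = \bigcup_(j : int)
    (((fun t : measurableTypeR R => m.+1%:R * (t : R)) @^-1` `[j%:~R, (j + 1)%:~R[) `*` (X (clamp (j%:~R / m.+1%:R)) @^-1` A))).
    apply: countable_bigcupT_measurable => // j.
    apply: measurableX; last first.
      rewrite -[X in measurable X]setTI; apply: (measurable_clamp_path hX) => //.
    rewrite -[X in measurable X]setTI.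
    have : measurable_fun setT (fun t : measurableTypeR R => m.+1%:R * (t : R)).
      exact: measurable_funM.
    by apply.
  apply/seteqP; split => [z /= Az|z [j _ [/= zj Az]]].
    exists (Num.floor (m.+1%:R * z.1)) => //; split => //=.
    by rewrite in_itv/=; exact: floor_itv.
  rewrite /h /=; move: zj; rewrite in_itv/= => /floor_def ->//.
rewrite /h; apply: (@cvg_comp _ _ _ (fun k : nat => (Num.floor (k.+1%:R * (z.1 : R)))%:~R / k.+1%:R : R)
   ((X ^~ z.2) \o @clamp R) \oo (nbhs (z.1 : R))).
  apply/cvgrPdist_lt => e e0; near=> k.
  have k0 : 0 < k.+1%:R :> R by [].
  have /andP[f1 f2] := floor_itv (k.+1%:R * (z.1 : R)).
  rewrite ger0_norm; last by rewrite subr_ge0 ler_pdivrMr// [z.1 * _]mulrC.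
  apply: (@le_lt_trans _ _ k.+1%:R^-1).
    rewrite -(ler_pM2l k0) mulrBr [_ / _]mulrC mulVKf ?gt_eqF// mulfV ?gt_eqF//.
    by move: f2; rewrite intrD; lra.
  by near: k; exact: (near_infty_natSinv_lt (PosNum e0)).
exact: fbridge_path_continuous.
Unshelve. all: by end_near. Qed.

End clamped_process.

(** * The Frostman bound *)

Section eventually_bounded.
Context {R : realType} d (T : measurableType d) (P : probability T R).

(** Markov's inequality is applied to the sum over the finite index set, which dominates every term;
    hence the condition that the number of indices times the moment bound be geometric. *)
Lemma eventually_le1 (I : nat -> finType) (A : forall k, I k -> T -> R) (D : nat -> R) (C q : R) :
  (forall k j, rint P setT (A k j)) -> (forall k j w, 0 <= A k j w) ->
  (forall k j, \int[P]_w A k j w <= D k) ->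
  0 <= C -> 0 <= q < 1 -> (forall k, #|I k|%:R * D k <= C * q ^+ k) ->
  exists O : set T, [/\ measurable O, P O = 1%E &
    forall w, O w -> exists k0, forall k, (k0 <= k)%N -> forall j, A k j w <= 1].
Proof.
move=> IA A0 AD C0 q01 hD.
pose Z k w := \sum_(j : I k) A k j w.
have IZ k := rint_sum measurableT (index_enum (I k)) (IA k).
pose E k := [set w | 1 < Z k w].
have mE k : measurable (E k).
  rewrite (_ : E k = Z k @^-1` `]1, +oo[).
    by rewrite -[X in measurable X]setTI; apply: (rint_meas (IZ k).1).
  by apply/seteqP; split => w; rewrite /E /= in_itv/= andbT.
have Z0 k w : 0 <= Z k w by apply: sumr_ge0 => j _; exact: A0.
have PE k : (P (E k) <= (C * q ^+ k)%:E)%E.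
  rewrite -[E k]setIT -integral_indic//.
  apply: (@le_trans _ _ (\int[P]_w (Z k w)%:E)%E).
    apply: ge0_le_integral_nomeas => w _; first by rewrite lee_fin.
    rewrite lee_fin indicE; case: (boolP (w \in E k)) => [/set_mem h|_] //.
    exact: ltW.
  rewrite (rintE measurableT (IZ k).1) lee_fin (IZ k).2.
  apply: le_trans (hD k); rewrite -sumr_const mulr_suml.
  by apply: ler_sum => j _; rewrite mul1r.
have [S [mS PS h]] := borel_cantelli C0 q01 mE PE.
exists S; split => // w /h[k0 hk]; exists k0 => k /hk nE j.
have : Z k w <= 1 by rewrite leNgt; apply/negP.
by apply: le_trans; rewrite /Z (bigD1 j)//= lerDl sumr_ge0.
Qed.

End eventually_bounded.

Section coordinates.
Context {R : realType} d (T : measurableType d) (P : probability T R) (n : nat).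
Variables (H : R) (B : R -> T -> 'rV[R]_n) (phi : R -> 'rV[R]_n).
Hypotheses (hH : 0 < H < 1) (hB : fbridge_rV P H B).
Hypothesis mphi : measurable_fun (`[0, 1]%classic : set R) phi.

Let G i := process_sigma_algebra `[0, 1]%classic (fun t w => B t w 0 i).

Lemma measurable_process_sigma_algebra (I : set R) (X : R -> T -> R) t : I t ->
  measurable_fun setT (X t : g_sigma_algebraType
    (\bigcup_(t in I) preimage_set_system setT (X t) measurable) -> R).
Proof. by move=> It _ A mA; apply: sub_sigma_algebra; exists t => //; exists A. Qed.

Lemma measurable_coord_clamp i t : measurable_fun setT (fun w => B (clamp t) w 0 i).
Proof. exact: (measurable_clamp_path (hB.1 i)). Qed.

Lemma measurable_phi_clamp i : measurable_fun setT (fun t : R => phi (clamp t) 0 i).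
Proof.
have mc : measurable_fun setT (@clamp R : R -> R).
  by apply: continuous_measurable_fun; exact: continuous_clamp.
apply: (measurableT_comp (measurable_coord i)).
apply: (@measurable_comp _ _ _ _ _ _ (`[0, 1]%classic : set R)) => //.
by move=> _ [t _ <-] /=; rewrite in_itv/=; exact: clamp01.
Qed.

Lemma bridge_coord_independent (l : seq R) (f : R -> R) (y : 'I_n -> R -> R) :
  measurable_fun setT f -> (forall x, 0 <= f x <= 1) ->
  \int[P]_w \prod_i \prod_(t <- l) f (B (clamp t) w 0 i - y i t) =
  \prod_i \int[P]_w \prod_(t <- l) f (B (clamp t) w 0 i - y i t).
Proof.
move=> mf f01.
have GM i A : G i A -> measurable A.
  apply; split; first exact: sigma_algebra_measurable.
  move=> _ [t /= t01 [C mC <-]]; rewrite in_itv/= in t01.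
  by have [mX _ _] := hB.1 i; exact: mX.
have mfX d' (T' : measurableType d') (X : R -> T' -> R) (z : R -> R) :
    (forall t, measurable_fun setT (X (clamp t))) ->
    measurable_fun setT (fun w => \prod_(t <- l) f (X (clamp t) w - z t)).
  move=> mX; apply: measurable_prod => t _; apply: (measurableT_comp mf).
  exact: measurable_funB.
apply: (independent_expectation_prod GM hB.2) => [i w|i|i u].
- apply/andP; split; first by apply: prodr_ge0 => t _; have /andP[] := f01 (B (clamp t) w 0 i - y i t).
  by apply: prodr_ile1 => t _; exact: f01.
- by apply: (mfX _ _ (fun t w => B t w 0 i)) => t; exact: measurable_coord_clamp.
pose gen := \bigcup_(t in `[0, 1]%classic) preimage_set_system setT (fun w => B t w 0 i) measurable.
have mg t : measurable_fun setT ((fun w => B (clamp t) w 0 i) : g_sigma_algebraType gen -> R).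
  apply: (@measurable_process_sigma_algebra `[0, 1]%classic (fun t w => B t w 0 i)).
  by rewrite /= in_itv/=; exact: clamp01.
have := mfX _ (g_sigma_algebraType gen) (fun t w => B t w 0 i) (y i) mg.
move=> /(_ measurableT `]u, +oo[%classic (measurable_itv _)); rewrite setTI.
rewrite (_ : _ @^-1` _ = [set w | u < \prod_(t <- l) f (B (clamp t) w 0 i - y i t)])//.
by apply/seteqP; split => w; rewrite /= in_itv/= andbT.
Qed.

(** Up to a constant a majorant of the indicator of a cube of half-side [r]. It factors over the
    coordinates, as independence wants, and [phi] is absorbed into the centre. *)
Definition path_bump (r : R) (y : 'rV[R]_n) (z : measurableTypeR R * T) : R :=
  \prod_i expR (- ((B (clamp z.1) z.2 0 i - (y 0 i - phi (clamp z.1) 0 i)) ^+ 2 / r ^+ 2)).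

Lemma bump01 r y z : 0 <= path_bump r y z <= 1.
Proof.
apply/andP; split; first by apply: prodr_ge0 => i _; exact: expR_ge0.
apply: prodr_ile1 => i _; rewrite expR_ge0/= -[X in _ <= X]expR0 ler_expR oppr_le0.
by apply: mulr_ge0; rewrite ?invr_ge0 sqr_ge0.
Qed.

Lemma measurable_bump r y : measurable_fun setT (path_bump r y).
Proof.
apply: measurable_prod => i _; apply: measurableT_comp => //.
apply: measurableT_comp => //; apply: measurable_funM => //; apply: measurable_funX.
apply: measurable_funB; first exact: (measurable_clamped_process (hB.1 i)).
apply: measurable_funB => //.
exact: (measurableT_comp (measurable_phi_clamp i) measurable_fst).
Qed.

Lemma bump_norm r y z : `|path_bump r y z| <= 1.
Proof. by have /andP[b0 b1] := bump01 r y z; rewrite ger0_norm. Qed.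

Lemma tailprodX (F : R -> seq R -> R) l m :
  tailprod F l ^+ m = tailprod (fun s l => F s l ^+ m) l.
Proof. by elim: l => [|s l IH] /=; rewrite ?expr1n// exprMn IH. Qed.

Lemma bump_moment_le (k0 e r : R) (y : 'rV[R]_n) (p : nat) : 0 < k0 ->
  (forall L c t r, uniq L -> t \in L -> 0 < r -> r <= t -> r <= 1 - t ->
     (forall s, s \in L -> s != t -> c s != 0 -> r <= `|s - t|) ->
     k0 * r `^ (2 * H) * c t ^+ 2 <= bridge_form H L c c) ->
  0 < r -> 0 <= e <= n%:R -> H * e < 1 ->
  \int[P]_w (time_int (path_bump r y) w ^+ p) <=
    rcst (H * e) 1 p 0 * ((r / Num.sqrt (2 * k0)) `^ e) ^+ p.
Proof.
move=> k00 lnd r0 /andP[e0 en] He; have /andP[H0 H1] := hH.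
set K := r / _; have K0 : 0 < K by rewrite divr_gt0// sqrtr_gt0 mulr_gt0.
have He0 : 0 <= H * e by rewrite mulr_ge0// ltW.
apply: (moment_rprod_le (measurable_bump r y) (bump_norm r y)).
- by rewrite He0.
- exact: powR_ge0.
move=> l _ l01.
have [spl|nspl] := boolP (spread l); last by rewrite rprod_pinfty ?leey// powR_gt0.
pose F (t : R) (l : seq R) := Num.min 1 (K * gap t l `^ (- H)).
have [|T0 Tle] := @rprod_ge R (H * e) (K `^ e) (fun t l => F t l ^+ n) l (powR_ge0 _ _) He0 _ spl l01.
  move=> s l' s01 sl'; have g0 := gap_gt0 sl'.
  have Kg0 : 0 < K * gap s l' `^ (- H) by rewrite mulr_gt0// powR_gt0.
  have F0 : 0 < F s l' by rewrite lt_min ltr01.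
  have F1 : F s l' <= 1 by rewrite ge_min lexx.
  rewrite exprn_ge0 ?(ltW F0)//= -powR_mulrn ?(ltW F0)//.
  (* [F] is at most 1, so lowering the exponent from [n] to [e] enlarges the bound; this is what
     brings the time singularity down to [H * e < 1]. *)
  apply: (@le_trans _ _ (F s l' `^ e)); first by rewrite ger_powR// F0.
  have -> : K `^ e * gap s l' `^ (- (H * e)) = (K * gap s l' `^ (- H)) `^ e.
    by rewrite powRM ?powR_ge0 ?(ltW K0)// -powRrM mulNr.
  by rewrite ge0_ler_powR ?nnegrE ?(ltW F0) ?(ltW Kg0)// ge_min lexx orbT.
apply: (le_trans _ Tle); rewrite lee_fin -tailprodX.
rewrite (_ : \int[P]_w _ = \prod_i \int[P]_w \prod_(t <- l)
    expR (- ((B (clamp t) w 0 i - (y 0 i - phi (clamp t) 0 i)) ^+ 2 / r ^+ 2))); last first.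
  rewrite -(@bridge_coord_independent l (fun x => expR (- (x ^+ 2 / r ^+ 2)))
    (fun i t => y 0 i - phi (clamp t) 0 i)).
  - by apply: eq_Rintegral => w _; rewrite /gprod /path_bump exchange_big.
  - apply: measurableT_comp => //; apply: measurableT_comp => //; exact: measurable_funM.
  - move=> x; rewrite expR_ge0/= -[X in _ <= X]expR0 ler_expR oppr_le0.
    by apply: mulr_ge0; rewrite ?invr_ge0 sqr_ge0.
apply: (@le_trans _ _ (\prod_(i < n) tailprod F l)); last by rewrite prodr_const card_ord.
apply: ler_prod => i _; apply/andP; split.
  apply: Rintegral_ge0 => w _; apply: prodr_ge0 => t _; exact: expR_ge0.
have := @gauss_product_le R _ T P H (fun t w => B t w 0 i) k0 hH (hB.1 i) k00 lnd l
  (fun t => y 0 i - phi (clamp t) 0 i) r r0 spl l01.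
by apply: le_trans; exact: ler_norm.
Qed.

End coordinates.

Section frostman.
Context {R : realType} d (T : measurableType d) (P : probability T R) (n : nat).
Notation mu := (@lebesgue_measure R).
Variables (H : R) (B : R -> T -> 'rV[R]_n) (phi : R -> 'rV[R]_n).
Hypotheses (hH : 0 < H < 1) (hB : fbridge_rV P H B).
Hypothesis mphi : measurable_fun (`[0, 1]%classic : set R) phi.
Hypothesis bphi : exists M : R, forall t, 0 <= t <= 1 -> enorm (phi t) <= M.

Lemma enorm_coord (x : 'rV[R]_n) i : `|x 0 i| <= enorm x.
Proof.
rewrite /enorm -sqrtr_sqr ler_wsqrtr// /dot (bigD1 i)//= -expr2 lerDl.
by apply: sumr_ge0 => j _; rewrite -expr2 sqr_ge0.
Qed.

Definition shifted_path w (s : measurableTypeR R) : 'rV[R]_n := B (clamp s) w + phi (clamp s).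

Lemma measurable_shifted_path w i : measurable_fun setT (fun s => shifted_path w s 0 i).
Proof.
rewrite /shifted_path; under eq_fun do rewrite mxE.
apply: measurable_funD; last exact: measurable_phi_clamp.
by apply: continuous_measurable_fun; exact: (fbridge_path_continuous (hB.1 i)).
Qed.

Lemma shifted_path_bounded w : exists2 M : R, 0 <= M & forall s i, `|shifted_path w s 0 i| <= M.
Proof.
pose f (s : R) := \sum_i `|B (clamp s) w 0 i|.
have cf : continuous f.
  rewrite /f; elim: (index_enum _) => [|i l IH].
    by under eq_fun do rewrite big_nil; exact: cst_continuous.
  under eq_fun do rewrite big_cons; move=> s; apply: cvgD; last exact: IH.
  by apply: cvg_norm; exact: (fbridge_path_continuous (hB.1 i)).
have [||c c01 hc] := @EVT_max R f 0 1; first exact: ler01.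
  exact: continuous_subspaceT.
have [M hM] := bphi.
exists (f c + `|M|).
  by rewrite addr_ge0//; apply: sumr_ge0.
move=> s i; rewrite mxE (le_trans (ler_normD _ _))// lerD//.
  have := hc (clamp s); rewrite in_itv/= clamp01 => /(_ isT); apply: le_trans.
  rewrite /f (clamp_id (clamp01 s)) (bigD1 i)//= lerDl; exact: sumr_ge0.
by rewrite (le_trans (enorm_coord _ _))// (le_trans (hM _ (clamp01 s)))// ler_norm.
Qed.

Definition cube_times w (y : 'rV[R]_n) (r : R) : set (measurableTypeR R) :=
  [set s | 0 <= s <= 1 /\ forall i, `|shifted_path w s 0 i - y 0 i| <= r].

Lemma measurable_cube_times w y r : measurable (cube_times w y r).
Proof.
rewrite (_ : cube_times w y r = `[0, 1]%classic `&`
    \bigcap_(i in [set: 'I_n]) [set s | `|shifted_path w s 0 i - y 0 i| <= r]); last first.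
  apply/seteqP; split => s /= [s01 h]; rewrite in_itv/= in s01 *; split => //.
    by move=> i _; exact: h.
  by move=> i; exact: h.
apply: measurableI; first exact: measurable_itv.
apply: fin_bigcap_measurable => // i _.
rewrite (_ : [set s | _] = (fun s => `|shifted_path w s 0 i - y 0 i|) @^-1` `]-oo, r]).
  rewrite -[X in measurable X]setTI.
  have : measurable_fun setT (fun s => `|shifted_path w s 0 i - y 0 i|).
    apply: measurableT_comp => //; apply: measurable_funB => //.
    exact: measurable_shifted_path.
  by apply.
by apply/seteqP; split => s /=; rewrite in_itv.
Qed.

(** On the cube around [y] the path is within [2 r] of [z] in each coordinate, so each factor of the
    bump is at least [e^(-4)]. Arbitrary centres are thereby reduced to grid points. *)
Lemma cube_times_le w (y z : 'rV[R]_n) (r : R) : 0 < r -> (forall i, `|y 0 i - z 0 i| <= r) ->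
  (mu (cube_times w y r) <= (expR 4 ^+ n * time_int (path_bump B phi r z) w)%:E)%E.
Proof.
move=> r0 yz.
have mQ := measurable_cube_times w y r.
have mb := measurable_bump hB mphi r z.
have mI : measurable (`[0, 1]%classic : set (measurableTypeR R)) by exact: measurable_itv.
have IC : rint mu (`[0, 1]%classic : set (measurableTypeR R)) (fun=> 1).
  apply: rint_ge0 => //; rewrite integral_cst//= lebesgue_measure_itv/= lte01.
  by rewrite -EFinD -EFinM ltry.
have I : rint mu (`[0, 1]%classic : set (measurableTypeR R)) (fun s => path_bump B phi r z (s, w)).
  apply: (le_rint mI _ _ IC).
    apply: measurable_funTS; apply: (measurableT_comp mb); exact: measurable_pair2.
  by move=> s _; exact: bump_norm.
rewrite /time_int -(RintegralZl _ mI I) -(rintE mI (rintZ mI _ I)).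
rewrite -[cube_times w y r]setIT -integral_indic// [leRHS]integral_mkcond.
apply: ge0_le_integral_nomeas => s _; first by rewrite lee_fin.
rewrite patchE indicE; have [sQ|_] := boolP (s \in cube_times w y r); last first.
  case: ifPn => // _; rewrite lee_fin mulr_ge0 ?exprn_ge0 ?expR_ge0//.
  by have /andP[] := bump01 B phi r z (s, w).
have [s01 hs] := set_mem sQ.
rewrite mem_set/=; last by rewrite in_itv.
rewrite lee_fin -[n in _ ^+ n]card_ord -prodr_const /path_bump -big_split/=.
rewrite [X in X <= _](_ : 1 = \prod_(i < n) 1); last by rewrite big1.
apply: ler_prod => i _; rewrite ler01/= -expRD -[X in X <= _]expR0 ler_expR.
rewrite subr_ge0 ler_pdivrMr ?exprn_gt0//.
have -> : 4 * r ^+ 2 = (2 * r) ^+ 2 by ring.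
rewrite -[X in X <= _]real_normK ?num_real// lerXn2r ?nnegrE// ?mulr_ge0 ?(ltW r0)//.
have -> : B (clamp s) w 0 i - (z 0 i - phi (clamp s) 0 i) =
    (shifted_path w s 0 i - y 0 i) + (y 0 i - z 0 i) by rewrite !mxE; ring.
by rewrite (le_trans (ler_normD _ _))// [2 * r]mulr_natl mulr2n lerD.
Qed.

(** Moments of order [p] decay like [2^(-k p e)] with an [e] above [theta] such that [H e < 1].
    Normalised by [2^(-k p theta)] they keep a geometric decay that a large [p] makes stronger than
    the growth of the grid. *)
Lemma frostman_as (theta : R) : 0 < theta < n%:R -> theta * H < 1 ->
  exists S : set T, [/\ measurable S, P S = 1%E & forall w, S w ->
    exists2 C : R, 0 <= C & forall y k,
      (mu (cube_times w y (2 ^- k)) <= (C * (2 `^ (- theta)) ^+ k)%:E)%E].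
Proof.
move=> /andP[th0 thn] thH; have /andP[H0 H1] := hH.
have [e /andP[the en] eH] : exists2 e : R, theta < e <= n%:R & H * e < 1.
  have [h|h] := leP (n%:R * H) 1.
    exists ((theta + n%:R) / 2); first by apply/andP; split; lra.
    nra.
  exists ((theta + H^-1) / 2); last first.
    by rewrite mulrA mulrDr mulfV ?gt_eqF//; lra.
  have : theta < H^-1 by rewrite -div1r ltr_pdivlMr.
  have : H^-1 <= n%:R by rewrite -[_^-1]mul1r ler_pdivrMr// ltW.
  by move=> *; apply/andP; split; lra.
have [k0 k00 lnd] := bridge_lnd hH.
(* The grid has at most [3^n 4^(k n)] points, to be paid for by [2^(-k p (e - theta))]; the surplus
   1 over [2 n] leaves the ratio [1/2]. *)
have [p p0 hp] : exists2 p, (0 < p)%N & (2 * n).+1%:R <= p%:R * (e - theta).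
  have et0 : 0 < e - theta by rewrite subr_gt0.
  exists (Num.bound (((2 * n).+1)%:R / (e - theta))).+1 => //.
  rewrite -ler_pdivrMr// ltW// (lt_trans (archi_boundP _))//; first by rewrite divr_ge0// ltW.
  by rewrite ltr_nat.
(* Grid of mesh [2^-k] on [[-2^k, 2^k]^n]: its range eventually contains the bounded path. *)
pose I k := {ffun 'I_n -> 'I_(2 * 4 ^ k).+1}.
pose gr k (j : I k) : 'rV[R]_n := \row_i ((j i)%:R / 2 ^+ k - 2 ^+ k).
pose lam : R := 2 `^ (- theta).
have lam0 : 0 < lam by rewrite powR_gt0.
pose A k (j : I k) w := time_int (path_bump B phi (2 ^- k) (gr k j)) w ^+ p / (lam ^+ k) ^+ p.
pose c0 := (Num.sqrt (2 * k0))^-1 `^ e.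
pose D k := rcst (H * e) 1 p 0 * ((2 ^- k / Num.sqrt (2 * k0)) `^ e) ^+ p / (lam ^+ k) ^+ p.
have r0 k : 0 < 2 ^- k :> R by rewrite invr_gt0 exprn_gt0.
have mb k j := measurable_bump hB mphi (2 ^- k) (gr k j).
have ti0 k j w : 0 <= time_int (path_bump B phi (2 ^- k) (gr k j)) w.
  by apply: Rintegral_ge0 => s _; have /andP[] := bump01 B phi (2 ^- k) (gr k j) (s, w).
have ti1 k j w : time_int (path_bump B phi (2 ^- k) (gr k j)) w <= 1.
  have := time_int_le (mb k j) (bump_norm B phi (2 ^- k) (gr k j)) w.
  by rewrite ger0_norm.
have IA0 k j : rint P setT (fun w => time_int (path_bump B phi (2 ^- k) (gr k j)) w ^+ p).
  have IC : rint P setT (fun=> 1) by exact: finite_measure_integrable_cst.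
  apply: (le_rint measurableT _ _ IC).
    apply: measurable_funX; exact: (measurable_time_int P (mb k j) (bump_norm B phi (2 ^- k) (gr k j))).
  by move=> w _; rewrite ger0_norm ?exprn_ge0// exprn_ile1.
have c00 : 0 <= c0 by exact: powR_ge0.
have rc0 : 0 <= rcst (H * e) 1 p 0.
  by apply: rcst_ge0 => //; rewrite eH mulr_ge0// ?(ltW H0)// ltW// (lt_trans th0).
have [||||||S [mS PS hS]] := @eventually_le1 R _ T P I A D (3 ^+ n * rcst (H * e) 1 p 0 * c0 ^+ p) 2^-1.
- move=> k j; apply: (eq_rint measurableT _ (rintZ measurableT ((lam ^+ k) ^+ p)^-1 (IA0 k j))) => w _.
  by rewrite mulrC.
- by move=> k j w; rewrite /A divr_ge0 ?exprn_ge0 ?(ltW lam0).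
- move=> k j; rewrite /A /D; under eq_Rintegral do rewrite mulrC.
  rewrite (RintegralZl _ measurableT (IA0 k j)) mulrC ler_wpM2r ?invr_ge0 ?exprn_ge0 ?(ltW lam0)//.
  apply: bump_moment_le => //; first by rewrite (ltW (lt_trans th0 the)).
- apply: mulr_ge0; last exact: exprn_ge0.
  by apply: mulr_ge0; [exact: exprn_ge0|exact: rc0].
- by apply/andP; split; lra.
- move=> k; rewrite card_ffun !card_ord natrX.
  have N3 : (2 * 4 ^ k).+1%:R <= 3 * 4 ^+ k :> R.
    rewrite -natr1 natrM natrX.
    have : 1 <= 4 ^+ k :> R by rewrite exprn_ege1// ler1n.
    by lra.
  pose rho : R := 2 `^ (- e) / lam.
  have rho0 : 0 <= rho by rewrite divr_ge0// ?powR_ge0// ltW.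
  have DE : D k = rcst (H * e) 1 p 0 * c0 ^+ p * (rho ^+ p) ^+ k.
    have rk : (2 ^- k) `^ e = (2 `^ (- e)) ^+ k.
      rewrite -(powR_invn k (ler0n R 2)) -powRrM -powR_mulrn ?powR_ge0// -powRrM.
      by congr (_ `^ _); ring.
    rewrite /D powRM ?invr_ge0 ?exprn_ge0 ?sqrtr_ge0// rk -/c0.
    rewrite /rho !exprMn !exprVn -!exprM [(k * p)%N]mulnC.
    by ring.
  rewrite DE; apply: (@le_trans _ _ ((3 * 4 ^+ k) ^+ n * (rcst (H * e) 1 p 0 * c0 ^+ p * (rho ^+ p) ^+ k))).
    rewrite ler_wpM2r ?lerXn2r ?nnegrE// ?mulr_ge0 ?exprn_ge0 ?c00 ?powR_ge0//.
  have h2 : 4 ^+ n * rho ^+ p <= 2^-1.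
    have -> : 4 ^+ n = 2 `^ (2 * n)%:R :> R by rewrite powR_mulrn// exprM; congr (_ ^+ n); rewrite expr2; ring.
    have -> : rho = 2 `^ (theta - e).
      by rewrite /rho /lam -powRN opprK -powRD ?pnatr_eq0 ?implybT// addrC.
    rewrite -powR_mulrn ?powR_ge0// -powRrM -powRD ?pnatr_eq0 ?implybT//.
    rewrite -[X in _ <= X]powR_inv1// ler_powR ?ler1n//.
    move: hp; rewrite -natr1; lra.
  have -> : (3 * 4 ^+ k) ^+ n * (rcst (H * e) 1 p 0 * c0 ^+ p * (rho ^+ p) ^+ k) =
      3 ^+ n * rcst (H * e) 1 p 0 * c0 ^+ p * (4 ^+ n * rho ^+ p) ^+ k.
    by rewrite !exprMn -!exprM [(k * n)%N]mulnC; ring.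
  rewrite ler_wpM2l ?mulr_ge0 ?exprn_ge0 ?c00 ?powR_ge0// lerXn2r ?nnegrE//.
    by rewrite mulr_ge0 ?exprn_ge0.
exists S; split => // w /hS[k1 hk1].
have [M M0 hM] := shifted_path_bounded w.
pose K1 := Num.bound (M + 1).
have MK k : (K1 <= k)%N -> M + 1 <= 2 ^+ k.
  move=> kk; have /ltW h : M + 1 < K1%:R by apply: archi_boundP; rewrite addr_ge0.
  apply: (le_trans h); rewrite -natrX ler_nat (leq_trans kk)// ltnW// ltn_expl//.
pose k2 := maxn k1 K1.
have lam1 : lam <= 1.
  rewrite /lam powRN invf_le1 ?powR_gt0//.
  by rewrite -[X in X <= _](powRr0 2) ler_powR ?ler1n// ltW.
(* The first term serves the levels from [k2] on; below [k2] the total mass 1 is at most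
   [lam ^- k2 * lam ^+ k]. *)
exists (expR 4 ^+ n + lam ^- k2).
  by rewrite addr_ge0 ?exprn_ge0 ?expR_ge0// invr_ge0 exprn_ge0// ltW.
move=> y k; have [kk2|kk2] := leqP k2 k; last first.
  apply: (@le_trans _ _ 1%E).
    rewrite (_ : 1%E = mu `[0, 1]%classic); last first.
      by rewrite lebesgue_measure_itv/= lte01 sube0.
    apply: le_measure; rewrite ?inE//; first exact: measurable_cube_times.
    by move=> s [s01 _]; rewrite /= in_itv.
  rewrite lee_fin mulrDl; apply: (@le_trans _ _ (lam ^- k2 * lam ^+ k)); last first.
    by rewrite lerDr mulr_ge0 ?exprn_ge0 ?expR_ge0// ltW.
  rewrite mulrC ler_pdivlMr ?exprn_gt0// mul1r.
  by apply: ler_wiXn2l; rewrite ?(ltW lam0)// ltnW.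
have [K1k k1k] : (K1 <= k)%N /\ (k1 <= k)%N.
  by move: kk2; rewrite geq_max => /andP[-> ->].
(* A cube that the path misses has no mass; otherwise its centre lies within the range of the
   grid. *)
have [->|/set0P[s [s01 hs]]] := eqVneq (cube_times w y (2 ^- k)) set0.
  rewrite measure0 lee_fin mulr_ge0 ?exprn_ge0 ?(ltW lam0)//.
  by rewrite addr_ge0 ?exprn_ge0 ?expR_ge0// invr_ge0 exprn_ge0// ltW.
have y2 i : `|y 0 i| <= 2 ^+ k.
  apply: le_trans (MK k K1k).
  have -> : y 0 i = shifted_path w s 0 i - (shifted_path w s 0 i - y 0 i) by ring.
  rewrite (le_trans (ler_normB _ _))// lerD// (le_trans (hs i))//.
  by rewrite invf_le1 ?exprn_gt0// exprn_ege1// ler1n.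
have p2 : 0 < 2 ^+ k :> R by rewrite exprn_gt0.
pose x i : R := (y 0 i + 2 ^+ k) * 2 ^+ k.
have x0 i : 0 <= x i.
  by have := y2 i; rewrite ler_norml => /andP[h1 h2]; rewrite mulr_ge0 ?(ltW p2)//; lra.
have xN i : (Num.truncn (x i) < (2 * 4 ^ k).+1)%N.
  rewrite ltnS -(ler_nat R) (le_trans (y := x i))//; first by have /andP[] := truncn_itv (x0 i).
  have := y2 i; rewrite ler_norml => /andP[h1 h2].
  rewrite /x natrM natrX (_ : 4 = 2 * 2 :> R); last by ring.
  by rewrite exprMn mulrA ler_wpM2r ?(ltW p2)//; lra.
pose j : I k := [ffun i => Ordinal (xN i)].
have yz i : `|y 0 i - gr k j 0 i| <= 2 ^- k.
  have /andP[t1 t2] := truncn_itv (x0 i).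
  rewrite mxE ffunE /=.
  have -> : y 0 i - ((Num.truncn (x i))%:R / 2 ^+ k - 2 ^+ k) = (x i - (Num.truncn (x i))%:R) / 2 ^+ k.
    by rewrite /x mulrBl mulfK ?gt_eqF//; ring.
  rewrite ger0_norm; last by rewrite divr_ge0 ?(ltW p2)// subr_ge0.
  rewrite ler_pdivrMr// mulVf ?gt_eqF//; move: t2; rewrite -natr1; lra.
apply: (le_trans (cube_times_le _ _ yz)); rewrite ?r0// lee_fin.
have := hk1 k k1k j; rewrite /A ler_pdivrMr ?exprn_gt0// mul1r.
rewrite ler_pXn2r ?nnegrE ?exprn_ge0 ?(ltW lam0)// => h.
rewrite mulrDl; apply: (@le_trans _ _ (expR 4 ^+ n * lam ^+ k)).
  by rewrite ler_wpM2l ?exprn_ge0 ?expR_ge0.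
by rewrite lerDl mulr_ge0 ?exprn_ge0 ?(ltW lam0)// invr_ge0 exprn_ge0// ltW.
Qed.

End frostman.

(** * Hoelder continuity *)

Section dyadic_chaining.
Context {R : realType}.
Variables (x : R -> R) (gamma : R).
Hypotheses (cx : continuous x) (gamma0 : 0 < gamma).

Let lam : R := 2 `^ (- gamma).

Let lam0 : 0 < lam. Proof. exact: powR_gt0. Qed.

Let lam1 : lam < 1.
Proof.
rewrite /lam powRN invf_lt1 ?powR_gt0//.
by have := @gt0_ltr_powR R gamma gamma0 1 2; rewrite powR1 !nnegrE ltr1n; exact.
Qed.

Variable k0 : nat.
Hypothesis hx : forall k j, (k0 <= k)%N -> (j < 2 ^ k)%N ->
  `|x (j.+1%:R / 2 ^+ k) - x (j%:R / 2 ^+ k)| <= lam ^+ k.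

Let fl k (t : R) := Num.truncn (2 ^+ k * t).
Let dy k t : R := (fl k t)%:R / 2 ^+ k.

Let p2 k : 0 < 2 ^+ k :> R. Proof. exact: exprn_gt0. Qed.

Let flP k t : 0 <= t -> (fl k t)%:R <= 2 ^+ k * t < (fl k t).+1%:R.
Proof. by move=> t0; apply: truncn_itv; rewrite mulr_ge0// ltW. Qed.

Let fl_le k t : 0 <= t <= 1 -> (fl k t <= 2 ^ k)%N.
Proof.
move=> /andP[t0 t1]; have /andP[h _] := flP k t0.
by rewrite -(ler_nat R) natrX (le_trans h)// ler_piMr// ltW.
Qed.

Let dy_step k t : (k0 <= k)%N -> 0 <= t <= 1 -> `|x (dy k.+1 t) - x (dy k t)| <= lam ^+ k.+1.
Proof.
move=> kk0 t01; have /andP[t0 t1] := t01.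
have /andP[a1 a2] := flP k t0; have /andP[b1 b2] := flP k.+1 t0.
have e2 : dy k t = (2 * fl k t)%N%:R / 2 ^+ k.+1.
  by rewrite /dy natrM exprS; field; rewrite gt_eqF.
have [h1 h2] : (2 * fl k t <= fl k.+1 t)%N /\ (fl k.+1 t <= (2 * fl k t).+1)%N.
  rewrite exprS -!mulrA in b1 b2; split; rewrite -ltnS -(ltr_nat R).
    by apply: le_lt_trans b2; rewrite natrM ler_wpM2l.
  have -> : (2 * fl k t).+2%:R = 2 * (fl k t)%:R + 2 :> R by rewrite -natrM -natrD addn2.
  apply: (le_lt_trans b1); move: a2; rewrite -natr1; lra.
have : (fl k.+1 t == 2 * fl k t)%N || (fl k.+1 t == (2 * fl k t).+1)%N.
  by move: h1 h2; rewrite leq_eqVlt eq_sym; case: eqP => //= _ h1 h2; rewrite eqn_leq h1 h2.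
rewrite e2 /dy => /orP[/eqP ->|/eqP E]; first by rewrite subrr normr0 exprn_ge0// ltW.
rewrite E; apply: hx; first by rewrite (leq_trans kk0).
by rewrite -E fl_le.
Qed.

Let dy_cvg (t e : R) : 0 <= t -> 0 < e -> exists m0, forall m, (m0 <= m)%N -> `|x t - x (dy m t)| < e.
Proof.
move=> t0 e0; have := @cx t; move/cvgrPdist_lt => /(_ e e0) /nbhs_ballP [r /= r0 hr].
exists (Num.bound r^-1) => m hm; apply: hr; rewrite /ball/=.
have /andP[a1 a2] := flP m t0.
have -> : t - dy m t = (2 ^+ m * t - (fl m t)%:R) / 2 ^+ m.
  by rewrite /dy; field; rewrite gt_eqF.
rewrite ger0_norm; last by rewrite divr_ge0 ?(ltW (p2 _))// subr_ge0.
rewrite ltr_pdivrMr// (@lt_le_trans _ _ 1)//; first by move: a2; rewrite -natr1; lra.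
rewrite mulrC -ler_pdivrMr// mul1r.
have /ltW h : r^-1 < (Num.bound r^-1)%:R by apply: archi_boundP; rewrite invr_ge0 ltW.
by apply: (le_trans h); rewrite -natrX ler_nat (leq_trans hm)// ltnW// ltn_expl.
Qed.

Let dy_dist k t : (k0 <= k)%N -> 0 <= t <= 1 ->
  `|x t - x (dy k t)| <= lam ^+ k.+1 / (1 - lam).
Proof.
move=> kk0 t01; have /andP[t0 t1] := t01.
have l1 : 0 < 1 - lam by rewrite subr_gt0.
(* The geometric tail still to come is added on the left, so that each induction step is just the
   triangle inequality. *)
have h i : `|x (dy (k + i) t) - x (dy k t)| + lam ^+ (k + i).+1 / (1 - lam) <= lam ^+ k.+1 / (1 - lam).
  elim: i => [|i IH]; first by rewrite addn0 subrr normr0 add0r.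
  apply: le_trans IH; rewrite addnS.
  have := dy_step (leq_trans kk0 (leq_addr i k)) t01.
  have -> : x (dy (k + i).+1 t) - x (dy k t) =
    (x (dy (k + i).+1 t) - x (dy (k + i) t)) + (x (dy (k + i) t) - x (dy k t)) by ring.
  have -> : lam ^+ (k + i).+1 / (1 - lam) = lam ^+ (k + i).+1 + lam ^+ (k + i).+2 / (1 - lam).
    by rewrite [_ ^+ (k + i).+2]exprS; field; rewrite gt_eqF.
  by have := ler_normD (x (dy (k + i).+1 t) - x (dy (k + i) t)) (x (dy (k + i) t) - x (dy k t)); lra.
apply/ler_addgt0Pl => e e0; have [m0 hm] := dy_cvg t0 e0.
have hm' := hm _ (leq_addl k m0).
have hk := h m0.
have q0 : 0 <= lam ^+ (k + m0).+1 / (1 - lam) by rewrite divr_ge0 ?exprn_ge0// ltW.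
have -> : x t - x (dy k t) = (x t - x (dy (k + m0) t)) + (x (dy (k + m0) t) - x (dy k t)) by ring.
by have := ler_normD (x t - x (dy (k + m0) t)) (x (dy (k + m0) t) - x (dy k t)); lra.
Qed.

(** Chaining: for [2^-(k+1) < t - s <= 2^-k] the approximations of [s] and [t] at level [k] coincide
    or are neighbours, and the finer levels contribute two geometric tails. *)
Lemma dyadic_holder : exists2 C, 0 <= C & forall s t, 0 <= s <= 1 -> 0 <= t <= 1 ->
  `|x t - x s| <= C * `|t - s| `^ gamma.
Proof.
have l1 : 0 < 1 - lam by rewrite subr_gt0.
have [M M0 hM] : exists2 M, 0 <= M & forall t, 0 <= t <= 1 -> `|x t| <= M.
  have [||c _ hc] := @EVT_max R (fun t => `|x t|) 0 1; first exact: ler01.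
    by apply: continuous_subspaceT => t; apply: cvg_norm; exact: cx.
  by exists `|x c| => // t t01; apply: hc; rewrite in_itv.
(* One step of level [k] and two tails, divided by [lam] because [t - s] is compared with level
   [k + 1]. [C2] covers the levels coarser than [k0], where the bound [M] on the path is used. *)
pose C1 := (1 + 2 * (lam / (1 - lam))) / lam.
have C10 : 0 <= C1.
  by rewrite /C1 divr_ge0 ?(ltW lam0)// addr_ge0// mulr_ge0// divr_ge0// ltW.
pose C2 := 2 * M / lam ^+ k0.
have C20 : 0 <= C2 by rewrite divr_ge0 ?mulr_ge0 ?exprn_ge0// ltW.
have lamX k : lam ^+ k = (2 ^- k) `^ gamma.
  rewrite -(powR_invn k (ler0n R 2)) -powRrM -powR_mulrn ?(ltW lam0)// -powRrM.
  by congr (_ `^ _); ring.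
suff lt s t : 0 <= s -> s < t -> t <= 1 -> `|x t - x s| <= (C1 + C2) * `|t - s| `^ gamma.
  exists (C1 + C2); first exact: addr_ge0.
  move=> s t /andP[s0 s1] /andP[t0 t1]; have [st|ts|->] := ltgtP s t; first exact: lt.
    by rewrite distrC (distrC t); exact: lt.
  by rewrite subrr normr0 mulr_ge0 ?addr_ge0 ?powR_ge0.
move=> s0 st t1; have t0 : 0 <= t by rewrite (le_trans s0)// ltW.
have s1 : s <= 1 by rewrite (le_trans _ t1)// ltW.
have ts0 : 0 < t - s by rewrite subr_gt0.
rewrite (gtr0_norm ts0).
have ex : exists k, (fun k => 2 ^- k < t - s) k.
  exists (Num.bound (t - s)^-1); rewrite invf_plt ?posrE//.
  have h : (t - s)^-1 < (Num.bound (t - s)^-1)%:R by apply: archi_boundP; rewrite invr_ge0 ltW.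
  by apply: (lt_le_trans h); rewrite -natrX ler_nat ltnW// ltn_expl.
case: (ex_minnP ex) => -[|k] hk mk; first by move: hk; rewrite expr0 invr1; lra.
have hk' : t - s <= 2 ^- k.
  by rewrite leNgt; apply/negP => /mk; rewrite ltnn.
have lk : lam ^+ k.+1 <= (t - s) `^ gamma.
  by rewrite lamX ge0_ler_powR ?nnegrE ?(ltW gamma0) ?(ltW ts0) ?(ltW hk)// invr_ge0 exprn_ge0.
have [kk0|kk0] := leqP k0 k; last first.
  apply: (@le_trans _ _ (C2 * (t - s) `^ gamma)); last first.
    by rewrite ler_wpM2r ?powR_ge0// lerDr.
  apply: (@le_trans _ _ (2 * M)).
    rewrite (le_trans (ler_normB _ _))// [2 * M]mulr_natl mulr2n lerD// hM//.
      by rewrite t0.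
    by rewrite s0.
  rewrite /C2 -mulrA ler_peMr ?mulr_ge0// mulrC ler_pdivlMr ?exprn_gt0// mul1r.
  by apply: le_trans lk; apply: ler_wiXn2l; rewrite ?(ltW lam0) ?(ltW lam1).
apply: (@le_trans _ _ (C1 * (t - s) `^ gamma)); last first.
  by rewrite ler_wpM2r ?powR_ge0// lerDl.
apply: (@le_trans _ _ (C1 * lam ^+ k.+1)); last by rewrite ler_wpM2l.
have dt := dy_dist kk0 (_ : 0 <= t <= 1); rewrite t0 t1 in dt.
have ds := dy_dist kk0 (_ : 0 <= s <= 1); rewrite s0 s1 in ds.
have dd : `|x (dy k t) - x (dy k s)| <= lam ^+ k.
  have /andP[a1 a2] := flP k t0; have /andP[b1 b2] := flP k s0.
  have h : 2 ^+ k * (t - s) <= 1 by rewrite mulrC -ler_pdivlMr// mul1r.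
  have ab : 2 ^+ k * s < 2 ^+ k * t by rewrite ltr_pM2l.
  rewrite mulrBr in h.
  have [h1 h2] : (fl k s <= fl k t)%N /\ (fl k t <= (fl k s).+1)%N.
    split; rewrite -ltnS -(ltr_nat R); first lra.
    by rewrite -[(fl k s).+2]addn1 natrD; lra.
  have : (fl k t == fl k s)%N || (fl k t == (fl k s).+1)%N.
    by move: h1 h2; rewrite leq_eqVlt eq_sym; case: eqP => //= _ h1 h2; rewrite eqn_leq h1 h2.
  rewrite /dy => /orP[/eqP ->|/eqP E]; first by rewrite subrr normr0 exprn_ge0// ltW.
  by rewrite E; apply: hx => //; rewrite -E fl_le// t0.
have -> : C1 * lam ^+ k.+1 = lam ^+ k + 2 * (lam ^+ k.+1 / (1 - lam)).
  by rewrite /C1 exprS; field; rewrite !gt_eqF.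
have -> : x t - x s = (x t - x (dy k t)) + (x (dy k t) - x (dy k s)) - (x s - x (dy k s)) by ring.
have := ler_normB (x t - x (dy k t) + (x (dy k t) - x (dy k s))) (x s - x (dy k s)).
have := ler_normD (x t - x (dy k t)) (x (dy k t) - x (dy k s)).
by move: (dt isT) (ds isT); lra.
Qed.

End dyadic_chaining.

Section almost_surely.
Context {R : realType} d (T : measurableType d) (P : probability T R).

Lemma almost_surelyP (Q : T -> Prop) : {ae P, forall w, Q w} <->
  exists S : set T, [/\ measurable S, P S = 1%E & forall w, S w -> Q w].
Proof.
split => [[N [mN PN hN]]|[S [mS PS hS]]].
  exists (~` N); split; first exact: measurableC.
    by rewrite probability_setC// PN sube0.
  by move=> w Nw; apply: contrapT => nQ; apply: Nw; exact: hN.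
exists (~` S); split; first exact: measurableC.
  by rewrite probability_setC// PS subee.
by move=> w nQ Sw; apply: nQ; exact: hS.
Qed.

End almost_surely.

Section holder.
Context {R : realType} d (T : measurableType d) (P : probability T R).
Variables (H : R) (X : R -> T -> R).
Hypotheses (hH : 0 < H < 1) (hX : fbridge P H X).

Lemma fbridge_vanish (t : R) : 0 <= t <= 1 -> bridge_cov H t t = 0 -> {ae P, forall w, X t w = 0}.
Proof.
move=> t01 tt; have L01 : {in [:: t], forall u, 0 <= u <= 1} by move=> u; rewrite inE => /eqP ->.
have [mY [s sE E]] := fbridge_combo_law (fun=> 1) hH hX L01.
apply/almost_surelyP; exists ((fun w => \sum_(u <- [:: t]) 1 * X u w) @^-1` [set 0]); split.
- by rewrite -[X in measurable X]setTI; exact: mY.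
- rewrite E// /gauss_law; have -> : s == 0.
    by rewrite -sqrf_eq0 sE /bridge_form !big_seq1 tt !mul1r.
  by rewrite diracE mem_set.
by move=> w; rewrite /= big_seq1 mul1r.
Qed.

Lemma fbridge_incr_tail (s t a : R) : 0 <= s <= 1 -> 0 <= t <= 1 -> s != t -> 0 < a ->
  measurable [set w | a <= `|X t w - X s w|] /\
  (P [set w | (a <= `|X t w - X s w|)%R] <=
    (Num.sqrt 2 * expR (- (a ^+ 2 / (4 * `|t - s| `^ (2 * H)))))%:E)%E.
Proof.
move=> s01 t01 st a0.
have L01 : {in [:: t; s], forall u, 0 <= u <= 1} by move=> u; rewrite !inE => /orP[] /eqP ->.
have [mY [v vE E]] := fbridge_combo_law (fun u => if u == t then 1 else -1) hH hX L01.
have YE : (fun w => \sum_(u <- [:: t; s]) (if u == t then 1 else -1) * X u w) = (fun w => X t w - X s w).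
  by apply/funext => w; rewrite big_cons big_seq1 eqxx (negbTE st) mul1r mulN1r.
rewrite YE in mY E.
have vle : v ^+ 2 <= `|t - s| `^ (2 * H).
  apply: le_trans (bridge_incr_le hH s t); rewrite vE /bridge_form !big_cons !big_nil eqxx (negbTE st).
  by rewrite (bridge_covC H t s); lra.
have mA : measurable [set x : R | a <= `|x|].
  rewrite (_ : [set x : R | a <= `|x|] = (fun x : R => `|x|) @^-1` `[a, +oo[%classic).
    by rewrite -[X in measurable X]setTI; exact: (@normr_measurable R setT).
  by apply/seteqP; split => x /=; rewrite in_itv/= andbT.
split; first by have := mY measurableT _ mA; rewrite setTI.
have [v0|v0] := eqVneq v 0.
  have := E _ mA; rewrite /preimage /= => ->.
  rewrite /gauss_law v0 eqxx diracE memNset/=; last by rewrite normr0; apply/negP; rewrite -ltNge.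
  by rewrite lee_fin mulr_ge0 ?expR_ge0 ?sqrtr_ge0.
apply: (le_trans (gauss_law_tail E erefl a0 v0)).
rewrite lee_fin ler_wpM2l ?sqrtr_ge0// ler_expR lerN2 ler_wpM2l ?sqr_ge0//.
have v2 : 0 < v ^+ 2 by rewrite exprn_even_gt0.
have b0 := lt_le_trans v2 vle.
have p1 : 0 < 4 * v ^+ 2 by rewrite mulr_gt0.
have p2 : 0 < 4 * `|t - s| `^ (2 * H) by rewrite mulr_gt0.
by move: (lef_pV2 p2 p1) => ->; rewrite ler_wpM2l.
Qed.

(** An increment over [2^-k] has deviation at most [2^(-k H)] and exceeds [2^(-k gamma)] with
    probability of order [exp (- rho^k / 4)], where [rho = 2^(2 (H - gamma)) > 1]. This beats the
    [2^k] increments of level [k]. *)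
Lemma fbridge_holder (gamma : R) : 0 < gamma < H ->
  {ae P, forall w, exists2 C, 0 <= C & forall s t, 0 <= s <= 1 -> 0 <= t <= 1 ->
    `|X t w - X s w| <= C * `|t - s| `^ gamma}.
Proof.
move=> /andP[g0 gH].
pose lam : R := 2 `^ (- gamma); have lam0 : 0 < lam by exact: powR_gt0.
pose pt k (j : nat) : R := j%:R / 2 ^+ k.
have p2 k : 0 < 2 ^+ k :> R by exact: exprn_gt0.
have pt01 k j : (j <= 2 ^ k)%N -> 0 <= pt k j <= 1.
  by move=> jk; rewrite divr_ge0 ?(ltW (p2 _))//= ler_pdivrMr// mul1r -natrX ler_nat.
have ptS k j : pt k j.+1 - pt k j = 2 ^- k by rewrite /pt -mulrBl -natr1 addrAC subrr add0r mul1r.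
have ptne k j : pt k j != pt k j.+1.
  by rewrite -subr_eq0 -opprB oppr_eq0 ptS invr_eq0 gt_eqF.
pose I k := 'I_(2 ^ k).
pose E k (j : I k) : set T := [set w | lam ^+ k <= `|X (pt k j.+1) w - X (pt k j) w|].
have tail k (j : I k) : measurable (E k j) /\ (P (E k j) <=
    (Num.sqrt 2 * expR (- ((lam ^+ k) ^+ 2 / (4 * (2 ^- k) `^ (2 * H)))))%:E)%E.
  have := @fbridge_incr_tail (pt k j) (pt k j.+1) (lam ^+ k) _ _ (ptne k j) (exprn_gt0 _ lam0).
  rewrite ptS gtr0_norm ?invr_gt0//; apply; apply: pt01 => //; exact: ltnW.
(* The factor 2 makes [A <= 1] say that the event fails. *)
pose A k (j : I k) w : R := 2 * \1_(E k j) w.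
have I1 k j : rint P setT (\1_(E k j) : T -> R).
  have IC : rint P setT (fun=> 1) by exact: finite_measure_integrable_cst.
  apply: (le_rint measurableT _ _ IC); first by apply: measurable_indic; exact: (tail k j).1.
  by move=> w _; rewrite indicE; case: (_ \in _); rewrite ?normr1 ?normr0.
pose rho : R := 2 `^ (2 * (H - gamma)).
(* Then [rho ^+ m.+1 >= 4], and the bound of [exp (- x)] by [m.+1! / x^(m+1)] leaves a ratio [2 / 4]
   after counting [2^k] increments. *)
have [m hm] : exists m, 1 <= m.+1%:R * (H - gamma).
  have hg : 0 < H - gamma by rewrite subr_gt0.
  exists (Num.bound (H - gamma)^-1); rewrite -ler_pdivrMr// div1r ltW//.
  by rewrite (lt_trans (archi_boundP _)) ?invr_ge0 ?(ltW hg)// ltr_nat.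
have rhoE k : (lam ^+ k) ^+ 2 / (4 * (2 ^- k) `^ (2 * H)) = rho ^+ k / 4.
  have e1 : (2 ^- k) `^ (2 * H) = (2 `^ (- (2 * H))) ^+ k.
    rewrite -(powR_invn k (ler0n R 2)) -powRrM -powR_mulrn ?powR_ge0// -powRrM.
    by congr (_ `^ _); ring.
  have e2 : lam ^+ 2 = 2 `^ (- (2 * gamma)).
    by rewrite -powR_mulrn ?(ltW lam0)// -powRrM; congr (_ `^ _); ring.
  rewrite e1 exprAC e2 invfM mulrCA [RHS]mulrC; congr (_ * _).
  rewrite -exprVn -exprMn; congr (_ ^+ _).
  by rewrite -powRN opprK -powRD ?pnatr_eq0 ?implybT// /rho; congr (_ `^ _); ring.
have rho0 : 0 < rho by exact: powR_gt0.
have [||||||S [mS PS hS]] := @eventually_le1 R _ T P I A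
  (fun k => 2 * (Num.sqrt 2 * expR (- (rho ^+ k / 4))))
  (2 * Num.sqrt 2 * (m.+1`!%:R * 4 ^+ m.+1)) 2^-1.
- by move=> k j; apply: rintZ.
- by move=> k j w; rewrite /A mulr_ge0.
- move=> k j; rewrite /A (RintegralZl _ measurableT (I1 k j)) ler_wpM2l//.
  rewrite -lee_fin -(rintE measurableT (I1 k j)) integral_indic ?setIT//; last exact: (tail k j).1.
  by rewrite -rhoE; exact: (tail k j).2.
- by rewrite !mulr_ge0 ?sqrtr_ge0 ?exprn_ge0.
- by apply/andP; split; lra.
- move=> k; rewrite card_ord natrX.
  have r4 : 4 <= rho ^+ m.+1.
    rewrite -powR_mulrn ?(ltW rho0)// -powRrM.
    have -> : 4 = 2 `^ 2%:R :> R by rewrite powR_mulrn// expr2; ring.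
    by rewrite ler_powR ?ler1n// -mulrA mulrC; move: hm; lra.
  have x0 : 0 < rho ^+ k / 4 by rewrite divr_gt0 ?exprn_gt0.
  have e1 : expR (- (rho ^+ k / 4)) <= m.+1`!%:R / (rho ^+ k / 4) ^+ m.+1.
    rewrite expRN -[X in _ <= X]invrK lef_pV2 ?posrE ?expR_gt0 ?invr_gt0 ?divr_gt0 ?exprn_gt0 ?ltr0n ?fact_gt0//.
    rewrite invf_div; have := expR_ge1Dxn m (ltW x0); lra.
  apply: (@le_trans _ _ (2 ^+ k * (2 * (Num.sqrt 2 * (m.+1`!%:R / (rho ^+ k / 4) ^+ m.+1))))).
    by rewrite !ler_wpM2l ?sqrtr_ge0// ltW.
  have -> : 2 ^+ k * (2 * (Num.sqrt 2 * (m.+1`!%:R / (rho ^+ k / 4) ^+ m.+1))) =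
     2 * Num.sqrt 2 * (m.+1`!%:R * 4 ^+ m.+1) * (2 / rho ^+ m.+1) ^+ k.
    rewrite !exprMn !exprVn invfM invrK -!exprM [(k * _)%N]mulnC; move: (m.+1) => m1; ring.
  rewrite ler_wpM2l ?mulr_ge0 ?sqrtr_ge0 ?exprn_ge0// lerXn2r ?nnegrE ?divr_ge0 ?exprn_ge0 ?(ltW rho0)//.
  rewrite ler_pdivrMr ?exprn_gt0//; lra.
apply/almost_surelyP; exists S; split => // w /hS[k0 hk].
have cw : continuous ((X ^~ w) \o @clamp R : R -> R) by exact: (fbridge_path_continuous hX).
have [|C C0 hC] := @dyadic_holder R ((X ^~ w) \o @clamp R) gamma cw g0 k0.
  move=> k j kk jk; have := hk k kk (Ordinal jk); rewrite /A indicE /= !clamp_id ?pt01 ?(ltnW jk)//.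
  case: (boolP (w \in _)) => [_|]; first by rewrite mulr1 => h; exfalso; lra.
  by rewrite notin_setE /E /= => /negP; rewrite -ltNge => /ltW.
exists C => // s t s01 t01; have := hC s t s01 t01.
by rewrite /= !clamp_id.
Qed.

End holder.

(** * The Bessel kernel *)

Section gaussian_rV.
Context {R : realType}.
Notation mu := (@lebesgue_measure R).

Section consing.
Variable n : nat.
HB.instance Definition _ := @isMeasurableFun.Build _ _ _ _ (@rV_cons R n) (@measurable_rV_cons R n).
End consing.

(** Centred normal law with independent coordinates, built by the same recursion as [lebesgue_rV] so
    that Fubini peels off one coordinate at a time. *)
Fixpoint gauss_rV (s : R) n : probability 'rV[R]_n R :=
  if n is k.+1 then distribution (normal_prob 0 s \x gauss_rV s k)%E (@rV_cons R k)
  else \d_(0 : 'rV[R]_0).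

Lemma measurable_dot n d (T : measurableType d) (f g : T -> 'rV[R]_n) :
  measurable_fun setT f -> measurable_fun setT g -> measurable_fun setT (fun x => dot (f x) (g x)).
Proof.
move=> mf mg; apply: measurable_sum => i; apply: measurable_funM.
  exact: (measurableT_comp (measurable_coord i) mf).
exact: (measurableT_comp (measurable_coord i) mg).
Qed.

Lemma dot_rV_cons n (u : R) (v : 'rV[R]_n) (z : 'rV[R]_n.+1) :
  dot (rV_cons (u, v)) z = u * z 0 ord0 + dot v (rV_uncons z).2.
Proof.
rewrite /dot big_ord_recl /= mxE unlift_none; congr (_ + _).
by apply: eq_bigr => i _; rewrite !mxE liftK.
Qed.

Lemma dot_ge0 n (x : 'rV[R]_n) : 0 <= dot x x.
Proof. by apply: sumr_ge0 => i _; rewrite -expr2 sqr_ge0. Qed.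

Lemma Rintegral_gauss_rVS s n (f : 'rV[R]_n.+1 -> R) C : measurable_fun setT f ->
  (forall x, `|f x| <= C) ->
  \int[gauss_rV s n.+1]_v f v =
  \int[normal_prob 0 s]_u \int[gauss_rV s n]_v f (rV_cons (u, v)).
Proof.
move=> mf fC.
have mfc : measurable_fun setT (f \o @rV_cons R n).
  exact: (measurableT_comp mf (@measurable_rV_cons R n)).
pose pr : probability (measurableTypeR R * 'rV[R]_n)%type R := (normal_prob 0 s \x gauss_rV s n)%E.
have IC : rint pr setT (fun=> C) by exact: finite_measure_integrable_cst.
have If : rint (normal_prob 0 s \x gauss_rV s n)%E setT (f \o @rV_cons R n).
  by apply: (le_rint measurableT _ _ IC) => // x _; exact: fC.
rewrite /Rintegral; congr fine.
rewrite [LHS](integral_pushforward (@measurable_rV_cons R n))//; last exact/measurable_EFinP.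
rewrite -(integral12_prod_meas1 If) /fubini_F.
apply: eq_integral => u _.
rewrite fineK//.
apply: integrable_fin_num => //.
have IC' : rint (gauss_rV s n) setT (fun=> C) by exact: finite_measure_integrable_cst.
apply: (le_rint measurableT _ _ IC'); last by move=> v _; exact: fC.
by apply: (measurableT_comp mfc); exact: measurable_pair1.
Qed.

(** The Gaussian damping turns the normal density into a multiple of another one, of variance
    [s^2 / (1 + 2 t s^2)], to which [normal_char] applies. *)
Lemma normal_cos_damped (s t z th : R) : s != 0 -> 0 <= t ->
  \int[normal_prob 0 s]_u (cos (u * z + th) * expR (- (t * u ^+ 2))) =
  cos th * ((Num.sqrt (1 + 2 * t * s ^+ 2))^-1 *
            expR (- (s ^+ 2 / (1 + 2 * t * s ^+ 2) * z ^+ 2 / 2))).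
Proof.
move=> s0 t0; pose D := 1 + 2 * t * s ^+ 2.
have D0 : 0 < D by rewrite ltr_pwDl// mulr_ge0 ?sqr_ge0// mulr_ge0.
have q0 : 0 < Num.sqrt D by rewrite sqrtr_gt0.
pose s' := s / Num.sqrt D; have s'0 : s' != 0 by rewrite mulf_neq0// invr_eq0 gt_eqF.
have s'2 : s' ^+ 2 = s ^+ 2 / D by rewrite expr_div_n sqr_sqrtr// ltW.
have s20 : s ^+ 2 != 0 by rewrite expf_neq0.
have E u : expR (- (t * u ^+ 2)) * normal_pdf 0 s u = (Num.sqrt D)^-1 * normal_pdf 0 s' u.
  rewrite !normal_pdfE// /normal_fun /normal_peak s'2 mulrCA [RHS]mulrA -expRD; congr (_ * expR _); last first.
    by rewrite !subr0 /D; field; rewrite s0/= -/D gt_eqF.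
  rewrite -invfM -sqrtrM ?(ltW D0)//; congr (Num.sqrt _)^-1.
  have -> : D * (s ^+ 2 / D * pi *+ 2) = D / D * (s ^+ 2 * pi *+ 2) by ring.
  by rewrite mulfV ?mul1r// gt_eqF.
have mc : measurable_fun setT (fun u : R => cos (u * z + th) * expR (- (t * u ^+ 2))).
  apply: measurable_funM.
    have := measurable_cos_affine z th; apply: eq_measurable_fun => u _.
    by rewrite mulrC.
  apply: measurableT_comp => //; apply: measurableT_comp => //; apply: measurable_funM => //.
have Ic : rint mu setT (fun u => cos (z * u + th) * normal_pdf 0 s' u) by exact: rint_cos_normal.
have E' u : cos (u * z + th) * expR (- (t * u ^+ 2)) * normal_pdf 0 s u =
    (Num.sqrt D)^-1 * (cos (z * u + th) * normal_pdf 0 s' u).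
  by rewrite -mulrA E mulrCA [u * z]mulrC.
have law A : measurable A -> normal_prob 0 s (id @^-1` A) = gauss_law 0 s A.
  by move=> mA; rewrite /gauss_law (negbTE s0).
have I0 : rint mu setT (fun u : R => cos (u * z + th) * expR (- (t * u ^+ 2)) * normal_pdf 0 s u).
  apply: (eq_rint measurableT _ (rintZ measurableT (Num.sqrt D)^-1 Ic)) => u _.
  by rewrite E'.
have [_] := gauss_law_Rintegral (P := normal_prob 0 s) (Y := id) (@measurable_id _ _ setT) law mc (fun=> I0).
rewrite (negbTE s0) => ->; under eq_Rintegral do rewrite E'.
rewrite (RintegralZl _ measurableT Ic) normal_char// s'2 mulrCA; congr (_ * (_ * expR _)).
by rewrite mulNr -/D.
Qed.

Lemma measurable_cos_damped n (t : R) (z : 'rV[R]_n) (th : R) :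
  measurable_fun setT (fun v : 'rV[R]_n => cos (dot v z + th) * expR (- (t * dot v v))).
Proof.
have mcos : measurable_fun setT (@cos R).
  by apply: continuous_measurable_fun; exact: continuous_cos.
apply: measurable_funM.
  apply: (measurableT_comp mcos); apply: measurable_funD => //; exact: measurable_dot.
apply: measurableT_comp => //; apply: measurableT_comp => //; apply: measurable_funM => //.
exact: measurable_dot.
Qed.

Lemma cos_damped_le1 n (t : R) (z : 'rV[R]_n) (th : R) v : 0 <= t ->
  `|cos (dot v z + th) * expR (- (t * dot v v))| <= 1.
Proof.
move=> t0; rewrite normrM mulr_ile1// ?cos_max// ger0_norm ?expR_ge0//.
by rewrite -[X in _ <= X]expR0 ler_expR oppr_le0 mulr_ge0 ?dot_ge0.
Qed.

Lemma gauss_rV_cos (s : R) n (t : R) (z : 'rV[R]_n) (th : R) : s != 0 -> 0 <= t ->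
  \int[gauss_rV s n]_v (cos (dot v z + th) * expR (- (t * dot v v))) =
  cos th * ((Num.sqrt (1 + 2 * t * s ^+ 2))^-1 ^+ n *
            expR (- (s ^+ 2 / (1 + 2 * t * s ^+ 2) * dot z z / 2))).
Proof.
move=> s0 t0; elim: n z th => [|n IH] z th.
  rewrite /Rintegral integral_dirac//; last by apply/measurable_EFinP; exact: measurable_cos_damped.
  rewrite diracE mem_set// mul1e/= /dot !big_ord0 !mulr0 mul0r oppr0 expR0 add0r expr0.
  by rewrite !mulr1.
rewrite (@Rintegral_gauss_rVS s n _ 1); last 2 first.
- exact: measurable_cos_damped.
- by move=> v; exact: cos_damped_le1.
set K := (Num.sqrt _)^-1; set b := s ^+ 2 / _.
have E (u : R) : \int[gauss_rV s n]_v (cos (dot (rV_cons (u, v)) z + th) *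
        expR (- (t * dot (rV_cons (u, v)) (rV_cons (u, v))))) =
        K ^+ n * expR (- (b * dot (rV_uncons z).2 (rV_uncons z).2 / 2)) *
        (cos (u * z 0 ord0 + th) * expR (- (t * u ^+ 2))).
  have IC : rint (gauss_rV s n) setT (fun=> 1) by exact: finite_measure_integrable_cst.
  have I1 : rint (gauss_rV s n) setT (fun v =>
      cos (dot v (rV_uncons z).2 + (u * z 0 ord0 + th)) * expR (- (t * dot v v))).
    apply: (le_rint measurableT _ _ IC); first exact: measurable_cos_damped.
    by move=> v _; exact: cos_damped_le1.
  transitivity (\int[gauss_rV s n]_v (expR (- (t * u ^+ 2)) *
      (cos (dot v (rV_uncons z).2 + (u * z 0 ord0 + th)) * expR (- (t * dot v v))))).
    apply: eq_Rintegral => v _; rewrite !dot_rV_cons rV_consK/= mxE unlift_none -expr2 mulrDr opprD expRD.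
    by rewrite mulrCA; congr (_ * (cos _ * _)); ring.
  rewrite (RintegralZl _ measurableT I1) IH; ring.
under eq_Rintegral do rewrite E.
have I2 : rint (normal_prob 0 s) setT (fun u : R => cos (u * z 0 ord0 + th) * expR (- (t * u ^+ 2))).
  have IC : rint (normal_prob 0 s) setT (fun=> 1) by exact: finite_measure_integrable_cst.
  apply: (le_rint measurableT _ _ IC).
    apply: measurable_funM.
      have := measurable_cos_affine (z 0 ord0) th; apply: eq_measurable_fun => u _.
      by rewrite mulrC.
    apply: measurableT_comp => //; apply: measurableT_comp => //; apply: measurable_funM => //.
  move=> u _; rewrite normrM mulr_ile1// ?cos_max// ger0_norm ?expR_ge0//.
  by rewrite -[X in _ <= X]expR0 ler_expR oppr_le0 mulr_ge0 ?sqr_ge0.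
rewrite (RintegralZl _ measurableT I2) normal_cos_damped// -/K -/b.
have -> : dot z z = z 0 ord0 ^+ 2 + dot (rV_uncons z).2 (rV_uncons z).2.
  rewrite /dot big_ord_recl expr2; congr (_ + _); by apply: eq_bigr => i _; rewrite !mxE.
clear E I2; move: K b => K b.
rewrite (mulrDr b) (mulrDl _ _ 2^-1) opprD expRD (exprS K); ring.
Qed.

End gaussian_rV.

Section lebesgue_cube.
Context {R : realType}.

Definition cube n (x : 'rV[R]_n) (r : R) : set 'rV[R]_n := [set y | forall i, `|y 0 i - x 0 i| <= r].

Lemma measurable_cube n (x : 'rV[R]_n) r : measurable (cube x r).
Proof.
rewrite (_ : cube x r = \bigcap_(i in [set: 'I_n]) [set y : 'rV[R]_n | `|y 0 i - x 0 i| <= r]); last first.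
  by apply/seteqP; split => [y h i _|y h i]; [exact: h|exact: (h i I)].
apply: fin_bigcap_measurable => // i _.
rewrite (_ : [set y | _] = (fun y : 'rV[R]_n => `|y 0 i - x 0 i|) @^-1` `]-oo, r]%classic).
  rewrite -[X in measurable X]setTI.
  have : measurable_fun setT (fun y : 'rV[R]_n => `|y 0 i - x 0 i|).
    by apply: measurableT_comp => //; apply: measurable_funB => //; exact: measurable_coord.
  by apply.
by apply/seteqP; split => s /=; rewrite in_itv.
Qed.

Lemma lebesgue_rV_cube n (x : 'rV[R]_n) (r : R) : 0 < r ->
  lebesgue_rV n (cube x r) = ((2 * r) ^+ n)%:E.
Proof.
move=> r0; elim: n x => [|n IH] x.
  by rewrite /= diracE mem_set ?expr0// => -[].
rewrite /= /lebesgue_step /pushforward.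
pose J : set (measurableTypeR R) := `[x 0 ord0 - r, x 0 ord0 + r]%classic.
rewrite (_ : _ @^-1` _ = J `*` cube (rV_uncons x).2 r); last first.
  apply/seteqP; split => [[u v] /= h|[u v] /= [h1 h2] i].
    split=> [|i].
      have := h ord0; rewrite mxE unlift_none /J /= in_itv/= ler_distl.
      by [].
    by have := h (lift ord0 i); rewrite !mxE liftK.
  rewrite mxE; case: unliftP => [j ->|->]; first by have := h2 j; rewrite mxE.
  by move: h1; rewrite /J /= in_itv/= ler_distl.
rewrite product_measure1E; last 2 first.
- exact: measurable_itv.
- exact: measurable_cube.
transitivity (lebesgue_measure J * lebesgue_rV n (cube (rV_uncons x).2 r))%E; first by [].
rewrite IH /J lebesgue_measure_itv/= lte_fin ifT; last by rewrite ltrBlDr; lra.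
rewrite -EFinB -EFinM exprS; congr (_ * _)%:E; ring.
Qed.

End lebesgue_cube.

Section two_regimes.
Context {R : realType}.
Notation mu := (@lebesgue_measure R).

Lemma integral_two_regimes (p q M : R) : -1 < p -> p - q < -1 -> 0 <= M ->
  (\int[mu]_(t in `]0%R, +oo[) (t `^ p * (if t <= 1 then M else t `^ (- q)))%:E <=
    (M / (p + 1) + (q - p - 1)^-1)%:E)%E.
Proof.
move=> p1 pq M0.
have mI1 : measurable (`]0, 1]%classic : set (measurableTypeR R)) by exact: measurable_itv.
have mI2 : measurable (`[1, +oo[%classic : set (measurableTypeR R)) by exact: measurable_itv.
have le1 : (\int[mu]_(x in `]0%R, 1%R]) (M%:E * (x `^ p)%:E) <= (M / (p + 1))%:E)%E.
  rewrite ge0_integralZl//; last 2 first.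
  - apply/measurable_EFinP; apply: measurable_funTS; exact: measurable_powR_cst.
  - by move=> x _; rewrite lee_fin powR_ge0.
  rewrite EFinM lee_wpmul2l ?lee_fin//; exact: integral_powR_01.
have le2 := integral_powR_1y pq.
apply: (@le_trans _ _ ((M / (p + 1))%:E + (- (p - q + 1)^-1)%:E)%E); last first.
  rewrite (_ : - (p - q + 1)^-1 = (q - p - 1)^-1) ?EFinD//.
  by rewrite -invrN; congr _^-1; ring.
apply: le_trans (leeD le1 le2).
rewrite integral_mkcond [X in (_ <= X + _)%E]integral_mkcond [X in (_ <= _ + X)%E]integral_mkcond.
rewrite -ge0_integralD//; last 4 first.
- by move=> x _; apply: erestrict_ge0 => y _; rewrite -EFinM lee_fin mulr_ge0 ?powR_ge0.
- apply/(measurable_restrictT _ mI1); apply: measurable_funeM.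
  apply/measurable_EFinP; apply: measurable_funTS; exact: measurable_powR_cst.
- by move=> x _; apply: erestrict_ge0 => y _; rewrite lee_fin powR_ge0.
- apply/(measurable_restrictT _ mI2).
  apply/measurable_EFinP; apply: measurable_funTS; exact: measurable_powR_cst.
apply: ge0_le_integral_nomeas => t _.
  apply: erestrict_ge0 => y _; rewrite lee_fin mulr_ge0 ?powR_ge0//.
  by case: ifP => _ //; rewrite powR_ge0.
rewrite !patchE; case: ifPn => [/set_mem/=|_]; last first.
  by apply: adde_ge0; case: ifPn => // _; rewrite -?EFinM lee_fin ?mulr_ge0 ?powR_ge0.
rewrite in_itv/= andbT => t0; rewrite -[point]/(0%E : \bar R); have [t1|t1] := leP t 1.
  rewrite mem_set/=; last by rewrite in_itv/= t0.
  rewrite -EFinM [M * _]mulrC leeDl//; case: ifPn => // _; by rewrite lee_fin powR_ge0.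
rewrite memNset/=; last by rewrite in_itv/= t0/= leNgt t1.
rewrite mem_set/=; last by rewrite in_itv/= ltW.
by rewrite add0e lee_fin -powRD// (gt_eqF t0) implybT.
Qed.

End two_regimes.

Section gamma_integral.
Context {R : realType}.
Notation mu := (@lebesgue_measure R).
Variable p : R.
Hypothesis p1 : -1 < p.

Definition gamma_weight (t : R) : R := if 0 < t then t `^ p * expR (- t) else 0.

(** The value of the Gamma function at [p + 1]. *)
Definition gamma_const : R := \int[mu]_t gamma_weight t.

Lemma gamma_weight_ge0 t : 0 <= gamma_weight t.
Proof. by rewrite /gamma_weight; case: ifP => // _; rewrite mulr_ge0 ?powR_ge0 ?expR_ge0. Qed.

Lemma integral_gamma_weight (h : R -> R) : (\int[mu]_t (h t * gamma_weight t)%:E =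
  \int[mu]_(t in `]0%R, +oo[) (h t * (t `^ p * expR (- t)))%:E)%E.
Proof.
rewrite [RHS]integral_mkcond; apply: eq_integral => t _.
rewrite patchE -[point]/(0%E : \bar R) /gamma_weight; case: ifPn => t0.
  by rewrite mem_set//= in_itv/= t0.
by rewrite memNset ?mulr0//= in_itv/= andbT; apply/negP.
Qed.

Lemma integral_gamma_weight1 : (\int[mu]_t (gamma_weight t)%:E =
  \int[mu]_(t in `]0%R, +oo[) (t `^ p * expR (- t))%:E)%E.
Proof.
transitivity (\int[mu]_t (1 * gamma_weight t)%:E)%E; first by apply: eq_integral => t _; rewrite mul1r.
by rewrite (integral_gamma_weight (fun=> 1)); apply: eq_integral => t _; rewrite mul1r.
Qed.

Lemma measurable_gamma_weight : measurable_fun setT gamma_weight.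
Proof.
apply: measurable_fun_ifT => //.
  by apply: measurable_fun_ltr.
apply: measurable_funM; first exact: measurable_powR_cst.
by apply: measurableT_comp.
Qed.

Lemma rint_gamma_weight : rint mu setT gamma_weight.
Proof.
apply: rint_ge0 => //; first by apply: measurable_funTS; exact: measurable_gamma_weight.
  by move=> t _; exact: gamma_weight_ge0.
rewrite integral_gamma_weight1.
pose m := Num.bound p; pose M : R := m.+1`!%:R.
have pm : p < m%:R.
  have [p0|p0] := leP 0 p; first exact: archi_boundP.
  by rewrite (lt_le_trans p0).
have M1 : 1 <= M by rewrite /M ler1n fact_gt0.
have q1 : p - m.+1%:R < -1 by rewrite -natr1; lra.
have := @integral_two_regimes R p m.+1%:R M p1 q1 (le_trans ler01 M1).
have me : measurable_fun setT (fun t : R => (t `^ p * (if t <= 1 then M else t `^ (- m.+1%:R)))%:E).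
  apply/measurable_EFinP; apply: measurable_funM; first exact: measurable_powR_cst.
  have mp := measurable_powR_cst (- m.+1%:R : R).
  by apply: measurable_fun_ifT => //; exact: measurable_fun_ler.
move=> le1; apply: (@le_lt_trans _ _ (M%:E * ((M / (p + 1) + (m.+1%:R - p - 1)^-1)%:E))%E); last first.
  by rewrite -EFinM ltry.
apply: (@le_trans _ _ (M%:E * \int[mu]_(t in `]0%R, +oo[) (t `^ p * (if t <= 1 then M else t `^ (- m.+1%:R)))%:E)%E); last first.
  by rewrite lee_wpmul2l// lee_fin (le_trans ler01).
rewrite -ge0_integralZl//; last 3 first.
- exact: measurable_funTS.
- move=> t _; rewrite lee_fin mulr_ge0 ?powR_ge0//; case: ifP => _; rewrite ?powR_ge0// (le_trans ler01)//.
- by rewrite lee_fin (le_trans ler01).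
apply: ge0_le_integral_nomeas => t; rewrite /= in_itv/= andbT => t0.
  by rewrite lee_fin mulr_ge0 ?powR_ge0 ?expR_ge0.
rewrite -EFinM lee_fin mulrCA ler_wpM2l ?powR_ge0//; case: ifP => _.
  apply: (@le_trans _ _ 1); first by rewrite -[X in _ <= X]expR0 ler_expR oppr_le0 ltW.
  by rewrite -[X in X <= _]mul1r ler_pM.
rewrite powR_invn ?(ltW t0)// expRN -[X in _ <= X]invrK invfM invrK lef_pV2 ?posrE ?expR_gt0//; last first.
  by rewrite mulr_gt0 ?invr_gt0 ?exprn_gt0// (lt_le_trans ltr01).
have := expR_ge1Dxn m (ltW t0); rewrite mulrC -/M; lra.
Qed.

Lemma gamma_const_gt0 : 0 < gamma_const.
Proof.
have mJ : measurable (`[2^-1, 1]%classic : set (measurableTypeR R)) by exact: measurable_itv.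
pose c : R := expR (-1) * Num.min 1 (2^-1 `^ p).
have c0 : 0 < c by rewrite mulr_gt0 ?expR_gt0// lt_min ltr01 powR_gt0.
rewrite -lte_fin -(rintE measurableT rint_gamma_weight).
apply: (@lt_le_trans _ _ (\int[mu]_(t in `[2^-1%R, 1%R]) c%:E)%E).
  rewrite integral_cst//= lebesgue_measure_itv/= lte_fin ifT; last lra.
  by rewrite -EFinD -EFinM lte_fin mulr_gt0//; lra.
rewrite [leLHS]integral_mkcond; apply: ge0_le_integral_nomeas => t _.
  by apply: erestrict_ge0 => y _; rewrite lee_fin ltW.
rewrite patchE -[point]/(0%E : \bar R); case: ifPn => [/set_mem/=|_]; last by rewrite lee_fin gamma_weight_ge0.
rewrite in_itv/= => /andP[t1 t2]; have t0 : 0 < t by lra.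
rewrite lee_fin /gamma_weight t0 mulrC; apply: ler_pM; rewrite ?expR_ge0 ?le_min ?ler01 ?powR_ge0//.
  by rewrite ler_expR lerN2.
rewrite ge_min; have [p0|p0] := leP 0 p.
  by rewrite [X in _ || X]ge0_ler_powR ?orbT// nnegrE ltW.
apply/orP; left; rewrite -[X in X <= _](powRr0 t) ger_powR ?t0//; exact: ltW.
Qed.

Lemma rint_gamma_subordination (l : R) : 0 <= l ->
  rint mu setT (fun t => expR (- (Num.max 0 t * l)) * gamma_weight t).
Proof.
move=> l0; apply: (le_rint measurableT _ _ rint_gamma_weight).
  apply: measurable_funM; last exact: measurable_gamma_weight.
  apply: measurableT_comp => //; apply: measurableT_comp => //; apply: measurable_funM => //.
  exact: measurable_maxr.
move=> t _; rewrite normrM [X in _ * X]ger0_norm ?gamma_weight_ge0//.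
rewrite ler_piMl ?gamma_weight_ge0// ger0_norm ?expR_ge0// -[X in _ <= X]expR0 ler_expR oppr_le0.
by rewrite mulr_ge0// le_max lexx.
Qed.

(** Time is rescaled by [1 + l]. With [l = |v|^2] the multiplier of the Bessel kernel becomes a
    mixture of Gaussian functions of [v]. [Num.max 0 t] keeps the integrand bounded by the weight on
    the whole line. *)
Lemma gamma_subordination (l : R) : 0 <= l ->
  \int[mu]_t (expR (- (Num.max 0 t * l)) * gamma_weight t) =
  gamma_const * (1 + l) `^ (- (p + 1)).
Proof.
move=> l0; have l1 : 0 < 1 + l by rewrite ltr_pwDl.
have I := rint_gamma_subordination l0.
apply/EFin_inj; rewrite -(rintE measurableT I) EFinM -(rintE measurableT rint_gamma_weight).
rewrite integral_gamma_weight integral_gamma_weight1.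
pose f (t : R) := (t `^ p * expR (- t))%:E.
have mf : measurable_fun setT f.
  apply/measurable_EFinP; apply: measurable_funM; first exact: measurable_powR_cst.
  by apply: measurableT_comp.
have f0 t : (0 <= f t)%E by rewrite lee_fin mulr_ge0 ?powR_ge0 ?expR_ge0.
have E := ge0_integral_scale l1 mf f0.
transitivity (\int[mu]_(t in `]0%R, +oo[) (((1 + l) `^ (- p))%:E * f ((1 + l) * t)%R))%E.
  apply: eq_integral => t /set_mem/=; rewrite in_itv/= andbT => t0.
  rewrite /f -EFinM (max_idPr (ltW t0)) powRM ?(ltW l1) ?(ltW t0)// powRN; congr EFin.
  rewrite mulrCA -expRD mulrA mulrA mulVf ?gt_eqF ?powR_gt0// mul1r.
  by congr (_ * expR _); ring.
rewrite ge0_integralZl//; last 2 first.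
- apply: measurable_funTS; apply: (measurableT_comp mf); exact: measurable_mulr.
- by rewrite lee_fin powR_ge0.
rewrite E muleA -EFinM muleC; congr (_ * _%:E)%E.
by rewrite opprD powRD ?(gt_eqF l1) ?implybT// powR_inv1// ltW.
Qed.

End gamma_integral.

(** * Gaussian averages of the Bessel kernel and its pointwise bound *)

Section bessel_bound.
Context {R : realType} {n : nat}.
Notation mu := (@lebesgue_measure R).
Notation leb := (lebesgue_rV n : {sigma_finite_measure set 'rV[R]_n -> \bar R}).
Variables (alpha : R) (g : 'rV[R]_n -> \bar R).
Hypotheses (hg : bessel_kernel alpha g) (ha : 0 < alpha < n%:R).

(** Real version of [g] for Lebesgue integrals, where only almost every value counts; the bound to
    be proved concerns [g] itself. *)
Let w (y : 'rV[R]_n) : R := fine (g y).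

Let Ig : leb.-integrable setT g. Proof. by have [_ _] := hg. Qed.

Let mg : measurable_fun setT g. Proof. exact: measurable_int Ig. Qed.

Let mw : measurable_fun setT w.
Proof. by apply: measurableT_comp => //; exact: fine_measurable. Qed.

Let Iw : rint leb setT w.
Proof.
apply: (le_integrable measurableT _ _ Ig); first exact/measurable_EFinP.
by move=> y _ /=; rewrite /w; case: (g y) => [r| |] //=; rewrite ?normr0 ?leey.
Qed.

Let w_integral (h : 'rV[R]_n -> R) : measurable_fun setT h ->
  (\int[leb]_y (g y * (h y)%:E) = \int[leb]_y (h y * w y)%:E)%E.
Proof.
move=> mh; apply: ae_eq_integral => //.
- by apply: emeasurable_funM => //; exact/measurable_EFinP.
- by apply/measurable_EFinP; exact: measurable_funM.
have := integrable_ae measurableT Ig; apply: filterS => y fy _.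
by rewrite mulrC EFinM /w fineK//; exact: fy.
Qed.

Let lam (v : 'rV[R]_n) : R := (1 + dot v v) `^ (- (alpha / 2)).

Let enorm_sqr (v : 'rV[R]_n) : enorm v ^+ 2 = dot v v.
Proof. by rewrite /enorm sqr_sqrtr ?dot_ge0. Qed.

Let mcos : measurable_fun setT (@cos R).
Proof. by apply: continuous_measurable_fun; exact: continuous_cos. Qed.

Let msin : measurable_fun setT (@sin R).
Proof. by apply: continuous_measurable_fun; exact: continuous_sin. Qed.

Let mdot v : measurable_fun setT (fun y : 'rV[R]_n => dot y v).
Proof. exact: measurable_dot. Qed.

Let w_cos v : \int[leb]_y (cos (dot y v) * w y) = lam v.
Proof.
have [_ _ _ /(_ v)] := hg; rewrite /fourier enorm_sqr => -[+ _].
rewrite (@w_integral (fun y => cos (dot y v))); first by [].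
exact: (measurableT_comp mcos (mdot v)).
Qed.

Let w_sin v : \int[leb]_y (sin (dot y v) * w y) = 0.
Proof.
have [_ _ _ /(_ v)] := hg; rewrite /fourier enorm_sqr => -[_ +].
rewrite (@w_integral (fun y => sin (dot y v))); first by [].
exact: (measurableT_comp msin (mdot v)).
Qed.

Let dotBr (v x y : 'rV[R]_n) : dot v (x - y) = dot v x - dot y v.
Proof.
by rewrite /dot -sumrB; apply: eq_bigr => i _; rewrite !mxE; ring.
Qed.

Let w_wave v x : \int[leb]_y (cos (dot v (x - y)) * w y) = cos (dot v x) * lam v.
Proof.
have b1 (f : R -> R) : measurable_fun setT f -> (forall x, `|f x| <= 1) ->
    rint leb setT (fun y => f (dot y v) * w y).
  move=> mf f1; have Inw := integrable_norm Iw.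
  apply: (le_rint measurableT _ _ Inw).
    apply: measurable_funM => //; exact: (measurableT_comp mf (mdot v)).
  by move=> y _; rewrite normrM ler_piMl.
have I1 := b1 _ mcos (@cos_max R); have I2 := b1 _ msin (@sin_max R).
transitivity (\int[leb]_y (cos (dot v x) * (cos (dot y v) * w y) + sin (dot v x) * (sin (dot y v) * w y))).
  by apply: eq_Rintegral => y _; rewrite dotBr cosB; ring.
rewrite (RintegralD measurableT (rintZ measurableT _ I1) (rintZ measurableT _ I2)).
rewrite (RintegralZl _ measurableT I1) (RintegralZl _ measurableT I2) w_cos w_sin.
by rewrite mulr0 addr0.
Qed.

(** Average of the kernel against a Gaussian function centred at [x]. Its width is [r] for
    [a = r^-2], the choice made below. *)
Let W (a : R) x := \int[leb]_y (w y * expR (- (a * dot (x - y) (x - y)))).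

(** The Gaussian function is a mean of waves over normal frequencies of variance [2 a]; exchanging
    the integrals brings in the known transform of [g]. *)
Let W_fourier a x : 0 < a ->
  W a x = \int[gauss_rV (Num.sqrt (2 * a)) n]_v (cos (dot v x) * lam v).
Proof.
move=> a0; have s0 : Num.sqrt (2 * a) != 0 by rewrite gt_eqF// sqrtr_gt0 mulr_gt0.
have s2 : Num.sqrt (2 * a) ^+ 2 = 2 * a by rewrite sqr_sqrtr// mulr_ge0// ltW.
set G := gauss_rV _ n.
pose K (z : 'rV[R]_n * 'rV[R]_n) := cos (dot z.1 (x - z.2)).
have mK : measurable_fun setT K.
  apply: (measurableT_comp mcos); apply: measurable_dot => //.
  apply: measurable_fun_rV => // i; under eq_fun do rewrite !mxE.
  apply: measurable_funB => //.
  exact: (measurableT_comp (measurable_coord i) measurable_snd).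
have := Rintegral_fubini G mK (fun z => cos_max _) Iw; rewrite /K /=.
under eq_Rintegral do rewrite w_wave.
move=> ->; apply: eq_Rintegral => y _; congr (_ * _).
have := @gauss_rV_cos R _ n 0 (x - y) 0 s0 (lexx 0).
rewrite cos0 mul1r s2 mulr0 mul0r [1 + 0]addr0 sqrtr1 invr1 expr1n mul1r mulr1.
have -> : 2 * a * dot (x - y) (x - y) / 2 = a * dot (x - y) (x - y) by field.
move=> <-; apply: eq_Rintegral => v _.
by rewrite addr0 mul0r oppr0 expR0 mulr1.
Qed.

Let p := alpha / 2 - 1.

Let p1 : -1 < p. Proof. by have /andP[a0 _] := ha; rewrite /p; lra. Qed.

(** Subordination makes the integrand Gaussian in the frequency, so a second exchange leaves a time
    integral of explicit heat kernels. *)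
Let W_gamma a x : 0 < a -> gamma_const p * W a x =
  \int[mu]_t (gamma_weight p t * ((Num.sqrt (1 + 4 * a * Num.max 0 t))^-1 ^+ n *
    expR (- (a / (1 + 4 * a * Num.max 0 t) * dot x x)))).
Proof.
move=> a0; have s0 : Num.sqrt (2 * a) != 0 by rewrite gt_eqF// sqrtr_gt0 mulr_gt0.
have s2 : Num.sqrt (2 * a) ^+ 2 = 2 * a by rewrite sqr_sqrtr// mulr_ge0// ltW.
rewrite W_fourier//; set G := gauss_rV _ n.
pose K (z : 'rV[R]_n * measurableTypeR R) :=
  cos (dot z.1 x + 0) * expR (- (Num.max 0 z.2 * dot z.1 z.1)).
have mK : measurable_fun setT K.
  apply: measurable_funM.
    apply: (measurableT_comp mcos); apply: measurable_funD => //; exact: measurable_dot.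
  apply: measurableT_comp => //; apply: measurableT_comp => //; apply: measurable_funM.
    exact: measurable_maxr.
  exact: measurable_dot.
have bK z : `|K z| <= 1 by apply: cos_damped_le1; rewrite le_max lexx.
have := Rintegral_fubini G mK bK (rint_gamma_weight p1); rewrite /K /=.
have lam1 v : `|lam v| <= 1.
  rewrite ger0_norm ?powR_ge0// -[X in _ <= X](powRr0 (1 + dot v v)) ler_powR ?lerDl ?dot_ge0//.
  by have /andP[a1 _] := ha; rewrite oppr_le0; lra.
have Il : rint G setT (fun v => cos (dot v x) * lam v).
  have IC : rint G setT (fun=> 1) by exact: finite_measure_integrable_cst.
  apply: (le_rint measurableT _ _ IC); last by move=> v _; rewrite normrM mulr_ile1// cos_max.
  apply: measurable_funM; first exact: (measurableT_comp mcos (mdot x)).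
  apply: (measurableT_comp (measurable_powR_cst _)); apply: measurable_funD => //.
  exact: measurable_dot.
move=> E; transitivity (\int[G]_x0 \int[mu]_y
     (cos (dot x0 x + 0) * expR (- (Num.max 0 y * dot x0 x0)) * gamma_weight p y)).
  rewrite -(RintegralZl _ measurableT Il); apply: eq_Rintegral => v _.
  have Is := rint_gamma_subordination p1 (dot_ge0 v).
  rewrite addr0; transitivity (\int[mu]_y (cos (dot v x) *
      (expR (- (Num.max 0 y * dot v v)) * gamma_weight p y))); last first.
    by apply: eq_Rintegral => y _; rewrite mulrA.
  rewrite (RintegralZl _ measurableT Is) gamma_subordination ?dot_ge0// mulrCA /lam; congr (_ * (_ * _ `^ _)).
  by rewrite /p; lra.
rewrite E; apply: eq_Rintegral => t _; congr (_ * _).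
rewrite gauss_rV_cos//; last by rewrite le_max lexx.
rewrite cos0 mul1r s2; congr (_ ^+ _ * expR _).
  by congr (Num.sqrt _)^-1; ring.
have -> : 2 * Num.max 0 t * (2 * a) = 4 * a * Num.max 0 t by ring.
congr (- _); field.
by rewrite gt_eqF// ltr_pwDl// mulr_ge0 ?le_max ?lexx// mulr_ge0// ltW.
Qed.

Let q : R := n%:R / 2.
Let M : R := n`!%:R * expR 1.
Let J0 : R := M / (p + 1) + (q - p - 1)^-1.

Let M0 : 0 <= M. Proof. by rewrite /M mulr_ge0 ?expR_ge0. Qed.

Let pq : p - q < -1. Proof. by have /andP[_ a1] := ha; rewrite /p /q; lra. Qed.

Let J00 : 0 <= J0.
Proof. by rewrite /J0 addr_ge0 ?divr_ge0 ?invr_ge0//; have := pq; have := p1; lra. Qed.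

(* The two bounds [y^n e^(-y^2) <= n! e] and [v^(-n/2) <= t^(-n/2)] on a heat
   kernel at time [v >= t]. *)
Let heat_bound (X t v : R) : 0 < X -> 0 < t -> t <= v ->
  (Num.sqrt v)^-1 ^+ n * expR (- (X / v)) <= if t <= X then M * X `^ (- q) else t `^ (- q).
Proof.
move=> X0 t0 tv; have v0 := lt_le_trans t0 tv.
have sq (z : R) : 0 < z -> z `^ (- q) = (Num.sqrt z)^-1 ^+ n.
  move=> z0; rewrite /q powRN mulrC powRrM powR12_sqrt ?(ltW z0)//.
  by rewrite powR_mulrn ?sqrtr_ge0// exprVn.
case: ifP => _.
  pose y := Num.sqrt X / Num.sqrt v.
  have y0 : 0 <= y by rewrite divr_ge0 ?sqrtr_ge0.
  have y2 : X / v = y ^+ 2 by rewrite /y expr_div_n !sqr_sqrtr// ltW.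
  rewrite sq// y2 -[X in _ <= M * X]mulr1.
  have -> : (Num.sqrt v)^-1 ^+ n = (Num.sqrt X)^-1 ^+ n * y ^+ n.
    by rewrite -exprMn /y mulrA mulVf ?mul1r// gt_eqF// sqrtr_gt0.
  rewrite mulr1 -mulrA [M * _]mulrC ler_wpM2l ?exprn_ge0 ?invr_ge0 ?sqrtr_ge0//.
  rewrite expRN ler_pdivrMr ?expR_gt0// /M -mulrA -expRD.
  have h1 : y ^+ n <= n`!%:R * expR y.
    case: (n) => [|m]; first by rewrite expr0 fact0 mul1r -[X in X <= _]expR0 ler_expR.
    have := expR_ge1Dxn m y0 => h; rewrite mulrC -ler_pdivrMr ?ltr0n ?fact_gt0//.
    by apply: le_trans h; rewrite lerDr.
  apply: (le_trans h1); rewrite ler_wpM2l// ler_expR.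
  have [y1|y1] := leP y 1; first by have := sqr_ge0 y; lra.
  have : y <= y ^+ 2 by rewrite expr2 ler_peMl// ltW.
  by lra.
rewrite sq// -[X in _ <= X]mulr1; apply: ler_pM; rewrite ?exprn_ge0 ?invr_ge0 ?sqrtr_ge0 ?expR_ge0//.
  rewrite lerXn2r ?nnegrE ?invr_ge0 ?sqrtr_ge0// lef_pV2 ?posrE ?sqrtr_gt0//.
  exact: ler_wsqrtr.
by rewrite -[X in _ <= X]expR0 ler_expR oppr_le0 divr_ge0 ?(ltW X0)// ltW.
Qed.

Lemma Rintegral_le d (T : measurableType d) (m : {measure set T -> \bar R}) (f : T -> R) (C : R) :
  (forall x, 0 <= f x) -> (\int[m]_x (f x)%:E <= C%:E)%E -> \int[m]_x f x <= C.
Proof.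
move=> f0 le; rewrite /Rintegral -lee_fin fineK//.
rewrite ge0_fin_numE; first exact: (le_lt_trans le (ltry _)).
by apply: integral_ge0 => x _; rewrite lee_fin.
Qed.

(** The factor [r^n] has the order of the volume of a cube of side [r], and the Riesz factor does
    not depend on [r]. Rescaling time by [X = |x|^2] makes the two regimes of [heat_bound] meet at
    1. *)
Let W_le (r : R) x : 0 < r -> 0 < dot x x ->
  gamma_const p * W (r ^- 2) x <= r ^+ n * (J0 * dot x x `^ (p + 1 - q)).
Proof.
move=> r0; set X := dot x x => X0.
have a0 : 0 < r ^- 2 by rewrite invr_gt0 exprn_gt0.
rewrite W_gamma//.
apply: Rintegral_le.
  by move=> t; rewrite mulr_ge0 ?gamma_weight_ge0// mulr_ge0 ?expR_ge0 ?exprn_ge0 ?invr_ge0 ?sqrtr_ge0.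
have mphi : measurable_fun setT (fun t : R => (t `^ p * (if t <= 1 then M else t `^ (- q)))%:E).
  apply/measurable_EFinP; apply: measurable_funM; first exact: measurable_powR_cst.
  have mp := measurable_powR_cst (- q).
  by apply: measurable_fun_ifT => //; exact: measurable_fun_ler.
have phi0 (t : R) : (0 <= (t `^ p * (if t <= 1 then M else t `^ (- q)))%:E)%E.
  by rewrite lee_fin mulr_ge0 ?powR_ge0//; case: ifP => _; rewrite ?M0 ?powR_ge0.
have iX0 : 0 < X^-1 by rewrite invr_gt0.
have sc := ge0_integral_scale iX0 mphi phi0.
rewrite invrK in sc.
pose c := r ^+ n * X `^ (p - q).
have c0 : 0 <= c by rewrite mulr_ge0 ?powR_ge0 ?exprn_ge0// ltW.
apply: (@le_trans _ _ (c%:E * (X%:E * J0%:E))%E); last first.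
  rewrite -!EFinM lee_fin /c le_eqVlt; apply/orP; left; apply/eqP.
  have -> : X `^ (p + 1 - q) = X `^ (p - q) * X.
    rewrite -[X in _ = _ * X](powRr1 (ltW X0)) -powRD ?(gt_eqF X0) ?implybT//.
    by congr (_ `^ _); ring.
  by ring.
apply: (@le_trans _ _ (c%:E * (X%:E *
    \int[mu]_(t in `]0%R, +oo[) (t `^ p * (if (t <= 1)%R then M else t `^ (- q)))%:E))%E); last first.
  rewrite lee_wpmul2l ?lee_fin// lee_wpmul2l ?lee_fin ?(ltW X0)//.
  exact: integral_two_regimes.
rewrite -sc -ge0_integralZl//; last first.
  by apply: measurable_funTS; apply: (measurableT_comp mphi); exact: measurable_mulr.
rewrite [leRHS]integral_mkcond; apply: ge0_le_integral_nomeas => t _.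
  by rewrite lee_fin mulr_ge0 ?gamma_weight_ge0// mulr_ge0 ?expR_ge0 ?exprn_ge0 ?invr_ge0 ?sqrtr_ge0.
rewrite patchE -[point]/(0%E : \bar R) /gamma_weight; case: (ltP 0 t) => t0; last first.
  rewrite mul0r; case: ifPn => // _.
  by apply: mule_ge0; [rewrite lee_fin|exact: phi0].
rewrite mem_set/=; last by rewrite in_itv/= andbT.
rewrite -EFinM lee_fin.
(* Up to the factor [r^n] the damped Gaussian is a heat kernel at time [v], which is at least [t]
   whatever [r] is. *)
pose v := r ^+ 2 + 4 * t.
have v0 : 0 < v by rewrite addr_gt0 ?exprn_gt0// mulr_gt0.
have tv : t <= v by rewrite /v; have := sqr_ge0 r; lra.
have e1 : 1 + 4 * r ^- 2 * t = v / r ^+ 2 by rewrite /v; field; rewrite gt_eqF.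
have e2 : (Num.sqrt (v / r ^+ 2))^-1 = r * (Num.sqrt v)^-1.
  rewrite sqrtrM ?(ltW v0)// sqrtrV ?sqr_ge0// sqrtr_sqr gtr0_norm// invfM invrK mulrC.
  by [].
have e3 : r ^- 2 / (v / r ^+ 2) = v^-1.
  have : r ^+ 2 != 0 by rewrite expf_neq0// gt_eqF.
  by move: (r ^+ 2) v v0 {tv e1 e2} => r2 v v0 r20; field; rewrite r20 gt_eqF.
rewrite e1 e2 e3 exprMn.
have hb := heat_bound X0 t0 tv.
rewrite [v^-1 * _]mulrC.
have tX : (X^-1 * t <= 1) = (t <= X) by rewrite ler_pdivrMl// mulr1.
rewrite tX; have Xt0 : 0 <= X^-1 by rewrite ltW.
apply: (@le_trans _ _ (t `^ p * (r ^+ n * (if t <= X then M * X `^ (- q) else t `^ (- q))))).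
  rewrite [X in X <= _](_ : _ = t `^ p * (expR (- t) *
    (r ^+ n * ((Num.sqrt v)^-1 ^+ n * expR (- (X / v)))))); last by rewrite /X; ring.
  rewrite ler_wpM2l ?powR_ge0//.
  rewrite -[X in _ <= X]mul1r; apply: ler_pM; rewrite ?expR_ge0//.
  - by rewrite !mulr_ge0 ?expR_ge0 ?exprn_ge0 ?invr_ge0 ?sqrtr_ge0// ltW.
  - by rewrite -[X in _ <= X]expR0 ler_expR oppr_le0 ltW.
  - by rewrite ler_wpM2l// exprn_ge0// ltW.
rewrite le_eqVlt; apply/orP; left; apply/eqP.
have Xpq : X `^ (p - q) = X `^ p * X `^ (- q) by rewrite powRD// (gt_eqF X0) implybT.
have Xn0 z : X `^ z != 0 by rewrite gt_eqF// powR_gt0.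
rewrite /c Xpq [(X^-1 * t) `^ p]powRM ?(ltW t0)//.
have iXp z : X^-1 `^ z = (X `^ z)^-1.
  by rewrite -powR_inv1 ?(ltW X0)// -powRrM mulN1r powRN.
rewrite iXp; case: ifP => _.
  have := Xn0 p; move: (X `^ p) (X `^ (- q)) => A A' A0; field; exact: A0.
rewrite powRM ?(ltW t0)// iXp.
have := Xn0 p; have := Xn0 (- q); move: (X `^ p) (X `^ (- q)) => A A' A'0 A0; field.
by rewrite A0 A'0.
Qed.

Lemma dot_gt0 m (x : 'rV[R]_m) : x != 0 -> 0 < dot x x.
Proof.
move=> x0; rewrite lt_def dot_ge0 andbT; apply: contra x0 => /eqP h.
apply/eqP/rowP => i; rewrite mxE; apply/eqP; rewrite -sqrf_eq0; apply/eqP.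
move: h; rewrite /dot => /psumr_eq0P => /(_ (fun i _ => ltac:(by rewrite -expr2 sqr_ge0)) i isT).
by rewrite expr2.
Qed.

(** By continuity a violation at [x] persists on a small cube, and the Gaussian average then exceeds
    [W_le], both bounds being proportional to [r^n]. Thus continuity passes from averages to the
    value at [x]. *)
Lemma bessel_kernel_bound : exists2 C : R, 0 <= C &
  forall x, x != 0 -> (g x <= (C * enorm x `^ (alpha - n%:R))%:E)%E.
Proof.
have g0 := gamma_const_gt0 p1.
(* On a cube of half-side [r] the Gaussian weight is at least [e^(-n)] and the volume is
   [(2 r)^n]. *)
pose C := expR n%:R / 2 ^+ n * J0 / gamma_const p.
exists C.
  by rewrite /C divr_ge0 ?mulr_ge0 ?divr_ge0 ?expR_ge0 ?exprn_ge0// ltW.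
move=> x x0; have X0 := dot_gt0 x0.
have -> : enorm x `^ (alpha - n%:R) = dot x x `^ (p + 1 - q).
  rewrite /enorm -powR12_sqrt ?(ltW X0)// -powRrM; congr (_ `^ _).
  by rewrite /p /q; lra.
rewrite leNgt; apply/negP => h.
set c := C * _ in h.
have c0 : 0 <= c.
  by rewrite mulr_ge0 ?powR_ge0 ?divr_ge0 ?mulr_ge0 ?divr_ge0 ?expR_ge0 ?exprn_ge0// ltW.
have [m m1 m2] : exists2 m : R, c < m & (m%:E < g x)%E.
  move: h; case: (g x) => [z| |] //=; first rewrite lte_fin => cz.
    by exists ((c + z) / 2); rewrite ?lte_fin; lra.
  by exists (c + 1); rewrite ?ltry// ltrDl.
have [cg gpos _ _] := hg.
have /nbhs_ballP[e /= e0 he] : nbhs x (g @^-1` [set z | (m%:E < z)%E]).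
  apply: cg; apply: open_nbhs_nbhs; split => //; exact: open_ereal_gt_ereal.
pose r := e / 2; have r0 : 0 < r by rewrite divr_gt0.
have hr y : cube x r y -> (m%:E < g y)%E.
  move=> xy; apply: he; split => // i0 i; rewrite (ord1 i0).
  rewrite /ball /= distrC (le_lt_trans (xy i))// /r; lra.
have m0 : 0 < m by rewrite (le_lt_trans c0).
have mE : measurable_fun setT (fun y : 'rV[R]_n => expR (- (r ^- 2 * dot (x - y) (x - y)))).
  apply: measurableT_comp => //; apply: measurableT_comp => //; apply: measurable_funM => //.
  by apply: measurable_dot; apply: measurable_fun_rV => // i; under eq_fun do rewrite !mxE;
    apply: measurable_funB => //; exact: measurable_coord.
have E1 y : 0 <= expR (- (r ^- 2 * dot (x - y) (x - y))) <= 1.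
  rewrite expR_ge0/= -[X in _ <= X]expR0 ler_expR oppr_le0 mulr_ge0 ?dot_ge0//.
  by rewrite invr_ge0 exprn_ge0// ltW.
have IW : rint leb setT (fun y => expR (- (r ^- 2 * dot (x - y) (x - y))) * w y).
  apply: (le_rint measurableT _ _ (integrable_norm Iw)); first exact: measurable_funM.
  move=> y _; have /andP[a1 a2] := E1 y.
  by rewrite normrM (ger0_norm a1) ler_piMl.
have lower : ((m * expR (- n%:R) * (2 * r) ^+ n)%:E <= (W (r ^- 2) x)%:E)%E.
  have -> : W (r ^- 2) x = \int[leb]_y (expR (- (r ^- 2 * dot (x - y) (x - y))) * w y).
    by apply: eq_Rintegral => y _; rewrite mulrC.
  rewrite -(rintE measurableT IW) -(w_integral mE) EFinM -(lebesgue_rV_cube x r0).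
  rewrite -integral_cst; last exact: measurable_cube.
  rewrite integral_mkcond; apply: ge0_le_integral_nomeas => y _.
    by apply: erestrict_ge0 => z _; rewrite lee_fin mulr_ge0 ?expR_ge0// ltW.
  rewrite patchE -[point]/(0%E : \bar R); case: ifPn => [/set_mem yx|_]; last first.
    by rewrite mule_ge0 ?lee_fin ?expR_ge0.
  rewrite EFinM; apply: lee_pmul; rewrite ?lee_fin ?expR_ge0 ?(ltW m0)//.
    exact: ltW (hr _ yx).
  rewrite ler_expR lerN2 mulrC ler_pdivrMr ?exprn_gt0//.
  rewrite /dot -[n in n%:R]card_ord -sumr_const mulr_suml; apply: ler_sum => i _.
  rewrite mul1r !mxE -expr2 -[X in X <= _]real_normK ?num_real// lerXn2r ?nnegrE ?(ltW r0)//.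
  by rewrite distrC; exact: yx.
have upper := W_le r0 X0.
have : gamma_const p * (m * expR (- n%:R) * (2 * r) ^+ n) <= r ^+ n * (J0 * dot x x `^ (p + 1 - q)).
  by apply: le_trans upper; rewrite ler_wpM2l ?(ltW g0)// -lee_fin.
have rn0 : 0 < r ^+ n by rewrite exprn_gt0.
have E2 : gamma_const p * (m * expR (- n%:R) * (2 * r) ^+ n) =
   r ^+ n * (gamma_const p * expR (- n%:R) * 2 ^+ n * m) by rewrite exprMn; ring.
rewrite E2 ler_pM2l//; apply/negP; rewrite -ltNge.
have -> : J0 * dot x x `^ (p + 1 - q) = gamma_const p * expR (- n%:R) * 2 ^+ n * c.
  rewrite /c /C expRN; have := @expR_gt0 R n%:R; move: (expR _) => E E0; field.
  by rewrite !gt_eqF ?exprn_gt0.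
by rewrite ltr_pM2l// !mulr_gt0 ?expR_gt0 ?exprn_gt0.
Qed.

End bessel_bound.

(** * Potentials *)

Section frostman_potential.
Context {R : realType} {n : nat}.
Variables (nu : {measure set 'rV[R]_n -> \bar R}) (C theta : R).
Hypotheses (C0 : 0 <= C) (nuT : (nu setT <= 1)%E).
Hypothesis frost : forall x k, (nu (cube x (2 ^- k)) <= (C * (2 `^ (- theta)) ^+ k)%:E)%E.
Variables (kr : 'rV[R]_n -> \bar R) (A b : R).
Hypotheses (kr0 : forall z, (0 <= kr z)%E) (A0 : 0 < A) (b0 : 0 < b) (bt : b < theta).
Hypothesis krb : forall z, z != 0 -> (kr z <= (A * enorm z `^ (- b))%:E)%E.

Let c K j : R := A * 2 `^ ((K + j).+1%:R * b).

Let c_ge K j : A <= c K j.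
Proof.
rewrite /c ler_peMr ?(ltW A0)// -[X in X <= _](powRr0 2) ler_powR ?ler1n//.
by rewrite mulr_ge0// ltW.
Qed.

(** Dyadic majorant of the kernel near [x]: [c K j] is the kernel bound at distance
    [2^-(K + j + 1)], a lower bound on the distance outside the next smaller cube. *)
Let rings K x (y : 'rV[R]_n) : \bar R :=
  (\sum_(j <oo) (c K j)%:E * (\1_(cube x (2 ^- (K + j))) y)%:E)%E.

Let ring_ge0 K (x y : 'rV[R]_n) j : (0 <= (c K j)%:E * (\1_(cube x (2 ^- (K + j))) y)%:E)%E.
Proof. by rewrite mule_ge0 ?lee_fin// (le_trans (ltW A0)). Qed.

Let p2 k : 0 < 2 ^+ k :> R. Proof. exact: exprn_gt0. Qed.

(** Off the centre, the smallest cube containing [y] already pays for the kernel. At [y = x] the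
    kernel may be [+oo], but there every cube contributes at least [A] and the series diverges. *)
Let kernel_le K (x y : 'rV[R]_n) : cube x (2 ^- K) y -> (kr (x - y) <= rings K x y)%E.
Proof.
move=> xyK; have [->|xy] := eqVneq y x.
  suff -> : rings K x x = +oo%E by rewrite leey.
  apply/eq_infty => t.
  pose N := Num.bound (`|t| / A).
  apply: (@le_trans _ _ (\sum_(0 <= j < N) (c K j)%:E * (\1_(cube x (2 ^- (K + j))) x)%:E)%E); last first.
    by apply: nneseries_lim_ge => j _ _; exact: ring_ge0.
  apply: (@le_trans _ _ (\sum_(0 <= j < N) A%:E)%E); last first.
    apply: lee_sum => j _; rewrite indicE mem_set ?mule1 ?lee_fin//.
    by move=> i; rewrite subrr normr0 invr_ge0 ltW.
  rewrite sumEFin sumr_const_nat subn0 lee_fin (le_trans (ler_norm t))// -mulr_natr.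
  rewrite mulrC -ler_pdivrMr// ltW//; apply: archi_boundP.
  by rewrite divr_ge0// ltW.
have ex : exists m, ~~ `[< cube x (2 ^- (K + m)) y >].
  have [i xi] : exists i, x 0 i != y 0 i.
    apply/existsP; apply: contraNT xy => /existsPn h; apply/eqP/rowP => i.
    by apply/eqP; rewrite eq_sym; have := h i; rewrite negbK.
  have d0 : 0 < `|y 0 i - x 0 i| by rewrite normr_gt0 subr_eq0 eq_sym.
  exists (Num.bound `|y 0 i - x 0 i|^-1); apply/asboolPn => /(_ i).
  apply/negP; rewrite -ltNge invf_plt ?posrE//.
  have h : `|y 0 i - x 0 i|^-1 < (Num.bound `|y 0 i - x 0 i|^-1)%:R by apply: archi_boundP; rewrite invr_ge0.
  by apply: (lt_le_trans h); rewrite -natrX ler_nat (leq_trans (ltnW (ltn_expl _ (isT : 1 < 2)%N)))// leq_exp2l// leq_addl.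
case: (ex_minnP ex) => -[|j] /asboolPn hj mj; first by rewrite addn0 in hj.
have cj : cube x (2 ^- (K + j)) y.
  by apply: contrapT => /asboolPn /mj; rewrite ltnn.
have [i hi] : exists i, 2 ^- (K + j.+1) < `|y 0 i - x 0 i|.
  by apply: contrapT => nh; apply: hj => i; rewrite leNgt; apply/negP => h; apply: nh; exists i.
apply: (@le_trans _ _ (c K j)%:E).
  have xy0 : x - y != 0 by rewrite subr_eq0 eq_sym.
  apply: (le_trans (krb xy0)); rewrite lee_fin /c ler_wpM2l ?(ltW A0)//.
  have e1 : 2 ^- (K + j.+1) <= enorm (x - y).
    by rewrite (le_trans (ltW hi))// -normrN opprB; have := enorm_coord (x - y) i; rewrite !mxE.
  have q0 : 0 < 2 ^- (K + j.+1) :> R by rewrite invr_gt0.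
  have -> : 2 `^ ((K + j).+1%:R * b) = (2 ^- (K + j.+1)) `^ (- b) :> R.
    rewrite -(powR_invn _ (ler0n R 2)) -powRrM addnS; congr (_ `^ _); ring.
  rewrite !powRN lef_pV2 ?posrE ?powR_gt0// ?(lt_le_trans q0)//.
  by rewrite ge0_ler_powR ?nnegrE ?(ltW b0) ?(ltW q0)// (le_trans (ltW q0)).
apply: (@le_trans _ _ (\sum_(0 <= i < j.+1) (c K i)%:E * (\1_(cube x (2 ^- (K + i))) y)%:E)%E); last first.
  by apply: nneseries_lim_ge => l _ _; exact: ring_ge0.
rewrite big_nat_recr//= indicE mem_set// mule1 leeDr// sume_ge0// => l _; exact: ring_ge0.
Qed.

(** Ratio of the geometric series: from one cube to the next the kernel bound grows by [2^b] and the
    bound on the measure shrinks by [2^(-theta)]. *)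
Let eta : R := 2 `^ (b - theta).
Let tailc : R := A * C * 2 `^ b / (1 - eta).

Let eta0 : 0 < eta. Proof. exact: powR_gt0. Qed.

Let eta1 : eta < 1.
Proof.
have h : 0 < theta - b by rewrite subr_gt0.
rewrite /eta -opprB powRN invf_lt1 ?powR_gt0//.
by have := @gt0_ltr_powR R (theta - b) h 1 2; rewrite powR1 !nnegrE ltr1n; exact.
Qed.

Let rings_integral K x : (\int[nu]_y rings K x y <= (tailc * eta ^+ K)%:E)%E.
Proof.
rewrite integral_nneseries//; last first.
  move=> j; apply: measurable_funeM; apply/measurable_EFinP/measurable_indic.
  exact: measurable_cube.
have e1 : 0 < 1 - eta by rewrite subr_gt0.
apply: lime_le.
  by apply: is_cvg_nneseries => j _ _; apply: integral_ge0 => y _; exact: ring_ge0.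
apply: nearW => N.
apply: (@le_trans _ _ (\sum_(0 <= j < N) (A * C * 2 `^ b * eta ^+ K * eta ^+ j)%:E)%E).
  apply: lee_sum => j _.
  rewrite ge0_integralZl//; last 2 first.
  - by apply/measurable_EFinP/measurable_indic; exact: measurable_cube.
  - by rewrite lee_fin (le_trans (ltW A0)).
  rewrite integral_indic//; last exact: measurable_cube.
  rewrite setIT (le_trans (lee_wpmul2l _ (frost _ _)))//; first by rewrite lee_fin (le_trans (ltW A0)).
  rewrite -EFinM lee_fin le_eqVlt; apply/orP; left; apply/eqP.
  rewrite /c /eta -mulrA; rewrite -!mulrA; congr (_ * _).
  rewrite mulrCA; congr (_ * _).
  rewrite -!powR_mulrn ?powR_ge0// -!powRrM -!powRD ?pnatr_eq0 ?implybT//.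
  by congr (_ `^ _); rewrite -natr1 natrD; ring.
rewrite sumEFin lee_fin -mulr_sumr big_mkord.
rewrite /tailc [X in _ <= X]mulrAC ler_wpM2l//.
  by rewrite !mulr_ge0 ?powR_ge0 ?exprn_ge0// ltW.
rewrite -[X in _ <= X]div1r ler_pdivlMr// mulrC -opprB mulNr -subrX1.
by rewrite opprB lerBlDr lerDl exprn_ge0// ltW.
Qed.

(** Uniform in [x] and tending to 0 with growing [K]: this controls the error of truncating the
    kernel. *)
Lemma potential_tail K x : (\int[nu]_(y in cube x (2 ^- K)) kr (x - y)%R <= (tailc * eta ^+ K)%:E)%E.
Proof.
apply: le_trans (rings_integral K x).
rewrite integral_mkcond; apply: ge0_le_integral_nomeas => y _.
  by apply: erestrict_ge0 => z _.
rewrite patchE -[point]/(0%E : \bar R); case: ifPn => [/set_mem|_]; first exact: kernel_le.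
by apply: nneseries_ge0 => j _ _; exact: ring_ge0.
Qed.

Lemma kernel_far K (x y : 'rV[R]_n) : ~ cube x (2 ^- K) y -> (kr (x - y) <= (A * 2 `^ (K%:R * b))%:E)%E.
Proof.
move=> nxy; have [i hi] : exists i, 2 ^- K < `|y 0 i - x 0 i|.
  by apply: contrapT => nh; apply: nxy => i; rewrite leNgt; apply/negP => h; apply: nh; exists i.
have q0 : 0 < 2 ^- K :> R by rewrite invr_gt0.
have e1 : 2 ^- K <= enorm (x - y).
  by rewrite (le_trans (ltW hi))// -normrN opprB; have := enorm_coord (x - y) i; rewrite !mxE.
have xy0 : x - y != 0.
  apply/eqP => xy0; move: hi; rewrite -normrN opprB.
  have -> : x 0 i - y 0 i = (x - y) 0 i by rewrite !mxE.
  by rewrite xy0 mxE normr0 ltNge ltW.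
apply: (le_trans (krb xy0)); rewrite lee_fin ler_wpM2l ?(ltW A0)//.
have -> : 2 `^ (K%:R * b) = (2 ^- K) `^ (- b) :> R.
  by rewrite -(powR_invn _ (ler0n R 2)) -powRrM; congr (_ `^ _); ring.
rewrite !powRN lef_pV2 ?posrE ?powR_gt0// ?(lt_le_trans q0)//.
by rewrite ge0_ler_powR ?nnegrE ?(ltW b0) ?(ltW q0)// (le_trans (ltW q0)).
Qed.

Lemma potential_le x : (potential kr nu x <= (tailc + A)%:E)%E.
Proof.
have mc := measurable_cube x (2 ^- 0).
apply: (@le_trans _ _ (\int[nu]_y (rings 0 x y + A%:E))%E).
  apply: ge0_le_integral_nomeas => y _; first exact: kr0.
  have r0 : (0 <= rings 0 x y)%E by apply: nneseries_ge0 => j _ _; exact: ring_ge0.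
  have [xy|xy] := pselect (cube x (2 ^- 0) y).
    by apply: (le_trans (kernel_le xy)); rewrite leeDl// lee_fin ltW.
  apply: (le_trans (kernel_far xy)); rewrite mul0r powRr0 mulr1.
  by rewrite leeDr.
have mr : measurable_fun setT (rings 0 x).
  apply: ge0_emeasurable_sum => j; first by move=> y _ _; exact: ring_ge0.
  move=> _; apply: measurable_funeM; apply/measurable_EFinP/measurable_indic.
  exact: measurable_cube.
rewrite ge0_integralD//; last 2 first.
- by move=> y _; apply: nneseries_ge0 => j _ _; exact: ring_ge0.
- by move=> y _; rewrite lee_fin ltW.
rewrite EFinD leeD//.
  by apply: (le_trans (rings_integral 0 x)); rewrite expr0 mulr1.
rewrite integral_cst//= -[X in (_ <= X)%E]mule1 lee_wpmul2l// lee_fin; exact: ltW.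
Qed.

Hypothesis ckr : continuous kr.
Hypothesis mkr : measurable_fun setT kr.

Section truncation.
Variable M : R.
Hypothesis M0 : 0 <= M.

Let tr z : R := fine (Order.min (kr z) M%:E).

Let trE z : (tr z)%:E = Order.min (kr z) M%:E.
Proof.
rewrite /tr fineK// fin_numElt; apply/andP; split.
  by rewrite lt_min ltNyr andbT (@lt_le_trans _ _ 0%E).
by rewrite gt_min ltry orbT.
Qed.

Let tr0M z : 0 <= tr z <= M.
Proof. by rewrite -!lee_fin trE le_min kr0 lee_fin M0/= ge_min lexx orbT. Qed.

Let tr_continuous : continuous tr.
Proof.
move=> z0; apply/(@cvgrPdist_lt _ _ _ (nbhs z0) (nbhs_filter z0) tr (tr z0)) => e e0; have /andP[t0 tM] := tr0M z0.
pose FF : Filter (nbhs z0) := nbhs_filter z0.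
have up : \forall z \near z0, tr z < tr z0 + e.
  have [h|h] := leP (tr z0 + e) M; last first.
    by apply: (@filterE _ (nbhs z0) FF) => z; have /andP[_ h'] := tr0M z; exact: le_lt_trans h.
  have k0 : kr z0 = (tr z0)%:E.
    have := trE z0; rewrite minEle; case: ifP => [_ ->//|_ tE].
    by exfalso; have := EFin_inj tE; lra.
  have : nbhs z0 (kr @^-1` [set u | (u < (tr z0 + e)%:E)%E]).
    apply: ckr; apply: open_nbhs_nbhs; split; first exact: open_ereal_lt_ereal.
    by rewrite /= k0 lte_fin ltrDl.
  by apply: (@filterS _ (nbhs z0) FF) => z /= hz; rewrite -lte_fin trE gt_min hz.
have down : \forall z \near z0, tr z0 - e < tr z.
  have : nbhs z0 (kr @^-1` [set u | ((tr z0 - e)%:E < u)%E]).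
    apply: ckr; apply: open_nbhs_nbhs; split; first exact: open_ereal_gt_ereal.
    rewrite /=; apply: (@lt_le_trans _ _ (tr z0)%:E); first by rewrite lte_fin ltrBlDr ltrDl.
    by rewrite trE ge_min lexx.
  apply: (@filterS _ (nbhs z0) FF) => z /= hz; rewrite -lte_fin trE lt_min hz lte_fin; lra.
apply: (@filterS2 _ (nbhs z0) FF _ _ _ _ up down) => z h1 h2.
by rewrite ltr_distl; apply/andP; split; lra.
Qed.

Let msub (x : 'rV[R]_n) : measurable_fun setT (fun y : 'rV[R]_n => x - y).
Proof.
apply: measurable_fun_rV => // i; under eq_fun do rewrite !mxE.
by apply: measurable_funB => //; exact: measurable_coord.
Qed.

Let mtr : measurable_fun setT tr.
Proof.
apply/measurable_EFinP; rewrite (_ : EFin \o tr = fun z => Order.min (kr z) M%:E).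
  exact: measurable_mine.
by apply/funext => z; rewrite /= trE.
Qed.

Let hM x : R := \int[nu]_y tr (x - y).

Let Itr x : rint nu setT (fun y => tr (x - y)).
Proof.
apply: rint_ge0 => //; first exact: (measurableT_comp mtr (msub x)).
  by move=> y _; have /andP[] := tr0M (x - y).
apply: (@le_lt_trans _ _ (\int[nu]_(y in setT) M%:E)%E).
  apply: ge0_le_integral_nomeas => y _; rewrite lee_fin; by have /andP[] := tr0M (x - y).
rewrite integral_cst//; apply: (@le_lt_trans _ _ (M%:E * 1)%E); last by rewrite mule1 ltry.
by rewrite lee_wpmul2l// lee_fin.
Qed.

(** Dominated convergence speaks of sequences, so a failure of continuity is first turned into a
    sequence tending to [x0]. *)
Lemma truncated_potential_continuous : continuous (fun x : 'rV[R]_n => \int[nu]_y fine (Order.min (kr (x - y)) M%:E)).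
Proof.
rewrite -[X in continuous X]/hM => x0; apply/(@cvgrPdist_lt _ _ _ (nbhs x0) (nbhs_filter x0) hM (hM x0)) => e e0; apply: contrapT => nn.
have h k : exists x, ball x0 (k.+1%:R^-1) x /\ ~ (`|hM x0 - hM x| < e).
  apply: contrapT => nx; apply: nn; apply/nbhs_ballP; exists k.+1%:R^-1; first by rewrite /= invr_gt0.
  by move=> x xb; apply: contrapT => nh; apply: nx; exists x.
have [u hu] := choice h.
have ux y : (u k - y : 'rV[R]_n) @[k --> \oo] --> (x0 - y : 'rV[R]_n).
  apply/cvg_ballP => r r0; near=> k.
  have [[_ ub] _] := hu k; split => // i j.
  have := ub i j; rewrite /ball /= !mxE opprB addrA subrK => /lt_trans; apply.
  by near: k; exact: (near_infty_natSinv_lt (PosNum r0)).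
have cv : hM (u k) @[k --> \oo] --> hM x0.
  have [] := @dominated_convergence _ _ R nu setT measurableT
    (fun k y => (tr (u k - y))%:E) (fun y => (tr (x0 - y))%:E) (fun=> M%:E).
  - by move=> k; apply/measurable_EFinP; exact: (measurableT_comp mtr (msub _)).
  - by apply/measurable_EFinP; exact: (measurableT_comp mtr (msub _)).
  - apply: aeW => y _; apply: cvg_EFin; first exact: nearW.
    by apply: (cvg_comp _ _ (ux y)); exact: tr_continuous.
  - apply: rint_ge0 => //.
    apply: (@le_lt_trans _ _ (M%:E * 1)%E); last by rewrite mule1 ltry.
    by rewrite integral_cst// lee_wpmul2l// lee_fin.
  - by apply: aeW => y k _; rewrite /= lee_fin; have /andP[t0 t1] := tr0M (u k - y); rewrite ger0_norm.
  move=> _ _ cv; rewrite /hM /Rintegral; apply: fine_cvg.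
  rewrite fineK; first exact: cv.
  by apply: integrable_fin_num => //; exact: Itr.
have /cvgrPdist_lt/(_ _ e0) [N _ /(_ N (leqnn N))] := cv.
by have [_] := hu N.
Unshelve. all: by end_near. Qed.

Lemma truncated_potential_le x : ((\int[nu]_y fine (Order.min (kr (x - y)) M%:E))%:E <= potential kr nu x)%E.
Proof.
have := rintE measurableT (Itr x); rewrite /tr => <-.
apply: ge0_le_integral_nomeas => y _; rewrite -/(tr (x - y)).
  by rewrite lee_fin; have /andP[] := tr0M (x - y).
by rewrite trE ge_min lexx.
Qed.

(** This [M] bounds the kernel off the cube of half-side [2^-K], so truncation is invisible there
    and the error is confined to the cube. *)
Lemma potential_le_truncated K x : M = A * 2 `^ (K%:R * b) ->
  (potential kr nu x <= (\int[nu]_y fine (Order.min (kr (x - y)) M%:E) + tailc * eta ^+ K)%:E)%E.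
Proof.
move=> ME; rewrite EFinD.
have := rintE measurableT (Itr x); rewrite /tr => <-.
apply: (@le_trans _ _ (\int[nu]_y ((tr (x - y))%:E + ((fun y => kr (x - y)) \_ (cube x (2 ^- K))) y))%E).
  apply: ge0_le_integral_nomeas => y _; first exact: kr0.
  rewrite patchE -[point]/(0%E : \bar R); case: ifPn => [_|/negP nxy].
    by rewrite leeDr// lee_fin; have /andP[] := tr0M (x - y).
  rewrite adde0 trE le_min lexx ME kernel_far// => xy; apply: nxy; exact: mem_set.
rewrite ge0_integralD//.
- by apply: leeD => //; rewrite -integral_mkcond; exact: potential_tail.
- by move=> y _; rewrite lee_fin; have /andP[] := tr0M (x - y).
- by apply/measurable_EFinP; exact: (measurableT_comp mtr (msub x)).
- by move=> y _; apply: erestrict_ge0 => z _; exact: kr0.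
- apply/(measurable_restrictT _ _).1; first exact: measurable_cube.
  by apply: measurable_funTS; exact: (measurableT_comp mkr (msub x)).
Qed.

End truncation.

Lemma potential_continuous : finite_continuous (potential kr nu).
Proof.
have pot0 x : (0 <= potential kr nu x)%E by apply: integral_ge0 => y _; exact: kr0.
have potE x : potential kr nu x = (fine (potential kr nu x))%:E.
  rewrite fineK// ge0_fin_numE//; apply: le_lt_trans (potential_le x) (ltry _).
exists (fun x => fine (potential kr nu x)) => // x0.
apply/(@cvgrPdist_lt _ _ _ (nbhs x0) (nbhs_filter x0) (fun x => fine (potential kr nu x)) (fine (potential kr nu x0))) => e e0.
have [K hK] : exists K, tailc * eta ^+ K < e / 2.
  have cv : tailc * eta ^+ K @[K --> \oo] --> (0 : R).
    rewrite -(mulr0 tailc); apply: cvgM; first exact: cvg_cst.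
    by apply: cvg_expr; rewrite (gtr0_norm eta0).
  have e20 : 0 < e / 2 by rewrite divr_gt0.
  have /cvgrPdist_lt/(_ _ e20) [N _ /(_ N (leqnn N))] := cv.
  by rewrite sub0r normrN => h; exists N; exact: le_lt_trans (ler_norm _) h.
pose M := A * 2 `^ (K%:R * b).
have M0 : 0 <= M by rewrite mulr_ge0 ?powR_ge0// ltW.
pose h (x : 'rV[R]_n) : R := \int[nu]_y fine (Order.min (kr (x - y)) M%:E).
have up (x : 'rV[R]_n) : fine (potential kr nu x) <= h x + tailc * eta ^+ K.
  by rewrite -lee_fin -potE; exact: (potential_le_truncated M0 x (erefl M)).
have lo (x : 'rV[R]_n) : h x <= fine (potential kr nu x).
  by rewrite -lee_fin -potE; exact: (truncated_potential_le M0 x).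
have ch : continuous h := truncated_potential_continuous M0.
have e20 : 0 < e / 2 by rewrite divr_gt0.
have := ch x0 => /(@cvgrPdist_lt _ _ _ (nbhs x0) (nbhs_filter x0) h (h x0)) /(_ _ e20).
apply: (@filterS _ (nbhs x0) (nbhs_filter x0)) => x hx.
have := up x0; have := lo x0; have := up x; have := lo x.
move=> h1 h2 h3 h4.
move: hx; rewrite !ltr_distl => /andP[h5 h6]; apply/andP; split; lra.
Qed.

End frostman_potential.

Section path_occupation.
Context {R : realType} {n : nat}.
Notation mu := (@lebesgue_measure R).
Variable (X : measurableTypeR R -> 'rV[R]_n).
Hypothesis mX : measurable_fun setT X.
Let mI : measurable (`[0, 1]%classic : set (measurableTypeR R)). Proof. exact: measurable_itv. Qed.

Definition path_occupation : {measure set 'rV[R]_n -> \bar R} :=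
  measure_function_pushforward__canonical__measure_function_Measure (mrestr mu mI) mX.

Lemma path_occupationE : occupation_measure X = path_occupation.
Proof. by apply/funext => A; rewrite /occupation_measure /= /pushforward /mrestr setIC. Qed.

Lemma path_occupation_le1 : (path_occupation setT <= 1)%E.
Proof.
rewrite -path_occupationE /occupation_measure preimage_setT setIT lebesgue_measure_itv/= lte_fin ltr01.
by rewrite -EFinB subr0.
Qed.

End path_occupation.

Section bridge_potentials.
Context {R : realType} d (T : measurableType d) (P : probability T R) (n : nat).
Notation mu := (@lebesgue_measure R).
Variables (H : R) (B : R -> T -> 'rV[R]_n) (phi : R -> 'rV[R]_n).
Hypotheses (hH : 0 < H < 1) (hB : fbridge_rV P H B).

Lemma enorm_le_sum (x : 'rV[R]_n) : enorm x <= \sum_i `|x 0 i|.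
Proof.
have S0 : 0 <= \sum_i `|x 0 i| by apply: sumr_ge0.
rewrite -[leRHS](ger0_norm S0) -sqrtr_sqr ler_wsqrtr// /dot expr2 mulr_suml.
apply: ler_sum => i _; rewrite -expr2 -[X in X <= _]real_normK ?num_real// expr2 ler_wpM2l//.
by rewrite (bigD1 i)//= lerDl sumr_ge0.
Qed.

Lemma fbridge_rV_holder00 (gamma : R) : 0 < gamma < H -> {ae P, forall w, holder00 gamma (B^~ w)}.
Proof.
move=> hg; have z01 : 0 <= (0 : R) <= 1 by rewrite lexx ler01.
have o01 : 0 <= (1 : R) <= 1 by rewrite lexx ler01.
have h i : {ae P, forall w, [/\ B 0 w 0 i = 0, B 1 w 0 i = 0 & exists2 C, 0 <= C &
    forall s t, 0 <= s <= 1 -> 0 <= t <= 1 -> `|B t w 0 i - B s w 0 i| <= C * `|t - s| `^ gamma]}.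
  have h0 := fbridge_vanish hH (hB.1 i) z01 (bridge_cov00 hH).
  have h1 := fbridge_vanish hH (hB.1 i) o01 (bridge_cov11 hH).
  have h2 := fbridge_holder hH (hB.1 i) hg.
  by apply: filterS3 h0 h1 h2 => w.
have hall := @filter_forall _ _ _ _ (ae_filter_ringOfSetsType P) h.
apply: (@filterS _ _ (ae_filter_ringOfSetsType P) _ _ _ hall) => w hw.
have /choice[C hC] (i : 'I_n) : exists C, 0 <= C /\ forall s t, 0 <= s <= 1 -> 0 <= t <= 1 ->
    `|B t w 0 i - B s w 0 i| <= C * `|t - s| `^ gamma.
  by have [_ _ [C C0 hC]] := hw i; exists C.
split; first by apply/rowP => i; have [] := hw i; rewrite mxE.
  by apply/rowP => i; have [] := hw i; rewrite mxE.
exists (\sum_i C i) => q [s [t [s01 t01 st ->]]].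
have p0 : 0 < `|t - s| `^ gamma by rewrite powR_gt0// normr_gt0 subr_eq0 eq_sym.
rewrite ler_pdivrMr// (le_trans (enorm_le_sum _))// mulr_suml; apply: ler_sum => i _.
by rewrite !mxE; exact: (hC i).2.
Qed.

Hypothesis mphi : measurable_fun (`[0, 1]%classic : set R) phi.
Hypothesis bphi : exists M : R, forall t, 0 <= t <= 1 -> enorm (phi t) <= M.

Let X w := shifted_path B phi w.

Lemma measurable_shifted_path_rV w : measurable_fun setT (X w).
Proof. by apply: measurable_fun_rV => // i; exact: (measurable_shifted_path hB mphi w i). Qed.

Lemma occupation_shifted_path w :
  occupation_measure (fun t => B t w + phi t) = occupation_measure (X w).
Proof.
apply/funext => A; rewrite /occupation_measure; congr (mu _); apply/seteqP; split => t [t01 tA];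
  split => //; move: t01 tA; rewrite /= in_itv/= => t01; by rewrite /X /shifted_path clamp_id.
Qed.

Lemma path_occupation_cube w x r :
  path_occupation (measurable_shifted_path_rV w) (cube x r) = mu (cube_times B phi w x r).
Proof.
rewrite -path_occupationE /occupation_measure; congr (mu _); apply/seteqP; split => t.
Qed.

Lemma powR_kernel_potential (kr : 'rV[R]_n -> \bar R) (A b : R) w :
  (forall z, (0 <= kr z)%E) -> 0 < b -> (forall z, z != 0 -> (kr z <= (A * enorm z `^ (- b))%:E)%E) ->
  (exists C theta, [/\ 0 <= C, b < theta & forall y k,
      (mu (cube_times B phi w y (2 ^- k)) <= (C * (2 `^ (- theta)) ^+ k)%:E)%E]) ->
  bounded_potential (potential kr (occupation_measure (fun t => B t w + phi t))) /\
  (continuous kr -> measurable_fun setT kr ->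
    finite_continuous (potential kr (occupation_measure (fun t => B t w + phi t)))).
Proof.
move=> kr0 b0 krb [C [theta [C0 bt frost]]].
rewrite occupation_shifted_path (path_occupationE (measurable_shifted_path_rV w)).
set nu := path_occupation _.
have nuT : (nu setT <= 1)%E := path_occupation_le1 _.
have fr x k : (nu (cube x (2 ^- k)) <= (C * (2 `^ (- theta)) ^+ k)%:E)%E.
  by rewrite path_occupation_cube.
(* [A] comes without a sign and is replaced by a positive bound. *)
have A'0 : 0 < `|A| + 1 by rewrite ltr_wpDl.
have krb' z : z != 0 -> (kr z <= ((`|A| + 1) * enorm z `^ (- b))%:E)%E.
  move=> z0; apply: (le_trans (krb _ z0)); rewrite lee_fin ler_wpM2r ?powR_ge0//.
  by rewrite (le_trans (ler_norm A))// lerDl.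
split; last by move=> ckr mkr; exact: (potential_continuous C0 nuT fr kr0 A'0 b0 bt krb' ckr mkr).
eexists => x; rewrite gee0_abs; last by apply: integral_ge0 => y _; exact: kr0.
exact: (potential_le C0 nuT fr kr0 A'0 b0 bt krb').
Qed.

Lemma bridge_potentials (alpha gamma : R) (g : 'rV[R]_n -> \bar R) : bessel_kernel alpha g ->
  0 < alpha < n%:R -> n%:R - (Num.max H (1 - H))^-1 < alpha -> 0 < gamma < H ->
  exists Omega1 : set T,
    [/\ measurable Omega1, P Omega1 = 1%E
      & forall w, Omega1 w ->
          let mu := occupation_measure (fun t => B t w + phi t) in
          [/\ holder00 gamma (B^~ w),
              finite_continuous (potential g mu),
              bounded_potential (potential g mu)
            & bounded_potential (potential (riesz_kernel alpha) mu)]].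
Proof.
move=> hg ha na hgam; have /andP[H0 H1] := hH; have /andP[a0 an] := ha.
(* As [max (H, 1 - H) >= H], the hypothesis leaves room for [theta] between [n - alpha] and
   [min (n, 1/H)]. *)
have nH : n%:R - alpha < H^-1.
  have : (Num.max H (1 - H))^-1 <= H^-1 by rewrite lef_pV2 ?posrE ?lt_max ?H0// le_max lexx.
  lra.
have [theta [th1 th2 th3]] : exists theta, [/\ n%:R - alpha < theta, theta < n%:R & theta < H^-1].
  have [h|h] := leP n%:R H^-1.
    by exists ((n%:R - alpha + n%:R) / 2); split; lra.
  by exists ((n%:R - alpha + H^-1) / 2); split; lra.
have thH : theta * H < 1 by rewrite -ltr_pdivlMr// div1r.
have th01 : 0 < theta < n%:R by rewrite th2 andbT; lra.
have /almost_surelyP hF := frostman_as hH hB mphi bphi th01 thH.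
have hh := fbridge_rV_holder00 hgam.
apply/almost_surelyP; apply: filterS2 hF hh => w [C C0 fr] hol.
have b0 : 0 < n%:R - alpha by rewrite subr_gt0.
have frw : exists C theta, [/\ 0 <= C, n%:R - alpha < theta & forall y k,
    (mu (cube_times B phi w y (2 ^- k)) <= (C * (2 `^ (- theta)) ^+ k)%:E)%E].
  by exists C, theta.
have [C' C'0 hC'] := bessel_kernel_bound hg ha.
have [cg g0 Ig _] := hg.
have gb z : z != 0 -> (g z <= (C' * enorm z `^ (- (n%:R - alpha)))%:E)%E.
  by rewrite opprB; exact: hC'.
have [bg cg'] := powR_kernel_potential g0 b0 gb frw.
have r0 (z : 'rV[R]_n) : (0 <= riesz_kernel alpha z)%E.
  by rewrite /riesz_kernel; case: ifP => _; rewrite ?leey// lee_fin powR_ge0.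
have rb (z : 'rV[R]_n) : z != 0 -> (riesz_kernel alpha z <= (1 * enorm z `^ (- (n%:R - alpha)))%:E)%E.
  by move=> /negPf z0; rewrite /riesz_kernel z0 mul1r opprB.
have [br _] := powR_kernel_potential r0 b0 rb frw.
split => //; apply: cg' => //; exact: (measurable_int _ Ig).
Qed.

End bridge_potentials.

(** * Local times *)

Section normal_pdf_bounds.
Context {R : realType}.

Lemma normal_pdf_le (s u : R) : 0 < s -> normal_pdf 0 s u <= s^-1.
Proof.
move=> s0; apply: (le_trans (normal_pdf_ub _ _ _)); first by rewrite gt_eqF.
rewrite /normal_peak lef_pV2 ?posrE//; last first.
  by rewrite sqrtr_gt0 -mulr_natr !mulr_gt0 ?exprn_gt0 ?pi_gt0.
rewrite -[X in X <= _](ger0_norm (ltW s0)) -sqrtr_sqr ler_wsqrtr// -mulr_natr -mulrA.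
rewrite ler_peMr ?sqr_ge0//; have := @pi_ge2 R; lra.
Qed.

Lemma expR_sqr_lip (a b : R) : `|expR (- (a ^+ 2)) - expR (- (b ^+ 2))| <= 2 * `|a - b|.
Proof.
have key (x y : R) : 0 <= x <= y -> expR (- (x ^+ 2)) - expR (- (y ^+ 2)) <= 2 * (y - x).
  move=> /andP[x0 xy]; have [h|h] := leP 1 (y - x).
    have : expR (- (x ^+ 2)) <= 1 by rewrite -[X in _ <= X]expR0 ler_expR oppr_le0 sqr_ge0.
    have := expR_ge0 (- (y ^+ 2)); lra.
  have -> : expR (- (y ^+ 2)) = expR (- (x ^+ 2)) * expR (- (y ^+ 2 - x ^+ 2)).
    by rewrite -expRD; congr expR; ring.
  have e1 := expR_ge1Dx (- (y ^+ 2 - x ^+ 2)).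
  have e2 := expR_ge0 (- (x ^+ 2)).
  have e3 : expR (- (x ^+ 2)) * (1 + x ^+ 2) <= 1.
    rewrite expRN mulrC ler_pdivrMr ?expR_gt0// mul1r; exact: expR_ge1Dx.
  (* Here [y - x < 1], so [y + x <= 2 x + 1 <= 2 (1 + x^2)], and [e3] applies. *)
  have e4 : expR (- (x ^+ 2)) * (y + x) <= 2.
    apply: (@le_trans _ _ (2 * (expR (- (x ^+ 2)) * (1 + x ^+ 2)))); last by lra.
    rewrite mulrCA ler_wpM2l//; have := sqr_ge0 (x - 1); rewrite sqrrB1 -mulr_natr; nra.
  have e5 : expR (- (x ^+ 2)) - expR (- (x ^+ 2)) * expR (- (y ^+ 2 - x ^+ 2)) <=
      expR (- (x ^+ 2)) * (y ^+ 2 - x ^+ 2).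
    by rewrite -{1}(mulr1 (expR _)) -mulrBr ler_wpM2l//; lra.
  apply: (le_trans e5).
  have -> : expR (- (x ^+ 2)) * (y ^+ 2 - x ^+ 2) = expR (- (x ^+ 2)) * (y + x) * (y - x) by ring.
  by rewrite ler_wpM2r// subr_ge0.
wlog ab : a b / `|a| <= `|b|.
  move=> wl; have [/wl//|/ltW/wl h] := leP `|a| `|b|.
  by rewrite distrC [`|a - b|]distrC.
have sq (x : R) : x ^+ 2 = `|x| ^+ 2 by rewrite real_normK ?num_real.
rewrite sq (sq b) ger0_norm; last first.
  by rewrite subr_ge0 ler_expR lerN2 lerXn2r ?nnegrE.
apply: (le_trans (key _ _ _)); first by rewrite normr_ge0.
rewrite ler_wpM2l// distrC; exact: le_trans (ler_norm _) (ler_dist_dist _ _).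
Qed.

Lemma normal_pdf_lip (s u v : R) : 0 < s ->
  `|normal_pdf 0 s u - normal_pdf 0 s v| <= 2 / s ^+ 2 * `|u - v|.
Proof.
move=> s0; have s1 : s != 0 by rewrite gt_eqF.
have s2 : 0 < Num.sqrt 2 * s by rewrite mulr_gt0// sqrtr_gt0.
have E (x : R) : normal_pdf 0 s x = normal_pdf 0 s 0 * expR (- ((x / (Num.sqrt 2 * s)) ^+ 2)).
  rewrite !normal_pdfE// /normal_fun !subr0 expr0n/= oppr0 mul0r expR0 mulr1; congr (_ * expR _).
  by rewrite expr_div_n exprMn sqr_sqrtr// -mulr_natr mulNr [2 * _]mulrC.
have p0 : 0 <= normal_pdf 0 s 0 by exact: normal_pdf_ge0.
rewrite E [normal_pdf 0 s v]E -mulrBr normrM (ger0_norm p0).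
apply: (@le_trans _ _ (s^-1 * (2 * (`|u - v| / s)))); last first.
  by rewrite le_eqVlt; apply/orP; left; apply/eqP; field.
apply: ler_pM => //; first exact: normal_pdf_le.
apply: (le_trans (expR_sqr_lip _ _)); rewrite ler_wpM2l//.
rewrite -mulrBl normrM ler_wpM2l// normfV (gtr0_norm s2) lef_pV2 ?posrE//.
by rewrite ler_peMl ?(ltW s0)// -[X in X <= _]sqrtr1 ler_wsqrtr// ler1n.
Qed.

End normal_pdf_bounds.

Section smoothed_density.
Context {R : realType} d (T : measurableType d) (P : probability T R).
Notation mu := (@lebesgue_measure R).
Variables (H : R) (X : R -> T -> R) (ph : R -> R).
Hypotheses (hH : 0 < H < 1) (hX : fbridge P H X).
Hypothesis mph : measurable_fun setT (fun t : R => ph (clamp t)).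

Definition path_gauss (k : nat) (x : R) (z : measurableTypeR R * T) : R :=
  normal_pdf 0 (2 ^- k) (X (clamp z.1) z.2 - (x - ph (clamp z.1))).

Let diff k x z := path_gauss k x z - path_gauss k.+1 x z.

Let s0 k : 0 < 2 ^- k :> R. Proof. by rewrite invr_gt0 exprn_gt0. Qed.

Lemma measurable_path_gauss k x : measurable_fun setT (path_gauss k x).
Proof.
apply: (measurableT_comp (measurable_normal_pdf _ _)).
apply: measurable_funB; first exact: (measurable_clamped_process hX).
by apply: measurable_funB => //; exact: (measurableT_comp mph measurable_fst).
Qed.

Lemma path_gauss_le k x z : 0 <= path_gauss k x z <= 2 ^+ k.
Proof. by rewrite normal_pdf_ge0//= -[2 ^+ k]invrK normal_pdf_le. Qed.

Let mdiff k x : measurable_fun setT (diff k x).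
Proof. by apply: measurable_funB; exact: measurable_path_gauss. Qed.

Let bdiff k x z : `|diff k x z| <= 2 ^+ k.+1.
Proof.
have /andP[a0 a1] := path_gauss_le k x z; have /andP[b0 b1] := path_gauss_le k.+1 x z.
have := exprn_gt0 k (ltr0n R 2); rewrite ler_norml /diff; move: a1 b1; rewrite exprS => *.
by apply/andP; split; lra.
Qed.

(** The moment bound gains [2^(-2 e k)] per factor; half of the gain is kept as the threshold
    [lam ^+ k], the other half pays for the grid. *)
Lemma smoothed_density_increments : exists2 lam : R, 2^-1 <= lam < 1 &
  exists S : set T, [/\ measurable S, P S = 1%E & forall w, S w ->
    exists k1, forall k, (k1 <= k)%N -> forall j, (j < (2 * 16 ^ k).+1)%N ->
      `|time_int (diff k (j%:R / 8 ^+ k - 2 ^+ k)) w| <= lam ^+ k].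
Proof.
have /andP[H0 H1] := hH.
have [e /andP[e0 e1] eH] : exists2 e : R, 0 < e <= 1 & H * (1 + 6 * e) < 1.
  (* Then [H (1 + 6 e) = H + H (1 - H) / 2 < 1]. *)
  exists ((1 - H) / 12); first by apply/andP; split; lra.
  nra.
have [k0 k00 lnd] := bridge_lnd hH.
(* With [p] even the moments are those of the absolute value. Of order [16^k] grid points are paid
   for by [2^(-k p e)], and [p e >= 5] leaves the ratio [1/2]. *)
have [p p0 hp] : exists2 p, [&& (0 < p)%N & ~~ odd p] & 5 <= p%:R * e.
  exists (2 * (Num.bound (5 / e)).+1)%N; first by rewrite muln_gt0 oddM.
  rewrite -ler_pdivrMr// ltW// (lt_le_trans (archi_boundP _))//; first by rewrite divr_ge0// ltW.
  by rewrite ler_nat mul2n -addnn (leq_trans (leqnSn _))// leq_addr.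
have /andP[p1 p2] := p0.
have [K K0 hK] := diff_product_le hH hX k00 lnd p1 (introT andP (conj e0 e1)).
pose b := H * (1 + 6 * e).
have b0 : 0 <= b by rewrite /b mulr_ge0 ?(ltW H0)//; lra.
pose lam : R := 2 `^ (- e).
have lam0 : 0 < lam by rewrite powR_gt0.
exists lam.
  apply/andP; split.
    by rewrite -[X in X <= _](powR_inv1 (ltW (ltr0n R 2))) ler_powR ?ler1n// lerN2.
  by rewrite /lam powRN invf_lt1 ?powR_gt0//;
    have := @gt0_ltr_powR R e e0 1 2; rewrite powR1 !nnegrE ltr1n; exact.
(* Mesh [8^-k] on [[-2^k, 2^k]]: the smoothed densities have Lipschitz constants of order [4^k], so
   rounding to the grid costs of order [2^-k <= lam ^+ k]. *)
pose I k : finType := 'I_(2 * 16 ^ k).+1.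
pose gr k (j : I k) : R := j%:R / 8 ^+ k - 2 ^+ k.
pose A k (j : I k) w := time_int (diff k (gr k j)) w ^+ p / (lam ^+ k) ^+ p.
(* [K + 1] instead of [K], because [rprod_pinfty] wants a positive constant. *)
pose c0 := rcst b 1 p 0 * (K + 1) ^+ p.
pose D k := c0 * ((2 ^- k) `^ (2 * e)) ^+ p / (lam ^+ k) ^+ p.
have IA0 k j : rint P setT (fun w => time_int (diff k (gr k j)) w ^+ p).
  have IC : rint P setT (fun=> (2 ^+ k.+1) ^+ p) by exact: finite_measure_integrable_cst.
  apply: (le_rint measurableT _ _ IC).
    by apply: measurable_funX; exact: (measurable_time_int P (mdiff k (gr k j)) (bdiff k (gr k j))).
  move=> w _; rewrite normrX lerXn2r ?nnegrE ?exprn_ge0//.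
  exact: (time_int_le (mdiff k (gr k j)) (bdiff k (gr k j))).
have rc0 : 0 <= rcst b 1 p 0 by apply: rcst_ge0 => //; rewrite b0.
have c00 : 0 <= c0 by rewrite mulr_ge0// exprn_ge0// addr_ge0.
have mom k j : \int[P]_w (time_int (diff k (gr k j)) w ^+ p) <= c0 * ((2 ^- k) `^ (2 * e)) ^+ p.
  have C1 : 0 < (K + 1) * (2 ^- k) `^ (2 * e) by rewrite mulr_gt0 ?powR_gt0// ltr_wpDl.
  rewrite /c0 -mulrA -exprMn.
  apply: (moment_rprod_le (mdiff k (gr k j)) (bdiff k (gr k j))).
  - by rewrite b0.
  - exact: ltW.
  move=> l lp l01; have [spl|nspl] := boolP (spread l); last by rewrite rprod_pinfty ?leey.
  have [|T0 Tle] := @rprod_ge R b ((K + 1) * (2 ^- k) `^ (2 * e))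
    (fun t l => K * (2 ^- k) `^ (2 * e) * gap t l `^ (- b)) l (ltW C1) b0 _ spl l01.
    move=> t l' t01 tl'; rewrite !mulr_ge0 ?powR_ge0//= ler_wpM2r ?powR_ge0//.
    by rewrite ler_wpM2r ?powR_ge0// lerDl.
  apply: (le_trans _ Tle); rewrite lee_fin.
  have := hK l (fun t => gr k j - ph (clamp t)) (2 ^- k) (s0 k) lp spl l01.
  rewrite -/b; apply: le_trans; rewrite (_ : \int[P]_w gprod (diff k (gr k j)) l w = 
    \int[P]_w0 \prod_(t <- l)
     (normal_pdf 0 (2 ^- k) (X (clamp t) w0 - (gr k j - ph (clamp t))) -
      normal_pdf 0 (2 ^- k / 2) (X (clamp t) w0 - (gr k j - ph (clamp t))))); first exact: ler_norm.
  apply: eq_Rintegral => w _; rewrite /gprod; apply: eq_bigr => t _.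
  by rewrite /diff /path_gauss /= exprSr invfM.
have [||||||S [mS PS hS]] := @eventually_le1 R _ T P I A D (3 * c0) 2^-1.
- move=> k j; apply: (eq_rint measurableT _ (rintZ measurableT ((lam ^+ k) ^+ p)^-1 (IA0 k j))) => w _.
  by rewrite mulrC.
- by move=> k j w; rewrite /A divr_ge0 ?exprn_even_ge0// ?exprn_ge0 ?exprn_ge0// ltW.
- move=> k j; rewrite /A /D; under eq_Rintegral do rewrite mulrC.
  rewrite (RintegralZl _ measurableT (IA0 k j)) mulrC ler_wpM2r//.
  by rewrite invr_ge0 !exprn_ge0// ltW.
- by rewrite mulr_ge0.
- by apply/andP; split; lra.
- move=> k; rewrite card_ord.
  have N3 : (2 * 16 ^ k).+1%:R <= 3 * 16 ^+ k :> R.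
    rewrite -natr1 natrM natrX.
    have : 1 <= 16 ^+ k :> R by rewrite exprn_ege1// ler1n.
    by lra.
  have -> : D k = c0 * (2 `^ (- (p%:R * e))) ^+ k.
    have rk : (2 ^- k) `^ (2 * e) = lam ^+ k * lam ^+ k.
      rewrite -exprD -(powR_invn k (ler0n R 2)) -powRrM -(powR_mulrn _ (ltW lam0)) -powRrM natrD.
      by congr (_ `^ _); ring.
    have -> : 2 `^ (- (p%:R * e)) = lam ^+ p.
      by rewrite -(powR_mulrn _ (ltW lam0)) -powRrM; congr (_ `^ _); ring.
    rewrite /D rk exprMn -!mulrA mulfV ?mulr1; last by rewrite !expf_neq0 ?gt_eqF.
    by rewrite -!exprM mulnC.
  apply: (@le_trans _ _ (3 * 16 ^+ k * (c0 * (2 `^ (- (p%:R * e))) ^+ k))).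
    by rewrite ler_wpM2r// mulr_ge0 ?exprn_ge0 ?powR_ge0.
  have h2 : 16 * 2 `^ (- (p%:R * e)) <= 2^-1 :> R.
    have -> : 16 = 2 `^ 4%:R :> R by rewrite powR_mulrn//; ring.
    rewrite -powRD ?pnatr_eq0 ?implybT// -[X in _ <= X]powR_inv1// ler_powR ?ler1n//; lra.
  have -> : 3 * 16 ^+ k * (c0 * (2 `^ (- (p%:R * e))) ^+ k) =
      3 * c0 * (16 * 2 `^ (- (p%:R * e))) ^+ k by rewrite exprMn; ring.
  apply: ler_wpM2l; first by rewrite mulr_ge0.
  by rewrite lerXn2r ?nnegrE// mulr_ge0// powR_ge0.
exists S; split => // w /hS[k1 hk1]; exists k1 => k kk j jk.
have := hk1 k kk (Ordinal jk); rewrite /A ler_pdivrMr ?exprn_gt0// mul1r /gr /=.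
set t := time_int _ _.
have -> : t ^+ p = `|t| ^+ p by rewrite -normrX ger0_norm// exprn_even_ge0.
by rewrite ler_pXn2r ?nnegrE ?exprn_ge0 ?(ltW lam0).
Qed.

End smoothed_density.

Section gaussian_smoothing.
Context {R : realType}.
Notation mu := (@lebesgue_measure R).
Local Notation I01 := (`[0%R, 1%R]%classic : set (measurableTypeR R)).

Let increment_arith (E l : R) : E <= 2 * l -> 4 * E + (l + E) <= 11 * l.
Proof. by move=> h; lra. Qed.

Let tail_arith (q e : R) : 0 < e -> q < e / 4 -> q + e / 4 + q < e.
Proof. by move=> e0 h; lra. Qed.

Variables (xi : measurableTypeR R -> R).
Hypothesis mxi : measurable_fun setT xi.

Definition smoothed (k : nat) (x : R) : R :=
  \int[mu]_(s in I01) normal_pdf 0 (2 ^- k) (xi s - x).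

Let s0 k : 0 < 2 ^- k :> R. Proof. by rewrite invr_gt0 exprn_gt0. Qed.

Let mI : measurable I01. Proof. exact: measurable_itv. Qed.

Let Icst (c : R) : 0 <= c -> rint mu I01 (fun=> c).
Proof.
move=> c0; apply: rint_ge0 => //; rewrite integral_cst//= lebesgue_measure_itv/= lte01.
by rewrite -EFinD -EFinM ltry.
Qed.

Let Rint01_le (f : measurableTypeR R -> R) c : rint mu I01 f -> (forall s, `|f s| <= c) ->
  `|\int[mu]_(s in I01) f s| <= c.
Proof.
move=> If fc; have c0 : 0 <= c by exact: le_trans (fc 0).
apply: (le_trans (le_normr_Rintegral _ If)) => //.
apply: (@le_trans _ _ (\int[mu]_(s in I01) c)).
  by apply: le_Rintegral => //; [exact: integrable_norm If|exact: Icst].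
by rewrite Rintegral_cst//= lebesgue_measure_itv/= lte01 -EFinD/= subr0 mulr1.
Qed.

Let mp k x : measurable_fun setT (fun s => normal_pdf 0 (2 ^- k) (xi s - x)).
Proof. by apply: (measurableT_comp (measurable_normal_pdf _ _)); exact: measurable_funB. Qed.

Lemma rint_smoothed k x : rint mu I01 (fun s => normal_pdf 0 (2 ^- k) (xi s - x)).
Proof.
apply: (le_rint _ _ _ (Icst (ltW (exprn_gt0 k (ltr0n R 2))))) => //.
  exact: measurable_funTS.
move=> s _; rewrite (ger0_norm (normal_pdf_ge0 _ _ _)).
by have := normal_pdf_le (xi s - x) (s0 k); rewrite invrK.
Qed.

Lemma smoothed_ge0 k x : 0 <= smoothed k x.
Proof. by apply: Rintegral_ge0 => s _; exact: normal_pdf_ge0. Qed.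

Lemma smoothed_lip k x y : `|smoothed k x - smoothed k y| <= 2 * 4 ^+ k * `|x - y|.
Proof.
rewrite /smoothed -(RintegralB _ (rint_smoothed k x) (rint_smoothed k y))//.
apply: Rint01_le; first exact: rintB (rint_smoothed k x) (rint_smoothed k y).
move=> s; apply: (le_trans (normal_pdf_lip _ _ (s0 k))).
rewrite le_eqVlt; apply/orP; left; apply/eqP; congr (_ * _).
  by rewrite exprVn invrK -exprM mulnC exprM; congr (_ * _ ^+ _); ring.
by rewrite -normrN; congr `|_|; ring.
Qed.

Variables (lam : R) (k1 : nat).
Hypothesis lam01 : 2^-1 <= lam < 1.
Hypothesis grid_increment : forall k, (k1 <= k)%N -> forall j, (j < (2 * 16 ^ k).+1)%N ->
  `|smoothed k (j%:R / 8 ^+ k - 2 ^+ k) - smoothed k.+1 (j%:R / 8 ^+ k - 2 ^+ k)| <= lam ^+ k.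

Let lam0 : 0 < lam. Proof. by have /andP[h _] := lam01; apply: lt_le_trans h. Qed.
Let lam1 : lam < 1. Proof. by have /andP[] := lam01. Qed.

(** In units of [lam ^+ k] the grid increment contributes 1, and rounding to the grid contributes 2
    at level [k] and 8 at level [k.+1]. *)
Lemma smoothed_increment k x : (k1 <= k)%N -> `|x| <= 2 ^+ k ->
  `|smoothed k.+1 x - smoothed k x| <= 11 * lam ^+ k.
Proof.
move=> kk; rewrite ler_norml => /andP[x1 x2].
have p8 : 0 < 8 ^+ k :> R by rewrite exprn_gt0.
pose y := (x + 2 ^+ k) * 8 ^+ k.
have y0 : 0 <= y by rewrite mulr_ge0 ?(ltW p8)//; lra.
have yN : (Num.truncn y < (2 * 16 ^ k).+1)%N.
  rewrite ltnS -(ler_nat R) (le_trans (y := y))//; first by have /andP[] := truncn_itv y0.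
  rewrite /y natrM natrX (_ : 16 = 2 * 8 :> R); last by ring.
  by rewrite exprMn mulrA ler_wpM2r ?(ltW p8)//; lra.
have := grid_increment kk yN; set z := (Num.truncn y)%:R / 8 ^+ k - 2 ^+ k => hz.
have xz : `|x - z| <= 8 ^- k.
  have /andP[t1 t2] := truncn_itv y0.
  have -> : x - z = (y - (Num.truncn y)%:R) / 8 ^+ k.
    by rewrite /z /y mulrBl mulfK ?gt_eqF//; ring.
  rewrite ger0_norm; last by rewrite divr_ge0 ?(ltW p8)// subr_ge0.
  rewrite ler_pdivrMr// mulVf ?gt_eqF//; move: t2; rewrite -natr1; lra.
have h1 := smoothed_lip k x z; have h2 := smoothed_lip k.+1 x z.
have e : 2 * 4 ^+ k * `|x - z| <= 2 * lam ^+ k.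
  rewrite -mulrA ler_wpM2l//; apply: (@le_trans _ _ (4 ^+ k * 8 ^- k)).
    by rewrite ler_wpM2l// exprn_ge0.
  rewrite -exprVn -exprMn (_ : 4 / 8 = 2^-1); last by field.
  by have /andP[h _] := lam01; rewrite lerXn2r ?nnegrE// ltW.
have e' : 2 * 4 ^+ k.+1 * `|x - z| = 4 * (2 * 4 ^+ k * `|x - z|) by rewrite exprS; ring.
rewrite e' in h2.
have l0 : 0 <= lam ^+ k by rewrite exprn_ge0// ltW.
rewrite distrC in hz; rewrite distrC in h1.
rewrite (le_trans (ler_distD (smoothed k.+1 z) _ _))// (le_trans (lerD h2 (ler_distD (smoothed k z) _ _)))//.
exact: (le_trans (lerD (lexx _) (lerD hz h1)) (increment_arith e)).
Qed.

Let D := 11 / (1 - lam).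

Let D0 : 0 <= D. Proof. by rewrite divr_ge0// subr_ge0 ltW. Qed.

(** [D] makes [11 * lam ^+ k] exactly [D] times the drop from [lam ^+ k] to [lam ^+ k.+1], so the
    induction telescopes. *)
Lemma smoothed_telescope k m x : (k1 <= k)%N -> `|x| <= 2 ^+ k ->
  `|smoothed (k + m) x - smoothed k x| <= D * (lam ^+ k - lam ^+ (k + m)).
Proof.
move=> kk xk; elim: m => [|m IH]; first by rewrite addn0 !subrr normr0 mulr0.
have h := @smoothed_increment (k + m) x (leq_trans kk (leq_addr _ _)).
have {}h : `|smoothed (k + m).+1 x - smoothed (k + m) x| <= 11 * lam ^+ (k + m).
  by apply: h; rewrite (le_trans xk)// ler_weXn2l ?ler1n// leq_addr.
have DE : 11 * lam ^+ (k + m) = D * (lam ^+ (k + m) - lam ^+ (k + m).+1).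
  by rewrite exprS /D; field; rewrite gt_eqF// subr_gt0.
rewrite addnS; apply: (le_trans (ler_distD (smoothed (k + m) x) _ _)).
have -> : D * (lam ^+ k - lam ^+ (k + m).+1) =
    D * (lam ^+ (k + m) - lam ^+ (k + m).+1) + D * (lam ^+ k - lam ^+ (k + m)) by ring.
by rewrite -DE lerD.
Qed.

Definition smoothed_lim (x : R) : R := lim (smoothed n x @[n --> \oo]).

Let kx (x : R) : exists k, (k1 <= k)%N /\ `|x| <= 2 ^+ k.
Proof.
exists (maxn k1 (Num.bound `|x|)); rewrite leq_maxl; split => //.
have /ltW h : `|x| < (Num.bound `|x|)%:R by exact: archi_boundP.
apply: (le_trans h); rewrite -natrX ler_nat; apply: (@leq_trans (2 ^ Num.bound `|x|)%N).
  by rewrite ltnW// ltn_expl.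
by rewrite leq_exp2l// leq_maxr.
Qed.

Lemma smoothed_cvg x : smoothed n x @[n --> \oo] --> smoothed_lim x.
Proof.
apply/cauchy_cvgP/cauchy_exP => e e0; have [k [kk xk]] := kx x.
have [N [kN hN]] : exists N, (k <= N)%N /\ D * lam ^+ N < e.
  have cv : D * lam ^+ N @[N --> \oo] --> (0 : R).
    rewrite -(mulr0 D); apply: cvgM; first exact: cvg_cst.
    by apply: cvg_expr; rewrite (gtr0_norm lam0).
  have /cvgrPdist_lt/(_ _ e0) [N _ hN] := cv.
  exists (maxn k N); rewrite leq_maxl; split => //.
  have := hN (maxn k N) (leq_maxr _ _); rewrite sub0r normrN; exact: le_lt_trans (ler_norm _).
exists (smoothed N x); exists N => // n /= Nn.
rewrite /ball /= distrC -(subnKC Nn); apply: le_lt_trans hN.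
apply: (le_trans (smoothed_telescope _ _ _)); first exact: leq_trans kN.
  by rewrite (le_trans xk)// ler_weXn2l ?ler1n.
by rewrite ler_wpM2l// lerBlDr lerDl exprn_ge0// ltW.
Qed.

Lemma smoothed_lim_dist k x : (k1 <= k)%N -> `|x| <= 2 ^+ k ->
  `|smoothed_lim x - smoothed k x| <= D * lam ^+ k.
Proof.
move=> kk xk; apply/ler_addgt0Pr => e e0.
have /cvgrPdist_lt/(_ _ e0) [N _ hN] := smoothed_cvg (x := x).
have h1 := hN (k + N)%N (leq_addl _ _); have h2 := smoothed_telescope N kk xk.
have h3 : D * (lam ^+ k - lam ^+ (k + N)) <= D * lam ^+ k.
  by rewrite ler_wpM2l// lerBlDr lerDl exprn_ge0// ltW.
rewrite (le_trans (ler_distD (smoothed (k + N) x) _ _))// addrC lerD//.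
  exact: le_trans h2 h3.
exact: ltW.
Qed.

Lemma smoothed_lim_ge0 x : 0 <= smoothed_lim x.
Proof.
apply: limr_ge; first by apply/cvg_ex; eexists; exact: smoothed_cvg.
by apply: nearW => n; exact: smoothed_ge0.
Qed.

Let small_tail (M e : R) : 0 < e -> exists k, [/\ (k1 <= k)%N, M <= 2 ^+ k & D * lam ^+ k < e].
Proof.
move=> e0; have [k [kk xk]] := kx M.
have cv : D * lam ^+ N @[N --> \oo] --> (0 : R).
  rewrite -(mulr0 D); apply: cvgM; first exact: cvg_cst.
  by apply: cvg_expr; rewrite (gtr0_norm lam0).
have /cvgrPdist_lt/(_ _ e0) [N _ hN] := cv.
exists (maxn k N); split; first exact: leq_trans (leq_maxl _ _).
  by rewrite (le_trans (ler_norm _))// (le_trans xk)// ler_weXn2l ?ler1n// leq_maxl.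
have := hN (maxn k N) (leq_maxr _ _); rewrite sub0r normrN; exact: le_lt_trans (ler_norm _).
Qed.

Lemma smoothed_lim_continuous : continuous smoothed_lim.
Proof.
move=> x; apply/cvgrPdist_lt => e e0.
have e4 : 0 < e / 4 by rewrite divr_gt0.
have [k [kk xk hk]] := small_tail (`|x| + 1) e4.
pose c : R := 2 * 4 ^+ k; have c0 : 0 < c by rewrite mulr_gt0// exprn_gt0.
near=> y.
have xy1 : `|x - y| < 1 by near: y; exact: cvgr_dist_lt.
have xyc : `|x - y| < e / 4 / c.
  near: y; apply: cvgr_dist_lt => //; by rewrite divr_gt0.
have yk : `|y| <= 2 ^+ k.
  apply: le_trans xk; have -> : y = x - (x - y) by ring.
  by rewrite (le_trans (ler_normB _ _))// lerD// ltW.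
have h1 := smoothed_lim_dist kk yk.
have h2 : `|smoothed_lim x - smoothed k x| <= D * lam ^+ k.
  by apply: smoothed_lim_dist => //; rewrite (le_trans _ xk)// lerDl.
have h3 : `|smoothed k x - smoothed k y| <= e / 4.
  by apply: (le_trans (smoothed_lip _ _ _)); rewrite -/c mulrC -ler_pdivlMr// ltW.
have h4 : `|smoothed_lim x - smoothed k y| <= D * lam ^+ k + e / 4.
  by rewrite (le_trans (ler_distD (smoothed k x) _ _))// lerD.
have h5 : `|smoothed_lim x - smoothed_lim y| <= (D * lam ^+ k + e / 4) + D * lam ^+ k.
  by rewrite (le_trans (ler_distD (smoothed k y) _ _))// [`|smoothed k y - _|]distrC lerD.
exact: le_lt_trans h5 (tail_arith e0 hk).
Unshelve. all: by end_near. Qed.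

(** Uniform in [k] on bounded sets: the majorant for dominated convergence in [occupation_itv]. *)
Lemma smoothed_bounded (M : R) :
  exists c k2, forall k x, (k2 <= k)%N -> `|x| <= M -> smoothed k x <= c.
Proof.
have [k2 [kk Mk]] := kx M; exists (2 ^+ k2 + D), k2 => k x k2k xM.
have xk : `|x| <= 2 ^+ k2 by rewrite (le_trans xM)// (le_trans (ler_norm _)).
have h1 : smoothed k2 x <= 2 ^+ k2.
  apply: (le_trans (ler_norm _)); apply: Rint01_le; first exact: rint_smoothed.
  move=> s; rewrite (ger0_norm (normal_pdf_ge0 _ _ _)).
  by have := normal_pdf_le (xi s - x) (s0 k2); rewrite invrK.
have := smoothed_telescope (k - k2) kk xk; rewrite subnKC// => h2.
have h3 : D * (lam ^+ k2 - lam ^+ k) <= D.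
  rewrite ler_piMr// lerBlDr (le_trans (exprn_ile1 _ (ltW lam0) (ltW lam1)))//.
  by rewrite lerDl exprn_ge0// ltW.
rewrite -(subrK (smoothed k2 x) (smoothed k x)) addrC lerD//.
exact: le_trans (ler_norm _) (le_trans h2 h3).
Qed.

End gaussian_smoothing.

Section density_measure.
Context d (T : measurableType d) (R : realType) (m : {measure set T -> \bar R}).
Variable f : T -> R.
Hypotheses (mf : measurable_fun setT f) (f0 : forall x, 0 <= f x).

Definition density_measure (A : set T) : \bar R := (\int[m]_(x in A) (f x)%:E)%E.

Let density0 : density_measure set0 = 0%E.
Proof. by rewrite /density_measure integral_set0. Qed.

Let density_ge0 A : (0 <= density_measure A)%E.
Proof. by apply: integral_ge0 => x _; rewrite lee_fin. Qed.

Let density_sigma_additive : semi_sigma_additive density_measure.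
Proof.
move=> A mA tA mUA; rewrite /density_measure ge0_integral_bigcup//.
- by apply: is_cvg_nneseries => n _ _; exact: density_ge0.
- by apply/measurable_EFinP; exact: measurable_funTS.
- by move=> x _; rewrite lee_fin.
Qed.

(** Packed as a measure so that it can be compared with the occupation measure by uniqueness. *)
Definition the_density_measure : {measure set T -> \bar R} :=
  HB.pack density_measure (isMeasure.Build _ _ _ density_measure density0 density_ge0 density_sigma_additive).

End density_measure.

Section gaussian_interval.
Context {R : realType}.
Notation mu := (@lebesgue_measure R).

Lemma normal_pdf_sym (s z x : R) : s != 0 -> normal_pdf 0 s (z - x) = normal_pdf z s x.
Proof. by move=> s0; rewrite !normal_pdfE// /normal_fun subr0 -[(z - x) ^+ 2]sqrrN opprB. Qed.

(** Chebyshev's inequality: where the indicator at [x] can differ from that at [z], the quotient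
    [(x - z)^2 / e^2] is at least 1. *)
Lemma normal_near_indic (J : set (measurableTypeR R)) (z s e : R) : measurable J -> 0 < s -> 0 < e ->
  (forall x, `|x - z| < e -> J x <-> J z) ->
  `|\int[mu]_x (\1_J x * normal_pdf z s x) - \1_J z| <= s ^+ 2 / e ^+ 2.
Proof.
move=> mJ s0 e0 hJ; have s1 : s != 0 by rewrite gt_eqF.
have Ip : rint mu setT (normal_pdf z s) by exact: integrable_normal_pdf.
have mi : measurable_fun setT (\1_J : measurableTypeR R -> R) by exact: measurable_indic.
have IJ : rint mu setT (fun x => \1_J x * normal_pdf z s x).
  apply: (le_rint measurableT _ _ Ip).
    by apply: measurable_funM => //; exact: measurable_normal_pdf.
  move=> x _; rewrite normrM (ger0_norm (normal_pdf_ge0 _ _ _)) ler_piMl ?normal_pdf_ge0//.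
  by rewrite indicE; case: (_ \in _); rewrite ?normr1 ?normr0.
have Iz := rintZ measurableT (\1_J z) Ip.
have -> : \1_J z = \int[mu]_x (\1_J z * normal_pdf z s x).
  by rewrite (RintegralZl _ measurableT Ip) Rintegral_normal_pdf// mulr1.
rewrite -(RintegralB measurableT IJ Iz).
have Iv := rintZ measurableT (e ^- 2) (rint_normal_sq z s1).
have IB := rintB measurableT IJ Iz.
apply: (le_trans (le_normr_Rintegral measurableT IB)).
rewrite [X in _ <= X]mulrC -(Rintegral_normal_var z s1) -(RintegralZl _ measurableT (rint_normal_sq z s1)).
apply: le_Rintegral => //; first exact: integrable_norm IB.
move=> x _; rewrite -mulrBl normrM (ger0_norm (normal_pdf_ge0 _ _ _)) mulrA ler_wpM2r ?normal_pdf_ge0//.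
have [h|h] := ltP `|x - z| e.
  have [h1 h2] := hJ x h; rewrite !indicE (_ : (x \in J) = (z \in J)); last first.
    by apply/idP/idP => /set_mem ?; apply/mem_set; auto.
  rewrite subrr normr0; apply: mulr_ge0; last exact: sqr_ge0.
  by rewrite invr_ge0 exprn_ge0// ltW.
apply: (@le_trans _ _ 1).
  by rewrite !indicE; case: (_ \in _); case: (_ \in _); rewrite ?subrr ?subr0 ?sub0r ?normrN ?normr1 ?normr0.
rewrite mulrC ler_pdivlMr ?exprn_gt0// mul1r -[X in _ <= X]real_normK ?num_real//.
by rewrite lerXn2r ?nnegrE// ltW.
Qed.

End gaussian_interval.

Section occupation_density.
Context {R : realType}.
Notation mu := (@lebesgue_measure R).
Local Notation I01 := (`[0%R, 1%R]%classic : set (measurableTypeR R)).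
Variables (xi : measurableTypeR R -> R).
Hypothesis mxi : measurable_fun setT xi.
Hypothesis no_atom : forall c, mu (I01 `&` xi @^-1` [set c]) = 0%E.
Variable L : R -> R.
Hypotheses (L0 : forall x, 0 <= L x) (mL : measurable_fun setT L).
Hypothesis smL : forall x, smoothed xi k x @[k --> \oo] --> L x.
Hypothesis smb : forall M, exists c k2, forall k x, (k2 <= k)%N -> `|x| <= M -> smoothed xi k x <= c.

Let mI : measurable I01. Proof. exact: measurable_itv. Qed.
Let s0 k : 0 < 2 ^- k :> R. Proof. by rewrite invr_gt0 exprn_gt0. Qed.

Let q (J : set (measurableTypeR R)) k z : R := \int[mu]_x (\1_J x * normal_pdf z (2 ^- k) x).

Let Ipdf k z (J : set (measurableTypeR R)) : measurable J ->
  rint mu setT (fun x => \1_J x * normal_pdf z (2 ^- k) x).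
Proof.
move=> mJ; have Ip : rint mu setT (normal_pdf z (2 ^- k)).
  by apply: integrable_normal_pdf.
apply: (le_rint measurableT _ _ Ip).
  by apply: measurable_funM => //; exact: measurable_normal_pdf.
move=> x _; rewrite normrM (ger0_norm (normal_pdf_ge0 _ _ _)) ler_piMl ?normal_pdf_ge0//.
by rewrite indicE; case: (_ \in _); rewrite ?normr1 ?normr0.
Qed.

Let q01 J k z : measurable J -> 0 <= q J k z <= 1.
Proof.
move=> mJ; have s1 : 2 ^- k != 0 :> R by rewrite gt_eqF.
apply/andP; split; first by apply: Rintegral_ge0 => x _; rewrite mulr_ge0 ?normal_pdf_ge0.
rewrite -(Rintegral_normal_pdf z (2 ^- k)); apply: le_Rintegral => //.
- exact: Ipdf.
- exact: integrable_normal_pdf.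
by move=> x _; rewrite ler_piMl ?normal_pdf_ge0// indicE; case: (_ \in _).
Qed.

Let smooth_fubini (J : set (measurableTypeR R)) k : measurable J ->
  measurable_fun setT (fun s => \1_I01 s * q J k (xi s)) /\
  (\int[mu]_x (\1_J x * smoothed xi k x)%:E = \int[mu]_s (\1_I01 s * q J k (xi s))%:E)%E.
Proof.
move=> mJ; pose f (z : measurableTypeR R * measurableTypeR R) : \bar R :=
  (\1_J z.1 * (\1_I01 z.2 * normal_pdf 0 (2 ^- k) (xi z.2 - z.1)))%:E.
have mf : measurable_fun setT f.
  apply/measurable_EFinP; apply: measurable_funM.
    by apply: (measurableT_comp _ measurable_fst); exact: measurable_indic.
  apply: measurable_funM.
    by apply: (measurableT_comp _ measurable_snd); exact: measurable_indic.
  apply: (measurableT_comp (measurable_normal_pdf _ _)).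
  by apply: measurable_funB; [exact: (measurableT_comp mxi measurable_snd)|exact: measurable_fst].
have f0 z : (0 <= f z)%E by rewrite lee_fin !mulr_ge0 ?normal_pdf_ge0.
have := @fubini_tonelli _ _ _ _ R mu mu f mf f0.
rewrite (_ : (fun x => \int[mu]_y f (x, y))%E = (fun x => (\1_J x * smoothed xi k x)%:E)); last first.
  apply/funext => x; have Is := rint_smoothed mxi k x.
  rewrite /f /=; under eq_integral do rewrite EFinM.
  have Is' : rint mu setT (fun s => \1_I01 s * normal_pdf 0 (2 ^- k) (xi s - x)).
    have := (integrable_mkcond _ mI).1 Is; apply: eq_integrable => // s _.
    by rewrite /= patchE indicE /=; case: ifP => _; rewrite ?mul1r ?mul0r.
  rewrite ge0_integralZl_EFin//; last 2 first.
  - by move=> s _; rewrite lee_fin mulr_ge0 ?normal_pdf_ge0.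
  - by apply/measurable_EFinP; exact: rint_meas Is'.
  rewrite (rintE measurableT Is') EFinM; congr (_ * _%:E)%E.
  rewrite /smoothed [RHS]Rintegral_mkcond; apply: eq_Rintegral => s _.
  by rewrite /patch indicE; case: ifP => _; rewrite ?mul1r ?mul0r.
have mG := @measurable_fun_fubini_tonelli_G _ _ _ _ R mu f mf f0.
have EG : (fun s => \int[mu]_x f (x, s))%E = (fun s => (\1_I01 s * q J k (xi s))%:E).
  apply/funext => s; rewrite /f /=.
  transitivity (\int[mu]_x ((\1_I01 s)%:E * (\1_J x * normal_pdf (xi s) (2 ^- k) x)%:E))%E.
    apply: eq_integral => x _; rewrite -EFinM normal_pdf_sym ?gt_eqF//; congr EFin; ring.
  rewrite ge0_integralZl_EFin//.
  - by rewrite (rintE measurableT (Ipdf k (xi s) mJ)) -EFinM.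
  - by move=> x _; rewrite lee_fin mulr_ge0 ?normal_pdf_ge0.
  - by apply/measurable_EFinP; exact: rint_meas (Ipdf k (xi s) mJ).
move=> ->; rewrite EG; split => //.
by move: mG; rewrite /fubini_G EG => /measurable_EFinP.
Qed.

Let q_cvg (a b z : R) : z != a -> z != b ->
  q `]a, b]%classic k z @[k --> \oo] --> (\1_(`]a, b]%classic) z : R).
Proof.
move=> za zb; have mJ : measurable (`]a, b]%classic : set (measurableTypeR R)) by exact: measurable_itv.
pose e := Num.min `|z - a| `|z - b|.
have e0 : 0 < e by rewrite lt_min !normr_gt0 !subr_eq0 za.
have hJ (x : R) : `|x - z| < e -> `]a, b]%classic x <-> `]a, b]%classic z.
  have side (c : R) : `|x - z| < `|z - c| -> (z < c -> x < c) /\ (c < z -> c < x).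
    move=> h; split => zc; move: h; [rewrite (@ltr0_norm _ (z - c)) ?subr_lt0//|rewrite (@gtr0_norm _ (z - c)) ?subr_gt0//];
      rewrite ltr_norml => /andP[]; lra.
  rewrite lt_min => /andP[/side[sa1 sa2] /side[sb1 sb2]]; rewrite /= !in_itv/=.
  by move: za zb; rewrite !neq_lt => /orP[/[dup] ha /sa1 ha'|/[dup] ha /sa2 ha']
    /orP[/[dup] hb /sb1 hb'|/[dup] hb /sb2 hb']; split => /andP[h5 h6]; apply/andP; split; lra.
apply/cvgrPdist_le => r r0.
have cv : (2 ^- 1 ^+ 2) ^+ k / e ^+ 2 @[k --> \oo] --> (0 : R).
  rewrite -(mul0r (e ^- 2)); apply: cvgM; last exact: cvg_cst.
  apply: cvg_expr; rewrite ger0_norm; last by rewrite exprn_ge0.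
  by rewrite expr1 expr2; lra.
have /cvgrPdist_le/(_ _ r0) [N _ hN] := cv.
exists N => // k /= Nk; rewrite distrC.
apply: (le_trans (normal_near_indic mJ (s0 k) e0 hJ)).
have := hN k Nk; rewrite sub0r normrN; apply: le_trans.
by rewrite -exprM mulnC exprM -exprVn expr1 (le_trans _ (ler_norm _)).
Qed.

Let cvg_shift (u : nat -> R) (l : R) N : u k @[k --> \oo] --> l -> u (k + N)%N @[k --> \oo] --> l.
Proof. by move=> ul; apply: (cvg_comp _ _ (cvg_addnr N) ul). Qed.

(** The smoothed density is integrated over the interval in two ways. Directly, it converges to the
    integral of [L]. By Fubini it is a time integral of normal probabilities of the interval, which
    converge to its indicator along the path. *)
Lemma occupation_itv (a b : R) :
  mu (I01 `&` xi @^-1` `]a, b]%classic) = (\int[mu]_(x in `]a, b]%classic) (L x)%:E)%E.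
Proof.
set J : set (measurableTypeR R) := `]a, b]%classic.
have mJ : measurable J by exact: measurable_itv.
have mxJ : measurable (xi @^-1` J) by rewrite -[X in measurable X]setTI; exact: mxi.
(* The uniform bound starts at index [k2], hence the shifted sequences below. *)
have [c [k2 hc]] := smb (`|a| + `|b|).
have cJ x k : J x -> `|smoothed xi (k + k2) x| <= c.
  rewrite /J /= in_itv/= => /andP[ax xb]; rewrite ger0_norm ?smoothed_ge0//.
  apply: hc; first exact: leq_addl.
  have := ler_norm a; have := ler_norm b; have := ler_norm (- a); have := ler_norm (- b).
  by rewrite !normrN ler_norml => *; apply/andP; split; lra.
have msm k : measurable_fun setT (smoothed xi k).
  apply: continuous_measurable_fun => x; apply/cvgrPdist_lt => e e0.
  have p0 : 0 < 2 * 4 ^+ k :> R by rewrite mulr_gt0// exprn_gt0.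
  near=> y; apply: (le_lt_trans (smoothed_lip mxi _ _ _)).
  rewrite mulrC -ltr_pdivlMr//; near: y; apply: cvgr_dist_lt => //; exact: divr_gt0.
have smL' (y : R) : smoothed xi (k + k2) y @[k --> \oo] --> L y.
  exact: (cvg_shift k2 (@smL y)).
have lhs : (\int[mu]_x (\1_J x * smoothed xi (k + k2) x)%:E)%E @[k --> \oo] -->
    (\int[mu]_x (\1_J x * L x)%:E)%E.
  have Idom : rint mu setT (fun x => c * \1_J x).
    apply: rintZ => //; exact: (@integrable_indic_itv R a b false false).
  have [] := @dominated_convergence _ _ R mu setT measurableT
    (fun k x => (\1_J x * smoothed xi (k + k2) x)%:E) (fun x => (\1_J x * L x)%:E) (fun x => (c * \1_J x)%:E).
  - by move=> k; apply/measurable_EFinP; apply: measurable_funM => //; exact: msm.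
  - by apply/measurable_EFinP; apply: measurable_funM.
  - apply: aeW => x _; apply: cvg_EFin; first exact: nearW.
    apply: cvgM; first exact: cvg_cst.
    exact: smL'.
  - exact: Idom.
  - apply: aeW => x k _; rewrite lee_fin normrM indicE.
    case: (boolP (x \in J)) => [/set_mem Jx|_]; last by rewrite normr0 mul0r mulr0.
    by rewrite normr1 mul1r mulr1 cJ.
  by [].
have mq k : measurable_fun setT (fun s => \1_I01 s * q J k (xi s)).
  by have [] := smooth_fubini k mJ.
have rhs : (\int[mu]_s (\1_I01 s * q J (k + k2) (xi s))%:E)%E @[k --> \oo] -->
    (\int[mu]_s (\1_I01 s * \1_J (xi s))%:E)%E.
  have Idom : rint mu setT (fun s => \1_I01 s).
    exact: (@integrable_indic_itv R 0 1 true false).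
  have [] := @dominated_convergence _ _ R mu setT measurableT
    (fun k s => (\1_I01 s * q J (k + k2) (xi s))%:E) (fun s => (\1_I01 s * \1_J (xi s))%:E) (fun s => (\1_I01 s)%:E).
  - by move=> k; apply/measurable_EFinP.
  - apply/measurable_EFinP; apply: measurable_funM; first exact: measurable_indic.
    by apply: (measurableT_comp _ mxi); exact: measurable_indic.
  (* Convergence to the indicator can fail only while the path sits at an end point, a null set of
     times by [no_atom]. *)
  - exists ((I01 `&` xi @^-1` [set a]) `|` (I01 `&` xi @^-1` [set b])); split.
    + apply: measurableU; apply: measurableI => //; rewrite -[X in measurable X]setTI; exact: mxi.
    + have mc (c' : R) : measurable (I01 `&` xi @^-1` [set c']).
        by apply: measurableI => //; rewrite -[X in measurable X]setTI; exact: mxi.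
      exact: (null_set_setU (mc a) (mc b) (no_atom a) (no_atom b)).
    move=> s ns; apply: contrapT => nab; apply: ns => _.
    apply: cvg_EFin; first exact: nearW.
    have [sI|sI] := pselect (I01 s); last first.
      have -> : \1_I01 s = 0 :> R by rewrite indicE memNset.
      rewrite mul0r; apply: cvg_near_cst; apply: nearW => k; by rewrite /= mul0r.
    apply: cvgM; first exact: cvg_cst.
    have za : xi s != a by apply/eqP => za; apply: nab; left.
    have zb : xi s != b by apply/eqP => zb; apply: nab; right.
    exact: (cvg_shift k2 (q_cvg za zb)).
  - exact: Idom.
  - apply: aeW => s k _; rewrite lee_fin; have /andP[h1 h2] := q01 (k + k2) (xi s) mJ.
    by rewrite ger0_norm ?mulr_ge0// ler_piMr.
  by [].
have E : (\int[mu]_x (\1_J x * L x)%:E = \int[mu]_s (\1_I01 s * \1_J (xi s))%:E)%E.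
  have EF : (fun k => \int[mu]_x (\1_J x * smoothed xi (k + k2) x)%:E)%E =
      (fun k => \int[mu]_s (\1_I01 s * q J (k + k2) (xi s))%:E)%E.
    by apply/funext => k; exact: (smooth_fubini _ mJ).2.
  rewrite EF in lhs; exact: (cvg_unique (@ereal_hausdorff R) lhs rhs).
transitivity (\int[mu]_s (\1_I01 s * \1_J (xi s))%:E)%E.
  rewrite -[I01 `&` _]setIT -integral_indic//; last exact: measurableI.
  apply: eq_integral => s _; rewrite !indicE in_setI.
  by case: (s \in I01); rewrite /= ?mul1r ?mul0r.
rewrite -E [RHS]integral_mkcond; apply: eq_integral => x _.
by rewrite patchE indicE; case: ifP => _; rewrite ?mul1r ?mul0r.
Unshelve. all: by end_near. Qed.

Lemma occupation_density (A : set (measurableTypeR R)) : measurable A ->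
  mu (I01 `&` xi @^-1` A) = (\int[mu]_(x in A) (L x)%:E)%E.
Proof.
pose xi' : measurableTypeR R -> measurableTypeR R := xi.
have mxi' : measurable_fun setT xi' by exact: mxi.
pose m1 : {measure set (measurableTypeR R) -> \bar R} :=
  measure_function_pushforward__canonical__measure_function_Measure (mrestr mu mI) mxi'.
have m1E B : m1 B = mu (I01 `&` xi @^-1` B) by rewrite /m1 /= /pushforward /mrestr setIC.
pose m2 := the_density_measure mu mL L0.
move=> mA; rewrite -m1E -[RHS]/(m2 A).
pose g (k : nat) : set (measurableTypeR R) := `](- k%:R), k%:R]%classic.
apply: (@measure_unique _ R (measurableTypeR R) (@ocitv R) g) => //.
- exact: ocitvI.
- by move=> k; exists (- k%:R, k%:R).
- apply/seteqP; split => // x _; exists (Num.bound `|x|) => //.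
  rewrite /g /= in_itv/=.
  have : `|x| < (Num.bound `|x|)%:R by exact: archi_boundP.
  by rewrite ltr_norml => /andP[-> /ltW ->].
- by move=> _ [[a b] _ <-]; rewrite m1E occupation_itv.
- move=> k; rewrite m1E; apply: (@le_lt_trans _ _ (mu I01)).
    apply: le_measure; rewrite ?inE//.
    apply: measurableI => //; rewrite -[X in measurable X]setTI; apply: mxi => //; exact: measurable_itv.
  by rewrite lebesgue_measure_itv/= lte01 sube0 ltry.
Qed.

End occupation_density.

Section bridge_local_times.
Context {R : realType} d (T : measurableType d) (P : probability T R).
Notation mu := (@lebesgue_measure R).
Local Notation I01 := (`[0%R, 1%R]%classic : set (measurableTypeR R)).

Let norm_near (a b : R) : `|a - b| < 1 -> `|b| <= `|a| + 1.
Proof. by rewrite -{2}(subKr a b) => h; rewrite (le_trans (ler_normB _ _))// lerD// ltW. Qed.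

Lemma lebesgue_rV1_coord (E : set (measurableTypeR R)) : measurable E ->
  lebesgue_rV 1 ((fun v : 'rV[R]_1 => v 0 0) @^-1` E) = mu E.
Proof.
move=> mE; rewrite /= /lebesgue_step /pushforward.
rewrite (_ : _ @^-1` _ = E `*` setT); last first.
  apply/seteqP; split => [[u v] /= h|[u v] /= [h _]].
    by split => //; move: h; rewrite mxE (_ : 0 = ord0) ?unlift_none//; exact: val_inj.
  by rewrite mxE (_ : 0 = ord0) ?unlift_none//; exact: val_inj.
by rewrite product_measure1E// [X in (_ * X)%E](_ : _ = 1%E) ?mule1//= diracT.
Qed.

Lemma ge0_integral_rV1 (E : set (measurableTypeR R)) (L : R -> R) : measurable E ->
  measurable_fun setT L -> (forall x, 0 <= L x) ->
  (\int[lebesgue_rV 1]_(v in (fun v : 'rV[R]_1 => v 0%R 0%R) @^-1` E) (L (v 0%R 0%R))%:E =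
   \int[mu]_(x in E) (L x)%:E)%E.
Proof.
move=> mE mL L0; pose c (v : 'rV[R]_1) : measurableTypeR R := v 0 0.
have mc : measurable_fun setT c by exact: measurable_coord.
have := @ge0_integral_pushforward _ _ _ _ R c mc (lebesgue_rV 1) E (fun x => (L x)%:E) mE.
move=> <-; last 2 first.
- by apply/measurable_EFinP; exact: measurable_funTS.
- by move=> x _; rewrite lee_fin.
by apply: eq_measure_integral => A mA _; exact: lebesgue_rV1_coord.
Qed.

Variables (H : R) (B : R -> T -> 'rV[R]_1) (phi : R -> 'rV[R]_1).
Hypotheses (hH : 0 < H < 1) (hB : fbridge_rV P H B).
Hypothesis mphi : measurable_fun (`[0, 1]%classic : set R) phi.
Hypothesis bphi : exists M : R, forall t, 0 <= t <= 1 -> enorm (phi t) <= M.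

Let xi w (s : measurableTypeR R) : R := shifted_path B phi w s 0 0.

Let mxi w : measurable_fun setT (xi w). Proof. exact: (measurable_shifted_path hB mphi w 0). Qed.

(** A level set lies in cubes of every size around its level, and their masses tend to 0. *)
Lemma shifted_path_no_atom w (C theta : R) c : 0 < theta ->
  (forall y k, (mu (cube_times B phi w y (2 ^- k)) <= (C * (2 `^ (- theta)) ^+ k)%:E)%E) ->
  mu (I01 `&` xi w @^-1` [set c]) = 0%E.
Proof.
move=> th0 hC; set D := I01 `&` _.
have mD : measurable D.
  by apply: measurableI => //; rewrite -[X in measurable X]setTI; exact: mxi.
have lam1 : `|2 `^ (- theta) : R| < 1.
  rewrite ger0_norm ?powR_ge0// powRN invf_lt1 ?powR_gt0//.
  by have := @gt0_ltr_powR R theta th0 1 2; rewrite powR1 !nnegrE ltr1n; exact.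
have le k : (mu D <= (C * (2 `^ (- theta)) ^+ k)%:E)%E.
  apply: le_trans (hC (const_mx c) k); apply: le_measure; rewrite ?inE//.
    exact: (measurable_cube_times hB mphi).
  move=> s [s01 sc]; split; first by move: s01; rewrite /= in_itv.
  move=> i; rewrite (ord1 i) [const_mx _ _ _]mxE; move: sc; rewrite /= /xi => ->.
  by rewrite subrr normr0 invr_ge0 exprn_ge0.
have D0 : (0 <= mu D)%E by exact: measure_ge0.
have fD : mu D \is a fin_num by rewrite ge0_fin_numE// (le_lt_trans (le 0%N)) ?ltry.
rewrite -(fineK fD); congr EFin; apply/eqP; rewrite eq_le fine_ge0// andbT.
have cv : C * (2 `^ (- theta)) ^+ k @[k --> \oo] --> (0 : R).
  rewrite -(mulr0 C); apply: cvgM; first exact: cvg_cst.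
  exact: cvg_expr.
rewrite -(cvg_lim (@Rhausdorff R) cv); apply: limr_ge; first by apply/cvg_ex; eexists; exact: cv.
by apply: nearW => k; rewrite -lee_fin fineK.
Qed.

Lemma time_int_path_gauss w k x :
  time_int (fun z => path_gauss (fun t w => B t w 0 0) (fun t => phi t 0 0) k x z -
                     path_gauss (fun t w => B t w 0 0) (fun t => phi t 0 0) k.+1 x z) w =
  smoothed (xi w) k x - smoothed (xi w) k.+1 x.
Proof.
transitivity (\int[mu]_(s in I01)
    (normal_pdf 0 (2 ^- k) (xi w s - x) - normal_pdf 0 (2 ^- k.+1) (xi w s - x))); last first.
  have mI : measurable I01 by exact: measurable_itv.
  exact: (RintegralB mI (rint_smoothed (mxi w) k x) (rint_smoothed (mxi w) k.+1 x)).
apply: eq_Rintegral => s _; rewrite /path_gauss /xi /shifted_path /= mxE.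
by rewrite (_ : B (clamp s) w 0 0 - (x - phi (clamp s) 0 0) = B (clamp s) w 0 0 + phi (clamp s) 0 0 - x)//; ring.
Qed.

Lemma bridge_local_times (gamma : R) : 0 < gamma < H ->
  exists Omega1 : set T,
    [/\ measurable Omega1, P Omega1 = 1%E
      & forall w, Omega1 w ->
          holder00 gamma (B^~ w) /\
          exists L : 'rV[R]_1 -> R,
            [/\ local_time (fun t => B t w + phi t) L, continuous L & locally_bounded L]].
Proof.
move=> hgam; have /andP[H0 H1] := hH.
(* Here the Frostman bound serves to exclude atoms, for which any positive exponent below 1 will
   do. *)
have th01 : 0 < (2^-1 : R) < 1%:R by rewrite invr_gt0 ltr0n invf_lt1 ?ltr1n.
have thH : 2^-1 * H < 1 by lra.
have /almost_surelyP hF := frostman_as hH hB mphi bphi th01 thH.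
have hh := fbridge_rV_holder00 hH hB hgam.
have mph := measurable_phi_clamp mphi (0 : 'I_1).
have [lam lam01 /almost_surelyP hS] :=
  @smoothed_density_increments R _ T P H (fun t w => B t w 0 0) (fun t => phi t 0 0) hH (hB.1 0) mph.
apply/almost_surelyP; apply: filterS3 hF hh hS => w [C C0 fr] hol [k1 hk1].
split => //.
have grid k : (k1 <= k)%N -> forall j, (j < (2 * 16 ^ k).+1)%N ->
    `|smoothed (xi w) k (j%:R / 8 ^+ k - 2 ^+ k) - smoothed (xi w) k.+1 (j%:R / 8 ^+ k - 2 ^+ k)| <= lam ^+ k.
  by move=> kk j jk; rewrite -time_int_path_gauss; exact: hk1.
pose L := smoothed_lim (xi w).
have cL : continuous L := smoothed_lim_continuous (mxi w) lam01 grid.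
have L0 x : 0 <= L x := smoothed_lim_ge0 (mxi w) lam01 grid x.
have mL : measurable_fun setT L by exact: continuous_measurable_fun.
have th0 : 0 < 2^-1 :> R by have /andP[] := th01.
have dens := @occupation_density R (xi w) (mxi w) (fun c => shifted_path_no_atom c th0 fr) L L0 mL
  (smoothed_cvg (mxi w) lam01 grid) (smoothed_bounded (mxi w) lam01 grid).
pose L' (v : 'rV[R]_1) := L (v 0 0).
have cL' : continuous L'.
  move=> v; apply: (cvg_comp (fun v : 'rV[R]_1 => v 0 0) L _ (cL (v 0 0))); exact: coord_continuous.
have mL' : measurable_fun setT L' by exact: (measurableT_comp mL (measurable_coord 0)).
have occ A : measurable A -> occupation_measure (fun t => B t w + phi t) A =
    (\int[lebesgue_rV 1]_(x in A) (L' x)%:E)%E.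
  move=> mA; rewrite occupation_shifted_path.
  (* [E] is the Borel set of the line corresponding to [A], to which [occupation_density]
     applies. *)
  pose E : set (measurableTypeR R) := (fun x => const_mx x : 'rV[R]_1) @^-1` A.
  have cE (v : 'rV[R]_1) : const_mx (v 0 0) = v by apply/rowP => i; rewrite mxE (ord1 i).
  have mE : measurable E.
    rewrite -[X in measurable X]setTI; apply: (measurable_fun_rV (f := fun x : measurableTypeR R => const_mx x)) => // i.
    by under eq_fun do rewrite mxE; exact: measurable_id.
  have AE : A = (fun v : 'rV[R]_1 => v 0 0) @^-1` E by rewrite /E -comp_preimage /= (_ : _ \o _ = id) //; apply/funext => v /=.
  rewrite {2}AE ge0_integral_rV1// -dens//.
  by rewrite /occupation_measure AE.
exists L'; split => //.
- split => //; first last.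
    by move=> x; exact: L0.
  apply/null_content_dominatesP => A mA A0; rewrite occ//.
  by apply: null_set_integral => //; apply/measurable_EFinP; exact: measurable_funTS.
- move=> v; exists (`|L' v| + 1).
  have := cL' v => /(@cvgrPdist_lt _ _ _ (nbhs v) (nbhs_filter v) L' (L' v)) /(_ _ ltr01).
  apply: (@filterS _ (nbhs v) (nbhs_filter v)) => y hy.
  exact: norm_near hy.
Qed.

End bridge_local_times.

Theorem lemma6p1 (R : realType) (d : measure_display) (Omega : measurableType d)
    (P : probability Omega R) (n : nat) (H : R) (hH : 0 < H < 1)
    (B : R -> Omega -> 'rV[R]_n) (hB : fbridge_rV P H B)
    (phi : R -> 'rV[R]_n) (mphi : measurable_fun (`[0, 1]%classic : set R) phi)
    (bphi : exists M : R, forall t, 0 <= t <= 1 -> enorm (phi t) <= M) :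
  (forall (alpha gamma : R) (g : 'rV[R]_n -> \bar R), bessel_kernel alpha g ->
     0 < alpha < n%:R -> n%:R - (Num.max H (1 - H))^-1 < alpha ->
     0 < gamma < H ->
     exists Omega1 : set Omega,
       [/\ measurable Omega1, P Omega1 = 1%E
         & forall w, Omega1 w ->
             let mu := occupation_measure (fun t => B t w + phi t) in
             [/\ holder00 gamma (B^~ w),
                 finite_continuous (potential g mu),
                 bounded_potential (potential g mu)
               & bounded_potential (potential (riesz_kernel alpha) mu)]]) /\
  (n = 1%N -> forall gamma : R, 0 < gamma < H ->
     exists Omega1 : set Omega,
       [/\ measurable Omega1, P Omega1 = 1%E
         & forall w, Omega1 w ->
             holder00 gamma (B^~ w) /\
             exists L : 'rV[R]_n -> R,
               [/\ local_time (fun t => B t w + phi t) L,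
                   continuous L
                 & locally_bounded L]]).
Proof.
split; first by move=> alpha gamma g; exact: bridge_potentials.
move=> n1; subst n; exact: bridge_local_times.
Qed.
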